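(* Let $p\in\mathbb N_+$ and let $(X^{(n)}_i)_{i\in T_n}$ be a sequence of mean-zero random fields as in the context, with $\alpha$-mixing coefficients $(\alpha_{\ell,n})_{\ell\ge1}$ (of order $p+1$). Suppose there exists $r\in[p+2,\infty]$ such that $$\liminf_{n\to\infty}\frac{\sigma_n^2}{|T_n|}>0,\qquad \sup_{n,\,i\in T_n}\|X_i^{(n)}\|_r<\infty,$$ and that $\alpha_{\ell,n}\le C\ell^{-v}$ for all $\ell\ge1$ and all $n$, with constants $C,v>0$ not depending on $n$. Put $A:=\frac{r-p-1}{r}v$ and $u:=\frac{r-p-2}{r}v$ (with $A=u=v$ when $r=\infty$). Whenever $A>d(p+1)/2$ and $N\ge2$, define $$\mathfrak R_{p,A}(N):=\begin{cases}N^{-\{A/(dp)-(p+1)/(2p)\}},&\frac{d(p+1)}2<A<dp,\\ N^{-(p-1)/(2p)}(\log N)^{1/p},&A=dp,\\ N^{-\{1/2-d/(A+dp)\}},&A>dp,\end{cases}$$ $$\mathfrak S_{p,A}(N):=\begin{cases}\mathfrak R_{p,A}(N),&A\le dp,\\ N^{-\{1/2-d(p+1)/(2p(A+d))\}},&A>dp,\end{cases}$$ and, for $u>d(p+2)/2$, define $$\mathfrak G_{p,u}(N):=\begin{cases}N^{-\{u/(dp)-(p+2)/(2p)\}},&\frac{d(p+2)}2<u<d(p+1),\\ N^{-1/2}(\log N)^{1/p},&u=d(p+1),\\ N^{-1/2},&u>d(p+1).\end{cases}$$ Then: (a) If $p\ge2$ and $A>d(p+1)/2$, then $\mathcal W_p(\mathcal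 L(W_n),N(0,1))=\mathcal O(\mathfrak R_{p,A}(|T_n|))$. This assertion includes the endpoint $r=p+2$. (b) Suppose that $r>p+2$ and $u>d(p+1)/2$. Then $\mathcal W_p(\mathcal L(W_n),N(0,1))=\mathcal O(\mathfrak S_{p,A}(|T_n|))$. If, in addition, $u>d(p+2)/2$, then $$\mathcal W_p(\mathcal L(W_n),N(0,1))=\mathcal O\bigl(\min\{\mathfrak S_{p,A}(|T_n|),\mathfrak G_{p,u}(|T_n|)\}\bigr).$$
   Context: Setting. Fix $d\in\mathbb N_+$. $T_1\subseteq T_2\subseteq\cdots$ are finite nonempty subsets of $\mathbb Z^d$ with $|T_n|\to\infty$. For each $n$, $(X^{(n)}_i)_{i\in T_n}$ is a family of real random variables with mean zero and finite second moments (no stationarity is assumed). Put $\sigma_n^2:=\operatorname{Var}(\sum_{i\in T_n}X^{(n)}_i)$ and $W_n:=\sigma_n^{-1}\sum_{i\in T_n}X^{(n)}_i$ (defined when $\sigma_n>0$). $\|X\|_r:=(\mathbb E|X|^r)^{1/r}$ for $r<\infty$, and $\|X\|_\infty$ is the essential supremum norm. Mixing coefficients. For sub-$\sigma$-algebras $\mathcal A,\mathcal B$, $\alpha(\mathcal A,\mathcal B):=\sup_{A\in\mathcal A,B\in\mathcal B}|\mathbb P(A\cap B)-\mathbb P(A)\mathbb P(B)|$. For positive integers $\ell,q$, $\alpha^{[q]}_{\ell,n}:=0\vee\sup\{\alpha(\sigma(X^{(n)}_i:i\in U_1),\sigma(X^{(n)}_i:i\in U_2)):U_1,U_2\subseteq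 T_n,\ |U_1|\le q,\ d(U_1,U_2)\ge\ell\}$, where $d(U_1,U_2)=\min\{\|i_1-i_2\|:i_1\in U_1,i_2\in U_2\}$ and $\|\cdot\|$ is the maximum norm. Throughout, $\alpha_{\ell,n}:=\alpha_{\ell,n}^{[p+1]}$. Wasserstein distance. $\mathcal W_p(\nu,\mu):=\inf_\gamma(\mathbb E_{(X,Y)\sim\gamma}|X-Y|^p)^{1/p}$, the infimum being over all couplings $\gamma$ of $\nu$ and $\mu$. $\mathcal L(W)$ is the law of $W$. $\mathcal O$-notation is as $n\to\infty$, with implied constants not depending on $n$. *)

(* Defs.v *)
From HB Require Import structures.
From mathcomp Require Import all_boot all_order all_algebra finmap.
From mathcomp Require Import all_classical all_reals all_analysis.
From mathcomp Require Import measurable_realfun.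

Set Implicit Arguments.
Unset Strict Implicit.
Unset Printing Implicit Defensive.

Import Order.TTheory GRing.Theory Num.Theory.
Import numFieldNormedType.Exports.

Local Open Scope classical_set_scope.
Local Open Scope ring_scope.

Definition max_norm (d : nat) (x : 'rV[int]_d) : nat :=
  (\max_(k < d) absz (x ord0 k)%R)%N.

(* The distance to the empty set is +oo; the sigma-algebra of the empty family
   is trivial, so the mixing coefficients do not depend on this convention. *)
Definition set_dist (R : realType) (d : nat) (U1 U2 : {fset 'rV[int]_d}) :
    \bar R :=
  ereal_inf [set ((max_norm (z.1 - z.2))%:R)%:E | z in [set` U1] `*` [set` U2]].

Section mixing.
Context {R : realType} {disp : measure_display} {Om : measurableType disp}.
Variable P : probability Om R.

Definition alpha_coef (A B : set (set Om)) : \bar R :=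
  (ereal_sup [set `|P (z.1 `&` z.2) - P z.1 * P z.2| | z in A `*` B])%E.

Context {d : nat}.
Variables (T : {fset 'rV[int]_d}) (X : 'rV[int]_d -> {RV P >-> R}).

Definition sigma_field (U : {fset 'rV[int]_d}) : set (set Om) :=
  <<s \bigcup_(i in [set` U]) preimage_set_system setT (X i) measurable >>.

Definition field_alpha (q l : nat) : \bar R :=
  maxe 0%E (ereal_sup [set alpha_coef (sigma_field U.1) (sigma_field U.2) |
    U in [set U : {fset 'rV[int]_d} * {fset 'rV[int]_d} |
      [/\ (U.1 `<=` T)%fset, (U.2 `<=` T)%fset, (#|` U.1| <= q)%N &
          (l%:R%:E <= set_dist R U.1 U.2)%E]]]).

Definition field_sum : {mfun Om >-> R} :=
  \sum_(i <- T) X i.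

Definition field_var : \bar R := 'V_P[field_sum]%E.

Definition field_sigma : R := Num.sqrt (fine field_var).

(* This is 0 in the degenerate case [field_sigma = 0]. *)
Definition field_W : {mfun Om >-> R} := scale_mfun field_sigma^-1 field_sum.

End mixing.

(* [nu] and [mu] are probability measures on the Borel sets, given as plain set
   functions because [distribution P X] and [normal_prob m s] are measures on
   [R] with two different (extensionally equal) measurable structures. *)
Definition is_coupling (R : realType) (nu mu : set R -> \bar R)
    (g : probability (R * R)%type R) :=
  (forall B : set R, measurable B -> g (fst @^-1` B) = nu B) /\
  (forall B : set R, measurable B -> g (snd @^-1` B) = mu B).

Definition wasserstein (R : realType) (p : nat) (nu mu : set R -> \bar R) :
    \bar R :=
  ereal_inf [set ((\int[g]_z (`|z.1 - z.2| ^+ p)%:E) `^ (p%:R^-1))%E |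
    g in [set g : probability (R * R)%type R | is_coupling nu mu g]].

Definition mix_A (R : realType) (p : nat) (r : \bar R) (v : R) : R :=
  if r is s%:E then (s - p%:R - 1) / s * v else v.

Definition mix_u (R : realType) (p : nat) (r : \bar R) (v : R) : R :=
  if r is s%:E then (s - p%:R - 2) / s * v else v.

(* The three rates are meaningful only for [2 <= N] and, respectively,
   [d (p + 1) / 2 < A], [d (p + 1) / 2 < A] and [d (p + 2) / 2 < u]. *)
Definition rate_R (R : realType) (d p : nat) (A : R) (N : nat) : R :=
  if A < d%:R * p%:R then
    N%:R `^ (- (A / (d%:R * p%:R) - (p%:R + 1) / (2 * p%:R)))
  else if A == d%:R * p%:R then
    N%:R `^ (- ((p%:R - 1) / (2 * p%:R))) * ln N%:R `^ (p%:R^-1)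
  else N%:R `^ (- (2^-1 - d%:R / (A + d%:R * p%:R))).

Definition rate_S (R : realType) (d p : nat) (A : R) (N : nat) : R :=
  if A <= d%:R * p%:R then rate_R d p A N
  else N%:R `^ (- (2^-1 - d%:R * (p%:R + 1) / (2 * p%:R * (A + d%:R)))).

Definition rate_G (R : realType) (d p : nat) (u : R) (N : nat) : R :=
  if u < d%:R * (p%:R + 1) then
    N%:R `^ (- (u / (d%:R * p%:R) - (p%:R + 2) / (2 * p%:R)))
  else if u == d%:R * (p%:R + 1) then
    N%:R `^ (- 2^-1) * ln N%:R `^ (p%:R^-1)
  else N%:R `^ (- 2^-1).

Definition is_bigO (R : realType) (f : nat -> \bar R) (g : nat -> R) :=
  exists K : R, \forall n \near \oo, (`|f n| <= (K * `|g n|)%:E)%E.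

(* Main.v *)
(* Write [W] for the normalized sum.

   Expansion. In [E[W f(W)] = sum_i kap E[X_i f(W)]] the sites are removed from [W] in the order
   of their distance to the sites already met and [f] is Taylor expanded. At each step the new
   factor [(Z - E Z) X_j ^+ q] is again nearly uncorrelated with the sites that remain, so that
   recursively [E[W f(W)] = sum_k beta_k E[f^(k)(W)] + remainder]. Testing on polynomials shows
   [beta_0 = 0], [beta_1 = 1] and that the [beta_k] do not depend on the order of the expansion;
   counting lattice points gives [|beta_k| <= C del ^+ (k-1)] and a remainder of order
   [del ^+ p], where [del] is the rate to be proved. For [A > d p] the last variable is expanded
   only up to a distance [m] that grows with the number of sites (rate [S]); under the stronger
   condition on [u] it is expanded at all distances (rate [G]). Rate [R] dominates rate [S].

   Correction. Solving Stein's equation repeatedly turns the expansion into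
   [|E h(W) - sum_m e_m G(He_m h)| <= C del ^+ p |h^(p)|_oo], where [G] is the Gaussian mean, the
   [He_m] are the Hermite polynomials, [e_0 = 1], [e_1 = e_2 = 0] and
   [(n+1) e_(n+1) = sum_j beta_j e_(n-j)].

   Transport. Let [T] be the monotone transport of the normal law to the law of [W]. For a shift
   [eta] of order [del (1 + |s|) ^+ M], the function [s + eta(s)] absorbs the Edgeworth-type
   correction of the distribution function. On each component [(a,b)] of the set where
   [F(s) > Phi(s + eta(s))] put the bump [((s-a)(b-s)/(b-a)) ^+ (p-1)]. Its primitive is a test
   function with bounded [p]-th derivative, and its integral over a subinterval is at least a
   constant times the [p]-th power of the length. Testing with it, and with its mirror image,
   bounds the [p]-th moment of [T(Z) - Z] by a constant times [del ^+ p]. *)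
Require Import Defs.
From HB Require Import structures.
From mathcomp Require Import all_boot all_order all_algebra finmap.
From mathcomp Require Import all_classical all_reals all_analysis.
From mathcomp Require Import measurable_realfun ess_sup_inf ring lra zify.

Set Implicit Arguments.
Unset Strict Implicit.
Unset Printing Implicit Defensive.

Import Order.TTheory GRing.Theory Num.Theory.
Import numFieldNormedType.Exports.

Local Open Scope classical_set_scope.
Local Open Scope ring_scope.

(** * Covariance inequality under strong mixing *)

(** Moments exist only up to order [r >= p + 2], and every step multiplies another power of a site
    into the integrand. The recursion therefore keeps the order already spent plus the derivatives
    still available equal to a constant [L]. At the top level [L = p + 1]: integrands of total order
    [p + 1] decorrelate at the rate [th A], and the one extra order needed to difference in the last
    variable has only the slower rate [th u]. Hence the two decay rates and the two treatments of
    the last variable. The coefficients beta_k are of order [del ^+ (k-1)] and not [del ^+ p], so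
    the Gaussian mean itself must be corrected. For p > 1 the distance W_p is not a supremum of
    differences of means over one class of functions, whence the direct bound on the transport. The
    correction is measured in powers of the cube root of [del]: with e_1 = e_2 = 0 a geometric bound
    in that scale is stable under the recursion, gives e_m = O(del), and leaves [del ^+ p] after
    truncation at [M = 3 * p]. All constants depend on [d], [p] and the moment, mixing and variance
    bounds only, which is the uniformity asked for by the O-notation. *)

Section real_integral.
Context d {T : measurableType d} {R : realType}.
Variable mu : {measure set T -> \bar R}.
Implicit Types f g : T -> R.

Definition L1 f := mu.-integrable setT (EFin \o f).
Definition Ex f : R := \int[mu]_x f x.

Lemma L1_meas f : L1 f -> measurable_fun setT f.
Proof. by move=> /integrableP[/measurable_EFinP]. Qed.

Lemma eq_Ex f g : f =1 g -> Ex f = Ex g.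
Proof. by move=> fg; apply: eq_Rintegral => x _; exact: fg. Qed.

Lemma eq_L1 f g : f =1 g -> L1 f -> L1 g.
Proof. by move=> /funext ->. Qed.

Lemma L1D f g : L1 f -> L1 g -> L1 (fun x => f x + g x).
Proof. by move=> hf hg; by apply: (@integrableD _ _ _ mu setT measurableT (EFin \o f) (EFin \o g)). Qed.

Lemma L1N f : L1 f -> L1 (fun x => - f x).
Proof. by move=> hf; by apply: (@integrableN _ _ _ mu setT (EFin \o f)). Qed.

Lemma L1B f g : L1 f -> L1 g -> L1 (fun x => f x - g x).
Proof. by move=> hf hg; by apply: (@integrableB _ _ _ mu setT measurableT (EFin \o f) (EFin \o g)). Qed.

Lemma L1Z k f : L1 f -> L1 (fun x => k * f x).
Proof. by move=> hf; by apply: (@integrableZl _ _ _ mu setT measurableT k (EFin \o f)). Qed.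

Lemma L1_sum I (s : seq I) (F : I -> T -> R) :
  (forall i, L1 (F i)) -> L1 (fun x => \sum_(i <- s) F i x).
Proof.
move=> hF; elim: s => [|i s IH].
  have h0 : L1 (fun=> 0) by exact: integrable0.
  by apply: eq_L1 h0 => x; rewrite big_nil.
by apply: (eq_L1 _ (L1D (hF i) IH)) => x; rewrite big_cons.
Qed.

Lemma L1_abs f : L1 f -> L1 (fun x => `|f x|).
Proof. by move=> hf; exact: (integrable_abse hf). Qed.

Lemma L1_le f g : measurable_fun setT f -> (forall x, `|f x| <= g x) ->
  L1 g -> L1 f.
Proof.
move=> mf fg hg; apply: (le_integrable measurableT _ _ hg).
  exact/measurable_EFinP.
move=> x _ /=; rewrite lee_fin (le_trans (fg x))//.
by rewrite ler_norm.
Qed.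

Lemma ExD f g : L1 f -> L1 g -> Ex (fun x => f x + g x) = Ex f + Ex g.
Proof. by move=> hf hg; rewrite /Ex RintegralD. Qed.

Lemma ExB f g : L1 f -> L1 g -> Ex (fun x => f x - g x) = Ex f - Ex g.
Proof. by move=> hf hg; rewrite /Ex RintegralB. Qed.

Lemma ExZ k f : L1 f -> Ex (fun x => k * f x) = k * Ex f.
Proof. by move=> hf; rewrite /Ex RintegralZl. Qed.

Lemma ExN f : L1 f -> Ex (fun x => - f x) = - Ex f.
Proof.
move=> hf; rewrite -mulN1r -ExZ//; apply: eq_Ex => x; by rewrite mulN1r.
Qed.

Lemma Ex_sum I (s : seq I) (F : I -> T -> R) : (forall i, L1 (F i)) ->
  Ex (fun x => \sum_(i <- s) F i x) = \sum_(i <- s) Ex (F i).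
Proof.
move=> hF; elim: s => [|i s IH].
  rewrite big_nil; under eq_Ex do rewrite big_nil.
  by rewrite /Ex Rintegral_cst// mul0r.
rewrite big_cons -IH -ExD//; last exact: L1_sum.
by apply: eq_Ex => x; rewrite big_cons.
Qed.

Lemma Ex_ge0 f : (forall x, 0 <= f x) -> 0 <= Ex f.
Proof. by move=> f0; apply: Rintegral_ge0. Qed.

Lemma Ex_le f g : L1 f -> L1 g -> (forall x, f x <= g x) -> Ex f <= Ex g.
Proof. by move=> hf hg fg; apply: le_Rintegral. Qed.

Lemma Ex_abs f : L1 f -> `|Ex f| <= Ex (fun x => `|f x|).
Proof. by move=> hf; exact: le_normr_Rintegral. Qed.

Lemma Ex_abs_le f g : L1 f -> L1 g -> (forall x, `|f x| <= g x) ->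
  `|Ex f| <= Ex g.
Proof.
move=> hf hg fg; apply: (le_trans (Ex_abs hf)).
by apply: Ex_le => //; exact: L1_abs.
Qed.

Lemma Ex_fin f : L1 f -> (\int[mu]_x (f x)%:E)%E = (Ex f)%:E.
Proof. by move=> hf; rewrite /Ex /Rintegral fineK// integrable_fin_num. Qed.

End real_integral.

Section probability_integral.
Context d {T : measurableType d} {R : realType}.
Variable P : probability T R.
Implicit Types f g : T -> R.

Lemma L1_cst c : L1 P (fun=> c).
Proof. exact: finite_measure_integrable_cst. Qed.

Lemma Ex_cst c : Ex P (fun=> c) = c.
Proof. by rewrite /Ex /Rintegral integral_cst//= probability_setT mule1. Qed.

Lemma L1_bounded c f : measurable_fun setT f -> (forall x, `|f x| <= c) -> L1 P f.
Proof. by move=> mf fc; exact: L1_le mf fc (L1_cst c). Qed.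

Definition Cov f g := Ex P (fun x => f x * g x) - Ex P f * Ex P g.

End probability_integral.

Section covariance_bounded.
Context d {T : measurableType d} {R : realType}.
Variable P : probability T R.
Implicit Types (f g Z xi M : T -> R) (a b c e t z : R).

Local Notation Pr A := (fine (P A)).

Lemma Ex_indic (A : set T) : measurable A -> Ex P (\1_A : T -> R) = Pr A.
Proof. by move=> mA; rewrite /Ex /Rintegral integral_indic// setIT. Qed.

Lemma L1_indic (A : set T) : measurable A -> L1 P (\1_A : T -> R).
Proof.
move=> mA; apply: (@L1_bounded _ _ _ _ 1) => // x.
by rewrite indicE; case: (_ \in _); rewrite ?normr1 ?normr0.
Qed.

(** Only superlevel sets appear: the layer-cake formula involves no other events, and a bound on
    them survives clipping and increasing affine maps. A bound on the alpha coefficient of two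
    sigma-algebras implies it for functions measurable with respect to them. *)
Definition mixing_bound f g a := forall s t,
  `|Pr ([set x | s < f x] `&` [set x | t < g x])
    - Pr [set x | s < f x] * Pr [set x | t < g x]| <= a.

Lemma measurable_gt f s : measurable_fun setT f -> measurable [set x | s < f x].
Proof.
move=> mf; have -> : [set x | s < f x] = setT `&` f @^-1` `]s, +oo[.
  by rewrite setTI; apply/seteqP; split => x /=; rewrite in_itv /= andbT.
by apply: mf.
Qed.

(** Counting thresholds approximates [y] from below with error at most one; [y <= k.+1%:R] says that
    the thresholds do not run out. Peeling off the threshold 1 replaces [y] by [y - 1]. *)
Lemma count_below (k : nat) (y : R) : 0 <= y ->
  \sum_(j < k) ((j.+1%:R < y)%R%:R : R) <= y /\
  (y <= k.+1%:R -> y - 1 <= \sum_(j < k) ((j.+1%:R < y)%R%:R : R)).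
Proof.
elim: k y => [|k IH] y y0.
  by rewrite big_ord0; split => // h; rewrite subr_le0.
rewrite big_ord_recl /=.
have [y1|y1] := leP y 1.
  have -> : \sum_(i < k) ((bump 0 i).+1%:R < y)%R%:R = 0 :> R.
    rewrite big1// => i _; apply/eqP; rewrite pnatr_eq0 eqb0 -leNgt.
    by rewrite (le_trans y1)// ler1n.
  by rewrite addr0 mulr0n; split => // _; rewrite subr_le0.
have -> : \sum_(i < k) ((bump 0 i).+1%:R < y)%R%:R =
          \sum_(i < k) (i.+1%:R < y - 1)%R%:R :> R.
  apply: eq_bigr => i _; congr ((_ : bool)%:R).
  by rewrite /bump leq0n add1n -(natr1 i.+1) ltrBrDr.
have y10 : 0 <= y - 1 by rewrite subr_ge0 ltW.
have [h1 h2] := IH _ y10.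
rewrite mulr1n; split; first by rewrite -lerBrDl.
move=> yk; rewrite -[leLHS](addrNK 1) addrC lerD2l; apply: h2.
by rewrite lerBlDr natr1.
Qed.

Lemma Cov_indic (A B : set T) : measurable A -> measurable B ->
  Cov P (\1_A) (\1_B) = Pr (A `&` B) - Pr A * Pr B.
Proof.
move=> mA mB; rewrite /Cov !Ex_indic//; congr (_ - _).
rewrite -Ex_indic; last exact: measurableI.
by apply: eq_Ex => x; rewrite indicI.
Qed.

Lemma Cov_perturb f g f' g' e : 0 <= e ->
  measurable_fun setT f -> measurable_fun setT g ->
  measurable_fun setT f' -> measurable_fun setT g' ->
  (forall x, `|f x| <= 1) -> (forall x, `|g x| <= 1) ->
  (forall x, `|f' x| <= 1) -> (forall x, `|g' x| <= 1) ->
  (forall x, `|f x - f' x| <= e) -> (forall x, `|g x - g' x| <= e) ->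
  `|Cov P f g| <= `|Cov P f' g'| + 4 * e.
Proof.
move=> e0 mf mg mf' mg' f1 g1 f'1 g'1 ff gg.
have Lf := L1_bounded P mf f1. have Lg := L1_bounded P mg g1.
have Lf' := L1_bounded P mf' f'1. have Lg' := L1_bounded P mg' g'1.
have b1 (u v : T -> R) : (forall x, `|u x| <= 1) -> (forall x, `|v x| <= 1) ->
    forall x, `|u x * v x| <= 1.
  by move=> hu hv x; rewrite normrM mulr_ile1.
have Lfg : L1 P (fun x => f x * g x).
  by apply: (L1_bounded P _ (b1 _ _ f1 g1)); exact: measurable_funM.
have Lfg' : L1 P (fun x => f' x * g' x).
  by apply: (L1_bounded P _ (b1 _ _ f'1 g'1)); exact: measurable_funM.
have E1 (u : T -> R) : L1 P u -> (forall x, `|u x| <= 1) -> `|Ex P u| <= 1.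
  move=> hu u1; rewrite -(Ex_cst P 1); apply: Ex_abs_le => //; exact: L1_cst.
have Ee (u v : T -> R) : L1 P u -> L1 P v -> (forall x, `|u x - v x| <= e) ->
    `|Ex P u - Ex P v| <= e.
  move=> hu hv uv; rewrite -ExB// -(Ex_cst P e).
  by apply: Ex_abs_le => //; [exact: L1B|exact: L1_cst].
have h1 : `|Ex P (fun x => f x * g x) - Ex P (fun x => f' x * g' x)| <= 2 * e.
  rewrite -ExB// -(Ex_cst P (2 * e)); apply: Ex_abs_le.
  - exact: L1B.
  - exact: L1_cst.
  move=> x; have -> : f x * g x - f' x * g' x =
    (f x - f' x) * g x + f' x * (g x - g' x) by ring.
  rewrite (le_trans (ler_normD _ _))// !normrM mulr2n mulrDl mul1r lerD//.
    by rewrite -[leRHS]mulr1 ler_pM.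
  by rewrite -[leRHS]mul1r ler_pM.
have h2 : `|Ex P f * Ex P g - Ex P f' * Ex P g'| <= 2 * e.
  have -> : Ex P f * Ex P g - Ex P f' * Ex P g' =
    (Ex P f - Ex P f') * Ex P g + Ex P f' * (Ex P g - Ex P g') by ring.
  rewrite (le_trans (ler_normD _ _))// !normrM mulr2n mulrDl mul1r lerD//.
    by rewrite -[leRHS]mulr1 ler_pM// ?E1// Ee.
  by rewrite -[leRHS]mul1r ler_pM// ?E1// Ee.
rewrite /Cov.
set A := Ex P (fun x => f x * g x) in h1 *.
set B := Ex P (fun x => f' x * g' x) in h1 *.
have -> : A - Ex P f * Ex P g = (B - Ex P f' * Ex P g') + (A - B)
   - (Ex P f * Ex P g - Ex P f' * Ex P g') by ring.
rewrite (le_trans (ler_normB _ _))// (le_trans (lerD (ler_normD _ _) h2))//.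
lra.
Qed.

(** Discretized layer-cake formula with [k] levels. Being an average of indicators, it turns a
    covariance into the average of [k ^ 2] covariances of events. *)
Definition layer_sum f k : T -> R :=
  fun x => k%:R^-1 * \sum_(j < k) \1_[set x | j.+1%:R / k%:R < f x] x.

Lemma layer_sum_close f k : (0 < k)%N -> (forall x, 0 <= f x <= 1) ->
  forall x, (0 <= layer_sum f k x <= 1) /\ `|f x - layer_sum f k x| <= k%:R^-1.
Proof.
move=> k0 f01 x; have /andP[f0 f1] := f01 x.
have kR : (0 : R) < k%:R by rewrite ltr0n.
have [h1 h2] := count_below k (mulr_ge0 (ltW kR) f0).
have h3 : k%:R * f x - 1 <= \sum_(j < k) (j.+1%:R < k%:R * f x)%R%:R.
  by apply: h2; rewrite -natr1 -[leLHS]addr0 lerD// -[leRHS]mulr1 ler_pM2l.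
have E : layer_sum f k x = k%:R^-1 * \sum_(j < k) (j.+1%:R < k%:R * f x)%R%:R.
  congr (_ * _); apply: eq_bigr => j _; rewrite indicE; congr ((nat_of_bool _)%:R).
  by apply/idP/idP; rewrite inE /= ltr_pdivrMr// mulrC.
set S := \sum_(j < k) _ in h1 h3 E.
have S0 : 0 <= S by apply: sumr_ge0 => j _; rewrite ler0n.
have kV : 0 < (k%:R : R)^-1 by rewrite invr_gt0.
have l1 : layer_sum f k x <= f x by rewrite E ler_pdivrMl.
have l2 : f x - k%:R^-1 <= layer_sum f k x.
  rewrite E -(@ler_pM2l _ k%:R)// mulrBr mulrA divff ?gt_eqF// mul1r.
  exact: h3.
split.
  by rewrite (le_trans l1 f1) E mulr_ge0// ltW.
by rewrite ger0_norm ?subr_ge0// lerBlDr addrC -lerBlDr.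
Qed.

Lemma Cov_mixing01 f g a : measurable_fun setT f -> measurable_fun setT g ->
  (forall x, 0 <= f x <= 1) -> (forall x, 0 <= g x <= 1) ->
  mixing_bound f g a -> `|Cov P f g| <= a.
Proof.
move=> mf mg f01 g01 H.
have n1 (u : R) : 0 <= u <= 1 -> `|u| <= 1 by move=> /andP[u0 u1]; rewrite ger0_norm.
have mI f0 k (j : 'I_k) : measurable_fun setT f0 ->
    measurable [set x | j.+1%:R / k%:R < f0 x] by move=> ?; exact: measurable_gt.
have LI f0 k (j : 'I_k) : measurable_fun setT f0 ->
    L1 P (\1_[set x | j.+1%:R / k%:R < f0 x] : T -> R).
  by move=> m0; apply: L1_indic; exact: mI.
have mstep f0 k : measurable_fun setT f0 -> measurable_fun setT (layer_sum f0 k).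
  move=> m0; apply: measurable_funM => //; apply: measurable_sum => j.
  by apply: measurable_indic; exact: mI.
have key k : (0 < k)%N -> `|Cov P f g| <= a + 4 * k%:R^-1.
  move=> k0; have k0R : (0 : R) < k%:R by rewrite ltr0n.
  have hf := layer_sum_close k0 f01. have hg := layer_sum_close k0 g01.
  apply: le_trans (@Cov_perturb f g (layer_sum f k) (layer_sum g k) k%:R^-1 _ mf mg _ _ _ _ _ _ _ _) _.
  - by rewrite invr_ge0.
  - exact: mstep.
  - exact: mstep.
  - by move=> x; exact: n1.
  - by move=> x; exact: n1.
  - by move=> x; apply: n1; have [] := hf x.
  - by move=> x; apply: n1; have [] := hg x.
  - by move=> x; have [] := hf x.
  - by move=> x; have [] := hg x.
  rewrite lerD2r.
  have -> : Cov P (layer_sum f k) (layer_sum g k) = k%:R^-1 ^+ 2 *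
      \sum_(i < k) \sum_(j < k) Cov P (\1_[set x | i.+1%:R / k%:R < f x])
                                 (\1_[set x | j.+1%:R / k%:R < g x]).
    rewrite /Cov /layer_sum !ExZ ?Ex_sum//; try (by move=> i; exact: LI);
      try (by apply: L1_sum => i; exact: LI).
    rewrite (_ : Ex P _ = k%:R^-1 ^+ 2 * \sum_(i < k) \sum_(j < k)
       Ex P (fun x => \1_[set x | i.+1%:R / k%:R < f x] x *
                      \1_[set x | j.+1%:R / k%:R < g x] x)); last first.
      have LII (i j : 'I_k) : L1 P (fun x => \1_[set x | i.+1%:R / k%:R < f x] x *
                      \1_[set x | j.+1%:R / k%:R < g x] x : R).
        apply: (eq_L1 (f := \1_([set x | i.+1%:R / k%:R < f x] `&` [set x | j.+1%:R / k%:R < g x]))).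
          by move=> x; rewrite indicI.
        by apply: L1_indic; apply: measurableI; exact: mI.
      under [in RHS]eq_bigr => i _ do rewrite -Ex_sum//.
      rewrite -Ex_sum; last by move=> i; apply: L1_sum => j; exact: LII.
      rewrite -ExZ; last by apply: L1_sum => i; apply: L1_sum => j; exact: LII.
      apply: eq_Ex => x; rewrite mulrACA -expr2; congr (_ * _).
      rewrite mulr_suml; apply: eq_bigr => i _; by rewrite mulr_sumr.
    rewrite mulrACA -expr2 -mulrBr; congr (_ * _).
    rewrite mulr_suml -sumrB; apply: eq_bigr => i _.
    by rewrite mulr_sumr -sumrB.
  rewrite normrM ger0_norm ?exprn_ge0 ?invr_ge0//.
  rewrite exprVn ler_pdivrMl ?exprn_gt0//.
  apply: (le_trans (ler_norm_sum _ _ _)).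
  apply: (@le_trans _ _ (\sum_(i < k) \sum_(j < k) a)).
    apply: ler_sum => i _; apply: (le_trans (ler_norm_sum _ _ _)).
    apply: ler_sum => j _; rewrite Cov_indic; [exact: H|exact: mI|exact: mI].
  by rewrite !sumr_const !card_ord -mulrnA -[leLHS]mulr_natl natrM expr2.
(* The error [4 / k] is arbitrarily small: a level count larger than 4 divided by the excess
   contradicts [key]. *)
rewrite leNgt; apply/negP => hlt.
pose e := `|Cov P f g| - a; have e0 : 0 < e by rewrite subr_gt0.
pose k := (Num.truncn (4 / e)).+1.
have := key k isT; rewrite -lerBlDl -/e.
have h4 : 4 / e < k%:R by exact: truncnS_gt.
by rewrite leNgt => /negP; apply; rewrite ltr_pdivrMr// mulrC -ltr_pdivrMr.
Qed.

(** Increasing affine maps into [[0,1]] only relabel the superlevel sets, so the mixing bound is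
    unchanged while the covariance is divided by [(2 * b) * (2 * c)]. *)
Lemma Cov_mixing_bounded f g a b c : 0 < b -> 0 < c ->
  measurable_fun setT f -> measurable_fun setT g ->
  (forall x, `|f x| <= b) -> (forall x, `|g x| <= c) ->
  mixing_bound f g a -> `|Cov P f g| <= 4 * b * c * a.
Proof.
move=> b0 c0 mf mg fb gc H.
pose nf x := (2 * b)^-1 * (f x + b); pose ng x := (2 * c)^-1 * (g x + c).
have b2 : 0 < 2 * b by rewrite mulr_gt0.
have c2 : 0 < 2 * c by rewrite mulr_gt0.
have nm (u : R) v : 0 < v -> `|u| <= v -> 0 <= (2 * v)^-1 * (u + v) <= 1.
  move=> v0; rewrite ler_norml => /andP[h1 h2]; apply/andP; split.
    by rewrite mulr_ge0 ?invr_ge0 ?mulr_ge0 ?(ltW v0)// -lerBlDr sub0r.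
  rewrite ler_pdivrMl ?mulr_gt0// mulr1; lra.
have lev (u v s : R) : 0 < v -> (s < (2 * v)^-1 * (u + v)) = (2 * v * s - v < u).
  by move=> v0; rewrite ltr_pdivlMl ?mulr_gt0// ltrBlDr.
have mnf : measurable_fun setT nf.
  by apply: measurable_funM => //; exact: measurable_funD.
have mng : measurable_fun setT ng.
  by apply: measurable_funM => //; exact: measurable_funD.
have := @Cov_mixing01 nf ng a mnf mng (fun x => nm _ _ b0 (fb x))
   (fun x => nm _ _ c0 (gc x)).
have Hn : mixing_bound nf ng a.
  move=> s t; have -> : [set x | s < nf x] = [set x | 2 * b * s - b < f x].
    by apply/seteqP; split => x /=; rewrite /nf lev.
  have -> : [set x | t < ng x] = [set x | 2 * c * t - c < g x].
    by apply/seteqP; split => x /=; rewrite /ng lev.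
  exact: H.
move=> /(_ Hn).
have Lf := L1_bounded P mf fb. have Lg := L1_bounded P mg gc.
have Lfg : L1 P (fun x => f x * g x).
  apply: (@L1_bounded _ _ _ P (b * c)); first exact: measurable_funM.
  by move=> x; rewrite normrM ler_pM.
have -> : Cov P nf ng = (4 * b * c)^-1 * Cov P f g.
  rewrite /Cov /nf /ng !ExZ; try (by apply: L1D => //; exact: L1_cst).
  rewrite !ExD ?Ex_cst//; try exact: L1_cst.
  rewrite (_ : Ex P _ = (4 * b * c)^-1 * (Ex P (fun x => f x * g x) + c * Ex P f + b * Ex P g + b * c)).
    field; by rewrite !gt_eqF.
  have LcF : L1 P (fun x => c * f x) by exact: L1Z.
  have LbG : L1 P (fun x => b * g x) by exact: L1Z.
  have L2 : L1 P (fun x => f x * g x + c * f x) by exact: L1D.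
  have L3 : L1 P (fun x => f x * g x + c * f x + b * g x) by exact: L1D.
  rewrite -(ExZ c)// -(ExZ b)// -ExD// -ExD// -[X in _ * (_ + X)](Ex_cst P) -ExD//; last exact: L1_cst.
  rewrite -ExZ; last by apply: L1D => //; exact: L1_cst.
  by apply: eq_Ex => x; field; rewrite !gt_eqF.
have p0 : 0 < 4 * b * c by rewrite !mulr_gt0.
by rewrite normrM gtr0_norm ?invr_gt0// ler_pdivrMl.
Qed.

Definition clip (b z : R) := Num.max (- b) (Num.min z b).

Lemma clip_le b z : 0 <= b -> `|clip b z| <= b.
Proof.
move=> b0; rewrite /clip ler_norml le_max lexx /= ge_max; apply/andP; split; first lra.
by rewrite ge_min lexx orbT.
Qed.

Lemma clip_id b z : `|z| <= b -> clip b z = z.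
Proof.
rewrite ler_norml => /andP[h1 h2]; rewrite /clip (min_idPl h2).
exact/max_idPr.
Qed.

Lemma clip_le_norm b z : 0 <= b -> `|clip b z| <= `|z|.
Proof.
move=> b0; have [h|h] := leP `|z| b; first by rewrite clip_id.
by rewrite (le_trans (clip_le z b0))// ltW.
Qed.

Lemma clip_dist b z : 0 <= b -> `|z - clip b z| <= `|z|.
Proof.
move=> b0; rewrite /clip; case: (leP z b) => h.
  case: (leP (- b) z) => h'; first by rewrite subrr normr0.
  have hz : z < 0 by lra.
  rewrite (ltr0_norm hz) ler_norml; apply/andP; split; lra.
rewrite (_ : Num.max (- b) b = b); last by apply/max_idPr; lra.
rewrite !ger0_norm; lra.
Qed.

Lemma measurable_clip b f : measurable_fun setT f ->
  measurable_fun setT (fun x => clip b (f x)).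
Proof.
move=> mf; apply: measurable_maxr => //; exact: measurable_minr.
Qed.

(** Clipping creates no new superlevel sets except the full and the empty one, which are independent
    of every event; hence [mixing_bound] passes to clipped functions. *)
Lemma clip_level b f s : 0 <= b ->
  [\/ [set x | s < clip b (f x)] = setT, [set x | s < clip b (f x)] = set0 |
     [set x | s < clip b (f x)] = [set x | s < f x]].
Proof.
move=> b0; have [h1|h1] := ltP s (- b).
  apply: Or31; apply/seteqP; split => x //= _.
  by rewrite (lt_le_trans h1)//; have := clip_le (f x) b0; rewrite ler_norml => /andP[].
have [h2|h2] := leP b s.
  apply: Or32; apply/seteqP; split => x //=; rewrite ltNge => /negP; apply.
  by rewrite (le_trans _ h2)//; have := clip_le (f x) b0; rewrite ler_norml => /andP[].
apply: Or33; apply/seteqP; split => x /=; rewrite /clip lt_max lt_min h2 andbT.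
  by move=> /orP[/lt_geF|//]; rewrite h1.
by move=> ->; rewrite orbT.
Qed.

Lemma mixing_bound_clip f g a b c : 0 <= a -> 0 <= b -> 0 <= c ->
  mixing_bound f g a ->
  mixing_bound (fun x => clip b (f x)) (fun x => clip c (g x)) a.
Proof.
move=> a0 b0 c0 H s t.
have PT : P setT = 1%E := probability_setT P.
have [->|->|->] := clip_level f s b0; have [->|->|->] := clip_level g t c0;
  by rewrite ?setIT ?setTI ?setI0 ?set0I ?PT ?measure0 /= ?mulr0 ?mul0r ?mulr1 ?mul1r
    ?subrr ?subr0 ?normr0.
Qed.

Definition tail_moment M (k : nat) t := Ex P (fun x => M x ^+ k * (\1_[set x | t < M x] x)).

Lemma L1_pow_le M (k k' : nat) : measurable_fun setT M -> (forall x, 1 <= M x) ->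
  (k <= k')%N -> L1 P (fun x => M x ^+ k') -> L1 P (fun x => M x ^+ k).
Proof.
move=> mM M1 kk; apply: L1_le; first exact: measurable_funX.
move=> x; rewrite ger0_norm ?exprn_ge0 ?(le_trans ler01)//.
exact: ler_weXn2l.
Qed.

(** One envelope [M] dominates both factors, so the single event [t < M] carries all the truncation
    errors: off it, clipping at [t ^+ a] and [t ^+ b] changes nothing, and on it each error is at
    most a multiple of [M ^+ (a + b)]. *)
Lemma Cov_truncate Z xi M (a b : nat) (t al K : R) : 0 <= al -> 1 <= t -> 0 <= K ->
  measurable_fun setT Z -> measurable_fun setT xi -> measurable_fun setT M ->
  (forall x, 1 <= M x) ->
  (forall x, `|Z x| <= M x ^+ a) -> (forall x, `|xi x| <= M x ^+ b) ->
  L1 P (fun x => M x ^+ (a + b)) -> Ex P (fun x => M x ^+ (a + b)) <= K ->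
  mixing_bound Z xi al ->
  `|Cov P Z xi| <= 4 * al * t ^+ (a + b) + (2 + 2 * K) * tail_moment M (a + b) t.
Proof.
move=> al0 t1 K0 mZ mxi mM M1 Za xib LM MK H.
have t0 : 0 < t := lt_le_trans ltr01 t1.
have M0 x : 0 < M x := lt_le_trans ltr01 (M1 x).
pose Z' x := clip (t ^+ a) (Z x); pose xi' x := clip (t ^+ b) (xi x).
have ta : 0 <= t ^+ a by rewrite exprn_ge0// ltW.
have tb : 0 <= t ^+ b by rewrite exprn_ge0// ltW.
have mZ' : measurable_fun setT Z' by exact: measurable_clip.
have mxi' : measurable_fun setT xi' by exact: measurable_clip.
have Mab k : (k <= a + b)%N -> L1 P (fun x => M x ^+ k).
  by move=> h; exact: L1_pow_le LM.
have Ma x : M x ^+ a <= M x ^+ (a + b) by apply: ler_weXn2l; rewrite ?leq_addr.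
have Mb x : M x ^+ b <= M x ^+ (a + b) by apply: ler_weXn2l; rewrite ?leq_addl.
have LZ : L1 P Z by apply: (L1_le mZ Za); apply: Mab; rewrite leq_addr.
have Lxi : L1 P xi by apply: (L1_le mxi xib); apply: Mab; rewrite leq_addl.
have Z'Z x : `|Z' x| <= `|Z x| by exact: clip_le_norm.
have xi'xi x : `|xi' x| <= `|xi x| by exact: clip_le_norm.
have LZ' : L1 P Z' := L1_le mZ' Z'Z (L1_abs LZ).
have Lxi' : L1 P xi' := L1_le mxi' xi'xi (L1_abs Lxi).
have prodb (u v : T -> R) : (forall x, `|u x| <= `|Z x|) -> (forall x, `|v x| <= `|xi x|) ->
    forall x, `|u x * v x| <= M x ^+ (a + b).
  move=> hu hv x; rewrite normrM exprD ler_pM//.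
    exact: le_trans (hu x) (Za x).
  exact: le_trans (hv x) (xib x).
have LZxi : L1 P (fun x => Z x * xi x).
  by apply: (L1_le _ (prodb _ _ (fun=> lexx _) (fun=> lexx _))) => //; exact: measurable_funM.
have LZxi' : L1 P (fun x => Z' x * xi' x).
  by apply: (L1_le _ (prodb _ _ Z'Z xi'xi)) => //; exact: measurable_funM.
pose I x : R := \1_[set x | t < M x] x.
have mI : measurable_fun setT I by apply: measurable_indic; exact: measurable_gt.
have Ltail : L1 P (fun x => M x ^+ (a + b) * I x).
  apply: (L1_le (g := fun x => M x ^+ (a + b))) => //.
    by apply: measurable_funM => //; exact: measurable_funX.
  move=> x; rewrite normrM ger0_norm ?exprn_ge0 ?(ltW (M0 x))// /I indicE.
  by case: (_ \in _); rewrite ?normr1 ?normr0 ?mulr1 ?mulr0// exprn_ge0// (ltW (M0 x)).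
have out x : (M x <= t) \/ I x = 1.
  have [h|h] := leP (M x) t; [by left|right].
  by rewrite /I indicE mem_set.
have I0 x : 0 <= I x by rewrite /I indicE ler0n.
have sameZ x : M x <= t -> Z' x = Z x.
  move=> h; rewrite /Z' clip_id// (le_trans (Za x))// lerXn2r// nnegrE ltW//.
have samexi x : M x <= t -> xi' x = xi x.
  move=> h; rewrite /xi' clip_id// (le_trans (xib x))// lerXn2r// nnegrE ltW//.
have sgle (u v w : R) : `|u| <= w -> `|v| <= `|u| -> `|u - v| <= 2 * w.
  move=> h1 h2; rewrite (le_trans (ler_normB _ _))// mulr2n mulrDl mul1r lerD//.
  exact: le_trans h2 h1.
have tail0 : 0 <= tail_moment M (a + b) t by apply: Ex_ge0 => x; rewrite mulr_ge0// exprn_ge0// ltW.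
have dZxi : `|Ex P (fun x => Z x * xi x) - Ex P (fun x => Z' x * xi' x)| <= 2 * tail_moment M (a + b) t.
  rewrite -ExB// /tail_moment -ExZ//; apply: Ex_abs_le; [exact: L1B|exact: L1Z|].
  move=> x; rewrite -/(I x); have [h|->] := out x.
    by rewrite sameZ// samexi// subrr normr0 mulr_ge0// mulr_ge0// exprn_ge0// ltW.
  rewrite mulr1; apply: sgle; first exact: prodb.
  by rewrite !normrM ler_pM.
have dZ : `|Ex P Z - Ex P Z'| <= tail_moment M (a + b) t.
  rewrite -ExB// /tail_moment; apply: Ex_abs_le => //; first exact: L1B.
  move=> x; have [h|I1] := out x.
    by rewrite sameZ// subrr normr0 mulr_ge0// exprn_ge0// ltW.
  rewrite -/(I x) I1 mulr1 (le_trans _ (Ma x))// (le_trans _ (Za x))//.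
  exact: clip_dist.
have dxi : `|Ex P xi - Ex P xi'| <= tail_moment M (a + b) t.
  rewrite -ExB// /tail_moment; apply: Ex_abs_le => //; first exact: L1B.
  move=> x; have [h|I1] := out x.
    by rewrite samexi// subrr normr0 mulr_ge0// exprn_ge0// ltW.
  rewrite -/(I x) I1 mulr1 (le_trans _ (Mb x))// (le_trans _ (xib x))//.
  exact: clip_dist.
have Exi : `|Ex P xi| <= K.
  apply: le_trans MK; apply: Ex_abs_le => // x; exact: le_trans (xib x) (Mb x).
have EZ' : `|Ex P Z'| <= K.
  apply: le_trans MK; apply: Ex_abs_le => // x.
  exact: le_trans (Z'Z x) (le_trans (Za x) (Ma x)).
have CT : `|Cov P Z' xi'| <= 4 * al * t ^+ (a + b).
  have h := @Cov_mixing_bounded Z' xi' al (t ^+ a) (t ^+ b)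
    (exprn_gt0 _ t0) (exprn_gt0 _ t0) mZ' mxi'
    (fun x => clip_le _ ta) (fun x => clip_le _ tb) (mixing_bound_clip al0 ta tb H).
  by rewrite exprD (_ : 4 * al * _ = 4 * t ^+ a * t ^+ b * al)//; ring.
have -> : Cov P Z xi = Cov P Z' xi' +
    (Ex P (fun x => Z x * xi x) - Ex P (fun x => Z' x * xi' x))
    - ((Ex P Z - Ex P Z') * Ex P xi + Ex P Z' * (Ex P xi - Ex P xi')).
  by rewrite /Cov; ring.
rewrite (le_trans (ler_normB _ _))//.
rewrite (le_trans (lerD (ler_normD _ _) (ler_normD _ _)))// !normrM.
have h1 : `|Ex P Z - Ex P Z'| * `|Ex P xi| <= K * tail_moment M (a + b) t.
  by rewrite mulrC ler_pM.
have h2 : `|Ex P Z'| * `|Ex P xi - Ex P xi'| <= K * tail_moment M (a + b) t.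
  by rewrite ler_pM.
lra.
Qed.

(* The truncation level [al `^ (- r^-1)] balances the two error terms. *)
Lemma Cov_moment Z xi M (a b : nat) (al r K : R) : 0 < al <= 1 -> 0 <= K -> (a + b)%:R <= r ->
  (0 < a + b)%N ->
  measurable_fun setT Z -> measurable_fun setT xi -> measurable_fun setT M ->
  (forall x, 1 <= M x) ->
  (forall x, `|Z x| <= M x ^+ a) -> (forall x, `|xi x| <= M x ^+ b) ->
  L1 P (fun x => M x `^ r) -> Ex P (fun x => M x `^ r) <= K ->
  mixing_bound Z xi al ->
  `|Cov P Z xi| <= (4 + (2 + 2 * K) * K) * al `^ (1 - (a + b)%:R / r).
Proof.
move=> /andP[al0 al1] K0 abr ab0 mZ mxi mM M1 Za xib LM MK H.
have r0 : 0 < r by rewrite (lt_le_trans _ abr)// ltr0n.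
have M0 x : 0 < M x := lt_le_trans ltr01 (M1 x).
have Mpow x : M x ^+ (a + b) <= M x `^ r.
  by rewrite -powR_mulrn ?(ltW (M0 x))//; exact: ler_powR.
have mMab : measurable_fun setT (fun x => M x ^+ (a + b)) by exact: measurable_funX.
have LMab : L1 P (fun x => M x ^+ (a + b)).
  by apply: (L1_le mMab _ LM) => x; rewrite ger0_norm// exprn_ge0// ltW.
have MabK : Ex P (fun x => M x ^+ (a + b)) <= K.
  by apply: le_trans MK; apply: Ex_le.
pose t := al `^ (- r^-1).
have t1 : 1 <= t.
  rewrite /t powRN -[leLHS]invr1 lef_pV2 ?posrE ?powR_gt0//.
  have rV : 0 <= r^-1 by rewrite invr_ge0 ltW.
  by have := @ge0_ler_powR R _ rV al 1 (ltW al0) ler01 al1; rewrite powR1.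
have t0 : 0 < t := lt_le_trans ltr01 t1.
apply: (le_trans (Cov_truncate (ltW al0) t1 K0 mZ mxi mM M1 Za xib LMab MabK H)).
have talE (s : R) : t `^ s = al `^ (- (s / r)) by rewrite /t -powRrM mulNr mulrC.
have h1 : al * t ^+ (a + b) = al `^ (1 - (a + b)%:R / r).
  rewrite -powR_mulrn ?(ltW t0)// talE -{1}[al]powRr1 ?(ltW al0)// -powRD//.
  by rewrite (gt_eqF al0) implybT.
(* On the event [t < M] the power a + b of M is at most the power a + b - r of t times the power r
   of M, because a + b - r is not positive. *)
have h2 : tail_moment M (a + b) t <= K * al `^ (1 - (a + b)%:R / r).
  have -> : al `^ (1 - (a + b)%:R / r) = t `^ ((a + b)%:R - r).
    by rewrite talE; congr (_ `^ _); field; rewrite gt_eqF.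
  have mI : measurable_fun setT (\1_[set x | t < M x] : T -> R).
    by apply: measurable_indic; exact: measurable_gt.
  rewrite mulrC (le_trans _ (ler_wpM2l (powR_ge0 _ _) MK))//.
  rewrite -ExZ//; apply: Ex_le.
  - apply: (L1_le _ _ LMab); first exact: measurable_funM.
    move=> x; rewrite normrM ger0_norm ?exprn_ge0 ?(ltW (M0 x))// indicE.
    by case: (_ \in _); rewrite ?normr1 ?normr0 ?mulr1 ?mulr0// exprn_ge0// (ltW (M0 x)).
  - exact: L1Z.
  move=> x; rewrite indicE; have [h|h] := boolP (x \in _); last first.
    by rewrite mulr0 mulr_ge0 ?powR_ge0.
  move: h; rewrite inE /= => h; rewrite mulr1.
  rewrite -powR_mulrn ?(ltW (M0 x))//.
  have -> : M x `^ (a + b)%:R = M x `^ ((a + b)%:R - r) * M x `^ r.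
    by rewrite -powRD ?subrK// (gt_eqF (M0 x)) implybT.
  rewrite ler_pM2r ?powR_gt0// -[_ - r]opprB !powRN lef_pV2 ?posrE ?powR_gt0//.
  by apply: ge0_ler_powR; rewrite ?nnegrE ?subr_ge0 ?(ltW t0) ?(ltW (M0 x)) ?(ltW h).
rewrite -mulrA h1 [X in _ <= X]mulrDl lerD2l -mulrA ler_wpM2l//.
by rewrite addr_ge0// mulr_ge0.
Qed.

Lemma Cov_bounded_ae Z xi M (a b : nat) (al K : R) : 0 <= al -> 1 <= K ->
  measurable_fun setT Z -> measurable_fun setT xi -> measurable_fun setT M ->
  (forall x, 1 <= M x) ->
  (forall x, `|Z x| <= M x ^+ a) -> (forall x, `|xi x| <= M x ^+ b) ->
  L1 P (fun x => M x ^+ (a + b)) -> P [set x | K < M x] = 0%E ->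
  mixing_bound Z xi al ->
  `|Cov P Z xi| <= 4 * al * K ^+ (a + b).
Proof.
move=> al0 K1 mZ mxi mM M1 Za xib LM MK H.
(* The tail moment vanishes at the level [K], so the size of this bound on the full moment drops out
   of the result. *)
pose K' := Num.max 0 (Ex P (fun x => M x ^+ (a + b))).
have := @Cov_truncate Z xi M a b K al K' al0 K1 _ mZ mxi mM M1 Za xib LM _ H.
have -> : tail_moment M (a + b) K = 0.
  have mI : measurable [set x | K < M x] by exact: measurable_gt.
  rewrite /tail_moment /Ex /Rintegral.
  rewrite (eq_integral ((fun x => (M x ^+ (a + b))%:E) \_ [set x | K < M x])); last first.
    move=> x _; rewrite patchE indicE; case: ifPn => h.
      by rewrite mulr1.
    by rewrite mulr0.
  rewrite -integral_mkcond null_set_integral//.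
  by apply/measurable_EFinP; apply: measurable_funTS; exact: measurable_funX.
rewrite mulr0 addr0; apply; by rewrite /K' le_max lexx ?orbT.
Qed.

End covariance_bounded.

(** * Chains of derivatives and Taylor remainders *)

Section chains.
Context {R : realType}.
Implicit Types (F : nat -> R -> R) (G : R -> R) (w x y : R) (K k q : nat).

(* [F k] is the [k]-th derivative of [F 0]. *)
Definition chain F K := forall k, (k < K)%N -> forall x, is_derive x 1 (F k) (F k.+1 x).

(** One number bounds both the oscillation and the Lipschitz constant. The first gives a Taylor
    remainder of order [K], the second one of order [K + 1]; the expansion uses the better of the
    two. *)
Definition osc w G := forall x y, `|G x - G y| <= w /\ `|G x - G y| <= w * `|x - y|.

Definition shift q F := fun k => F (q + k)%N.

Lemma chain_shift q F K : (q <= K)%N -> chain F K -> chain (shift q F) (K - q).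
Proof. by move=> qK cF k kK x; rewrite /shift addnS; apply: cF; rewrite -ltn_subRL. Qed.

Lemma chain_le F K k : (k <= K)%N -> chain F K -> chain F k.
Proof. by move=> kK cF j jk; apply: cF; exact: leq_trans jk kK. Qed.

Lemma chain_continuous F K k : chain F K -> (k < K)%N -> continuous (F k).
Proof.
move=> cF kK x; apply: differentiable_continuous; apply/derivable1_diffP.
by have h := cF k kK x; exact: ex_derive.
Qed.

Lemma lipschitz_continuous G w : (forall x y, `|G x - G y| <= w * `|x - y|) -> continuous G.
Proof.
move=> hG x; apply/cvgrPdist_lt => e e0.
pose w' := `|w| + 1; have w'0 : 0 < w' by rewrite ltr_pwDr.
near=> y; apply: (le_lt_trans (hG _ _)).
apply: (@le_lt_trans _ _ (w' * `|x - y|)).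
  by rewrite ler_wpM2r// (le_trans (ler_norm _))// lerDl.
rewrite mulrC -ltr_pdivlMr//; near: y.
apply/nbhs_ballP; exists (e / w') => /=; first by rewrite divr_gt0.
by move=> z.
Unshelve. all: by end_near. Qed.

Lemma osc_continuous w G : osc w G -> continuous G.
Proof. by move=> h; apply: (@lipschitz_continuous _ w) => x y; have [] := h x y. Qed.

Lemma osc_ge0 w G : osc w G -> 0 <= w.
Proof. by move=> /(_ 0 0)[h _]; exact: le_trans h. Qed.

Lemma chain_cont_le F K k w : chain F K -> osc w (F K) -> (k <= K)%N -> continuous (F k).
Proof.
move=> cF hw; rewrite leq_eqVlt => /predU1P[->|kK]; first exact: osc_continuous hw.
exact: chain_continuous cF kK.
Qed.

Lemma MVT_bound (f df : R -> R) a b c : (forall x, is_derive x 1 f (df x)) ->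
  (forall x, Num.min a b <= x <= Num.max a b -> `|df x| <= c) ->
  `|f b - f a| <= c * `|b - a|.
Proof.
wlog ab : a b / a < b => [H df1 h|].
  have [ab|ba|->] := ltgtP a b; first exact: H.
  - by rewrite distrC (distrC b); apply: H => // x; rewrite minC maxC; exact: h.
  - by rewrite !subrr normr0 mulr0.
move=> df1; rewrite (min_idPl (ltW ab)) (max_idPr (ltW ab)) => h.
have cf : {within `[a, b], continuous f}.
  apply: continuous_subspaceT => y; apply: differentiable_continuous.
  by apply/derivable1_diffP; have h' := df1 y; exact: ex_derive.
have [z zab ->] := @MVT R f df a b ab (fun x _ => df1 x) cf.
rewrite normrM ler_wpM2r// h//; move: zab; rewrite in_itv/= => /andP[z1 z2].
by rewrite !ltW.
Qed.

Definition taylor_rem F K x y := F 0%N (x + y) - \sum_(q < K.+1) y ^+ q / q`!%:R * F q x.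

(** The remainder of the derived chain is the derivative of the remainder in the increment, so
    [taylor_remP] follows by induction from the mean value inequality. *)
Lemma taylor_remS F K x y : chain F K.+1 ->
  is_derive y 1 (taylor_rem F K.+1 x) (taylor_rem (shift 1 F) K x y).
Proof.
move=> cF.
have d1 : is_derive y 1 (fun y => F 0%N (x + y)) (F 1%N (x + y)).
  have h : is_derive y 1 (fun y => x + y) 1.
    by rewrite -[X in is_derive _ _ _ X]add0r; apply: is_deriveD.
  have := @is_derive1_comp R (F 0%N) (fun y => x + y) y _ _ (cF 0%N isT (x + y)) h.
  by rewrite mulr1.
have d2 : is_derive y 1 (fun y => \sum_(q < K.+2) y ^+ q / q`!%:R * F q x)
    (\sum_(q < K.+1) y ^+ q / q`!%:R * F q.+1 x).
  have -> : (fun y => \sum_(q < K.+2) y ^+ q / q`!%:R * F q x) =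
      \sum_(q < K.+2) (fun y => y ^+ q / q`!%:R * F q x).
    by apply/funext => z; rewrite fct_sumE.
  have -> : \sum_(q < K.+1) y ^+ q / q`!%:R * F q.+1 x =
      \sum_(q < K.+2) (q%:R * y ^+ q.-1) / q`!%:R * F q x.
    rewrite [RHS]big_ord_recl /= mul0r !mul0r add0r; apply: eq_bigr => q _ /=.
    rewrite /bump leq0n add1n factS natrM; congr (_ * _).
    have h1 : (q.+1%:R : R) != 0 by rewrite pnatr_eq0.
    have h2 : (q`!%:R : R) != 0 by rewrite pnatr_eq0 -lt0n fact_gt0.
    rewrite add0n; move: (q.+1%:R : R) (q`!%:R : R) h1 h2 => u v h1 h2.
    by field; rewrite h1 h2.
  apply: is_derive_sum => q.
  have h : is_derive y 1 (fun y : R => y ^+ q) (q%:R * y ^+ q.-1).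
    have := @is_deriveX R R id q y 1 1 (is_derive_id _ _).
    by rewrite (_ : id ^+ q = (fun y : R => y ^+ q)) ?exprfctE// /GRing.scale /= mulr1.
  have h2 := @is_deriveZ R R R (fun y : R => y ^+ q) (F q x / q`!%:R) y 1 _ h.
  have -> : (fun y0 => y0 ^+ q / q`!%:R * F q x) = (F q x / q`!%:R) \*: (fun y : R => y ^+ q).
    by apply/funext => z; rewrite /= /GRing.scale /=; ring.
  by apply: is_derive_eq; rewrite /GRing.scale /=; ring.
exact: is_deriveB.
Qed.

Lemma taylor_remP F K x y w : chain F K -> osc w (F K) ->
  `|taylor_rem F K x y| <= w * `|y| ^+ K /\ `|taylor_rem F K x y| <= w * `|y| ^+ K.+1.
Proof.
elim: K F y => [|K IH] F y cF hw.
  rewrite /taylor_rem big_ord_recl big_ord0 addr0 expr0 fact0 invr1 mulr1 mul1r mulr1 expr1.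
  have [h1 h2] := hw (x + y) x; split=> //.
  by rewrite (_ : x + y - x = y) in h2; last by ring.
have w0 := osc_ge0 hw.
have cF1 : chain (shift 1 F) K by have := @chain_shift 1 F K.+1 isT cF; rewrite subn1.
have hw1 : osc w (shift 1 F K) by [].
have z0 : taylor_rem F K.+1 x 0 = 0.
  rewrite /taylor_rem addr0 big_ord_recl /= big1 ?addr0.
    by rewrite expr0 fact0 invr1 mulr1 mul1r subrr.
  by move=> i _; rewrite expr0n /= !mul0r.
have M (c : R) : (forall z, `|z| <= `|y| -> `|taylor_rem (shift 1 F) K x z| <= c) ->
    `|taylor_rem F K.+1 x y| <= c * `|y|.
  move=> h; have := @MVT_bound (taylor_rem F K.+1 x) _ 0 y c (fun z => taylor_remS x z cF).
  rewrite z0 !subr0; apply => z hz; apply: h.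
  move: hz => /andP[h1 h2]; have [y0|y0] := leP 0 y.
    move: h1 h2; rewrite (min_idPl y0) (max_idPr y0) => h1 h2.
    by rewrite !ger0_norm// (le_trans h1).
  move: h1 h2; rewrite (min_idPr (ltW y0)) (max_idPl (ltW y0)) => h1 h2.
  by rewrite !ler0_norm ?(ltW y0)// lerN2.
split.
  rewrite exprS mulrCA mulrC; apply: M => z zy.
  apply: (le_trans (proj1 (IH _ z cF1 hw1))); rewrite ler_wpM2l//.
  by rewrite lerXn2r ?nnegrE.
rewrite (exprS _ K.+1) mulrCA mulrC; apply: M => z zy.
apply: (le_trans (proj2 (IH _ z cF1 hw1))); rewrite ler_wpM2l//.
by rewrite lerXn2r ?nnegrE.
Qed.

(** The top function is bounded because its oscillation is; each integration raises the degree by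
    one. *)
Lemma chain_growth F K w : chain F K -> osc w (F K) ->
  exists2 C, 0 <= C & forall k, (k <= K)%N -> forall x, `|F k x| <= C * (1 + `|x|) ^+ (K - k).
Proof.
elim: K F => [|K IH] F cF hw.
  exists (`|F 0%N 0| + w); first by rewrite addr_ge0// (osc_ge0 hw).
  move=> k; rewrite leqn0 => /eqP -> x; rewrite subnn expr0 mulr1.
  rewrite -[F 0%N x](subrK (F 0%N 0)) addrC (le_trans (ler_normD _ _))// lerD2l.
  by have [] := hw x 0.
have cF1 : chain (shift 1 F) K by have := @chain_shift 1 F K.+1 isT cF; rewrite subn1.
have [C C0 hC] := IH (shift 1 F) cF1 hw.
exists (`|F 0%N 0| + C); first by rewrite addr_ge0.
have one x : 1 <= 1 + `|x| by rewrite lerDl.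
case=> [_ x|k kK x]; last first.
  have := hC k kK x; rewrite /shift add1n subSS => h; apply: (le_trans h).
  rewrite ler_wpM2r ?exprn_ge0 ?(le_trans ler01)//.
  by rewrite lerDr.
rewrite subn0.
have h : `|F 0%N x - F 0%N 0| <= C * (1 + `|x|) ^+ K * `|x - 0|.
  apply: (@MVT_bound _ (F 1%N)); first by move=> z; exact: (cF 0%N isT z).
  move=> z hz; have := hC 0%N isT z; rewrite /shift add1n subn0 => h; apply: (le_trans h).
  rewrite ler_wpM2l// lerXn2r ?nnegrE ?(le_trans ler01)// lerD2l.
  move: hz => /andP[h1 h2]; have [y0|y0] := leP 0 x.
    move: h1 h2; rewrite (min_idPl y0) (max_idPr y0) => h1 h2.
    by rewrite !ger0_norm// (le_trans h1).
  move: h1 h2; rewrite (min_idPr (ltW y0)) (max_idPl (ltW y0)) => h1 h2.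
  by rewrite !ler0_norm ?(ltW y0)// lerN2.
rewrite -[F 0%N x](subrK (F 0%N 0)) addrC (le_trans (ler_normD _ _))// mulrDl.
apply: lerD.
  by rewrite ler_peMr// exprn_ege1.
apply: (le_trans h); rewrite subr0 -mulrA ler_wpM2l// exprSr ler_wpM2l ?exprn_ge0 ?(le_trans ler01)//.
by rewrite lerDr.
Qed.

End chains.

(** * Sigma-algebras generated by finite families of sites *)

Section generated_sigma_algebra.
Context {d} {Om : measurableType d} {R : realType} {S : choiceType}.
Variable X : S -> Om -> R.
Hypothesis mX : forall i, measurable_fun setT (X i).
Implicit Types (U V : seq S) (Z : Om -> R).

(** The generators of [sigma_field], restated for sequences over an arbitrary index type. *)
Definition gens U : set (set Om) :=
  \bigcup_(i in [set i | i \in U]) preimage_set_system setT (X i) measurable.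

Definition smeas U Z :=
  measurable_fun setT (Z : g_sigma_algebraType (gens U) -> R).

Lemma smeas_gen U i : i \in U -> smeas U (X i).
Proof.
move=> iU _ B mB; apply: sub_sigma_algebra; exists i => //=.
by exists B => //; rewrite setTI.
Qed.

Lemma smeasS U V Z : {subset U <= V} -> smeas U Z -> smeas V Z.
Proof.
move=> UV h _ B mB; have := h measurableT B mB; rewrite setTI; apply: sub_sigma_algebra2.
by move=> A [i iU hA]; exists i => //=; exact: UV.
Qed.

Lemma smeas_measurable U Z : smeas U Z -> measurable_fun setT Z.
Proof.
move=> h _ B mB; have := h measurableT B mB; apply: smallest_sub.
  exact: sigma_algebra_measurable.
move=> A [i _ [C mC <-]]; rewrite setTI.
by rewrite -[X in measurable X]setTI; exact: mX.
Qed.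

Lemma smeas_cst U c : smeas U (fun=> c).
Proof. exact: measurable_cst. Qed.

Lemma smeasD U Z Z' : smeas U Z -> smeas U Z' -> smeas U (fun x => Z x + Z' x).
Proof. exact: measurable_funD. Qed.

Lemma smeasB U Z Z' : smeas U Z -> smeas U Z' -> smeas U (fun x => Z x - Z' x).
Proof. exact: measurable_funB. Qed.

Lemma smeasM U Z Z' : smeas U Z -> smeas U Z' -> smeas U (fun x => Z x * Z' x).
Proof. exact: measurable_funM. Qed.

Lemma smeasXn U Z n : smeas U Z -> smeas U (fun x => Z x ^+ n).
Proof. exact: measurable_funX. Qed.

Lemma smeas_comp U Z (F : R -> R) : continuous F -> smeas U Z -> smeas U (fun x => F (Z x)).
Proof.
move=> cF hZ; apply: (measurableT_comp _ hZ); exact: continuous_measurable_fun.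
Qed.

Lemma smeas_sum U I (s : seq I) (F : I -> Om -> R) :
  (forall i, smeas U (F i)) -> smeas U (fun x => \sum_(i <- s) F i x).
Proof. by move=> h; apply: measurable_sum. Qed.

Lemma smeas_level U Z c : smeas U Z -> <<s gens U>> [set x | c < Z x].
Proof.
move=> h; have := h measurableT `]c, +oo[%classic (measurable_itv _).
rewrite setTI; congr (<<s _ >> _); apply/seteqP; split => x /=;
by rewrite in_itv /= andbT.
Qed.

End generated_sigma_algebra.

(** * Envelopes measuring the polynomial order of an integrand *)

Section envelopes.
Context {d} {Om : measurableType d} {R : realType} {S : choiceType}.
Variable X : S -> Om -> R.
Implicit Types (I J : seq S) (w : Om).

(** The constant 1 makes powers monotone in the exponent. The orders of products then simply add,
    and one exponent records how many moments an integrand uses. *)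
Definition env J w : R := 1 + \sum_(i <- J) `|X i w|.

Lemma env_ge1 J w : 1 <= env J w.
Proof. by rewrite lerDl sumr_ge0. Qed.

Lemma env_gt0 J w : 0 < env J w.
Proof. exact: lt_le_trans ltr01 (env_ge1 J w). Qed.

Lemma env_ge0 J w : 0 <= env J w.
Proof. exact: ltW (env_gt0 J w). Qed.

Lemma env_cons j J w : env (j :: J) w = env J w + `|X j w|.
Proof. by rewrite /env big_cons; ring. Qed.

Lemma env_cons_ge j J w : env J w <= env (j :: J) w.
Proof. by rewrite env_cons lerDl. Qed.

Lemma norm_le_env_cons j J w : `|X j w| <= env (j :: J) w.
Proof. by rewrite env_cons lerDr env_ge0. Qed.

Lemma norm_le_env j J w : j \in J -> `|X j w| <= env J w.
Proof.
move=> jJ; rewrite /env (perm_big _ (perm_to_rem jJ)) /= big_cons.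
by rewrite addrCA lerDl addr_ge0// sumr_ge0.
Qed.

Lemma env_exp_mul j J w q s :
  `|X j w ^+ q| * env J w ^+ s <= env (j :: J) w ^+ (q + s).
Proof.
rewrite exprD normrX ler_pM ?exprn_ge0 ?env_ge0// lerXn2r ?nnegrE ?env_ge0//.
  exact: norm_le_env_cons.
exact: env_cons_ge.
Qed.

Lemma env_le_size J T w : {subset J <= T} -> env J w <= (size J).+1%:R * env T w.
Proof.
move=> JT; rewrite /env -natr1 mulrDl mul1r addrC lerD//; last exact: env_ge1.
elim: J JT => [|j J IH] JT; first by rewrite big_nil mul0r.
rewrite big_cons /= -natr1 mulrDl mul1r addrC lerD//.
  by apply: IH => i iJ; apply: JT; rewrite inE iJ orbT.
by apply: norm_le_env; apply: JT; rewrite mem_head.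
Qed.

Lemma measurable_env J : (forall i, measurable_fun setT (X i)) -> measurable_fun setT (env J).
Proof.
move=> mX; apply: measurable_funD => //; apply: measurable_sum => i.
exact: measurableT_comp.
Qed.

End envelopes.

(** * Expansion of E[W f(W)] under mixing *)

Section expansion.
Context {d} {Om : measurableType d} {R : realType} {S : choiceType}.
Variables (P : probability Om R) (X : S -> Om -> R) (Ts : seq S).
Variables (x0 : S) (dist : S -> S -> nat) (D L : nat) (kap Lam Cf : R).
Variables (th th' B : nat -> R) (ct cth : nat -> R).

Implicit Types (I J Q U A u r : seq S) (Z xi : Om -> R) (c w : R) (o : Om) (n s k q g l : nat) (e : nat -> R).
Implicit Types (F : nat -> R -> R).

Local Notation env := (env X).
Local Notation smeas := (smeas X).
Local Notation E := (Ex P).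

Definition Wsum u : Om -> R := fun o => kap * \sum_(i <- u) X i o.

(** The distance to a set of sites capped at [D], with the empty set at distance [D]. The cap makes
    the sums over scales in [V] finite. *)
Definition dst j Q : nat := \big[minn/D]_(x <- Q) dist x j.

(* Weighted count of the [k]-tuples of sites added at distance at least [g]: summing
   [V e k (maxn g (dst j Q))] over the sites [j] gives at most [V e k.+1 g]. *)
Definition V e k g : R := \sum_(l < D.+1 | (g <= l)%N) e l * B l ^+ k.

(** The function [xi] may depend on every site of [U] while its size is governed by the few sites of
    [J]: a Taylor remainder sees all the remaining sites but is bounded by a power of a single one.
    A total order up to [L] decays like [th]; one order more leaves only [th']. *)
Definition cov_decay := forall I U J Z xi n s c1 c2 g,
  {subset I <= Ts} -> {subset U <= Ts} -> {subset J <= Ts} ->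
  (size I <= n)%N -> (size J <= s)%N -> smeas I Z -> smeas U xi -> 0 <= c1 -> 0 <= c2 ->
  (forall o, `|Z o| <= c1 * env I o ^+ n) -> (forall o, `|xi o| <= c2 * env J o ^+ s) ->
  (forall x y, x \in I -> y \in U -> (g <= dist x y)%N) -> (0 < n <= L)%N ->
  ((n + s <= L)%N -> `|Cov P Z xi| <= c1 * c2 * Lam * th g) /\
  ((n + s <= L.+1)%N -> `|Cov P Z xi| <= c1 * c2 * Lam * th' g).

(* [Z] is a function of the sites of [I], of polynomial order [n], nearly orthogonal to the
   functions of the sites of [A]; the recentered products met in the expansion have this form. *)
Definition good c n I g A Z :=
  [/\ [/\ {subset I <= Ts}, (size I <= n)%N & {subset A <= Ts}], smeas I Z, 0 <= c,
   (forall o, `|Z o| <= c * env I o ^+ n) &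
   forall xi J s c2, 0 <= c2 -> smeas A xi -> {subset J <= Ts} -> (size J <= s)%N ->
     (forall o, `|xi o| <= c2 * env J o ^+ s) ->
     ((n + s <= L)%N -> `|E (fun o => Z o * xi o)| <= c * c2 * th g) /\
     ((n + s <= L.+1)%N -> `|E (fun o => Z o * xi o)| <= c * c2 * th' g)].

Hypotheses (mX : forall i, measurable_fun setT (X i)) (uTs : uniq Ts).
Hypotheses (Lam1 : 1 <= Lam) (kap0 : 0 <= kap) (Cf0 : 0 <= Cf).
Hypothesis Lenv : L1 P (fun o => env Ts o ^+ L.+1).
Hypothesis mom : forall J s, {subset J <= Ts} -> (size J <= s)%N -> (s <= L.+1)%N ->
  E (fun o => env J o ^+ s) <= Lam.
Hypothesis covb : cov_decay.
Hypotheses (th0 : 1 <= th 0%N) (thp : forall g, 0 <= th g) (thth' : forall g, th g <= th' g).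
Hypotheses (ct0 : forall l, 0 <= ct l) (cth0 : forall l, 0 <= cth l) (B1 : forall l, 1 <= B l).
(** Writing the decay as a tail sum over scales replaces sums over sites by counts of the sites
    within each scale. *)
Hypothesis thV : forall g, (g <= D)%N -> th g <= V cth 0 g.
Hypothesis Bcount : forall Q, {subset Q <= Ts} -> (size Q <= L)%N ->
  forall l, (l <= D)%N -> (count (fun j => dst j Q <= l)%N Ts)%:R <= B l.
(** The minimum is over the two Taylor remainder bounds: stop one order early and keep the fast
    decay, or go one order further at the price of a factor [kap] and of the slow decay. *)
Hypothesis tay : forall g, (g <= D)%N -> Num.min (th g) (kap * th' g) <= Cf * V ct 0 g.
(** The last level, where no derivative of [F] is left. It is kept abstract because the truncated
    and the full expansion treat it differently. *)
Hypothesis fin : forall c I g A u r Q Z (F : R -> R) w,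
  good c L I g A Z -> {subset u <= A} -> perm_eq Ts (r ++ u) -> (0 < L)%N ->
  {subset Q <= Ts} -> (size Q <= L)%N -> {subset I <= Q} -> I != [::] ->
  (forall y, y \in r -> (dst y Q <= g)%N) -> (g <= D)%N -> osc w F ->
  `|E (fun x => Z x * F (Wsum u x)) - E Z * E (fun x => F (Wsum Ts x))|
    <= Cf * c * w * V ct 0 g.

Let Lam0 : 0 <= Lam := le_trans ler01 Lam1.
Let env0 J o : 0 <= env J o := env_ge0 X J o.

Lemma dst_leD j Q : (dst j Q <= D)%N.
Proof.
rewrite /dst; elim: Q => [|x Q IH]; first by rewrite big_nil.
by rewrite big_cons geq_min IH orbT.
Qed.

Lemma dst_le j Q x : x \in Q -> (dst j Q <= dist x j)%N.
Proof.
rewrite /dst; elim: Q => // y Q IH; rewrite inE big_cons => /predU1P[->|/IH h].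
  by rewrite geq_min leqnn.
by rewrite geq_min h orbT.
Qed.

Lemma dst_sub j Q Q' : {subset Q <= Q'} -> (dst j Q' <= dst j Q)%N.
Proof.
elim: Q => [_|x Q IH h]; first by rewrite {2}/dst big_nil dst_leD.
rewrite {2}/dst big_cons leq_min dst_le ?h ?mem_head//=.
by apply: IH => y yQ; apply: h; rewrite inE yQ orbT.
Qed.

Lemma V_ge0 e k g : (forall l, 0 <= e l) -> 0 <= V e k g.
Proof. by move=> e0; rewrite sumr_ge0// => l _; rewrite mulr_ge0// exprn_ge0// (le_trans ler01). Qed.

Lemma V_mono e k k' g : (forall l, 0 <= e l) -> (k <= k')%N -> V e k g <= V e k' g.
Proof.
move=> e0 kk; apply: ler_sum => l _; rewrite ler_wpM2l//.
exact: ler_weXn2l.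
Qed.

(** After exchanging the sums, the scale [l] is hit once by each site within distance [l] of [Q],
    hence at most [B l] times. *)
Lemma V_sum e k g Q : (forall l, 0 <= e l) -> {subset Q <= Ts} -> (size Q <= L)%N ->
  \sum_(j <- Ts) V e k (maxn g (dst j Q)) <= V e k.+1 g.
Proof.
move=> e0 QT sQ; rewrite /V.
rewrite (eq_bigr (fun j => \sum_(l < D.+1 | (g <= l)%N)
   (dst j Q <= l)%N%:R * (e l * B l ^+ k))); last first.
  move=> j _; rewrite big_mkcond [RHS]big_mkcond; apply: eq_bigr => l _ /=.
  by rewrite geq_max; case: (g <= l)%N => //=; case: leqP => _; rewrite ?mul1r ?mul0r.
rewrite exchange_big /=; apply: ler_sum => l _.
rewrite (_ : \sum_(i <- Ts) _ = (\sum_(i <- Ts) (dst i Q <= l)%N%:R) * (e l * B l ^+ k)); last first.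
  by rewrite mulr_suml.
rewrite exprS (mulrCA (e l)); apply: ler_wpM2r.
  by rewrite mulr_ge0// exprn_ge0// (le_trans ler01).
apply: le_trans (Bcount QT sQ _); last by rewrite -ltnS.
rewrite -sum1_count natr_sum [leRHS]big_mkcond; apply: ler_sum => i _.
by case: ifP.
Qed.

Lemma V_sum_sub e k g Q r : (forall l, 0 <= e l) -> {subset Q <= Ts} -> (size Q <= L)%N ->
  uniq r -> {subset r <= Ts} -> \sum_(j <- r) V e k (maxn g (dst j Q)) <= V e k.+1 g.
Proof.
move=> e0 QT sQ ur rT; apply: le_trans (V_sum k g e0 QT sQ).
have pe : perm_eq Ts (r ++ [seq x <- Ts | x \notin r]).
  apply: uniq_perm => //.
    rewrite cat_uniq ur filter_uniq// andbT; apply/hasPn => x.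
    by rewrite mem_filter => /andP[].
  move=> x; rewrite mem_cat mem_filter; case: (boolP (x \in r)) => //= /rT ->//.
by rewrite (perm_big _ pe) big_cat /= lerDl sumr_ge0// => j _; exact: V_ge0.
Qed.

Lemma V_sum_near e k g Q r : (forall l, 0 <= e l) -> {subset Q <= Ts} -> (size Q <= L)%N ->
  uniq r -> {subset r <= Ts} -> (forall y, y \in r -> (dst y Q <= g)%N) ->
  \sum_(j <- r) V e k g <= V e k.+1 g.
Proof.
move=> e0 QT sQ ur rT hr; apply: le_trans (V_sum_sub k g e0 QT sQ ur rT).
by rewrite !big_seq; apply: ler_sum => j /hr h; rewrite (maxn_idPl h).
Qed.

(* Polynomial domination by the envelope of the whole field: ensures integrability only. *)
Definition dom s Z := measurable_fun setT Z /\
  exists2 C, 0 <= C & forall o, `|Z o| <= C * env Ts o ^+ s.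

Lemma dom_L1 (s : nat) Z : (s <= L.+1)%N -> dom s Z -> L1 P Z.
Proof.
move=> sL [mZ [C C0 hZ]]; apply: (L1_le mZ (g := fun o => C * env Ts o ^+ L.+1)).
  move=> o; apply: (le_trans (hZ o)); rewrite ler_wpM2l//.
  by apply: ler_weXn2l => //; exact: env_ge1.
exact: L1Z.
Qed.

Lemma dom_le (s s' : nat) Z : (s <= s')%N -> dom s Z -> dom s' Z.
Proof.
move=> ss [mZ [C C0 hZ]]; split=> //; exists C => // o; apply: (le_trans (hZ o)).
by rewrite ler_wpM2l//; apply: ler_weXn2l => //; exact: env_ge1.
Qed.

Lemma domM (s s' : nat) Z Z' : dom s Z -> dom s' Z' -> dom (s + s') (fun o => Z o * Z' o).
Proof.
move=> [mZ [C C0 hZ]] [mZ' [C' C'0 hZ']]; split; first exact: measurable_funM.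
exists (C * C'); first exact: mulr_ge0.
by move=> o; rewrite normrM exprD mulrACA ler_pM.
Qed.

Lemma domD (s : nat) Z Z' : dom s Z -> dom s Z' -> dom s (fun o => Z o + Z' o).
Proof.
move=> [mZ [C C0 hZ]] [mZ' [C' C'0 hZ']]; split; first exact: measurable_funD.
exists (C + C'); first exact: addr_ge0.
by move=> o; rewrite (le_trans (ler_normD _ _))// mulrDl lerD.
Qed.

Lemma domZ (s : nat) c Z : dom s Z -> dom s (fun o => c * Z o).
Proof.
move=> [mZ [C C0 hZ]]; split; first exact: measurable_funM.
exists (`|c| * C); first exact: mulr_ge0.
by move=> o; rewrite normrM -mulrA ler_wpM2l.
Qed.

Lemma domB (s : nat) Z Z' : dom s Z -> dom s Z' -> dom s (fun o => Z o - Z' o).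
Proof.
move=> h h'; have := domD h (domZ (-1) h'); congr dom; apply/funext => o.
by rewrite mulN1r.
Qed.

Lemma dom_cst c : dom 0 (fun=> c).
Proof. by split => //; exists `|c| => // o; rewrite expr0 mulr1. Qed.

Lemma domX j q : j \in Ts -> dom q (fun o => X j o ^+ q).
Proof.
move=> jT; split; first exact: measurable_funX.
exists 1 => // o; rewrite mul1r normrX lerXn2r ?nnegrE//.
exact: norm_le_env.
Qed.

Lemma measurable_Wsum u : measurable_fun setT (Wsum u).
Proof. by apply: measurable_funM => //; apply: measurable_sum. Qed.

Lemma smeas_Wsum u U : {subset u <= U} -> smeas U (Wsum u).
Proof.
move=> uU; apply: smeasM; first exact: smeas_cst.
elim: u uU => [|i u IH] uU.
  by apply: (@smeasS _ _ _ _ _ U) => //; under eq_fun do rewrite big_nil; exact: smeas_cst.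
under eq_fun do rewrite big_cons.
apply: smeasD; first by apply: smeas_gen; apply: uU; rewrite mem_head.
by apply: IH => x xu; apply: uU; rewrite inE xu orbT.
Qed.

Lemma dom_chain F K w u k : {subset u <= Ts} -> chain F K -> osc w (F K) -> (k <= K)%N ->
  dom (K - k) (fun x => F k (Wsum u x)).
Proof.
move=> sT cF hw kK; split.
  apply: (measurableT_comp _ (measurable_Wsum u)).
  by apply: continuous_measurable_fun; exact: chain_cont_le cF hw kK.
have [C C0 hC] := chain_growth cF hw.
pose b := 1 + kap * (size u).+1%:R.
have b0 : 0 <= b by rewrite addr_ge0// mulr_ge0.
exists (C * b ^+ (K - k)); first by rewrite mulr_ge0// exprn_ge0.
move=> x; apply: (le_trans (hC k kK _)); rewrite -mulrA ler_wpM2l// -exprMn.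
rewrite lerXn2r ?nnegrE ?addr_ge0 ?mulr_ge0//.
rewrite mulrDl mul1r lerD ?env_ge1// normrM ger0_norm// -mulrA ler_wpM2l//.
apply: (le_trans (ler_norm_sum _ _ _)).
by apply: le_trans (env_le_size X x sT); rewrite /env lerDr.
Qed.

Lemma good_dom c n I g A Z : good c n I g A Z -> dom n Z.
Proof.
move=> [[IT sI AT] mZ c0 hZ _]; split; first exact: smeas_measurable mZ.
exists (c * (size I).+1%:R ^+ n); first by rewrite mulr_ge0// exprn_ge0.
move=> o; apply: (le_trans (hZ o)); rewrite -mulrA ler_wpM2l// -exprMn.
by rewrite lerXn2r ?nnegrE ?mulr_ge0//; exact: env_le_size.
Qed.

(** The constant 1 is an admissible test function, of order 0. *)
Lemma good_E c n I g A Z : good c n I g A Z -> (n <= L)%N -> `|E Z| <= c * th g.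
Proof.
move=> [_ _ c0 _ h] nL.
have b1 o : `|1 : R| <= 1 * env [::] o ^+ 0 by rewrite normr1 mul1r expr0.
have mc : smeas A (fun=> 1) by exact: smeas_cst.
have nT : {subset [::] <= Ts} by [].
have [+ _] := h (fun=> 1) [::] 0%N 1 ler01 mc nT isT b1.
rewrite addn0 mulr1 => /(_ nL); congr (`|_| <= _).
by apply: eq_Ex => o; rewrite mulr1.
Qed.

Lemma good_absE c n I g A Z : good c n I g A Z -> (n <= L.+1)%N -> `|E Z| <= c * Lam.
Proof.
move=> gZ nL; have dZ := good_dom gZ; have [[IT sI AT] mZ c0 hZ _] := gZ.
have Li : L1 P (fun o => env I o ^+ n).
  apply: (@dom_L1 n) => //; split; first by apply: measurable_funX; exact: measurable_env.
  exists ((size I).+1%:R ^+ n); first by rewrite exprn_ge0.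
  move=> o; rewrite ger0_norm ?exprn_ge0// -exprMn.
  by rewrite lerXn2r ?nnegrE ?mulr_ge0//; exact: env_le_size.
apply: (@le_trans _ _ (E (fun o => c * env I o ^+ n))).
  apply: Ex_abs_le => //; [exact: dom_L1 dZ|exact: L1Z].
by rewrite ExZ// ler_wpM2l//; exact: mom.
Qed.

Lemma bound_dom J s xi c2 : 0 <= c2 -> measurable_fun setT xi -> {subset J <= Ts} ->
  (forall o, `|xi o| <= c2 * env J o ^+ s) -> dom s xi.
Proof.
move=> c20 mxi JT h; split=> //; exists (c2 * (size J).+1%:R ^+ s).
  by rewrite mulr_ge0// exprn_ge0.
move=> o; apply: (le_trans (h o)); rewrite -mulrA ler_wpM2l// -exprMn.
by rewrite lerXn2r ?nnegrE ?mulr_ge0//; exact: env_le_size.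
Qed.

Lemma bound_E J s xi c2 : 0 <= c2 -> measurable_fun setT xi -> {subset J <= Ts} ->
  (size J <= s)%N -> (s <= L.+1)%N ->
  (forall o, `|xi o| <= c2 * env J o ^+ s) -> `|E xi| <= c2 * Lam.
Proof.
move=> c20 mxi JT sJ sL h; have dx := bound_dom c20 mxi JT h.
have Li : L1 P (fun o => env J o ^+ s).
  apply: (@dom_L1 s) => //; apply: (@bound_dom J s _ 1) => //.
    by apply: measurable_funX; exact: measurable_env.
  by move=> o; rewrite ger0_norm ?exprn_ge0// mul1r.
apply: (@le_trans _ _ (E (fun o => c2 * env J o ^+ s))).
  apply: Ex_abs_le => //; [exact: dom_L1 dx|exact: L1Z].
by rewrite ExZ// ler_wpM2l//; exact: mom.
Qed.

Lemma centered_E c n I g A Z xi s : good c n I g A Z -> dom s xi -> (n + s <= L.+1)%N ->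
  E (fun o => (Z o - E Z) * xi o) = E (fun o => Z o * xi o) - E Z * E xi.
Proof.
move=> gZ dx ns; have dZ := good_dom gZ.
have Lx : L1 P xi by apply: dom_L1 dx; exact: leq_trans (leq_addl _ _) ns.
have LZx : L1 P (fun o => Z o * xi o) by exact: dom_L1 (domM dZ dx).
under eq_Ex do rewrite mulrBl.
by rewrite ExB ?ExZ//; exact: L1Z.
Qed.

(* The two available estimates, via [good] and via the covariance inequality, are combined:
   the decay is governed by the largest gap met so far. *)
Lemma good_centered c n I g g0 A A' Z xi J s c2 : good c n I g A Z -> (0 < n)%N -> (n <= L)%N ->
  {subset A' <= A} -> (forall x y, x \in I -> y \in A' -> (g0 <= dist x y)%N) ->
  0 <= c2 -> smeas A' xi -> {subset J <= Ts} -> (size J <= s)%N ->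
  (forall o, `|xi o| <= c2 * env J o ^+ s) ->
  ((n + s <= L)%N -> `|E (fun o => (Z o - E Z) * xi o)| <= c * (1 + Lam) * c2 * th (maxn g g0)) /\
  ((n + s <= L.+1)%N -> `|E (fun o => (Z o - E Z) * xi o)| <= c * (1 + Lam) * c2 * th' (maxn g g0)).
Proof.
move=> gZ n0 nL A'A far c20 mxi JT sJ hxi; have [[IT sI AT] mZ c0 hZ hgood] := gZ.
have mxiA : smeas A xi := smeasS A'A mxi.
have mxi' : measurable_fun setT xi := smeas_measurable mX mxi.
have dx := bound_dom c20 mxi' JT hxi.
have A'T : {subset A' <= Ts} by move=> x /A'A /AT.
have [G1 G2] := hgood xi J s c2 c20 mxiA JT sJ hxi.
have nn : (0 < n <= L)%N by rewrite n0.
have [C1 C2] := covb IT A'T JT sI sJ mZ mxi c0 c20 hZ hxi far nn.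
have EZ := good_E gZ nL.
have cc : 0 <= c * c2 by rewrite mulr_ge0.
have Exi : (s <= L.+1)%N -> `|E xi| <= c2 * Lam by move=> ?; exact: bound_E hxi.
have main t : (n + s <= L.+1)%N -> (forall g, th g <= t g) -> (forall g, 0 <= t g) ->
    `|E (fun o => Z o * xi o)| <= c * c2 * t g -> `|Cov P Z xi| <= c * c2 * Lam * t g0 ->
    `|E (fun o => (Z o - E Z) * xi o)| <= c * (1 + Lam) * c2 * t (maxn g g0).
  move=> ns tht t0 h1 h2; rewrite (centered_E gZ dx ns).
  (* If the new gap is the larger one, the covariance inequality decides; otherwise the
     near-orthogonality at gap [g] bounds both the mixed moment and [E Z]. *)
  have [_|_] := leqP g g0.
    rewrite -/(Cov P Z xi); apply: (le_trans h2).
    have -> : c * (1 + Lam) * c2 * t g0 = c * c2 * Lam * t g0 + c * c2 * t g0 by ring.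
    by rewrite lerDl mulr_ge0.
  have -> : c * (1 + Lam) * c2 * t g = c * c2 * t g + (c * t g) * (c2 * Lam) by ring.
  rewrite (le_trans (ler_normB _ _))// lerD// normrM ler_pM//.
    by rewrite (le_trans EZ)// ler_wpM2l.
  by apply: Exi; exact: leq_trans (leq_addl _ _) ns.
split=> ns.
  by apply: (main th) => //; [exact: leqW|exact: G1|exact: C1].
apply: (main th') => //; [|exact: G2|exact: C2].
by move=> h; exact: le_trans (thp h) (thth' h).
Qed.

(** The power of [X j] is moved to the test function: as [j] belongs to [A'], the product
    [X j ^+ q * xi] is again a test function on [A'], of order [q + s], and [good_centered]
    applies. *)
Lemma good_step c n I g g0 A A' Z j q : good c n I g A Z -> (0 < n)%N -> (0 < q)%N -> (n + q <= L)%N ->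
  {subset A' <= A} -> j \in A' -> (forall x y, x \in I -> y \in A' -> (g0 <= dist x y)%N) ->
  good (c * (1 + Lam)) (n + q) (j :: I) (maxn g g0) A' (fun o => (Z o - E Z) * X j o ^+ q).
Proof.
move=> gZ n0 q0 nqL A'A jA' far; have [[IT sI AT] mZ c0 hZ hgood] := gZ.
have nL : (n <= L)%N := leq_trans (leq_addr _ _) nqL.
have A'T : {subset A' <= Ts} by move=> x /A'A /AT.
split.
- split=> //; first by move=> x; rewrite inE => /predU1P[->|/IT//]; exact: A'T.
  by rewrite /= -addn1 leq_add.
- apply: smeasM.
    by apply: smeasB; [apply: smeasS mZ => x xI; rewrite inE xI orbT|exact: smeas_cst].
  by apply: smeasXn; apply: smeas_gen; rewrite mem_head.
- by rewrite mulr_ge0// addr_ge0.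
- move=> o; rewrite normrM.
  have h1 : `|Z o - E Z| <= c * (1 + Lam) * env I o ^+ n.
    rewrite (le_trans (ler_normB _ _))// mulrDr mulr1 mulrDl lerD//.
    rewrite (le_trans (good_absE gZ (leqW nL)))// ler_peMr ?mulr_ge0//.
    by rewrite exprn_ege1// env_ge1.
  have := env_exp_mul X j I o q n; rewrite (addnC n) => h2.
  apply: le_trans (ler_wpM2l _ h2); last by rewrite mulr_ge0// addr_ge0.
  rewrite mulrC mulrCA; apply: ler_wpM2l => //.
- move=> xi J s c2 c20 mxi JT sJ hxi.
  have mxi' : smeas A' (fun o => X j o ^+ q * xi o).
    by apply: smeasM => //; apply: smeasXn; exact: smeas_gen.
  have jJT : {subset j :: J <= Ts}.
    by move=> x; rewrite inE => /predU1P[->|/JT//]; exact: A'T.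
  have sjJ : (size (j :: J) <= q + s)%N by rewrite /= -add1n leq_add.
  have hb o : `|X j o ^+ q * xi o| <= c2 * env (j :: J) o ^+ (q + s).
    rewrite normrM; apply: le_trans (ler_wpM2l c20 (env_exp_mul X j J o q s)).
    by rewrite mulrCA; apply: ler_wpM2l.
  have := good_centered gZ n0 nL A'A far c20 mxi' jJT sjJ hb.
  rewrite addnA => -[H1 H2].
  have eqE : E (fun o => (Z o - E Z) * X j o ^+ q * xi o) =
      E (fun o => (Z o - E Z) * (X j o ^+ q * xi o)).
    by apply: eq_Ex => o; rewrite mulrA.
  by rewrite eqE; split.
Qed.

(** In the product of means the decay at gap [g] already sits in the number [E Z]. The site [j] can
    therefore start a new cluster that is tested against all of [Ts] and still inherits the gap
    [g]. *)
Lemma good_restart c n I g A Z j q : good c n I g A Z -> (0 < n)%N -> (0 < q)%N -> (n + q <= L)%N ->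
  j \in Ts ->
  good (c * (1 + Lam)) (n + q) [:: j] g Ts (fun o => E Z * X j o ^+ q).
Proof.
move=> gZ n0 q0 nqL jT; have [[IT sI AT] mZ c0 hZ hgood] := gZ.
have nL : (n <= L)%N := leq_trans (leq_addr _ _) nqL.
have EZ := good_E gZ nL; have aEZ := good_absE gZ (leqW nL).
have cL : 0 <= c * (1 + Lam) by rewrite mulr_ge0// addr_ge0.
split=> //.
- split=> //; first by move=> x; rewrite inE => /eqP->.
  by rewrite /= addn_gt0 n0.
- apply: smeasM; first exact: smeas_cst.
  by apply: smeasXn; apply: smeas_gen; rewrite mem_head.
- move=> o; rewrite normrM.
  have h2 := env_exp_mul X j [::] o q n.
  have h3 : env [::] o = 1 by rewrite /env big_nil addr0.
  rewrite addnC; apply: le_trans (ler_wpM2l cL h2).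
  rewrite h3 expr1n mulr1 ler_wpM2r// (le_trans aEZ)// ler_wpM2l// lerDr//.
- move=> xi J s c2 c20 mxi JT sJ hxi.
  have mxi' : measurable_fun setT (fun o => X j o ^+ q * xi o).
    by apply: measurable_funM; [exact: measurable_funX|exact: smeas_measurable mxi].
  have jJT : {subset j :: J <= Ts}.
    by move=> x; rewrite inE => /predU1P[->|/JT//].
  have sjJ : (size (j :: J) <= q + s)%N by rewrite /= -add1n leq_add.
  have hb o : `|X j o ^+ q * xi o| <= c2 * env (j :: J) o ^+ (q + s).
    rewrite normrM; apply: le_trans (ler_wpM2l c20 (env_exp_mul X j J o q s)).
    by rewrite mulrCA; apply: ler_wpM2l.
  have main : (n + q + s <= L.+1)%N -> `|E (fun o => E Z * X j o ^+ q * xi o)| <= c * (1 + Lam) * c2 * th g.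
    rewrite -addnA => nqs.
    have sL : (q + s <= L.+1)%N := leq_trans (leq_addl _ _) nqs.
    have Lx : L1 P (fun o => X j o ^+ q * xi o) by exact: dom_L1 sL (bound_dom c20 mxi' jJT hb).
    have -> : E (fun o => E Z * X j o ^+ q * xi o) = E Z * E (fun o => X j o ^+ q * xi o).
      by rewrite -ExZ//; apply: eq_Ex => o; rewrite mulrA.
    have -> : c * (1 + Lam) * c2 * th g = (c * th g) * (c2 * Lam) + c * th g * c2 by ring.
    apply: (@le_trans _ _ ((c * th g) * (c2 * Lam))); last by rewrite lerDl !mulr_ge0.
    by rewrite normrM ler_pM// (bound_E _ mxi' jJT sjJ).
  split=> ns; first by apply: main; exact: leqW.
  by apply: (le_trans (main ns)); rewrite ler_wpM2l// mulr_ge0.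
Qed.

Fixpoint expand_const K : R := if K is K'.+1 then
  2 * K'.+1%:R * (1 + Lam) * expand_const K' + 2 * (1 + Lam) * Cf + 1 else Cf + 1.

Lemma expand_constS K : expand_const K.+1 = 2 * K.+1%:R * (1 + Lam) * expand_const K + 2 * (1 + Lam) * Cf + 1.
Proof. by []. Qed.

Lemma expand_const_ge1 K : 1 <= expand_const K.
Proof.
elim: K => [|K IH] /=; first by rewrite lerDr.
rewrite lerDr addr_ge0// !mulr_ge0// ?addr_ge0//; exact: le_trans IH.
Qed.

Lemma expand_const_mono k K : (k <= K)%N -> expand_const k <= expand_const K.
Proof.
elim: K => [|K IH]; first by rewrite leqn0 => /eqP->.
rewrite leq_eqVlt => /predU1P[->//|]; rewrite ltnS => /IH h; apply: (le_trans h) => /=.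
have C0 : 0 <= expand_const K := le_trans ler01 (expand_const_ge1 K).
rewrite -addrA -[leLHS]addr0 lerD//; last by rewrite addr_ge0// !mulr_ge0// addr_ge0.
rewrite -[leLHS]mul1r ler_wpM2r//.
have h1 : (1 : R) <= K.+1%:R by rewrite ler1n.
have h2 : (1 : R) <= 1 + Lam by rewrite lerDl.
rewrite -[leLHS]mul1r ler_pM// -[leLHS]mul1r ler_pM//; lra.
Qed.

Lemma Wsum_perm u u' : perm_eq u u' -> Wsum u =1 Wsum u'.
Proof. by move=> h o; rewrite /Wsum (perm_big _ h). Qed.

Lemma Wsum_cons j u o : Wsum (j :: u) o = Wsum u o + kap * X j o.
Proof. by rewrite /Wsum big_cons mulrDr addrC. Qed.

(** Each removal of a site is Taylor expanded at the sum that remains; the terms of order 0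
    telescope. *)
Lemma telescope F K u t o : F 0%N (Wsum (u ++ t) o) - F 0%N (Wsum t o) =
  \sum_(i < size u) (
    \sum_(q < K) (kap * X (nth x0 u i) o) ^+ q.+1 / (q.+1)`!%:R * F q.+1 (Wsum (drop i.+1 u ++ t) o) +
    taylor_rem F K (Wsum (drop i.+1 u ++ t) o) (kap * X (nth x0 u i) o)).
Proof.
elim: u => [|x u IH]; first by rewrite big_ord0 subrr.
rewrite big_ord_recl /= drop0 -IH Wsum_cons /taylor_rem big_ord_recl /=.
rewrite expr0 fact0 invr1 mulr1 mul1r; set a := \sum_(q < K) _.
by ring.
Qed.

Lemma shift_sum K q (b e : nat -> R) : (q <= K)%N ->
  \sum_(k < K.+1) (if (q <= k)%N then b (k - q)%N else 0) * e k =
  \sum_(k < (K - q).+1) b k * e (q + k)%N.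
Proof.
move=> qK; rewrite -(big_mkord xpredT (fun k => (if (q <= k)%N then b (k - q)%N else 0) * e k)).
rewrite (@big_cat_nat _ _ _ q)//=; last exact: leqW.
rewrite [X in X + _]big_nat [X in X + _]big1 ?add0r; last first.
  by move=> k /andP[_ kq]; rewrite leqNgt kq mul0r.
rewrite -{1}[q]add0n big_addn subSn// big_mkord; apply: eq_bigr => k _.
by rewrite leq_addl addnK addnC.
Qed.

Lemma sorted_dst I u (s := sort (fun x y => (dst x I <= dst y I)%N) u) i : (i < size s)%N ->
  (forall y, y \in drop i s -> (dst (nth x0 s i) I <= dst y I)%N) /\
  (forall y, y \in take i.+1 s -> (dst y I <= dst (nth x0 s i) I)%N).
Proof.
move=> si; set le := (fun x y => (dst x I <= dst y I)%N).
have le_tr : transitive le by move=> a b c; rewrite /le; exact: leq_trans.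
have le_refl : reflexive le by move=> a; exact: leqnn.
have ss : sorted le s by apply: sort_sorted => a b; exact: leq_total.
split=> y hy.
  have /(nthP x0)[k kd <-] := hy; rewrite size_drop in kd; rewrite nth_drop.
  by apply: (sorted_leq_nth le_tr le_refl x0 ss); rewrite ?inE ?leq_addr// -ltn_subRL.
have /(nthP x0)[k kt <-] := hy; rewrite size_take in kt.
have ki : (k <= i)%N.
  by rewrite -ltnS; apply: leq_trans kt _; case: ifP => //; move/negbT; rewrite -leqNgt.
rewrite nth_take//.
by apply: (sorted_leq_nth le_tr le_refl x0 ss); rewrite ?inE// (leq_ltn_trans ki).
Qed.

(** Induction on the number [K] of available derivatives, with [n + K] fixed. [u] holds the sites
    still in the sum, [r] those removed, and [Q] the at most [n] sites met so far; since [r] lies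
    within [g] of [Q], a ball count bounds its size. Removing [u] against the centered [Z] gives one
    family of Taylor terms; restoring [r], which turns the mean over the partial sum into the mean
    over the full sum, gives the other. A Taylor term of order [q] is an instance with [q] fewer
    derivatives, and each sum over sites raises the index of [V] by one. *)
Lemma expand K n : (n + K)%N = L -> (0 < n)%N -> forall c I g A Z u r Q,
  good c n I g A Z -> {subset u <= A} -> perm_eq Ts (r ++ u) -> {subset Q <= Ts} ->
  (size Q <= n)%N -> {subset I <= Q} -> I != [::] ->
  (forall y, y \in r -> (dst y Q <= g)%N) -> (g <= D)%N ->
  exists b : nat -> R,
    (forall k, (k <= K)%N -> `|b k| <= expand_const K * c * kap ^+ k * V cth k g) /\
    forall F w, chain F K -> osc w (F K) ->
      `|E (fun o => Z o * F 0%N (Wsum u o)) - \sum_(k < K.+1) b k * E (fun o => F k (Wsum Ts o))|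
        <= expand_const K * c * w * kap ^+ K * V ct K g.
Proof.
elim/ltn_ind: K n => -[_|K IH] n nKL n0 c I g A Z u r Q gZ uA pT QT sQ IQ I0 near gD.
  rewrite addn0 in nKL; rewrite {}nKL in n0 gZ sQ.
  have [[IT sI AT] mZ c0 hZ hgood] := gZ.
  exists (fun=> E Z); split=> [k|F w cF hw].
    rewrite leqn0 => /eqP->; rewrite expr0 mulr1.
    apply: (le_trans (good_E gZ (leqnn _))); apply: (le_trans (ler_wpM2l c0 (thV gD))).
    by rewrite -mulrA ler_peMl ?mulr_ge0 ?V_ge0// lerDr.
  rewrite big_ord1 expr0 mulr1.
  apply: (le_trans (fin gZ uA pT n0 QT sQ IQ I0 near gD hw)).
  by rewrite -!mulrA ler_wpM2r ?lerDl// !mulr_ge0 ?V_ge0// (osc_ge0 hw).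
have [[IT sI AT] mZ c0 hZ hgood] := gZ.
pose s := sort (fun x y => (dst x I <= dst y I)%N) u.
have psu : perm_eq s u by rewrite /s perm_sort.
have nL : (n <= L)%N by rewrite -nKL leq_addr.
have sIL : (size I <= L)%N := leq_trans sI nL.
have sQL : (size Q <= L)%N := leq_trans sQ nL.
have uru : uniq (r ++ u) by rewrite -(perm_uniq pT).
have [ur [_ uu]] : uniq r /\ ~~ has (mem r) u /\ uniq u by move: uru; rewrite cat_uniq => /and3P[].
have rT : {subset r <= Ts} by move=> x xr; rewrite (perm_mem pT) mem_cat xr.
have uT : {subset u <= Ts} by move=> x xu; rewrite (perm_mem pT) mem_cat xu orbT.
have us : uniq s by rewrite (perm_uniq psu).
have sT : {subset s <= Ts} by move=> x; rewrite (perm_mem psu); exact: uT.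
have sA : {subset s <= A} by move=> x; rewrite (perm_mem psu); exact: uA.
pose g1 i := maxn g (dst (nth x0 s i) I).
pose c' := c * (1 + Lam); have c'E : c' = c * (1 + Lam) by [].
have c'0 : 0 <= c' by rewrite mulr_ge0// addr_ge0.
clearbody c'; have CK0 : 0 <= expand_const K := le_trans ler01 (expand_const_ge1 K).
(* [Z1] extends the cluster [I] by a site of [u]; [Z2] starts a cluster at a removed site, with
   [E Z] as a constant factor. *)
pose Z1 i q := fun o => (Z o - E Z) * X (nth x0 s i) o ^+ q.
pose Z2 i q := fun o => E Z * X (nth x0 r i) o ^+ q.
have [g1D CKm] : (forall i, (g1 i <= D)%N) /\ forall q : 'I_K.+1, expand_const (K.+1 - q.+1) <= expand_const K.
  by split=> [i|q]; [rewrite geq_max gD dst_leD|apply: expand_const_mono; rewrite subSS leq_subr].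
have G1 (i : 'I_(size s)) q : (0 < q)%N -> (n + q <= L)%N ->
    good c' (n + q) (nth x0 s i :: I) (g1 i) (drop i s) (Z1 i q).
  move=> q0 nq; rewrite c'E; apply: (good_step gZ) => //.
  - by move=> x /mem_drop /sA.
  - by rewrite (drop_nth x0)// mem_head.
  - move=> x y xI yd; have [h _] := sorted_dst (I := I) (ltn_ord i).
    exact: leq_trans (h y yd) (dst_le _ xI).
have G2 (i : 'I_(size r)) q : (0 < q)%N -> (n + q <= L)%N ->
    good c' (n + q) [:: nth x0 r i] g Ts (Z2 i q).
  by move=> q0 nq; rewrite c'E; apply: (good_restart gZ) => //; apply: rT; exact: mem_nth.
have st1 (iq : 'I_(size s) * 'I_K.+1) : exists b : nat -> R,
   (forall k, (k <= K.+1 - iq.2.+1)%N -> `|b k| <= expand_const K * c' * kap ^+ k * V cth k (g1 iq.1)) /\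
   forall F w, chain F (K.+1 - iq.2.+1) -> osc w (F (K.+1 - iq.2.+1)%N) ->
     `|E (fun o => Z1 iq.1 iq.2.+1 o * F 0%N (Wsum (drop iq.1.+1 s) o))
        - \sum_(k < (K.+1 - iq.2.+1).+1) b k * E (fun o => F k (Wsum Ts o))|
        <= expand_const K * c' * w * kap ^+ (K.+1 - iq.2.+1) * V ct (K.+1 - iq.2.+1) (g1 iq.1).
  case: iq => i q /=; set K1 := (K.+1 - q.+1)%N.
  have K1K : (K1 < K.+1)%N by rewrite /K1 subSS ltnS leq_subr.
  have nK1 : (n + q.+1 + K1)%N = L by rewrite -nKL -addnA subnKC.
  have nqL : (n + q.+1 <= L)%N by rewrite -nK1 leq_addr.
  have [h1 h2] := sorted_dst (I := I) (ltn_ord i).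
  have [||||||||b [hb1 hb2]] := IH K1 K1K (n + q.+1)%N nK1 (ltn_addr _ n0) c' _ _ _ _
    (drop i.+1 s) (r ++ take i.+1 s) (nth x0 s i :: Q) (G1 i q.+1 isT nqL).
  - by move=> x; rewrite [in _ \in drop i s](drop_nth x0)// inE => ->; rewrite orbT.
  - apply: (perm_trans pT); rewrite -catA perm_cat2l cat_take_drop perm_sym; exact: psu.
  - by move=> x; rewrite inE => /predU1P[->|/QT//]; apply: sT; exact: mem_nth.
  - by rewrite /= -addn1 leq_add.
  - by move=> x; rewrite !inE => /predU1P[->|/IQ ->]; rewrite ?eqxx ?orbT.
  - by [].
  - move=> y; rewrite mem_cat => /orP[yr|ys].
      apply: leq_trans (leq_maxl _ _); apply: leq_trans (near y yr).
      by apply: dst_sub => x xQ; rewrite inE xQ orbT.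
    apply: leq_trans (leq_maxr _ _); apply: leq_trans (h2 y ys).
    by apply: dst_sub => x xI; rewrite inE IQ ?orbT.
  - exact: g1D.
  exists b; split=> [k kK|F w cF hw].
    apply: (le_trans (hb1 k kK)); rewrite -!mulrA ler_wpM2r ?mulr_ge0 ?V_ge0 ?exprn_ge0//.
    exact: (CKm q).
  apply: (le_trans (hb2 F w cF hw)); rewrite -!mulrA ler_wpM2r ?mulr_ge0 ?V_ge0 ?exprn_ge0 ?(osc_ge0 hw)//.
  exact: (CKm q).
have st2 (iq : 'I_(size r) * 'I_K.+1) : exists b : nat -> R,
   (forall k, (k <= K.+1 - iq.2.+1)%N -> `|b k| <= expand_const K * c' * kap ^+ k * V cth k g) /\
   forall F w, chain F (K.+1 - iq.2.+1) -> osc w (F (K.+1 - iq.2.+1)%N) ->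
     `|E (fun o => Z2 iq.1 iq.2.+1 o * F 0%N (Wsum (drop iq.1.+1 r ++ u) o))
        - \sum_(k < (K.+1 - iq.2.+1).+1) b k * E (fun o => F k (Wsum Ts o))|
        <= expand_const K * c' * w * kap ^+ (K.+1 - iq.2.+1) * V ct (K.+1 - iq.2.+1) g.
  case: iq => i q /=; set K1 := (K.+1 - q.+1)%N.
  have K1K : (K1 < K.+1)%N by rewrite /K1 subSS ltnS leq_subr.
  have nK1 : (n + q.+1 + K1)%N = L by rewrite -nKL -addnA subnKC.
  have nqL : (n + q.+1 <= L)%N by rewrite -nK1 leq_addr.
  have [||||||||b [hb1 hb2]] := IH K1 K1K (n + q.+1)%N nK1 (ltn_addr _ n0) c' _ _ _ _
    (drop i.+1 r ++ u) (take i.+1 r) (nth x0 r i :: Q) (G2 i q.+1 isT nqL).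
  - by move=> x; rewrite mem_cat => /orP[/mem_drop /rT|/uT].
  - by rewrite catA cat_take_drop.
  - by move=> x; rewrite inE => /predU1P[->|/QT//]; apply: rT; exact: mem_nth.
  - by rewrite /= -addn1 leq_add.
  - by move=> x; rewrite !inE => /eqP ->; rewrite eqxx.
  - by [].
  - move=> y /mem_take yr; apply: leq_trans (near y yr).
    by apply: dst_sub => x xQ; rewrite inE xQ orbT.
  - exact: gD.
  exists b; split=> [k kK|F w cF hw].
    apply: (le_trans (hb1 k kK)); rewrite -!mulrA ler_wpM2r ?mulr_ge0 ?V_ge0 ?exprn_ge0//.
    exact: (CKm q).
  apply: (le_trans (hb2 F w cF hw)); rewrite -!mulrA ler_wpM2r ?mulr_ge0 ?V_ge0 ?exprn_ge0 ?(osc_ge0 hw)//.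
  exact: (CKm q).
have [b1 hb1] := choice st1; have [b2 hb2] := choice st2.
pose a (q : nat) : R := kap ^+ q.+1 / (q.+1)`!%:R.
have a0 q : 0 <= a q by rewrite mulr_ge0 ?exprn_ge0 ?invr_ge0.
have ak q : a q <= kap ^+ q.+1.
  rewrite ler_pdivrMr ?ltr0n ?fact_gt0// ler_peMr ?exprn_ge0//.
  by rewrite ler1n fact_gt0.
(* A Taylor term of order [q + 1] replaces [F] by its derivative of that order, whence the shift of
   the coefficients by [q + 1]. *)
pose fam N' (b' : 'I_N' * 'I_K.+1 -> nat -> R) (k : nat) : R :=
  \sum_(i < N') \sum_(q < K.+1) a q * (if (q.+1 <= k)%N then b' (i, q) (k - q.+1)%N else 0).
have Vs1 (e : nat -> R) k : (forall l, 0 <= e l) -> \sum_(i < size s) V e k (g1 i) <= V e k.+1 g.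
  move=> e0; apply: le_trans (V_sum_sub k g e0 IT sIL us sT).
  by rewrite (big_nth x0) big_mkord.
have Vs2 (e : nat -> R) k : (forall l, 0 <= e l) -> \sum_(i < size r) V e k g <= V e k.+1 g.
  move=> e0; apply: le_trans (V_sum_near k e0 QT sQL ur rT near).
  by rewrite (big_nth x0) big_mkord.
have famB N' (b' : 'I_N' * 'I_K.+1 -> nat -> R) (gg : 'I_N' -> nat) :
    (forall (iq : 'I_N' * 'I_K.+1) k, (k <= K.+1 - iq.2.+1)%N ->
       `|b' iq k| <= expand_const K * c' * kap ^+ k * V cth k (gg iq.1)) ->
    (forall k, \sum_(i < N') V cth k (gg i) <= V cth k.+1 g) ->
    forall k, (k <= K.+1)%N -> `|fam N' b' k| <= K.+1%:R * expand_const K * c' * kap ^+ k * V cth k g.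
  move=> hb' hV k kK; have M0 : 0 <= K.+1%:R * expand_const K * c' * kap ^+ k by rewrite !mulr_ge0 ?exprn_ge0.
  case: k kK M0 => [_|k kK] M0.
    rewrite /fam big1 ?normr0 ?mulr_ge0 ?V_ge0// => i _.
    by rewrite big1// => q _; rewrite mulr0.
  apply: le_trans (ler_wpM2l M0 (hV k)); rewrite mulr_sumr.
  apply: (le_trans (ler_norm_sum _ _ _)); apply: ler_sum => i _.
  apply: (le_trans (ler_norm_sum _ _ _)).
  have -> : K.+1%:R * expand_const K * c' * kap ^+ k.+1 * V cth k (gg i) =
     \sum_(q < K.+1) expand_const K * c' * kap ^+ k.+1 * V cth k (gg i).
    by rewrite sumr_const card_ord -[RHS]mulr_natl !mulrA.
  apply: ler_sum => q _; rewrite normrM (ger0_norm (a0 q)).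
  case: ifP => qk; last by rewrite normr0 mulr0 !mulr_ge0 ?exprn_ge0 ?V_ge0.
  rewrite ltnS in qk; rewrite subSS.
  apply: (le_trans (ler_pM (a0 q) (normr_ge0 _) (ak q) (hb' (i, q) (k - q)%N _))).
    by rewrite /= subSS leq_sub2r// -ltnS.
  have -> : kap ^+ k.+1 = kap ^+ q.+1 * kap ^+ (k - q) by rewrite -exprD addSn subnKC.
  rewrite /= [leLHS](_ : _ = expand_const K * c' * (kap ^+ q.+1 * kap ^+ (k - q)) * V cth (k - q) (gg i)); last by ring.
  by rewrite ler_wpM2l ?mulr_ge0 ?exprn_ge0//; apply: V_mono => //; exact: leq_subr.
have remB N' (T' : 'I_N' * 'I_K.+1 -> R) (gg : 'I_N' -> nat) w : 0 <= w ->
    (forall iq : 'I_N' * 'I_K.+1, `|T' iq| <= expand_const K * c' * w * kap ^+ (K.+1 - iq.2.+1) * V ct (K.+1 - iq.2.+1) (gg iq.1)) ->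
    (forall k, \sum_(i < N') V ct k (gg i) <= V ct k.+1 g) ->
    `|\sum_(i < N') \sum_(q < K.+1) a q * T' (i, q)| <= K.+1%:R * expand_const K * c' * w * kap ^+ K.+1 * V ct K.+1 g.
  move=> w0 hT hV; have M0 : 0 <= K.+1%:R * expand_const K * c' * w * kap ^+ K.+1 by rewrite !mulr_ge0 ?exprn_ge0.
  apply: le_trans (ler_wpM2l M0 (hV K)); rewrite mulr_sumr.
  apply: (le_trans (ler_norm_sum _ _ _)); apply: ler_sum => i _.
  apply: (le_trans (ler_norm_sum _ _ _)).
  have -> : K.+1%:R * expand_const K * c' * w * kap ^+ K.+1 * V ct K (gg i) =
     \sum_(q < K.+1) expand_const K * c' * w * kap ^+ K.+1 * V ct K (gg i).
    by rewrite sumr_const card_ord -[RHS]mulr_natl !mulrA.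
  apply: ler_sum => q _; rewrite normrM (ger0_norm (a0 q)).
  apply: (le_trans (ler_pM (a0 q) (normr_ge0 _) (ak q) (hT (i, q)))).
  rewrite /= -!mulrA mulrCA ler_wpM2l// mulrCA ler_wpM2l// mulrCA ler_wpM2l//.
  rewrite mulrA -exprD subnKC// ler_wpM2l ?exprn_ge0//.
  by apply: V_mono => //; rewrite subSS leq_subr.
(* The minus sign: the removed sites account for the passage from the full sum back to the partial
   sum. *)
pose b k : R := (k == 0%N)%:R * E Z + fam _ b1 k - fam _ b2 k.
exists b; split=> [k kK|F w cF hw].
  rewrite /b (le_trans (ler_normB _ _))//.
  have h1 := @famB _ b1 (fun i => g1 i) (fun iq => proj1 (hb1 iq)) (fun k => Vs1 _ k cth0) k kK.
  have h2 := @famB _ b2 (fun i => g) (fun iq => proj1 (hb2 iq)) (fun k => Vs2 _ k cth0) k kK.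
  have h0 : `|(k == 0%N)%:R * E Z| <= c * kap ^+ k * V cth k g.
    case: k {kK h1 h2} => [|k]; last by rewrite mul0r normr0 !mulr_ge0 ?exprn_ge0 ?V_ge0.
    rewrite mul1r expr0 mulr1; apply: (le_trans (good_E gZ nL)).
    by rewrite ler_wpM2l// thV.
  apply: (le_trans (lerD (ler_normD _ _) h2)).
  apply: (le_trans (lerD (lerD h0 h1) (lexx _))).
  set M := kap ^+ k; set W := V cth k g.
  have W0 : 0 <= W by exact: V_ge0.
  have M0 : 0 <= M by exact: exprn_ge0.
  rewrite c'E [leLHS](_ : _ = (2 * K.+1%:R * (1 + Lam) * expand_const K + 1) * (c * M * W)); last by ring.
  rewrite [leRHS](_ : _ = (2 * K.+1%:R * (1 + Lam) * expand_const K + 2 * (1 + Lam) * Cf + 1) * (c * M * W)); last by rewrite expand_constS; ring.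
  rewrite ler_wpM2r ?mulr_ge0// lerD2r lerDl !mulr_ge0// addr_ge0//.
have w0 := osc_ge0 hw.
have dZ := good_dom gZ.
have dZE : dom n (fun o => Z o - E Z) by apply: domB => //; exact: dom_le (leq0n _) (dom_cst _).
pose e k := E (fun o => F k (Wsum Ts o)).
have famS N' (b' : 'I_N' * 'I_K.+1 -> nat -> R) : \sum_(k < K.+2) fam N' b' k * e k =
    \sum_(i < N') \sum_(q < K.+1) a q *
      \sum_(k < (K.+1 - q.+1).+1) b' (i, q) k * e (q.+1 + k)%N.
  rewrite /fam; under eq_bigr do rewrite mulr_suml.
  rewrite exchange_big; apply: eq_bigr => i _ /=.
  under eq_bigr do rewrite mulr_suml.
  rewrite exchange_big; apply: eq_bigr => q _ /=.
  rewrite -(shift_sum (b' (i, q)) e (ltn_ord q)) mulr_sumr.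
  by apply: eq_bigr => k _; rewrite mulrA.
have cFq (q : 'I_K.+1) : chain (shift q.+1 F) (K.+1 - q.+1) by exact: chain_shift.
have hwq (q : 'I_K.+1) : osc w (shift q.+1 F (K.+1 - q.+1)) by rewrite /shift subnKC.
have dF v (q : 'I_K.+1) : {subset v <= Ts} -> dom (K.+1 - q.+1) (fun o => F q.+1 (Wsum v o)).
  by move=> vT; exact: dom_chain cF hw (ltn_ord q).
pose rem j v o := taylor_rem F K.+1 (Wsum v o) (kap * X j o).
have srem j v U : j \in U -> {subset v <= U} -> smeas U (rem j v).
  move=> jU vU; have mW := smeas_Wsum vU.
  have mX' : smeas U (fun o => kap * X j o) by apply: smeasM; [exact: smeas_cst|exact: smeas_gen].
  apply: smeasB.
    apply: (smeas_comp (chain_cont_le cF hw (leq0n _))); exact: smeasD.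
  apply: smeas_sum => q; apply: smeasM.
    by apply: smeasM; [exact: smeasXn|exact: smeas_cst].
  by apply: (smeas_comp (chain_cont_le cF hw _)) => //; rewrite -ltnS.
have remb j v o : `|rem j v o| <= w * kap ^+ K.+1 * env [:: j] o ^+ K.+1 /\
    `|rem j v o| <= w * kap ^+ K.+2 * env [:: j] o ^+ K.+2.
  have [h1 h2] := taylor_remP (Wsum v o) (kap * X j o) cF hw.
  have hX m : `|kap * X j o| ^+ m <= kap ^+ m * env [:: j] o ^+ m.
    rewrite normrM (ger0_norm kap0) exprMn ler_wpM2l ?exprn_ge0//.
    by rewrite lerXn2r ?nnegrE// norm_le_env_cons.
  split; [apply: (le_trans h1)|apply: (le_trans h2)]; by rewrite -mulrA ler_wpM2l.
have j1T j : j \in Ts -> {subset [:: j] <= Ts} by move=> jT x; rewrite inE => /eqP->.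
have wk m : 0 <= w * kap ^+ m by rewrite mulr_ge0 ?exprn_ge0.
have drem j v : j \in Ts -> {subset v <= Ts} -> dom K.+1 (rem j v).
  move=> jT vT; apply: (bound_dom (wk K.+1) (smeas_measurable mX (srem _ _ _ jT vT)) (j1T _ jT)).
  by move=> o; have [] := remb j v o.
have minb t1 t2 (h : R) : h <= t1 -> h <= t2 -> h <= Num.min t1 t2 by rewrite le_min => -> ->.
(* Both remainder estimates are kept, and [tay] is applied to their minimum. *)
have R1B (i : 'I_(size s)) : `|E (fun o => (Z o - E Z) * rem (nth x0 s i) (drop i.+1 s) o)| <=
    c' * w * kap ^+ K.+1 * Cf * V ct 0 (g1 i).
  have [hd _] := sorted_dst (I := I) (ltn_ord i).
  have xid : nth x0 s i \in drop i s by rewrite (drop_nth x0)// mem_head.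
  have far x y : x \in I -> y \in drop i s -> (dst (nth x0 s i) I <= dist x y)%N.
    by move=> xI yd; exact: leq_trans (hd y yd) (dst_le _ xI).
  have sub : {subset drop i s <= A} by move=> x /mem_drop /sA.
  have sr : smeas (drop i s) (rem (nth x0 s i) (drop i.+1 s)).
    by apply: srem => // x; rewrite [in _ \in drop i s](drop_nth x0)// inE => ->; rewrite orbT.
  have jT : nth x0 s i \in Ts by apply: sT; exact: mem_nth.
  rewrite c'E; have [H1 _] := @good_centered _ _ _ _ _ _ _ _ _ [:: nth x0 s i] K.+1 _ gZ n0 nL sub far (wk K.+1) sr (j1T _ jT)
     isT (fun o => proj1 (remb _ _ o)).
  have [_ H2] := @good_centered _ _ _ _ _ _ _ _ _ [:: nth x0 s i] K.+2 _ gZ n0 nL sub far (wk K.+2) sr (j1T _ jT)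
     isT (fun o => proj2 (remb _ _ o)).
  have hm := ler_wpM2l (mulr_ge0 c'0 (wk K.+1)) (tay (g1D i)).
  rewrite -c'E [leRHS](_ : _ = c' * (w * kap ^+ K.+1) * (Cf * V ct 0 (g1 i))); last by ring.
  apply: le_trans hm; rewrite minr_pMr; last by rewrite mulr_ge0.
  rewrite -c'E in H1 H2; apply: minb; first by apply: H1; rewrite nKL.
  apply: (le_trans (H2 _)); first by rewrite addnS nKL.
  rewrite exprSr -!mulrA; exact: lexx.
have R2B (i : 'I_(size r)) : `|E Z * E (rem (nth x0 r i) (drop i.+1 r ++ u))| <=
    c' * w * kap ^+ K.+1 * Cf * V ct 0 g.
  have jT : nth x0 r i \in Ts by apply: rT; exact: mem_nth.
  have vT : {subset drop i.+1 r ++ u <= Ts} by move=> x; rewrite mem_cat => /orP[/mem_drop /rT|/uT].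
  have mr := smeas_measurable mX (srem _ _ _ jT vT).
  have H1 := @bound_E [:: nth x0 r i] K.+1 _ _ (wk K.+1) mr (j1T _ jT) isT _ (fun o => proj1 (remb _ _ o)).
  have H2 := @bound_E [:: nth x0 r i] K.+2 _ _ (wk K.+2) mr (j1T _ jT) isT _ (fun o => proj2 (remb _ _ o)).
  have KL : (K.+2 <= L.+1)%N by rewrite ltnS -nKL leq_addl.
  have EZ := good_E gZ nL.
  have hm := ler_wpM2l (mulr_ge0 c'0 (wk K.+1)) (tay gD).
  rewrite [leRHS](_ : _ = c' * (w * kap ^+ K.+1) * (Cf * V ct 0 g)); last by ring.
  apply: le_trans hm; rewrite minr_pMr; last by rewrite mulr_ge0.
  have LL : Lam <= 1 + Lam by rewrite lerDr.
  rewrite normrM; apply: minb.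
    apply: (le_trans (ler_pM _ _ EZ (H1 (ltnW KL)))) => //.
    rewrite c'E [leLHS](_ : _ = c * Lam * (w * kap ^+ K.+1) * th g); last by ring.
    by rewrite ler_wpM2r// ler_wpM2r// ler_wpM2l.
  apply: (le_trans (ler_pM _ _ EZ (H2 KL))) => //.
  rewrite c'E exprSr [leLHS](_ : _ = c * Lam * (w * kap ^+ K.+1) * (kap * th g)); last by ring.
  apply: ler_pM; rewrite ?mulr_ge0// ?exprn_ge0//.
    by rewrite ler_wpM2r// ler_wpM2l.
  by rewrite ler_wpM2l.
have nKL' : (n + K.+1 <= L.+1)%N by rewrite nKL.
have d0 v : {subset v <= Ts} -> dom K.+1 (fun o => F 0%N (Wsum v o)).
  by move=> vT; have := dom_chain vT cF hw (leq0n _); rewrite subn0.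
have LZE : L1 P (fun o => Z o - E Z) by apply: dom_L1 dZE; exact: leqW.
have EZE0 : E (fun o => Z o - E Z) = 0.
  by rewrite ExB ?Ex_cst ?subrr//; [apply: dom_L1 dZ; exact: leqW|exact: L1_cst].
have sdT i : {subset drop i s <= Ts} by move=> x /mem_drop /sT.
have rdT i : {subset drop i r ++ u <= Ts} by move=> x; rewrite mem_cat => /orP[/mem_drop /rT|/uT].
have nsT (i : 'I_(size s)) : nth x0 s i \in Ts by apply: sT; exact: mem_nth.
have nrT (i : 'I_(size r)) : nth x0 r i \in Ts by apply: rT; exact: mem_nth.
(* The telescope ends at the empty sum, where [F] takes the constant value [F 0%N 0]; the centered
   factor annihilates it. *)
have T1 : E (fun o => (Z o - E Z) * F 0%N (Wsum s o)) =
    \sum_(i < size s) (\sum_(q < K.+1) a q * E (fun o => Z1 i q.+1 o * F q.+1 (Wsum (drop i.+1 s) o))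
      + E (fun o => (Z o - E Z) * rem (nth x0 s i) (drop i.+1 s) o)).
  have LQ (i : 'I_(size s)) (q : 'I_K.+1) : L1 P (fun o => a q * (Z1 i q.+1 o * F q.+1 (Wsum (drop i.+1 s) o))).
    apply: L1Z; apply: (@dom_L1 (n + q.+1 + (K.+1 - q.+1))%N); first by rewrite -addnA subnKC.
    by apply: domM; [apply: domM => //; exact: domX|exact: dF].
  have LR (i : 'I_(size s)) : L1 P (fun o => (Z o - E Z) * rem (nth x0 s i) (drop i.+1 s) o).
    by apply: (@dom_L1 (n + K.+1)%N) => //; apply: domM => //; exact: drem.
  rewrite (@eq_Ex _ _ _ _ _ (fun o => F 0%N 0 * (Z o - E Z) + \sum_(i < size s)
     (\sum_(q < K.+1) a q * (Z1 i q.+1 o * F q.+1 (Wsum (drop i.+1 s) o)) +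
      (Z o - E Z) * rem (nth x0 s i) (drop i.+1 s) o))); last first.
    move=> o; have := telescope F K.+1 s [::] o; rewrite cats0 {2}/Wsum big_nil mulr0.
    move=> /eqP; rewrite subr_eq => /eqP ->; rewrite mulrDr addrC (mulrC (F 0%N 0)); congr (_ + _).
    rewrite mulr_sumr; apply: eq_bigr => i _; rewrite mulrDr cats0; congr (_ + _).
    rewrite mulr_sumr; apply: eq_bigr => q _; rewrite /a /Z1 exprMn; ring.
  rewrite ExD; first last.
  - by apply: L1_sum => i; apply: L1D => //; apply: L1_sum.
  - exact: L1Z.
  rewrite ExZ// EZE0 mulr0 add0r Ex_sum; last by move=> i; apply: L1D => //; apply: L1_sum.
  apply: eq_bigr => i _; rewrite ExD ?Ex_sum//; last by apply: L1_sum.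
  congr (_ + _); apply: eq_bigr => q _; rewrite ExZ//.
  apply: (@dom_L1 (n + q.+1 + (K.+1 - q.+1))%N); first by rewrite -addnA subnKC.
  by apply: domM; [apply: domM => //; exact: domX|exact: dF].
have T2 : e 0%N - E (fun o => F 0%N (Wsum u o)) =
    \sum_(i < size r) (\sum_(q < K.+1) a q *
       E (fun o => X (nth x0 r i) o ^+ q.+1 * F q.+1 (Wsum (drop i.+1 r ++ u) o))
      + E (rem (nth x0 r i) (drop i.+1 r ++ u))).
  have KL : (K.+1 <= L.+1)%N by rewrite -nKL; exact: leqW (leq_addl _ _).
  have LX (i : 'I_(size r)) (q : 'I_K.+1) :
      L1 P (fun o => X (nth x0 r i) o ^+ q.+1 * F q.+1 (Wsum (drop i.+1 r ++ u) o)).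
    apply: (@dom_L1 (q.+1 + (K.+1 - q.+1))%N); first by rewrite subnKC.
    by apply: domM; [exact: domX|exact: dF].
  have LQ (i : 'I_(size r)) (q : 'I_K.+1) :
    L1 P (fun o => a q * (X (nth x0 r i) o ^+ q.+1 * F q.+1 (Wsum (drop i.+1 r ++ u) o))).
    exact: L1Z.
  have LR (i : 'I_(size r)) : L1 P (rem (nth x0 r i) (drop i.+1 r ++ u)).
    by apply: (@dom_L1 K.+1) => //; exact: drem.
  rewrite /e -ExB; [|exact: dom_L1 KL (d0 Ts (fun x h => h))|exact: dom_L1 KL (d0 _ uT)].
  rewrite (@eq_Ex _ _ _ _ _ (fun o => \sum_(i < size r)
     (\sum_(q < K.+1) a q * (X (nth x0 r i) o ^+ q.+1 * F q.+1 (Wsum (drop i.+1 r ++ u) o)) +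
      rem (nth x0 r i) (drop i.+1 r ++ u) o))); last first.
    move=> o; rewrite (Wsum_perm pT) (telescope F K.+1); apply: eq_bigr => i _; congr (_ + _).
    by apply: eq_bigr => q _; rewrite /a exprMn; ring.
  rewrite Ex_sum; last by move=> i; apply: L1D => //; apply: L1_sum.
  apply: eq_bigr => i _; rewrite ExD ?Ex_sum//; last by apply: L1_sum.
  by congr (_ + _); apply: eq_bigr => q _; rewrite ExZ.
have Sb : \sum_(k < K.+2) b k * e k = E Z * e 0%N +
    \sum_(i < size s) \sum_(q < K.+1) a q * (\sum_(k < (K.+1 - q.+1).+1) b1 (i, q) k * e (q.+1 + k)%N) -
    \sum_(i < size r) \sum_(q < K.+1) a q * (\sum_(k < (K.+1 - q.+1).+1) b2 (i, q) k * e (q.+1 + k)%N).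
  rewrite -!famS /b; under eq_bigr do rewrite mulrBl mulrDl.
  rewrite sumrB big_split /=; congr (_ + _ - _).
  by rewrite big_ord_recl /= mul1r big1 ?addr0// => k _; rewrite mul0r mul0r.
pose D1 (iq : 'I_(size s) * 'I_K.+1) := E (fun o => Z1 iq.1 iq.2.+1 o * F iq.2.+1 (Wsum (drop iq.1.+1 s) o))
    - \sum_(k < (K.+1 - iq.2.+1).+1) b1 iq k * e (iq.2.+1 + k)%N.
pose D2 (iq : 'I_(size r) * 'I_K.+1) := E (fun o => Z2 iq.1 iq.2.+1 o * F iq.2.+1 (Wsum (drop iq.1.+1 r ++ u) o))
    - \sum_(k < (K.+1 - iq.2.+1).+1) b2 iq k * e (iq.2.+1 + k)%N.
have D1B iq : `|D1 iq| <= expand_const K * c' * w * kap ^+ (K.+1 - iq.2.+1) * V ct (K.+1 - iq.2.+1) (g1 iq.1).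
  by have := proj2 (hb1 iq) _ w (cFq iq.2) (hwq iq.2); rewrite /shift addn0.
have D2B iq : `|D2 iq| <= expand_const K * c' * w * kap ^+ (K.+1 - iq.2.+1) * V ct (K.+1 - iq.2.+1) g.
  by have := proj2 (hb2 iq) _ w (cFq iq.2) (hwq iq.2); rewrite /shift addn0.
have EZ0 : E (fun o => Z o * F 0%N (Wsum u o)) =
    E (fun o => (Z o - E Z) * F 0%N (Wsum s o)) + E Z * E (fun o => F 0%N (Wsum u o)).
  rewrite (centered_E gZ (d0 _ sT) nKL').
  rewrite (@eq_Ex _ _ _ _ (fun o => F 0%N (Wsum u o)) (fun o => F 0%N (Wsum s o))).
    rewrite subrK; apply: eq_Ex => o; by rewrite (Wsum_perm psu).
  by move=> o; rewrite (Wsum_perm psu).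
have -> : E (fun o => Z o * F 0%N (Wsum u o)) - \sum_(k < K.+2) b k * e k =
    \sum_(i < size s) \sum_(q < K.+1) a q * D1 (i, q)
    - \sum_(i < size r) \sum_(q < K.+1) a q * D2 (i, q)
    + \sum_(i < size s) E (fun o => (Z o - E Z) * rem (nth x0 s i) (drop i.+1 s) o)
    - \sum_(i < size r) E Z * E (rem (nth x0 r i) (drop i.+1 r ++ u)).
  rewrite EZ0 Sb T1.
  have -> : E (fun o => F 0%N (Wsum u o)) = e 0%N - (e 0%N - E (fun o => F 0%N (Wsum u o))) by ring.
  rewrite T2 !big_split /=.
  have -> : \sum_(i < size s) \sum_(q < K.+1) a q * D1 (i, q) =
     \sum_(i < size s) \sum_(q < K.+1) a q * E (fun o => Z1 i q.+1 o * F q.+1 (Wsum (drop i.+1 s) o)) -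
     \sum_(i < size s) \sum_(q < K.+1) a q * (\sum_(k < (K.+1 - q.+1).+1) b1 (i, q) k * e (q.+1 + k)%N).
    rewrite -sumrB; apply: eq_bigr => i _; rewrite -sumrB; apply: eq_bigr => q _.
    by rewrite -mulrBr.
  have -> : \sum_(i < size r) \sum_(q < K.+1) a q * D2 (i, q) =
     E Z * (\sum_(i < size r) \sum_(q < K.+1) a q *
       E (fun o => X (nth x0 r i) o ^+ q.+1 * F q.+1 (Wsum (drop i.+1 r ++ u) o))) -
     \sum_(i < size r) \sum_(q < K.+1) a q * (\sum_(k < (K.+1 - q.+1).+1) b2 (i, q) k * e (q.+1 + k)%N).
    rewrite mulr_sumr -sumrB; apply: eq_bigr => i _; rewrite mulr_sumr -sumrB; apply: eq_bigr => q _.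
    rewrite mulrCA -mulrBr; congr (_ * (_ - _)); rewrite -ExZ.
      by apply: eq_Ex => o; rewrite /Z2 mulrA.
    apply: (@dom_L1 (q.+1 + (K.+1 - q.+1))%N).
      by rewrite subnKC// -nKL; exact: leqW (leq_addl _ _).
    by apply: domM; [exact: domX|exact: dF].
  rewrite -mulr_sumr; ring.
have B1' := @remB _ D1 (fun i => g1 i) w w0 D1B (fun k => Vs1 _ k ct0).
have B2' := @remB _ D2 (fun i => g) w w0 D2B (fun k => Vs2 _ k ct0).
have cwk : 0 <= c' * w * kap ^+ K.+1 * Cf by rewrite !mulr_ge0 ?exprn_ge0.
have V1K : V ct 1 g <= V ct K.+1 g by exact: V_mono.
have B3 : `|\sum_(i < size s) E (fun o => (Z o - E Z) * rem (nth x0 s i) (drop i.+1 s) o)| <=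
    c' * w * kap ^+ K.+1 * Cf * V ct K.+1 g.
  apply: le_trans (ler_wpM2l cwk (le_trans (Vs1 ct 0%N ct0) V1K)); rewrite mulr_sumr.
  by apply: (le_trans (ler_norm_sum _ _ _)); apply: ler_sum => i _.
have B4 : `|\sum_(i < size r) E Z * E (rem (nth x0 r i) (drop i.+1 r ++ u))| <=
    c' * w * kap ^+ K.+1 * Cf * V ct K.+1 g.
  apply: le_trans (ler_wpM2l cwk (le_trans (Vs2 ct 0%N ct0) V1K)); rewrite mulr_sumr.
  by apply: (le_trans (ler_norm_sum _ _ _)); apply: ler_sum => i _.
apply: (le_trans (ler_normB _ _)); apply: (le_trans (lerD (ler_normD _ _) B4)).
apply: (le_trans (lerD (lerD (ler_normB _ _) B3) (lexx _))).
apply: (le_trans (lerD (lerD (lerD B1' B2') (lexx _)) (lexx _))).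
set M := kap ^+ K.+1; set W := V ct K.+1 g.
have W0 : 0 <= W by exact: V_ge0.
have M0 : 0 <= M by exact: exprn_ge0.
rewrite c'E [leLHS](_ : _ = (2 * K.+1%:R * (1 + Lam) * expand_const K + 2 * (1 + Lam) * Cf) * (c * w * M * W)); last by ring.
rewrite [leRHS](_ : _ = (2 * K.+1%:R * (1 + Lam) * expand_const K + 2 * (1 + Lam) * Cf + 1) * (c * w * M * W)); last by rewrite expand_constS; ring.
by rewrite ler_wpM2r ?mulr_ge0// lerDl.
Qed.

End expansion.

(** * The last variable of the expansion *)

Section final_level.
Context {d} {Om : measurableType d} {R : realType} {S : choiceType}.
Variables (P : probability Om R) (X : S -> Om -> R) (Ts : seq S).
Variables (x0 : S) (dist : S -> S -> nat) (D L : nat) (kap Lam : R).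
Variables (th th' B : nat -> R).
Implicit Types (I J Q U A u r : seq S) (Z xi : Om -> R) (c w : R) (o : Om) (n s k q g l m : nat).

Local Notation env := (env X).
Local Notation smeas := (smeas X).
Local Notation E := (Ex P).
Local Notation Wsum := (Wsum X kap).
Local Notation dst := (dst dist D).
Local Notation V := (V D B).
Local Notation good := (good P X Ts L th th').

Hypotheses (mX : forall i, measurable_fun setT (X i)) (uTs : uniq Ts).
Hypotheses (Lam1 : 1 <= Lam) (kap0 : 0 <= kap).
Hypothesis Lenv : L1 P (fun o => env Ts o ^+ L.+1).
Hypothesis mom : forall J s, {subset J <= Ts} -> (size J <= s)%N -> (s <= L.+1)%N ->
  E (fun o => env J o ^+ s) <= Lam.
Hypothesis covb : cov_decay P X Ts dist L Lam th th'.
Hypotheses (th0 : 1 <= th 0%N) (thp : forall g, 0 <= th g) (thth' : forall g, th g <= th' g).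
Hypothesis B1 : forall l, 1 <= B l.
Hypothesis Bcount : forall Q, {subset Q <= Ts} -> (size Q <= L)%N ->
  forall l, (l <= D)%N -> (count (fun j => dst j Q <= l)%N Ts)%:R <= B l.

Let Lam0 : 0 <= Lam := le_trans ler01 Lam1.

(** At gap 0 no decay is claimed: [1 <= th 0] makes the moment bound sufficient. *)
Lemma good_start i : i \in Ts -> (0 < L)%N -> good Lam 1 [:: i] 0 Ts (X i).
Proof.
move=> iT L0; split=> //.
- by split=> //; move=> x; rewrite inE => /eqP->.
- by apply: smeas_gen; rewrite mem_head.
- by move=> o; rewrite -[leLHS]mul1r ler_pM// expr1 norm_le_env_cons.
- move=> xi J s c2 c20 mxi JT sJ hxi.
  have mxi' : measurable_fun setT (fun o => X i o * xi o).
    by apply: measurable_funM => //; exact: smeas_measurable mxi.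
  have iJT : {subset i :: J <= Ts} by move=> x; rewrite inE => /predU1P[->|/JT].
  have siJ : (size (i :: J) <= s.+1)%N by [].
  have hb o : `|X i o * xi o| <= c2 * env (i :: J) o ^+ s.+1.
    have := env_exp_mul X i J o 1 s; rewrite expr1 => h.
    rewrite normrM; apply: le_trans (ler_wpM2l c20 h).
    by rewrite mulrCA ler_wpM2l.
  have main : (1 + s <= L.+1)%N -> `|E (fun o => X i o * xi o)| <= Lam * c2.
    by move=> h; rewrite mulrC; exact: (bound_E mX Lenv mom c20 mxi' iJT siJ h hb).
  split=> h.
    apply: (le_trans (main (leqW h))); by rewrite ler_peMr// mulr_ge0.
  apply: (le_trans (main h)); rewrite ler_peMr// ?mulr_ge0//.
  exact: le_trans th0 (thth' _).
Qed.

Lemma osc_measurable w (F : R -> R) u : osc w F -> measurable_fun setT (fun o => F (Wsum u o)).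
Proof.
move=> hw; apply: (measurableT_comp _ (measurable_Wsum kap mX u)).
by apply: continuous_measurable_fun; exact: osc_continuous hw.
Qed.

(** Subtracting [F 0] changes nothing against a centered factor and leaves a function bounded by
    [w], that is, of order 0; [Z] has already spent the whole order [L]. *)
Lemma final_split c I g A u Z (F : R -> R) w : good c L I g A Z -> {subset u <= A} -> osc w F ->
  E (fun o => Z o * F (Wsum u o)) - E Z * E (fun o => F (Wsum Ts o)) =
  E (fun o => (Z o - E Z) * (F (Wsum u o) - F 0)) +
  E Z * E (fun o => F (Wsum u o) - F (Wsum Ts o)).
Proof.
move=> gZ uA hw; have [[IT sI AT] _ _ _ _] := gZ; have uT : {subset u <= Ts} by move=> x /uA /AT.
have dF v : dom X Ts 0 (fun o => F (Wsum v o) - F 0).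
  split; first by apply: measurable_funB => //; exact: osc_measurable hw.
  exists w; first exact: osc_ge0 hw.
  by move=> o; rewrite expr0 mulr1; have [] := hw (Wsum v o) 0.
have LF v : L1 P (fun o => F (Wsum v o) - F 0) by exact: (@dom_L1 _ _ _ _ P X Ts L Lenv 0%N _ isT (dF v)).
have LF' v : L1 P (fun o => F (Wsum v o)).
  apply: (eq_L1 (f := fun o => (F (Wsum v o) - F 0) + F 0)); first by move=> o; rewrite subrK.
  by apply: L1D => //; exact: L1_cst.
rewrite (centered_E mX Lenv gZ (dF u)); last by rewrite addn0.
have dZ := good_dom mX gZ; have LZ := dom_L1 Lenv (leqW (leqnn L)) dZ.
rewrite (ExB (LF' u) (L1_cst P (F 0))) (ExB (LF' u) (LF' Ts)).
have -> : E (fun o => Z o * (F (Wsum u o) - F 0)) = E (fun o => Z o * F (Wsum u o)) - F 0 * E Z.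
  rewrite -ExZ// -ExB//; first by apply: eq_Ex => o; ring.
    apply: (eq_L1 (f := fun o => Z o * (F (Wsum u o) - F 0) + F 0 * Z o)); first by move=> o; ring.
    apply: L1D; last exact: L1Z.
    apply: (dom_L1 Lenv (s := (L + 0)%N)); first by rewrite addn0.
    exact: domM.
  exact: L1Z.
rewrite Ex_cst; ring.
Qed.

(** Nothing is expanded: [F] enters through its oscillation alone. This is the estimate for large
    gaps, where [th g] is small by itself. *)
Lemma final_trivial c I g A u Z (F : R -> R) w : good c L I g A Z -> {subset u <= A} -> (0 < L)%N ->
  osc w F ->
  `|E (fun o => Z o * F (Wsum u o)) - E Z * E (fun o => F (Wsum Ts o))| <= 3 * c * w * th g.
Proof.
move=> gZ uA L0 hw; rewrite (final_split gZ uA hw).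
have [[IT sI AT] mZ c0 hZ hgood] := gZ; have w0 := osc_ge0 hw.
have uT : {subset u <= Ts} by move=> x /uA /AT.
have EZ := good_E gZ (leqnn L).
have bF v v' : `|E (fun o => F (Wsum v o) - F (Wsum v' o))| <= w.
  rewrite -(Ex_cst P w); apply: Ex_abs_le; [|exact: L1_cst|by move=> o; have [] := hw (Wsum v o) (Wsum v' o)].
  apply: (@L1_bounded _ _ _ P w); last by move=> o; have [] := hw (Wsum v o) (Wsum v' o).
  by apply: measurable_funB; exact: osc_measurable hw.
have sF : smeas A (fun o => F (Wsum u o) - F 0).
  apply: smeasB; last exact: smeas_cst.
  by apply: (smeas_comp (osc_continuous hw)); exact: smeas_Wsum.
have bnd o : `|F (Wsum u o) - F 0| <= w * env [::] o ^+ 0.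
  by rewrite expr0 mulr1; have [] := hw (Wsum u o) 0.
have nT : {subset [::] <= Ts} by [].
have [H1 _] := hgood _ [::] 0%N w w0 sF nT isT bnd.
rewrite (centered_E mX Lenv gZ (bound_dom w0 (smeas_measurable mX sF) nT bnd)); last by rewrite addn0.
have E0 : `|E (fun o => F (Wsum u o) - F 0)| <= w.
  have := bF u [::]; congr (`|_| <= _); apply: eq_Ex => o; by rewrite {2}/Wsum big_nil mulr0.
have M (u1 u2 : R) : `|u1| <= c * th g -> `|u2| <= w -> `|u1 * u2| <= c * w * th g.
  by move=> h1 h2; rewrite normrM mulrAC ler_pM.
rewrite (le_trans (ler_normD _ _))//.
rewrite (_ : 3 * c * w * th g = (c * w * th g + c * w * th g) + c * w * th g); last by ring.
rewrite lerD//; last exact: M.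
rewrite (le_trans (ler_normB _ _))// lerD//; last exact: M.
by apply: H1; rewrite addn0.
Qed.

(** The sites of [u] within [m] of [I] are removed one by one, each paying the Lipschitz factor
    [kap] and the slow decay; the sites beyond [m] go in one block that pays the fast decay at [m];
    the last term restores [r]. With [m = D] no block is left, because distances are capped at
    [D]. *)
Lemma final_near c I g A u r Z (F : R -> R) w m : good c L I g A Z -> {subset u <= A} ->
  (0 < L)%N -> perm_eq Ts (r ++ u) -> osc w F ->
  `|E (fun o => Z o * F (Wsum u o)) - E Z * E (fun o => F (Wsum Ts o))| <=
  c * (1 + Lam) * w * (kap * \sum_(x <- u | (dst x I <= m)%N) th' (maxn g (dst x I)) +
     (m < D)%N%:R * th (maxn g m) + kap * (size r)%:R * th g).
Proof.
move=> gZ uA L0 pT hw; rewrite (final_split gZ uA hw).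
have [[IT sI AT] mZ c0 hZ hgood] := gZ; have w0 := osc_ge0 hw.
have uT : {subset u <= Ts} by move=> x /uA /AT.
have rT : {subset r <= Ts} by move=> x xr; rewrite (perm_mem pT) mem_cat xr.
have EZ := good_E gZ (leqnn L).
pose F' : nat -> R -> R := fun=> F.
have cF : chain (fun=> F) 0 by [].
have c1L : 0 <= c * (1 + Lam) by rewrite mulr_ge0// addr_ge0.
have remE x y : taylor_rem (fun=> F) 0 x y = F (x + y) - F x.
  by rewrite /taylor_rem big_ord1 expr0 fact0 invr1 mulr1 mul1r.
have remb j v o : `|F (Wsum v o + kap * X j o) - F (Wsum v o)| <= w * kap * env [:: j] o ^+ 1.
  have [_ h] := taylor_remP (Wsum v o) (kap * X j o) cF hw.
  rewrite remE expr1 in h; apply: (le_trans h).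
  by rewrite normrM ger0_norm// mulrA ler_wpM2l ?mulr_ge0// expr1 norm_le_env_cons.
have mF v : measurable_fun setT (fun o => F (Wsum v o)) by exact: osc_measurable hw.
have LF v v' : L1 P (fun o => F (Wsum v o) - F (Wsum v' o)).
  apply: (@L1_bounded _ _ _ P w); last by move=> o; have [] := hw (Wsum v o) (Wsum v' o).
  exact: measurable_funB.
have tele (v t : seq S) o : F (Wsum (v ++ t) o) - F (Wsum t o) =
    \sum_(i < size v) (F (Wsum (nth x0 v i :: drop i.+1 v ++ t) o) - F (Wsum (drop i.+1 v ++ t) o)).
  rewrite (telescope X x0 kap F' 0); apply: eq_bigr => i _.
  by rewrite big_ord0 add0r remE Wsum_cons.
have j1T j : j \in Ts -> {subset [:: j] <= Ts} by move=> jT x; rewrite inE => /eqP->.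
rewrite mulrDr (le_trans (ler_normD _ _))// lerD//; last first.
  rewrite normrM.
  have -> : E (fun o => F (Wsum u o) - F (Wsum Ts o)) = - \sum_(i < size r)
     E (fun o => F (Wsum (nth x0 r i :: drop i.+1 r ++ u) o) - F (Wsum (drop i.+1 r ++ u) o)).
    rewrite -Ex_sum; last by move=> i; exact: LF.
    rewrite -ExN; last by apply: L1_sum => i; exact: LF.
    by apply: eq_Ex => o; rewrite -tele opprB (Wsum_perm X kap pT).
  rewrite normrN.
  have S1 : `|\sum_(i < size r) E (fun o => F (Wsum (nth x0 r i :: drop i.+1 r ++ u) o)
       - F (Wsum (drop i.+1 r ++ u) o))| <= \sum_(i < size r) w * kap * Lam.
    apply: (le_trans (ler_norm_sum _ _ _)); apply: ler_sum => i _.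
    have jT : nth x0 r i \in Ts by apply: rT; exact: mem_nth.
    apply: (bound_E mX Lenv mom (J := [:: nth x0 r i]) (s := 1%N)) => //.
    - exact: mulr_ge0.
    - exact: measurable_funB.
    - exact: j1T.
    - by move=> o; rewrite Wsum_cons.
  rewrite sumr_const card_ord -mulr_natl in S1.
  apply: (le_trans (ler_pM _ _ EZ S1)) => //.
  rewrite [leLHS](_ : _ = c * Lam * w * (kap * (size r)%:R * th g)); last by ring.
  by rewrite ler_wpM2r ?mulr_ge0// ler_wpM2r// ler_wpM2l// lerDr.
pose nr := sort (fun x y => (dst x I <= dst y I)%N) [seq x <- u | (dst x I <= m)%N].
pose fr := [seq x <- u | ~~ (dst x I <= m)%N].
have pu : perm_eq u (nr ++ fr).
  have h : perm_eq ([seq x <- u | (dst x I <= m)%N] ++ fr) u by apply/permPl; exact: perm_filterC.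
  by rewrite perm_sym; apply: perm_trans h; rewrite perm_cat2r /nr perm_sort.
have nrT : {subset nr <= A} by move=> x; rewrite mem_sort mem_filter => /andP[_ /uA].
have frT : {subset fr <= A} by move=> x; rewrite mem_filter => /andP[_ /uA].
have frfar x : x \in fr -> (m < dst x I)%N by rewrite mem_filter -ltnNge => /andP[].
have W0 o : Wsum [::] o = 0 by rewrite /Wsum big_nil mulr0.
have LZE v v' : L1 P (fun o => (Z o - E Z) * (F (Wsum v o) - F (Wsum v' o))).
  have dZ := good_dom mX gZ.
  apply: (dom_L1 Lenv (s := (L + 0)%N)); first by rewrite addn0.
  apply: domM; first by apply: domB => //; exact: dom_le (leq0n _) (dom_cst _ _ _).
  split; first exact: measurable_funB.
  by exists w => // o; rewrite expr0 mulr1; have [] := hw (Wsum v o) (Wsum v' o).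
have -> : E (fun o => (Z o - E Z) * (F (Wsum u o) - F 0)) =
    \sum_(i < size nr) E (fun o => (Z o - E Z) * (F (Wsum (nth x0 nr i :: drop i.+1 nr ++ fr) o)
       - F (Wsum (drop i.+1 nr ++ fr) o))) +
    E (fun o => (Z o - E Z) * (F (Wsum fr o) - F (Wsum [::] o))).
  rewrite -Ex_sum; last by move=> i; exact: LZE.
  rewrite -ExD; [|by apply: L1_sum => i; exact: LZE|exact: LZE].
  apply: eq_Ex => o; rewrite -mulr_sumr -tele -mulrDr (Wsum_perm X kap pu) W0; congr (_ * _); ring.
have Z1L s' : (L + s' <= L.+1)%N = (s' <= 1)%N by rewrite -addn1 leq_add2l.
rewrite mulrDr (le_trans (ler_normD _ _))// lerD//.
  apply: (le_trans (ler_norm_sum _ _ _)).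
  have -> : c * (1 + Lam) * w * (kap * \sum_(x <- u | (dst x I <= m)%N) th' (maxn g (dst x I))) =
      \sum_(i < size nr) c * (1 + Lam) * (w * kap) * th' (maxn g (dst (nth x0 nr i) I)).
    have ps : perm_eq nr [seq x <- u | (dst x I <= m)%N] by rewrite /nr perm_sort.
    rewrite -big_filter -(perm_big _ ps) /=.
    by rewrite (big_nth x0) big_mkord !mulr_sumr; apply: eq_bigr => i _; rewrite !mulrA.
  apply: ler_sum => i _.
  have [hd _] := @sorted_dst _ x0 dist D I [seq x <- u | (dst x I <= m)%N] _ (ltn_ord i).
  rewrite -/nr in hd.
  have xin : nth x0 nr i \in nr by exact: mem_nth.
  have xm : (dst (nth x0 nr i) I <= m)%N by move: xin; rewrite mem_sort mem_filter => /andP[].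
  pose A' := drop i nr ++ fr.
  have sub : {subset A' <= A} by move=> x; rewrite mem_cat => /orP[/mem_drop /nrT|/frT].
  have far x y : x \in I -> y \in A' -> (dst (nth x0 nr i) I <= dist x y)%N.
    move=> xI; rewrite mem_cat => /orP[yd|yf].
      by apply: leq_trans (hd y yd) _; exact: dst_le.
    apply: (leq_trans xm); apply: ltnW; apply: leq_trans (frfar y yf) _; exact: dst_le.
  have jT : nth x0 nr i \in Ts by apply: AT; exact: nrT.
  have xA : {subset nth x0 nr i :: drop i.+1 nr ++ fr <= A'} by rewrite /A' [in drop i nr](drop_nth x0).
  have xA' : {subset drop i.+1 nr ++ fr <= A'} by move=> x xd; apply: xA; rewrite inE xd orbT.
  have sm : smeas A' (fun o => F (Wsum (nth x0 nr i :: drop i.+1 nr ++ fr) o) - F (Wsum (drop i.+1 nr ++ fr) o)).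
    by apply: smeasB; apply: (smeas_comp (osc_continuous hw)); exact: smeas_Wsum.
  have rb o : `|F (Wsum (nth x0 nr i :: drop i.+1 nr ++ fr) o) - F (Wsum (drop i.+1 nr ++ fr) o)|
     <= w * kap * env [:: nth x0 nr i] o ^+ 1 by rewrite Wsum_cons.
  have [_ H] := good_centered mX Lenv mom covb thp thth' gZ L0 (leqnn L) sub far (mulr_ge0 w0 kap0) sm
     (j1T _ jT) (leqnn 1) rb.
  by apply: H; rewrite Z1L.
have [mD|mD] := ltnP m D; last first.
  have fr0 : fr = [::].
    apply/nilP; rewrite /nilp size_filter -leqn0 leqNgt -has_count; apply/hasPn => x _.
    by rewrite negbK (leq_trans (dst_leD _ _ _ _))//.
  rewrite fr0 mul0r mulr0; under eq_Ex do rewrite subrr mulr0.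
  by rewrite Ex_cst normr0.
rewrite mul1r.
have far x y : x \in I -> y \in fr -> (m <= dist x y)%N.
  by move=> xI yf; apply: ltnW; apply: leq_trans (frfar y yf) _; exact: dst_le.
have sm : smeas fr (fun o => F (Wsum fr o) - F (Wsum [::] o)).
  by apply: smeasB; apply: (smeas_comp (osc_continuous hw)); exact: smeas_Wsum.
have nT : {subset [::] <= Ts} by [].
have rb o : `|F (Wsum fr o) - F (Wsum [::] o)| <= w * env [::] o ^+ 0.
  by rewrite expr0 mulr1; have [] := hw (Wsum fr o) (Wsum [::] o).
have [H _] := good_centered mX Lenv mom covb thp thth' gZ L0 (leqnn L) frT far w0 sm
     nT (leqnn 0) rb.
by apply: H; rewrite addn0.
Qed.

Hypotheses (BD : forall l l', (l <= l')%N -> B l <= B l').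

Lemma count_near u Q l : {subset u <= Ts} -> uniq u -> {subset Q <= Ts} -> (size Q <= L)%N ->
  (l <= D)%N -> (count (fun j => dst j Q <= l)%N u)%:R <= B l.
Proof.
move=> uT uu QT QL lD; apply: le_trans (Bcount QT QL lD); rewrite ler_nat.
rewrite -!size_filter; apply: uniq_leq_size; first exact: filter_uniq.
by move=> x; rewrite !mem_filter => /andP[-> /uT].
Qed.

Lemma size_near r Q g : {subset r <= Ts} -> uniq r -> {subset Q <= Ts} -> (size Q <= L)%N ->
  (g <= D)%N -> (forall y, y \in r -> (dst y Q <= g)%N) -> (size r)%:R <= B g.
Proof.
move=> rT ur QT QL gD near; apply: le_trans (count_near rT ur QT QL gD).
by rewrite ler_nat -[leqLHS](@count_predT _ r); rewrite (@eq_in_count _ xpredT (fun j => dst j Q <= g)%N r)// => y /near ->.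
Qed.

(* Weights for the truncated expansion: beyond the scale [m] the last variable is not expanded. *)
Definition cut_weight (cth : nat -> R) m l : R :=
  (l == m)%:R * (kap * B m) + (m <= l)%N%:R * cth l.

Lemma V_cut cth m k g : (m <= D)%N -> (g <= m)%N ->
  V (cut_weight cth m) k g = kap * B m ^+ k.+1 + V cth k m.
Proof.
move=> mD gm; rewrite /V /cut_weight.
under eq_bigr do rewrite mulrDl.
rewrite big_split /=; congr (_ + _).
  have mD' : (m < D.+1)%N by [].
  rewrite (bigD1 (Ordinal mD')) //= eqxx mul1r big1 ?addr0; first by rewrite exprS mulrA.
  move=> i /andP[_]; rewrite -val_eqE /= => /negbTE ->; by rewrite !mul0r.
rewrite big_mkcond [RHS]big_mkcond; apply: eq_bigr => l _.
have [ml|lm] := leqP m l; first by rewrite (leq_trans gm ml) mul1r.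
by rewrite mul0r mul0r; case: ifP.
Qed.

Lemma V_cut_gt cth m k g : (m < g)%N -> V (cut_weight cth m) k g = V cth k g.
Proof.
move=> mg; rewrite /V /cut_weight; apply: eq_bigr => l gl.
by rewrite gtn_eqF ?(leq_trans mg)// mul0r add0r (ltnW (leq_trans mg gl)) mul1r.
Qed.

(** For a gap up to [m], at most [B m] sites are near [I], which gives the term [kap * B m] of the
    weight; for a larger gap the crude bound [final_trivial] is already as good as the weight. *)
Lemma final_cut cth m : (m <= D)%N -> (forall l, 0 <= cth l) ->
  (forall g, (g <= D)%N -> th g <= V cth 0 g) -> (forall g, th' g <= 1) ->
  (forall g g', (g <= g')%N -> th g' <= th g) ->
  forall c I g A u r Q Z (F : R -> R) w,
  good c L I g A Z -> {subset u <= A} -> perm_eq Ts (r ++ u) -> (0 < L)%N ->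
  {subset Q <= Ts} -> (size Q <= L)%N -> {subset I <= Q} -> I != [::] ->
  (forall y, y \in r -> (dst y Q <= g)%N) -> (g <= D)%N -> osc w F ->
  `|E (fun o => Z o * F (Wsum u o)) - E Z * E (fun o => F (Wsum Ts o))|
    <= 3 * (1 + Lam) * c * w * V (cut_weight cth m) 0 g.
Proof.
move=> mD cth0 thV th'1 thmono c I g A u r Q Z F w gZ uA pT L0 QT QL IQ I0 near gD hw.
have [[IT sI AT] _ c0 _ _] := gZ; have w0 := osc_ge0 hw.
have [gm|mg] := leqP g m; last first.
  rewrite V_cut_gt//; apply: (le_trans (final_trivial gZ uA L0 hw)).
  apply: (@le_trans _ _ (3 * c * w * V cth 0 g)).
    by rewrite ler_wpM2l ?thV// !mulr_ge0.
  rewrite [leRHS](_ : _ = (1 + Lam) * (3 * c * w * V cth 0 g)); last by ring.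
  by rewrite ler_peMl ?lerDl// !mulr_ge0// V_ge0.
rewrite V_cut// expr1.
apply: (le_trans (final_near m gZ uA L0 pT hw)).
rewrite [leRHS](_ : _ = c * (1 + Lam) * w * (3 * (kap * B m + V cth 0 m))); last by ring.
rewrite ler_wpM2l ?mulr_ge0 ?addr_ge0//.
have uru : uniq (r ++ u) by rewrite -(perm_uniq pT).
have [ur [_ uu]] : uniq r /\ ~~ has (mem r) u /\ uniq u by move: uru; rewrite cat_uniq => /and3P[].
have rT : {subset r <= Ts} by move=> x xr; rewrite (perm_mem pT) mem_cat xr.
have uT : {subset u <= Ts} by move=> x xu; rewrite (perm_mem pT) mem_cat xu orbT.
have B0 : 0 <= B m := le_trans ler01 (B1 m).
have V0 : 0 <= V cth 0 m by exact: V_ge0.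
have h1 : kap * \sum_(x <- u | (dst x I <= m)%N) th' (maxn g (dst x I)) <= kap * B m.
  rewrite ler_wpM2l//; apply: (@le_trans _ _ (\sum_(x <- u | (dst x I <= m)%N) 1)).
    by apply: ler_sum => x _.
  by rewrite big_const_seq iter_addr addr0; exact: count_near.
have h2 : (m < D)%N%:R * th (maxn g m) <= V cth 0 m.
  rewrite (maxn_idPr gm); apply: le_trans (thV m mD).
  by rewrite ler_piMl// lern1; case: (m < D)%N.
have th1 : th g <= 1 := le_trans (thth' g) (th'1 g).
have h3 : kap * (size r)%:R * th g <= kap * B m.
  rewrite -mulrA ler_wpM2l// -[leRHS]mulr1 ler_pM//.
  by apply: le_trans (BD gm); exact: size_near near.
have := mulr_ge0 kap0 B0; lra.
Qed.

Lemma tay_cut cth m : (m <= D)%N -> (forall l, 0 <= cth l) ->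
  (forall g, (g <= D)%N -> th g <= V cth 0 g) -> (forall g, th' g <= 1) ->
  forall g, (g <= D)%N -> Num.min (th g) (kap * th' g) <= 3 * (1 + Lam) * V (cut_weight cth m) 0 g.
Proof.
move=> mD cth0 thV th'1 g gD; have [gm|mg] := leqP g m.
  rewrite V_cut// expr1 ge_min; apply/orP; right.
  have V0 : 0 <= V cth 0 m by exact: V_ge0.
  have h : kap * th' g <= kap * B m by rewrite ler_wpM2l// (le_trans (th'1 g)).
  apply: (le_trans h); have kB := mulr_ge0 kap0 (le_trans ler01 (B1 m)).
  rewrite [leRHS](_ : _ = kap * B m + ((3 * Lam + 2) * (kap * B m) + 3 * (1 + Lam) * V cth 0 m)); last by ring.
  by rewrite lerDl addr_ge0// mulr_ge0// ?addr_ge0 ?mulr_ge0// addr_ge0.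
rewrite V_cut_gt// ge_min; apply/orP; left; apply: (le_trans (thV g gD)).
by rewrite ler_peMl ?V_ge0//; have := Lam1; lra.
Qed.

(* Weights for the full expansion, where the last variable is expanded at all scales. *)
Definition full_weight (cth' : nat -> R) l : R := kap * cth' l * B l.

Lemma V_full cth' k g : V (full_weight cth') k g = kap * V cth' k.+1 g.
Proof.
rewrite /V mulr_sumr; apply: eq_bigr => l _; rewrite /full_weight exprS; ring.
Qed.

(** The case [m = D] of [final_near]. Summing the slow decay over the sites raises the index of [V]
    by one, which is the factor [B l] in [full_weight]. *)
Lemma final_full cth' : (forall l, 0 <= cth' l) ->
  (forall g, (g <= D)%N -> th' g <= V cth' 0 g) ->
  forall c I g A u r Q Z (F : R -> R) w,
  good c L I g A Z -> {subset u <= A} -> perm_eq Ts (r ++ u) -> (0 < L)%N ->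
  {subset Q <= Ts} -> (size Q <= L)%N -> {subset I <= Q} -> I != [::] ->
  (forall y, y \in r -> (dst y Q <= g)%N) -> (g <= D)%N -> osc w F ->
  `|E (fun o => Z o * F (Wsum u o)) - E Z * E (fun o => F (Wsum Ts o))|
    <= 3 * (1 + Lam) * c * w * V (full_weight cth') 0 g.
Proof.
move=> cth'0 thV c I g A u r Q Z F w gZ uA pT L0 QT QL IQ I0 near gD hw.
have [[IT sI AT] _ c0 _ _] := gZ; have w0 := osc_ge0 hw.
rewrite V_full.
apply: (le_trans (final_near D gZ uA L0 pT hw)); rewrite ltnn mul0r addr0.
rewrite [leRHS](_ : _ = c * (1 + Lam) * w * (3 * (kap * V cth' 1 g))); last by ring.
rewrite ler_wpM2l ?mulr_ge0 ?addr_ge0//.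
have uru : uniq (r ++ u) by rewrite -(perm_uniq pT).
have [ur [_ uu]] : uniq r /\ ~~ has (mem r) u /\ uniq u by move: uru; rewrite cat_uniq => /and3P[].
have rT : {subset r <= Ts} by move=> x xr; rewrite (perm_mem pT) mem_cat xr.
have uT : {subset u <= Ts} by move=> x xu; rewrite (perm_mem pT) mem_cat xu orbT.
have V0 k : 0 <= V cth' k g by exact: V_ge0.
have h1 : \sum_(x <- u | (dst x I <= D)%N) th' (maxn g (dst x I)) <= V cth' 1 g.
  apply: le_trans (V_sum_sub uTs B1 Bcount 0%N g cth'0 IT sI uu uT).
  rewrite big_mkcond; apply: ler_sum => x _; rewrite dst_leD; apply: thV.
  by rewrite geq_max gD dst_leD.
have h3 : (size r)%:R * th g <= V cth' 1 g.
  apply: le_trans (V_sum_near uTs B1 Bcount 0%N cth'0 QT QL ur rT near).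
  rewrite big_const_seq count_predT iter_addr addr0 -[leRHS]mulr_natl ler_wpM2l//.
  exact: le_trans (thth' g) (thV g gD).
rewrite -mulrA -mulrDr mulrCA ler_wpM2l//.
have := V0 1%N; lra.
Qed.

Lemma tay_full cth' : (forall l, 0 <= cth' l) ->
  (forall g, (g <= D)%N -> th' g <= V cth' 0 g) ->
  forall g, (g <= D)%N -> Num.min (th g) (kap * th' g) <= 3 * (1 + Lam) * V (full_weight cth') 0 g.
Proof.
move=> cth'0 thV g gD; rewrite ge_min; apply/orP; right; rewrite V_full.
have V0 k : 0 <= V cth' k g by exact: V_ge0.
apply: (@le_trans _ _ (kap * V cth' 1 g)).
  rewrite ler_wpM2l//; apply: (le_trans (thV g gD)); exact: V_mono.
by rewrite ler_peMl ?mulr_ge0//; have := Lam1; lra.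
Qed.

(** Each summand starts an expansion at gap 0 with nothing removed and with cluster and record equal
    to one site. Adding the results over the sites produces the factor [size Ts] and one more power
    of [kap]. *)
Lemma beta_expansion K Cf (ct cth : nat -> R) : L = K.+1 -> 0 <= Cf ->
  (forall l, 0 <= ct l) -> (forall l, 0 <= cth l) ->
  (forall g, (g <= D)%N -> th g <= V cth 0 g) ->
  (forall g, (g <= D)%N -> Num.min (th g) (kap * th' g) <= Cf * V ct 0 g) ->
  (forall c I g A u r Q Z (F : R -> R) w,
    good c L I g A Z -> {subset u <= A} -> perm_eq Ts (r ++ u) -> (0 < L)%N ->
    {subset Q <= Ts} -> (size Q <= L)%N -> {subset I <= Q} -> I != [::] ->
    (forall y, y \in r -> (dst y Q <= g)%N) -> (g <= D)%N -> osc w F ->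
    `|E (fun o => Z o * F (Wsum u o)) - E Z * E (fun o => F (Wsum Ts o))|
      <= Cf * c * w * V ct 0 g) ->
  exists b : nat -> R,
    (forall k, (k <= K)%N ->
      `|b k| <= expand_const Lam Cf K * Lam * (size Ts)%:R * kap ^+ k.+1 * V cth k 0) /\
    forall F w, chain F K -> osc w (F K) ->
      `|E (fun o => Wsum Ts o * F 0%N (Wsum Ts o))
          - \sum_(k < K.+1) b k * E (fun o => F k (Wsum Ts o))|
        <= expand_const Lam Cf K * Lam * (size Ts)%:R * w * kap ^+ K.+1 * V ct K 0.
Proof.
move=> LK Cf0 ct0 cth0 thV tay fin.
have L0 : (0 < L)%N by rewrite LK.
have st (i : 'I_(size Ts)) : exists b : nat -> R,
    (forall k, (k <= K)%N -> `|b k| <= expand_const Lam Cf K * Lam * kap ^+ k * V cth k 0) /\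
    forall F w, chain F K -> osc w (F K) ->
      `|E (fun o => X (nth x0 Ts i) o * F 0%N (Wsum Ts o)) - \sum_(k < K.+1) b k * E (fun o => F k (Wsum Ts o))|
        <= expand_const Lam Cf K * Lam * w * kap ^+ K * V ct K 0.
  have iT : nth x0 Ts i \in Ts by exact: mem_nth.
  apply: (expand x0 mX uTs Lam1 kap0 Cf0 Lenv mom covb thp thth' ct0 cth0 B1 thV Bcount tay fin
     (n := 1%N) _ isT (good_start iT L0) _ (r := [::]) (Q := [:: nth x0 Ts i])) => //.
  by move=> x; rewrite inE => /eqP ->.
have [b hb] := choice st.
exists (fun k => kap * \sum_(i < size Ts) b i k); split=> [k kK|F w cF hw].
  rewrite normrM ger0_norm//.
  have h : `|\sum_(i < size Ts) b i k| <= \sum_(i < size Ts) expand_const Lam Cf K * Lam * kap ^+ k * V cth k 0.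
    by apply: (le_trans (ler_norm_sum _ _ _)); apply: ler_sum => i _; exact: (proj1 (hb i)).
  apply: (le_trans (ler_wpM2l kap0 h)); rewrite sumr_const card_ord -[X in _ * X]mulr_natl exprS.
  by rewrite le_eqVlt; apply/orP; left; apply/eqP; ring.
have w0 := osc_ge0 hw.
have dF : dom X Ts K (fun o => F 0%N (Wsum Ts o)).
  by have := dom_chain mX kap0 (fun x h => h) cF hw (leq0n K); rewrite subn0.
have LX (i : 'I_(size Ts)) : L1 P (fun o => X (nth x0 Ts i) o * F 0%N (Wsum Ts o)).
  apply: (dom_L1 Lenv (s := (1 + K)%N)); first by rewrite LK.
  apply: domM => //; have := domX mX 1 (mem_nth x0 (ltn_ord i)).
  by congr dom; apply/funext => o; rewrite expr1.
have -> : E (fun o => Wsum Ts o * F 0%N (Wsum Ts o)) =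
    kap * \sum_(i < size Ts) E (fun o => X (nth x0 Ts i) o * F 0%N (Wsum Ts o)).
  rewrite -Ex_sum// -ExZ; last by apply: L1_sum.
  apply: eq_Ex => o; rewrite {1}/Wsum -mulrA; congr (_ * _).
  by rewrite (big_nth x0) big_mkord mulr_suml.
have -> : \sum_(k < K.+1) kap * (\sum_(i < size Ts) b i k) * E (fun o => F k (Wsum Ts o)) =
    kap * \sum_(i < size Ts) \sum_(k < K.+1) b i k * E (fun o => F k (Wsum Ts o)).
  rewrite exchange_big mulr_sumr; apply: eq_bigr => k _.
  by rewrite -mulrA mulr_suml.
rewrite -mulrBr -sumrB normrM ger0_norm//.
have h : `|\sum_(i < size Ts) (E (fun o => X (nth x0 Ts i) o * F 0%N (Wsum Ts o)) -
    \sum_(k < K.+1) b i k * E (fun o => F k (Wsum Ts o)))| <=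
    \sum_(i < size Ts) expand_const Lam Cf K * Lam * w * kap ^+ K * V ct K 0.
  by apply: (le_trans (ler_norm_sum _ _ _)); apply: ler_sum => i _; exact: (proj2 (hb i)).
apply: (le_trans (ler_wpM2l kap0 h)); rewrite sumr_const card_ord -[X in _ * X]mulr_natl exprS.
by rewrite le_eqVlt; apply/orP; left; apply/eqP; ring.
Qed.

End final_level.

(** * Stein's equation with polynomial growth *)

Section real_derivatives.
Context {R : realType}.
Implicit Types (f g : R -> R) (x a b c : R).

Lemma derD f g x a b : is_derive x 1 f a -> is_derive x 1 g b ->
  is_derive x 1 (fun y => f y + g y) (a + b).
Proof. by move=> hf hg; exact: is_deriveD. Qed.

Lemma derB f g x a b : is_derive x 1 f a -> is_derive x 1 g b ->
  is_derive x 1 (fun y => f y - g y) (a - b).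
Proof. by move=> hf hg; exact: is_deriveB. Qed.

Lemma derN f x a : is_derive x 1 f a -> is_derive x 1 (fun y => - f y) (- a).
Proof. by move=> hf; exact: is_deriveN. Qed.

Lemma der_cst c x : is_derive x 1 (fun=> c) 0.
Proof. exact: is_derive_cst. Qed.

Lemma der_id x : is_derive x 1 (fun y => y) 1.
Proof. exact: is_derive_id. Qed.

Lemma der_eq f x a b : a = b -> is_derive x 1 f a -> is_derive x 1 f b.
Proof. by move=> ->. Qed.

Lemma derM f g x a b : is_derive x 1 f a -> is_derive x 1 g b ->
  is_derive x 1 (fun y => f y * g y) (a * g x + f x * b).
Proof.
move=> hf hg; have := is_deriveM hf hg; apply: der_eq.
by rewrite /GRing.scale /= addrC (mulrC a).
Qed.

Lemma derZ c f x a : is_derive x 1 f a -> is_derive x 1 (fun y => c * f y) (c * a).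
Proof. by move=> hf; have := derM (der_cst c x) hf; apply: der_eq; rewrite mul0r add0r. Qed.

Lemma derX f x a n : is_derive x 1 f a ->
  is_derive x 1 (fun y => f y ^+ n) (n%:R * f x ^+ n.-1 * a).
Proof.
move=> hf; elim: n => [|n IH].
  by under eq_fun do rewrite expr0; rewrite !mul0r; exact: der_cst.
under eq_fun do rewrite exprS.
apply: der_eq (derM hf IH); case: n {IH} => [|n] /=; first by rewrite expr0; ring.
by rewrite exprS -(natr1 n.+1); ring.
Qed.

Lemma der_comp f g x a b : is_derive (g x) 1 f a -> is_derive x 1 g b ->
  is_derive x 1 (fun y => f (g y)) (a * b).
Proof. by move=> hf hg; exact: is_derive1_comp. Qed.

Lemma der_exp f x a : is_derive x 1 f a -> is_derive x 1 (fun y => expR (f y)) (a * expR (f x)).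
Proof.
by move=> hf; apply: der_eq (der_comp (is_derive_expR (f x)) hf); rewrite mulrC.
Qed.

Lemma derV f x a : f x != 0 -> is_derive x 1 f a ->
  is_derive x 1 (fun y => (f y)^-1) (- a / f x ^+ 2).
Proof.
move=> f0 hf; have := is_deriveV f0 hf; apply: der_eq.
by rewrite /GRing.scale /= mulNr mulrC mulNr.
Qed.

Lemma der_continuous f x a : is_derive x 1 f a -> {for x, continuous f}.
Proof.
by move=> h; apply: differentiable_continuous; apply/derivable1_diffP; exact: ex_derive.
Qed.

Lemma der_le0_decr f df a b : a <= b -> (forall x, a <= x <= b -> is_derive x 1 f (df x)) ->
  (forall x, a <= x <= b -> df x <= 0) -> f b <= f a.
Proof.
rewrite le_eqVlt => /predU1P[->//|ab] hf h0.
have cf : {within `[a, b], continuous f}.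
  apply: derivable_within_continuous => x; rewrite in_itv /= => xab.
  by have h := hf x xab; exact: ex_derive.
have hf' x : x \in `]a, b[ -> is_derive x 1 f (df x).
  by rewrite in_itv /= => /andP[h1 h2]; apply: hf; rewrite !ltW.
have [z] := MVT ab hf' cf.
rewrite in_itv /= => /andP[az zb] E.
by rewrite -subr_le0 E mulr_le0_ge0 ?subr_ge0 ?(ltW ab)// h0// !ltW.
Qed.

Lemma MVT_seg f df a b c : a <= b -> (forall x, a <= x <= b -> is_derive x 1 f (df x)) ->
  (forall x, a <= x <= b -> `|df x| <= c) -> `|f b - f a| <= c * (b - a).
Proof.
rewrite le_eqVlt => /predU1P[->|ab] hf h0; first by rewrite !subrr normr0 mulr0.
have cf : {within `[a, b], continuous f}.
  apply: derivable_within_continuous => x; rewrite in_itv /= => xab.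
  by have h := hf x xab; exact: ex_derive.
have hf' x : x \in `]a, b[ -> is_derive x 1 f (df x).
  by rewrite in_itv /= => /andP[h1 h2]; apply: hf; rewrite !ltW.
have [z] := MVT ab hf' cf.
rewrite in_itv /= => /andP[az zb] ->.
by rewrite normrM (gtr0_norm (x := b - a)) ?subr_gt0// ler_wpM2r ?subr_ge0 ?(ltW ab)// h0// !ltW.
Qed.

End real_derivatives.

Section gaussian_decay.
Context {R : realType}.
Implicit Types (x y C K : R) (m : nat).

Local Notation bas x := (1 + `|x|) (only parsing).

Lemma bas_ge1 x : 1 <= bas x :> R.
Proof. by rewrite lerDl. Qed.

Lemma bas_gt0 x : 0 < bas x :> R.
Proof. exact: lt_le_trans ltr01 (bas_ge1 x). Qed.

Lemma expn_le_expR m y : 0 <= y -> y ^+ m <= m`!%:R * expR y.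
Proof.
move=> y0; case: m => [|m]; first by rewrite expr0 fact0 mul1r -expR0 ler_expR.
have := expR_ge1Dxn m y0; set F := m.+1`!%:R.
have F0 : 0 < F by rewrite ltr0n fact_gt0.
move=> h; rewrite -ler_pdivrMl// mulrC; apply: le_trans h.
by rewrite lerDr.
Qed.

(** From [1 + |x| <= 4 * y] with [y = 1/2 + x^2/4] and from [y^m <= m! exp y]. *)
Definition Kpow m : R := 4 ^+ m * m`!%:R * expR (2^-1).

Lemma pow_le_expR m x : bas x ^+ m <= Kpow m * expR (x ^+ 2 / 4).
Proof.
pose y := 2^-1 + x ^+ 2 / 4.
have y0 : 0 <= y by rewrite addr_ge0 ?divr_ge0 ?sqr_ge0 ?invr_ge0.
have h : bas x <= 4 * y.
  rewrite (_ : 4 * y = 2 + `|x| ^+ 2); last first.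
    by rewrite /y real_normK ?num_real//; field.
  have := sqr_ge0 (`|x| - 2^-1); nra.
apply: (@le_trans _ _ ((4 * y) ^+ m)).
  by rewrite lerXn2r ?nnegrE ?mulr_ge0 ?(ltW (bas_gt0 x)).
have := expn_le_expR m y0; rewrite expRD exprMn /Kpow -!mulrA => h'.
by rewrite ler_wpM2l ?exprn_ge0.
Qed.

Lemma Kpow_gt0 m : 0 < Kpow m.
Proof. by rewrite !mulr_gt0 ?exprn_gt0 ?expR_gt0// ltr0n fact_gt0. Qed.

Lemma pow_decay m x : bas x ^+ m * expR (- (x ^+ 2 / 2)) <= Kpow m * expR (- (x ^+ 2 / 4)).
Proof.
apply: (le_trans (ler_wpM2r (expR_ge0 _) (pow_le_expR m x))).
rewrite -mulrA -expRD; apply: ler_wpM2l; first exact: ltW (Kpow_gt0 m).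
by rewrite ler_expR; lra.
Qed.

Lemma pow_decay1 m x : bas x ^+ m * expR (- (x ^+ 2 / 2)) <= Kpow m.+1 / bas x.
Proof.
rewrite ler_pdivlMr ?bas_gt0// mulrAC -exprSr; apply: (le_trans (pow_decay m.+1 x)).
rewrite -[leRHS]mulr1 ler_wpM2l ?(ltW (Kpow_gt0 _))// -expR0 ler_expR.
by rewrite oppr_le0 divr_ge0// sqr_ge0.
Qed.

End gaussian_decay.

Section growth.
Context {R : realType}.
Implicit Types (g r : R -> R) (x y C K : R) (m : nat).

Local Notation bas x := (1 + `|x|) (only parsing).

(** Beyond [X0 = m + 1] the barrier is in force, and the 2 suffices. The other term carries the
    value at [X0] back towards the origin, with the inverse of the integrating factor bounded by
    [expR (X0 ^+ 2 / 2)]. *)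
Definition Kgrow m : R :=
  let X0 := m.+1%:R in 2 + (1 + X0) * (expR (X0 ^+ 2 / 2) * ((2 + X0) * (1 + X0) ^+ m)).

Lemma Kgrow_ge0 m : 0 <= Kgrow m.
Proof. by rewrite /Kgrow addr_ge0// !mulr_ge0 ?expR_ge0 ?exprn_ge0 ?addr_ge0. Qed.

Lemma Kgrow_ge2 m : 2 <= Kgrow m.
Proof. by rewrite /Kgrow lerDl !mulr_ge0 ?expR_ge0 ?exprn_ge0 ?addr_ge0. Qed.

Definition gex x := expR (- (x ^+ 2 / 2)) : R.

Lemma gex_gt0 x : 0 < gex x. Proof. exact: expR_gt0. Qed.

Lemma gex_le1 x : gex x <= 1.
Proof. by rewrite -expR0 ler_expR oppr_le0 divr_ge0// sqr_ge0. Qed.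

Lemma der_gex x : is_derive x 1 gex (- x * gex x).
Proof.
have h := derN (derZ (2^-1) (derX 2 (der_id x))).
have E : gex = (fun y => expR (- (2^-1 * y ^+ 2))).
  by apply/funext => y; rewrite /gex (mulrC 2^-1).
by rewrite {1}E; apply: der_eq (der_exp h); rewrite E /= expr1; field.
Qed.

(* The barrier [(1 + x) ^+ m / (1 + x) * exp (- x^2/2)] dominates the solution that decays at
   infinity. *)
Lemma barrier_tail u r C K m : 0 <= C ->
  (forall x, 0 <= x -> is_derive x 1 u (r x * gex x)) ->
  (forall x, 0 <= x -> r x <= C * (1 + x) ^+ m) ->
  (forall x, 0 <= x -> - r x <= C * (1 + x) ^+ m) ->
  (forall x, 0 <= x -> `|u x| <= K / (1 + x)) ->
  forall x, m.+1%:R <= x -> u x <= 2 * C * ((1 + x) ^+ m / (1 + x) * gex x).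
Proof.
move=> C0 hu hr hrN hK.
pose V x := (1 + x) ^+ m / (1 + x) * gex x.
have dV x : 0 <= x -> is_derive x 1 V
   (((m%:R - 1) / (1 + x) - x) * ((1 + x) ^+ m / (1 + x) * gex x)).
  move=> x0; have y0 : 1 + x != 0 by rewrite gt_eqF// ltr_pwDl.
  have d1 : is_derive x 1 (fun y => 1 + y) (0 + 1) by apply: derD (der_cst _ _) (der_id _).
  apply: der_eq (derM (derM (derX m d1) (derV y0 d1)) (der_gex x)).
  clear hr hrN; case: m V => [|n] V /=; first by rewrite !expr0; field.
  by rewrite !exprS -!(natr1 n) /=; field.
have V0 x : 0 <= x -> 0 <= V x.
  by move=> x0; rewrite mulr_ge0 ?divr_ge0 ?exprn_ge0 ?addr_ge0// (ltW (gex_gt0 _)).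
have m0 : 0 <= m.+1%:R :> R by [].
(* The difference is nondecreasing, and at infinity it is at most 0 since [u] decays and the barrier
   is nonnegative; hence it is at most 0 everywhere. *)
have mono x y : m.+1%:R <= x -> x <= y -> u x - 2 * C * V x <= u y - 2 * C * V y.
  move=> mx xy.
  rewrite -lerN2.
  have D z (hz : x <= z <= y) : is_derive z 1 (fun z => - (u z - 2 * C * V z))
     (- (r z * gex z - 2 * C * (((m%:R - 1) / (1 + z) - z) * ((1 + z) ^+ m / (1 + z) * gex z)))).
    have z0 : 0 <= z by case/andP: hz => h _; apply: le_trans h; apply: le_trans mx.
    by apply: derN; apply: derB (hu z z0) _; apply: derZ; exact: dV.
  apply: (der_le0_decr xy D) => z /andP[xz _].
  have mz := le_trans mx xz; have z0 := le_trans m0 mz.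
  rewrite oppr_le0 (_ : _ - _ = gex z * (r z + 2 * C * (1 + z) ^+ m * ((z - (m%:R - 1) / (1 + z)) / (1 + z)))); last first.
    by field; rewrite gt_eqF// ltr_pwDl.
  rewrite mulr_ge0 ?(ltW (gex_gt0 _))//.
  (* Origin of the factor 2 in the bound: beyond [m + 1] the logarithmic derivative of the barrier
     is at most minus one half of [1 + z]. *)
  have q : 2^-1 <= (z - (m%:R - 1) / (1 + z)) / (1 + z).
    have z1 : 0 < 1 + z by rewrite ltr_pwDl.
    rewrite ler_pdivlMr// lerBrDr.
    have : (m%:R - 1) / (1 + z) <= z - 2^-1 * (1 + z).
      rewrite ler_pdivrMr//; move: mz; rewrite -natr1 => mz.
      have : 0 <= m%:R :> R by []. nra.
    by rewrite lerBrDr addrC.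
  have := hrN z z0; have := ler_wpM2l (mulr_ge0 C0 (exprn_ge0 m (addr_ge0 ler01 z0))) q.
  lra.
move=> x mx; have x0 := le_trans m0 mx.
rewrite -subr_le0; apply/ler_addgt0Pr => e e0; rewrite add0r.
pose y := x + `|K| / e.
have xy : x <= y by rewrite lerDl divr_ge0// ltW.
apply: le_trans (mono x y mx xy) _.
have y0 := le_trans x0 xy.
rewrite lerBlDr -[leLHS]addr0 lerD//; last by rewrite mulr_ge0 ?V0 ?mulr_ge0.
apply: le_trans (ler_norm _) (le_trans (hK y y0) _).
rewrite ler_pdivrMr ?ltr_pwDl// /y mulrDr mulrDr mulr1 mulrCA divff ?gt_eqF// mulr1.
by have := ler_norm K; have := mulr_ge0 (ltW e0) x0; lra.
Qed.

Lemma growth_pos g r C K m : 0 <= C ->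
  (forall x, 0 <= x -> is_derive x 1 g (x * g x + r x)) ->
  (forall x, 0 <= x -> `|r x| <= C * (1 + x) ^+ m) ->
  (forall x, 0 <= x -> `|g x| * gex x <= K / (1 + x)) ->
  forall x, 0 <= x -> (1 + x) * `|g x| <= C * Kgrow m * (1 + x) ^+ m.
Proof.
move=> C0 hg hr hK.
pose u x := g x * gex x.
have du x : 0 <= x -> is_derive x 1 u (r x * gex x).
  by move=> x0; apply: der_eq (derM (hg x x0) (der_gex x)); ring.
have uK x : 0 <= x -> `|u x| <= K / (1 + x).
  by move=> x0; rewrite normrM (gtr0_norm (gex_gt0 x)) hK.
have r1 x : 0 <= x -> r x <= C * (1 + x) ^+ m.
  by move=> x0; apply: le_trans (hr x x0); exact: ler_norm.
have r2 x : 0 <= x -> - r x <= C * (1 + x) ^+ m.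
  by move=> x0; apply: le_trans (hr x x0); rewrite -normrN ler_norm.
have tl x : m.+1%:R <= x -> `|u x| <= 2 * C * ((1 + x) ^+ m / (1 + x) * gex x).
  move=> mx; rewrite ler_norml lerNl; apply/andP; split.
    apply: (@barrier_tail (fun x => - u x) (fun x => - r x) C K) => //.
    - by move=> z z0; apply: der_eq (derN (du z z0)); rewrite mulNr.
    - by move=> z z0; rewrite opprK r1.
    - by move=> z z0; rewrite normrN uK.
  exact: (@barrier_tail u r C K).
move=> x x0.
have y0 : 0 < 1 + x by rewrite ltr_pwDl.
have gu : `|g x| = `|u x| / gex x.
  by rewrite normrM (gtr0_norm (gex_gt0 x)) mulfK ?gt_eqF ?gex_gt0.
case: (leP m.+1%:R x) => mx.
  apply: (@le_trans _ _ (C * 2 * (1 + x) ^+ m)); last first.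
    by rewrite ler_wpM2r ?exprn_ge0 ?(ltW y0)// ler_wpM2l// Kgrow_ge2.
  rewrite gu mulrA ler_pdivrMr ?gex_gt0//.
  rewrite -ler_pdivlMl// (le_trans (tl x mx))//.
  by rewrite le_eqVlt; apply/orP; left; apply/eqP; field; rewrite gt_eqF.
set X0 : R := m.+1%:R in mx *.
have X00 : 0 <= X0 by [].
have bX : 0 < 1 + X0 by rewrite ltr_pwDl.
have ux : `|u x| <= C * ((2 + X0) * (1 + X0) ^+ m).
  have h1 : `|u X0| <= 2 * C * (1 + X0) ^+ m.
    apply: le_trans (tl X0 (lexx _)) _; rewrite ler_wpM2l ?mulr_ge0//.
    rewrite -mulrA ler_piMr ?exprn_ge0 ?(ltW bX)//.
    rewrite -[leRHS]mulr1 ler_pM ?invr_ge0 ?(ltW bX) ?(ltW (gex_gt0 _)) ?gex_le1//.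
    by rewrite invf_le1// lerDl.
  have h2 : `|u X0 - u x| <= C * (1 + X0) ^+ m * (X0 - x).
    apply: (@MVT_seg _ u (fun z => r z * gex z)) (ltW mx) _ _ => z /andP[xz zX].
      by apply: du; exact: le_trans xz.
    have z0 := le_trans x0 xz.
    rewrite normrM (gtr0_norm (gex_gt0 z)) -[leRHS]mulr1 ler_pM ?(ltW (gex_gt0 _)) ?gex_le1//.
    apply: (le_trans (hr z z0)); rewrite ler_wpM2l// lerXn2r ?nnegrE ?addr_ge0//.
    by rewrite lerD2l.
  have h3 : C * (1 + X0) ^+ m * (X0 - x) <= C * (1 + X0) ^+ m * X0.
    by rewrite ler_wpM2l ?mulr_ge0 ?exprn_ge0 ?(ltW bX)// lerBlDr lerDl.
  have := ler_normB (u X0) (u X0 - u x); rewrite opprB addrC subrK; lra.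
have gx : `|g x| <= C * (expR (X0 ^+ 2 / 2) * ((2 + X0) * (1 + X0) ^+ m)).
  rewrite gu ler_pdivrMr ?gex_gt0//; apply: le_trans ux _.
  rewrite -mulrA ler_wpM2l// mulrAC ler_peMl ?mulr_ge0 ?exprn_ge0 ?(ltW bX) ?addr_ge0//.
  rewrite /gex -expRD -expR0 ler_expR subr_ge0 ler_wpM2r ?invr_ge0//.
  by rewrite lerXn2r ?nnegrE// ltW.
apply: (@le_trans _ _ (C * Kgrow m)); last first.
  by rewrite ler_peMr ?mulr_ge0 ?Kgrow_ge0 ?exprn_ege1 ?lerDl.
apply: le_trans (ler_pM (ltW y0) (normr_ge0 _) _ gx) _; first exact: (lexx (1 + x)).
rewrite mulrCA ler_wpM2l// /Kgrow -/X0 (@le_trans _ _ ((1 + X0) * (expR (X0 ^+ 2 / 2) * ((2 + X0) * (1 + X0) ^+ m))))//; last by rewrite lerDr.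
by rewrite ler_wpM2r ?mulr_ge0 ?expR_ge0 ?exprn_ge0 ?(ltW bX) ?addr_ge0// lerD2l ltW.
Qed.

Lemma growth g r C K m : 0 <= C ->
  (forall x, is_derive x 1 g (x * g x + r x)) ->
  (forall x, `|r x| <= C * bas x ^+ m) ->
  (forall x, bas x * `|g x| * gex x <= K) ->
  forall x, bas x * `|g x| <= C * Kgrow m * bas x ^+ m.
Proof.
move=> C0 hg hr hK x.
have hK' y : `|g y| * gex y <= K / bas y.
  by rewrite ler_pdivlMr ?bas_gt0// mulrC mulrA.
case: (leP 0 x) => x0.
  rewrite (ger0_norm x0); apply: (@growth_pos g r C K) => // y y0.
    by have := hr y; rewrite (ger0_norm y0).
  by have := hK' y; rewrite (ger0_norm y0).
rewrite (ltr0_norm x0).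
have -> : g x = g (- - x) by rewrite opprK.
apply: (@growth_pos (fun y => g (- y)) (fun y => - r (- y)) C K) => //.
- move=> y y0; apply: der_eq (der_comp (hg (- y)) (derN (der_id y))); ring.
- by move=> y y0; have := hr (- y); rewrite !normrN (ger0_norm y0).
- by move=> y y0; have := hK' (- y); rewrite normrN (ger0_norm y0) /gex sqrrN.
- by rewrite oppr_ge0 ltW.
Qed.

End growth.

Section gaussian_integral.
Context {R : realType}.
Implicit Types (f g h v : R -> R) (x y C K : R) (m n : nat).
Local Notation mu := (@lebesgue_measure R).
Local Notation bas x := (1 + `|x|) (only parsing).

Lemma continuous_meas f : continuous f -> measurable_fun setT f.
Proof. exact: continuous_measurable_fun. Qed.

Definition lint v x : R := \int[mu]_(t in `]-oo, x]) v t.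

Lemma lintE v x : lint v x = Ex mu (fun t => v t * \1_`]-oo, x] t).
Proof.
rewrite /lint Rintegral_mkcond; apply: eq_Ex => t; rewrite patchE indicE.
by case: ifP => _; rewrite ?mulr1 ?mulr0.
Qed.

Lemma L1_indicM v (D : set R) : measurable D -> L1 mu v -> L1 mu (fun t => v t * \1_D t).
Proof.
move=> mD hv; apply: (L1_le _ _ (L1_abs hv)).
  by apply: measurable_funM; [exact: L1_meas hv|exact: measurable_indic].
by move=> t; rewrite normrM ler_piMr// indicE; case: (_ \in _); rewrite ?normr1 ?normr0.
Qed.

Lemma der_lint v x : L1 mu v -> continuous v -> is_derive x 1 (lint v) (v x).
Proof.
move=> hv cv.
have xx : x < x + 1 by rewrite ltrDl.
have hi : mu.-integrable `]-oo, x + 1] (EFin \o v) by apply: integrableS hv.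
have [h1 h2] := @continuous_FTC1 R v -oo%O x (x + 1) xx hi (ltNyr x) (cv x).
by rewrite -h2 derive1E; apply: DeriveDef.
Qed.

(** For [t <= x <= 0] the weight at [t] dominates the weight at [x]. *)
Lemma lint_left v x : L1 mu v -> L1 mu (fun t => bas t * `|v t|) -> x <= 0 ->
  bas x * `|lint v x| <= Ex mu (fun t => bas t * `|v t|).
Proof.
move=> hv hw x0; rewrite lintE.
have h1 := L1_indicM (measurable_itv `]-oo, x]) hv.
rewrite -(gtr0_norm (bas_gt0 x)) -normrM -ExZ//.
apply: Ex_abs_le => //; first exact: L1Z.
move=> t; rewrite !normrM (gtr0_norm (bas_gt0 x)) indicE.
case: (boolP (t \in _)); rewrite ?normr0 ?mulr0 ?mulr_ge0 ?(ltW (bas_gt0 t))//.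
rewrite inE /= in_itv /= => tx; rewrite normr1 mulr1 ler_wpM2r// lerD2l.
by rewrite !ler0_norm// ?lerN2// (le_trans tx).
Qed.

Lemma lint_right v x : L1 mu v -> L1 mu (fun t => bas t * `|v t|) -> 0 <= x ->
  bas x * `|Ex mu v - lint v x| <= Ex mu (fun t => bas t * `|v t|).
Proof.
move=> hv hw x0; rewrite lintE.
have h1 := L1_indicM (measurable_itv `]-oo, x]) hv.
have h2 := L1B hv h1.
rewrite -ExB// -(gtr0_norm (bas_gt0 x)) -normrM -ExZ//.
apply: Ex_abs_le => //; first exact: L1Z.
move=> t; rewrite -{1}(mulr1 (v t)) -mulrBr !normrM (gtr0_norm (bas_gt0 x)) indicE.
case: (boolP (t \in _)); rewrite ?subrr ?normr0 ?mulr0 ?mulr_ge0 ?(ltW (bas_gt0 t))//.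
rewrite notin_setE /= in_itv /= => /negP; rewrite -ltNge => tx.
rewrite subr0 normr1 mulr1 ler_wpM2r// lerD2l.
by rewrite !ger0_norm// ?(ltW tx)// (le_trans x0)// ltW.
Qed.

Lemma bas_small (c K : R) : (forall x : R, 0 <= x -> bas x * `|c| <= K) -> c = 0.
Proof.
move=> h; apply/eqP; apply: contraT => c0.
have c1 : 0 < `|c| by rewrite normr_gt0.
have /h : 0 <= `|K| / `|c| by rewrite divr_ge0.
rewrite (ger0_norm (divr_ge0 _ _))// mulrDl mul1r divfK ?gt_eqF//.
by have := ler_norm K; lra.
Qed.

Lemma is_derive0_cst f : (forall x, is_derive x 1 f 0) -> forall x, f x = f 0.
Proof.
move=> h x; apply/eqP; rewrite -subr_eq0 -normr_le0.
have := @MVT_bound R f (fun=> 0) 0 x 0 h; rewrite mul0r; apply => z _; by rewrite normr0.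
Qed.

(** [lint v - u] is constant, and both terms are O(1 / (1 + |x|)) at minus infinity, so the constant
    is 0; the decay at plus infinity then makes the whole integral vanish. *)
Lemma integral_derivative u v K : L1 mu v -> L1 mu (fun t => bas t * `|v t|) -> continuous v ->
  (forall x, is_derive x 1 u (v x)) -> (forall x, bas x * `|u x| <= K) -> Ex mu v = 0.
Proof.
move=> hv hw cv du uK.
have E x : lint v x - u x = lint v 0 - u 0.
  apply: (is_derive0_cst (f := fun x => lint v x - u x)) => z.
  by apply: der_eq (derB (der_lint z hv cv) (du z)); rewrite subrr.
set K' := Ex mu (fun t => bas t * `|v t|).
have c0 : lint v 0 - u 0 = 0.
  apply: (@bas_small _ (K' + K)) => x x0.
  have x0' : - x <= 0 by rewrite oppr_le0.
  have := lint_left hv hw x0'; have := uK (- x); rewrite -(E (- x)) normrN => h1 h2.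
  have := ler_wpM2l (ltW (bas_gt0 x)) (ler_normB (lint v (- x)) (u (- x))).
  by rewrite mulrDr -/K' in h2 *; lra.
apply: (@bas_small _ (K' + K)) => x x0.
have := lint_right hv hw x0; have := uK x => h1 h2.
have e : lint v x = u x by apply/eqP; rewrite -subr_eq0 E c0.
have := ler_wpM2l (ltW (bas_gt0 x)) (ler_normD (Ex mu v - lint v x) (u x)).
by rewrite {3}e -e subrK mulrDr e -/K' in h2 *; lra.
Qed.

Definition gs : R -> R := normal_pdf 0 1.
Definition gpk : R := normal_peak 1.

Lemma gpk_gt0 : 0 < gpk. Proof. by rewrite normal_peak_gt0. Qed.

Lemma gsE x : gs x = gpk * gex x.
Proof.
rewrite /gs normal_pdfE//; congr (_ * expR _).
by rewrite subr0 expr1n mulNr.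
Qed.

Lemma gs_gt0 x : 0 < gs x.
Proof. by rewrite gsE mulr_gt0 ?gpk_gt0 ?gex_gt0. Qed.

Lemma gs_continuous : continuous gs.
Proof. exact: continuous_normal_pdf. Qed.

Lemma der_gs x : is_derive x 1 gs (- x * gs x).
Proof.
have E : gs = (fun y => gpk * gex y) by apply/funext => y; rewrite gsE.
by rewrite E; apply: der_eq (derZ gpk (der_gex x)); ring.
Qed.

Lemma L1_gex4 : L1 mu (fun x => expR (- (x ^+ 2 / 4))).
Proof.
have s0 : Num.sqrt 2 != 0 :> R by rewrite gt_eqF// sqrtr_gt0.
have h : L1 mu (normal_pdf 0 (Num.sqrt 2)) by exact: integrable_normal_pdf.
apply: eq_L1 (L1Z (normal_peak (Num.sqrt 2))^-1 h) => x.
rewrite normal_pdfE// mulrA mulVf ?mul1r ?gt_eqF ?normal_peak_gt0//.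
by rewrite /normal_fun subr0 sqr_sqrtr// mulNr -mulr_natl -natrM.
Qed.

Definition pg f := measurable_fun setT f /\
  exists C m, 0 <= C /\ forall x, `|f x| <= C * bas x ^+ m.

Lemma pg_meas f : pg f -> measurable_fun setT f. Proof. by case. Qed.

Lemma pg_bounded f C : measurable_fun setT f -> (forall x, `|f x| <= C) -> pg f.
Proof.
move=> mf h; split=> //; exists C, 0%N; split; first exact: le_trans (normr_ge0 _) (h 0).
by move=> x; rewrite mulr1.
Qed.

Lemma pg_cst c : pg (fun=> c).
Proof. by apply: (@pg_bounded _ `|c|). Qed.

Lemma pg_id : pg (fun x => x).
Proof.
split; first exact: measurable_id.
by exists 1, 1%N; split=> // x; rewrite mul1r expr1 lerDr.
Qed.

Lemma pgM f g : pg f -> pg g -> pg (fun x => f x * g x).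
Proof.
move=> [mf [C [m [C0 hf]]]] [mg [K [n [K0 hg]]]]; split; first exact: measurable_funM.
exists (C * K), (m + n)%N; split; first exact: mulr_ge0.
by move=> x; rewrite normrM exprD mulrACA ler_pM.
Qed.

Lemma pgZ k f : pg f -> pg (fun x => k * f x).
Proof. by move=> hf; apply: pgM => //; exact: pg_cst. Qed.

Lemma pgD f g : pg f -> pg g -> pg (fun x => f x + g x).
Proof.
move=> [mf [C [m [C0 hf]]]] [mg [K [n [K0 hg]]]]; split; first exact: measurable_funD.
exists (C + K), (m + n)%N; split; first exact: addr_ge0.
move=> x; rewrite (le_trans (ler_normD _ _))// mulrDl; apply: lerD.
  by apply: (le_trans (hf x)); rewrite ler_wpM2l// ler_weXn2l ?bas_ge1// leq_addr.
by apply: (le_trans (hg x)); rewrite ler_wpM2l// ler_weXn2l ?bas_ge1// leq_addl.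
Qed.

Lemma pgN f : pg f -> pg (fun x => - f x).
Proof. by move=> /(pgZ (-1)); under eq_fun do rewrite mulN1r. Qed.

Lemma pgB f g : pg f -> pg g -> pg (fun x => f x - g x).
Proof. by move=> hf hg; apply: pgD => //; exact: pgN. Qed.

Lemma pgX f n : pg f -> pg (fun x => f x ^+ n).
Proof.
move=> hf; elim: n => [|n IH]; first by under eq_fun do rewrite expr0; exact: pg_cst.
by under eq_fun do rewrite exprS; exact: pgM.
Qed.

Lemma pg_abs f : pg f -> pg (fun x => `|f x|).
Proof.
move=> [mf [C [m [C0 hf]]]]; split; first exact: measurableT_comp.
by exists C, m; split=> // x; rewrite normr_id.
Qed.

Lemma L1_pg f : pg f -> L1 mu (fun x => f x * gs x).
Proof.
move=> [mf [C [m [C0 hf]]]].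
apply: (L1_le _ _ (L1Z (C * gpk * Kpow m) L1_gex4)).
- by apply: measurable_funM => //; exact: measurable_normal_pdf.
- move=> x; rewrite normrM (gtr0_norm (gs_gt0 x)) gsE.
  have := ler_wpM2r (ltW (gex_gt0 x)) (hf x) => h.
  have := ler_wpM2l C0 (pow_decay m x); rewrite mulrA => h'.
  have := ler_wpM2l (ltW gpk_gt0) (le_trans h h'); lra.
Qed.

Lemma pg_decay f : pg f -> exists K, forall x, bas x * `|f x| * gex x <= K.
Proof.
move=> [mf [C [m [C0 hf]]]]; exists (C * Kpow m.+1) => x.
have h1 := ler_wpM2l C0 (pow_decay1 m x).
have h2 := ler_wpM2r (ltW (gex_gt0 x)) (hf x).
rewrite -mulrA in h2.
have := ler_wpM2l (ltW (bas_gt0 x)) (le_trans h2 h1); rewrite mulrA => /le_trans; apply.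
by rewrite le_eqVlt; apply/orP; left; apply/eqP; field; rewrite gt_eqF ?bas_gt0.
Qed.

Definition NN f := Ex mu (fun x => f x * gs x).

Lemma eq_NN f g : f =1 g -> NN f = NN g.
Proof. by move=> fg; apply: eq_Ex => x; rewrite fg. Qed.

Lemma NND f g : pg f -> pg g -> NN (fun x => f x + g x) = NN f + NN g.
Proof.
move=> hf hg; rewrite -ExD; try exact: L1_pg.
by apply: eq_Ex => x; rewrite mulrDl.
Qed.

Lemma NNZ k f : pg f -> NN (fun x => k * f x) = k * NN f.
Proof.
move=> hf; rewrite -ExZ; last exact: L1_pg.
by apply: eq_Ex => x; rewrite mulrA.
Qed.

Lemma NNB f g : pg f -> pg g -> NN (fun x => f x - g x) = NN f - NN g.
Proof.
move=> hf hg; rewrite -ExB; try exact: L1_pg.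
by apply: eq_Ex => x; rewrite mulrBl.
Qed.

Lemma NN_cst c : NN (fun=> c) = c.
Proof.
rewrite /NN ExZ; last exact: integrable_normal_pdf.
by rewrite /Ex /Rintegral integral_normal_pdf mulr1.
Qed.

Lemma NN_le f g : pg f -> pg g -> (forall x, f x <= g x) -> NN f <= NN g.
Proof.
move=> hf hg fg; apply: Ex_le; [exact: L1_pg|exact: L1_pg|].
by move=> x; rewrite ler_wpM2r// ltW// gs_gt0.
Qed.

Lemma NN_abs_le f g : pg f -> pg g -> (forall x, `|f x| <= g x) -> `|NN f| <= NN g.
Proof.
move=> hf hg fg; apply: Ex_abs_le; [exact: L1_pg|exact: L1_pg|].
by move=> x; rewrite normrM (gtr0_norm (gs_gt0 x)) ler_wpM2r// ltW// gs_gt0.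
Qed.

Lemma pg_wL1 f : pg f -> L1 mu (fun t => bas t * `|f t * gs t|).
Proof.
move=> hf; have := L1_pg (pgM (pgD (pg_cst 1) (pg_abs pg_id)) (pg_abs hf)).
by apply: eq_L1 => t; rewrite normrM (gtr0_norm (gs_gt0 t)) mulrA.
Qed.

(** The product [f * gs] has derivative [(df - x * f) * gs] and vanishes at both ends. *)
Lemma gauss_ibp f df : (forall x, is_derive x 1 f (df x)) -> continuous df ->
  pg f -> pg df -> NN (fun x => x * f x) = NN df.
Proof.
move=> hf cdf pf pdf.
have pxf := pgM pg_id pf.
apply/eqP; rewrite eq_sym -subr_eq0 -NNB//; apply/eqP.
have [K hK] := pg_decay pf.
have pd := pgB pdf pxf.
apply: (@integral_derivative (fun x => f x * gs x) _ (gpk * K)).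
- exact: L1_pg.
- exact: pg_wL1.
- move=> x; apply: cvgM; last exact: gs_continuous.
  apply: cvgB; first exact: cdf.
  by apply: cvgM; [exact: cvg_id|apply: (der_continuous (hf x))].
- by move=> x; apply: der_eq (derM (hf x) (der_gs x)); ring.
- move=> x; have := ler_wpM2l (ltW gpk_gt0) (hK x).
  by rewrite normrM (gtr0_norm (gs_gt0 x)) gsE; lra.
Qed.

(** The classical solution: a primitive of the centered right-hand side times the density, divided
    by the density. Because of the centering, the integral up to [x] is minus the integral beyond
    [x], so each half-line can use its own tail. *)
Lemma stein_base h : continuous h -> pg h ->
  exists f, (forall x, is_derive x 1 f (x * f x + (h x - NN h))) /\
    exists K, forall x, bas x * `|f x| * gex x <= K.
Proof.
move=> ch ph; pose v x := (h x - NN h) * gs x.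
have pv : pg (fun x => h x - NN h) by apply: pgB => //; exact: pg_cst.
have hv : L1 mu v by exact: L1_pg.
have hw : L1 mu (fun t => bas t * `|v t|) by exact: pg_wL1.
have cv : continuous v.
  move=> x; apply: cvgM; last exact: gs_continuous.
  by apply: cvgB; [exact: ch|exact: cvg_cst].
have v0 : Ex mu v = 0.
  by have := NNB ph (pg_cst (NN h)); rewrite NN_cst subrr.
exists (fun x => lint v x / gs x); split.
  move=> x; have g0 : gs x != 0 by rewrite gt_eqF// gs_gt0.
  apply: der_eq (derM (der_lint x hv cv) (derV g0 (der_gs x))).
  by rewrite /v; field.
exists (Ex mu (fun t => bas t * `|v t|) / gpk) => x.
have -> : bas x * `|lint v x / gs x| * gex x = bas x * `|lint v x| / gpk.
  rewrite normrM normfV (gtr0_norm (gs_gt0 x)) gsE; field.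
  by rewrite !gt_eqF ?gpk_gt0 ?gex_gt0.
rewrite ler_wpM2r ?invr_ge0 ?(ltW gpk_gt0)//.
case: (leP x 0) => x0; first exact: lint_left.
by have := lint_right hv hw (ltW x0); rewrite v0 sub0r normrN.
Qed.

End gaussian_integral.
Section primitive.
Context {R : realType}.
Local Notation mu := (@lebesgue_measure R).

Lemma near_dist (x r : R) (Q : R -> Prop) : 0 < r -> (forall y, `|y - x| < r -> Q y) ->
  \forall y \near x, Q y.
Proof.
move=> r0 h; apply/nbhs_ballP; exists r => //= y; rewrite /ball /= distrC; exact: h.
Qed.

(** The signed integral from 0. Near a given point it differs by a constant from an integral with a
    fixed lower end further left, to which the fundamental theorem applies. *)
Lemma primitive (h : R -> R) : continuous h -> exists H : R -> R, forall x : R, is_derive x 1 H (h x).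
Proof.
move=> ch.
pose I a x := \int[mu]_(t in `[a, x]) h t.
have hI a b : mu.-integrable `[a, b] (EFin \o h).
  by apply: continuous_compact_integrable; [exact: segment_compact|exact: continuous_subspaceT].
have split (a b c : R) : a <= b <= c -> I a c = I a b + I b c.
  move=> /andP[ab bc]; have := @Rintegral_itvB R h (BLeft a) (BRight c) b (hI a c).
  rewrite !bnd_simp => /(_ ab bc); rewrite -/(I a c) -/(I a b) => E.
  have -> : I b c = \int[mu]_(t in `]b, c]) h t.
    rewrite /I -(@Rintegral_itv_obnd_cbnd _ b (BRight c))//.
    by apply: integrableS (hI b c) => //; apply: subset_itv; rewrite bnd_simp.
  by rewrite -E addrC subrK.
pose H x := if 0 <= x then I 0 x else - I x 0.
have HI a x : a <= 0 -> a <= x -> H x = I a x - I a 0.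
  move=> a0 ax; rewrite /H; case: leP => x0.
    by rewrite (split a 0 x) ?a0//; ring.
  by rewrite (split a x 0) ?ax ?(ltW x0)//; ring.
exists H => x; pose a := Num.min x 0 - 1.
have ax : a < x by rewrite /a ltrBlDr ltr_pwDr// ge_min lexx.
have a0 : a <= 0 by rewrite /a lerBlDr ler_wpDr// ge_min lexx orbT.
have xx : x < x + 1 by rewrite ltrDl.
have [h1 h2] := @continuous_FTC1_closed R h a x (x + 1) xx (hI a (x + 1)) ax (ch x).
have d1 : is_derive x 1 (I a) (h x) by rewrite -h2 derive1E; apply: DeriveDef.
have d2 : is_derive x 1 (fun y => I a y - I a 0) (h x).
  by apply: der_eq (derB d1 (der_cst (I a 0) x)); rewrite subr0.
apply: near_eq_is_derive d2; apply: (@near_dist _ (x - a)); first by rewrite subr_gt0.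
move=> y; rewrite ltr_norml => /andP[h3 _]; rewrite (HI a y)// ltW//; lra.
Qed.

End primitive.

Section stein_chain.
Context {R : realType}.
Implicit Types (f h : nat -> R -> R) (x y C K w : R) (m n k p : nat).
Local Notation bas x := (1 + `|x|) (only parsing).

Lemma osc_bounded_derivative (G dG : R -> R) (a b : R) : (forall x, is_derive x 1 G (dG x)) ->
  (forall x, `|G x| <= a) -> (forall x, `|dG x| <= b) -> osc (2 * a + b) G.
Proof.
move=> hG ha hb x y.
have a0 : 0 <= a by exact: le_trans (ha 0).
have b0 : 0 <= b by exact: le_trans (hb 0).
split.
  by have := ler_normB (G x) (G y); have := ha x; have := ha y; lra.
have := @MVT_bound R G dG y x b hG (fun z _ => hb z).
move=> /le_trans; apply; rewrite ler_wpM2r// lerDr mulr_ge0//.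
Qed.

(** Descending induction from the bounded top derivative. Vanishing at 0 removes the constants of
    integration, so that the bound does not depend on [h]. *)
Lemma chain_flat_growth h p : chain h p -> (forall x, `|h p x| <= 1) ->
  (forall k, (k < p)%N -> h k 0 = 0) ->
  forall k, (k <= p)%N -> forall x, `|h k x| <= bas x ^+ (p - k).
Proof.
move=> ch h1 h0 k kp; rewrite -{1}(subKn kp); have : (p - k <= p)%N by rewrite leq_subr.
elim: (p - k)%N => [|n IH] np x; first by rewrite subn0 expr0 h1.
have e : (p - n = (p - n.+1).+1)%N by lia.
have lt : (p - n.+1 < p)%N by lia.
have := @MVT_bound R (h (p - n.+1)%N) (h (p - n)%N) 0 x (bas x ^+ n).
rewrite h0// !subr0 => H; rewrite exprSr.
apply: le_trans (H _ _) _.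
- by move=> z; rewrite e; exact: ch.
- move=> z hz; apply: le_trans (IH (ltnW np) z) _.
  rewrite lerXn2r ?nnegrE ?(ltW (bas_gt0 _))// lerD2l.
  move: hz => /andP[z1 z2]; have [y0|y0] := leP 0 x.
    move: z1 z2; rewrite (min_idPl y0) (max_idPr y0) => z1 z2.
    by rewrite !ger0_norm// (le_trans z1).
  move: z1 z2; rewrite (min_idPr (ltW y0)) (max_idPl (ltW y0)) => z1 z2.
  by rewrite !ler0_norm ?(ltW y0)// lerN2.
by rewrite ler_wpM2l ?exprn_ge0 ?(ltW (bas_gt0 _))// lerDr.
Qed.

Lemma growth_decay (f : R -> R) C m : 0 <= C -> (forall x, `|f x| <= C * bas x ^+ m) ->
  exists K, forall x, bas x * `|f x| * gex x <= K.
Proof.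
move=> C0 hf; exists (C * Kpow m.+1) => x.
have h1 := ler_wpM2l C0 (pow_decay1 m x).
have h2 := ler_wpM2r (ltW (gex_gt0 x)) (hf x).
rewrite -mulrA in h2.
have := ler_wpM2l (ltW (bas_gt0 x)) (le_trans h2 h1); rewrite mulrA => /le_trans; apply.
by rewrite le_eqVlt; apply/orP; left; apply/eqP; field; rewrite gt_eqF ?bas_gt0.
Qed.

(** Differentiating f' = x f + h - c exactly k times gives f_(k+1) = x f_k + k f_(k-1) + h_k: every
    derivative satisfies Stein's equation with a new right-hand side, which is this function. *)
Definition stein_rem (c : R) h f k x : R :=
  if k is k'.+1 then k%:R * f k' x + h k x else h 0%N x - c.

Fixpoint stein_f (f0 : R -> R) (c : R) h k x : R :=
  if k is k'.+1 then
    x * stein_f f0 c h k' x +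
    (if k' is k''.+1 then k'%:R * stein_f f0 c h k'' x + h k' x else h 0%N x - c)
  else f0 x.

Lemma stein_fS (f0 : R -> R) c h k x : stein_f f0 c h k.+1 x =
  x * stein_f f0 c h k x + stein_rem c h (stein_f f0 c h) k x.
Proof. by case: k. Qed.

Fixpoint stein_const p k : R :=
  if k is k'.+1 then k%:R * (stein_const p k' * Kgrow (p - k')) + 1
  else 1 + NN (fun x => bas x ^+ p).

Lemma stein_const_ge0 p k : 0 <= stein_const p k.
Proof.
elim: k => [|k IH] /=.
  rewrite addr_ge0//; apply: Ex_ge0 => x.
  by rewrite mulr_ge0 ?exprn_ge0 ?(ltW (bas_gt0 _)) ?(ltW (gs_gt0 _)).
by rewrite addr_ge0// !mulr_ge0 ?Kgrow_ge0.
Qed.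

Definition stein_w p : R := 2 * (stein_const p p * Kgrow 0) + (stein_const p p * Kgrow 0 + stein_const p p).

Lemma stein_w_ge0 p : 0 <= stein_w p.
Proof. by rewrite /stein_w !(addr_ge0, mulr_ge0) ?Kgrow_ge0 ?stein_const_ge0. Qed.

Lemma pg_bas p : pg (fun x : R => bas x ^+ p).
Proof. by apply: pgX; apply: pgD; [exact: pg_cst|apply: pg_abs; exact: pg_id]. Qed.

(** [growth] gains a factor [1 + |x|] over the right-hand side, so the degree of the right-hand side
    for the [k]-th derivative is [p - k]. It is 0 for [k = p], and the derivatives of orders [p] and
    [p + 1] are both bounded: the solution has one bounded derivative more than [h]. *)
Lemma stein_chain p h : (0 < p)%N -> chain h p -> (forall x, `|h p x| <= 1) ->
  (forall k, (k < p)%N -> h k 0 = 0) ->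
  exists f, [/\ chain f p.+1, osc (stein_w p) (f p),
    (forall x, `|f p x| <= stein_w p), (forall x, `|f p.+1 x| <= stein_w p) &
    forall x, h 0%N x - NN (h 0%N) = f 1%N x - x * f 0%N x].
Proof.
move=> p0 ch h1 h0.
have hg := chain_flat_growth ch h1 h0.
have ch0 : continuous (h 0%N) by exact: chain_continuous ch p0.
have ph0 : pg (h 0%N).
  by split; [exact: continuous_meas|exists 1, p; split=> // x; have := hg 0%N isT x; rewrite subn0 mul1r].
have [f0 [df0 df0K]] := stein_base ch0 ph0.
set c := NN (h 0%N) in df0.
have cM : `|c| <= NN (fun x => bas x ^+ p).
  by apply: NN_abs_le => //; [exact: pg_bas|move=> x; have := hg 0%N isT x; rewrite subn0].
pose f := stein_f f0 c h.
have df k : (k <= p)%N -> forall x, is_derive x 1 (f k) (f k.+1 x).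
  elim/ltn_ind: k => -[_|k IH] kp x; first exact: df0.
  have E : f k.+1 = (fun x => x * f k x + stein_rem c h f k x).
    by apply/funext => z; exact: stein_fS.
  have dr : is_derive x 1 (stein_rem c h f k) (k%:R * f k x + h k.+1 x).
    case: k kp {E} IH => [|k] kp IH /=.
      have := derB (ch 0%N kp x) (der_cst c x); apply: der_eq; ring.
    by apply: derD; [apply: derZ; apply: IH => //; exact: ltnW (ltnW kp)|exact: ch].
  rewrite [X in is_derive _ _ X]E.
  apply: der_eq (derD (derM (der_id x) (IH k (ltnSn k) (ltnW kp) x)) dr).
  have -> : f k.+2 x = x * f k.+1 x + (k.+1%:R * f k x + h k.+1 x) by rewrite /f stein_fS.
  by rewrite -natr1; ring.
have bnd k : (k <= p)%N -> [/\ (forall x, `|stein_rem c h f k x| <= stein_const p k * bas x ^+ (p - k)),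
    (exists K, forall x, bas x * `|f k x| * gex x <= K) &
    forall x, bas x * `|f k x| <= stein_const p k * Kgrow (p - k) * bas x ^+ (p - k)].
  elim: k => [|k IH] kp.
    have r0 x : `|stein_rem c h f 0 x| <= stein_const p 0 * bas x ^+ (p - 0).
      rewrite /= subn0 mulrDl mul1r (le_trans (ler_normB _ _))// lerD//.
        by have := hg 0%N isT x; rewrite subn0.
      apply: (le_trans cM); rewrite ler_peMr ?exprn_ege1 ?bas_ge1//.
      exact: le_trans (normr_ge0 _) cM.
    split=> //; have [K hK] := df0K.
    by apply: (growth (stein_const_ge0 p 0) df0 r0 hK).
  have [r1 _ g1] := IH (ltnW kp).
  have e : (p - k = (p - k.+1).+1)%N by lia.
  have fk x : `|f k x| <= stein_const p k * Kgrow (p - k) * bas x ^+ (p - k.+1).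
    by have := g1 x; rewrite {2}e exprS mulrCA ler_pM2l// bas_gt0.
  have r2 x : `|stein_rem c h f k.+1 x| <= stein_const p k.+1 * bas x ^+ (p - k.+1).
    rewrite /stein_rem [stein_const p k.+1]/= mulrDl mul1r (le_trans (ler_normD _ _))// lerD ?hg//.
    by rewrite normrM ger0_norm// -mulrA ler_wpM2l.
  have d2 : exists K, forall x, bas x * `|f k.+1 x| * gex x <= K.
    apply: (@growth_decay _ (stein_const p k * Kgrow (p - k) + stein_const p k) (p - k)).
      by rewrite addr_ge0 ?mulr_ge0 ?Kgrow_ge0 ?stein_const_ge0.
    move=> x; rewrite /f stein_fS -/f mulrDl (le_trans (ler_normD _ _))// lerD//.
    rewrite normrM; apply: le_trans (g1 x).
    by rewrite ler_wpM2r// lerDr.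
  split=> //; have [K hK] := d2.
  apply: (growth (stein_const_ge0 p k.+1) _ r2 hK) => x.
  by apply: der_eq (df _ kp x); exact: stein_fS.
have [r1 _ g1] := bnd p (leqnn p).
have a1 x : bas x * `|f p x| <= stein_const p p * Kgrow 0.
  by have := g1 x; rewrite subnn expr0 mulr1.
have a2 x : `|f p x| <= stein_const p p * Kgrow 0.
  by apply: le_trans (a1 x); rewrite ler_peMl// bas_ge1.
have a3 x : `|f p.+1 x| <= stein_const p p * Kgrow 0 + stein_const p p.
  rewrite /f stein_fS -/f (le_trans (ler_normD _ _))// lerD//.
    by rewrite normrM (le_trans _ (a1 x))// ler_wpM2r// lerDr.
  by have := r1 x; rewrite subnn expr0 mulr1.
have C0 := mulr_ge0 (stein_const_ge0 p p) (Kgrow_ge0 (R := R) 0).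
have D0 := stein_const_ge0 p p.
exists f; split.
- by move=> k kp; apply: df.
- by apply: osc_bounded_derivative a2 a3; exact: df.
- by move=> x; apply: (le_trans (a2 x)); rewrite /stein_w; lra.
- by move=> x; apply: (le_trans (a3 x)); rewrite /stein_w; lra.
- by move=> x; rewrite /f stein_fS /= addrAC subrr add0r.
Qed.

End stein_chain.

(** * Corrected normal law *)

Section hermite.
Context {R : realType}.
Implicit Types (f h : nat -> R -> R) (x y C K w : R) (m n k p q : nat).

(** The probabilists' Hermite polynomials, given by their three-term recursion. *)
Fixpoint hermite n x : R :=
  if n is n'.+1 then
    x * hermite n' x - (if n' is n''.+1 then n'%:R * hermite n'' x else 0)
  else 1.

Lemma hermite_rec n x : x * hermite n x = hermite n.+1 x + n%:R * hermite n.-1 x.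
Proof. by case: n => [|n] /=; [rewrite mul0r subr0 addr0|rewrite subrK]. Qed.

Lemma hermiteS n x : hermite n.+1 x = x * hermite n x - n%:R * hermite n.-1 x.
Proof. by rewrite hermite_rec addrK. Qed.

Lemma der_hermite n x : is_derive x 1 (hermite n) (n%:R * hermite n.-1 x).
Proof.
elim/ltn_ind: n x => -[_ x|n IH x]; first by rewrite mul0r; exact: der_cst.
have d1 := derM (der_id x) (IH n (ltnSn n) x).
case: n IH d1 => [|n] IH d1.
  by apply: der_eq (derB d1 (der_cst 0 x)) => /=; ring.
apply: der_eq (derB d1 (derZ n.+1%:R (IH n (leqW (ltnSn n)) x))).
rewrite -[n.+2.-1]/n.+1 -[n.+1.-1]/n (hermiteS n) -(natr1 n.+1) -(natr1 n); ring.
Qed.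

Lemma hermite_continuous n : continuous (hermite n).
Proof. by move=> x; apply: (der_continuous (der_hermite n x)). Qed.

Lemma pg_hermite n : pg (hermite n).
Proof.
elim/ltn_ind: n => -[_|n IH]; first exact: pg_cst.
apply: pgB; first by apply: pgM; [exact: pg_id|apply: IH].
by case: n IH => [|n] IH; [exact: pg_cst|apply: pgZ; apply: IH; exact: leqW].
Qed.

(** Integration by parts of [x * (hermite n x * u x)]; the derivative of [hermite n] cancels the
    second term of the three-term recursion. *)
Lemma NN_hermiteS n (u du : R -> R) : (forall x, is_derive x 1 u (du x)) ->
  continuous du -> pg u -> pg du ->
  NN (fun x => hermite n.+1 x * u x) = NN (fun x => hermite n x * du x).
Proof.
move=> hu cdu pu pdu.
have pH := pg_hermite.
pose dh x : R := n%:R * hermite n.-1 x.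
have pdh : pg dh by apply: pgZ.
have ib : NN (fun x => x * (hermite n x * u x)) = NN (fun x => dh x * u x + hermite n x * du x).
  apply: gauss_ibp.
  - by move=> x; exact: derM (der_hermite n x) (hu x).
  - have ch := hermite_continuous.
    move=> x; apply: cvgD; apply: cvgM; [|exact: der_continuous (hu x)|exact: ch|exact: cdu].
    by apply: cvgM; [exact: cvg_cst|exact: ch].
  - exact: pgM.
  - by apply: pgD; exact: pgM.
have e x : hermite n.+1 x * u x = x * (hermite n x * u x) - dh x * u x.
  by rewrite mulrA hermite_rec; rewrite /dh; ring.
rewrite (eq_NN e) NNB ?ib ?NND; first by ring.
- by apply: pgM.
- by apply: pgM.
- by apply: pgM; [exact: pg_id|apply: pgM].
- by apply: pgM.
Qed.

Lemma NN_hermite_chain f q n : chain f q -> (forall k, (k <= q)%N -> continuous (f k)) ->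
  (forall k, (k <= q)%N -> pg (f k)) -> forall k, (k <= q)%N ->
  NN (fun x => hermite (n + k) x * f 0%N x) = NN (fun x => hermite n x * f k x).
Proof.
move=> cf ctf pf k; elim: k n => [|k IH] n kq; first by rewrite addn0.
rewrite addnS -addSn (IH _ (ltnW kq)); apply: NN_hermiteS; [exact: cf|exact: ctf|exact: pf (ltnW kq)|exact: pf].
Qed.

Lemma NN_hermite0 n : (0 < n)%N -> NN (hermite n) = 0 :> R.
Proof.
case: n => // n _; have := @NN_hermiteS n (fun=> 1) (fun=> 0) (der_cst 1) _ (pg_cst 1) (pg_cst 0).
under eq_NN do rewrite mulr1; move=> -> //; last by move=> x; exact: cvg_cst.
by under eq_NN do rewrite mulr0; rewrite NN_cst.
Qed.

Definition hermite_max M : R := \sum_(i < M.+1) NN (fun x => `|hermite i x|).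

Lemma hermite_le_max M n : (n <= M)%N -> NN (fun x => `|hermite n x|) <= hermite_max M.
Proof.
move=> nM; rewrite /hermite_max (bigD1 (Ordinal (n := M.+1) (m := n) nM)) //= lerDl.
apply: sumr_ge0 => i _; apply: Ex_ge0 => x.
by rewrite mulr_ge0 ?(ltW (gs_gt0 _)).
Qed.

Lemma hermite_max_ge0 M : 0 <= hermite_max M.
Proof.
apply: sumr_ge0 => i _; apply: Ex_ge0 => x.
by rewrite mulr_ge0 ?(ltW (gs_gt0 _)).
Qed.

End hermite.

(** * Coefficients of the correction and its approximate Stein identity *)

Section correction.
Context {R : realType}.
Variables (p M : nat) (beta : nat -> R) (eps B : R).
Hypotheses (eps0 : 0 <= eps) (eps1 : eps <= 1) (B1 : 1 <= B) (M3 : (3 * p <= M)%N).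
Hypothesis beta_le : forall j, (2 <= j <= p)%N -> `|beta j| <= B * eps ^+ (3 * j.-1).
Hypotheses (beta0 : beta 0%N = 0) (beta1 : beta 1%N = 1).

(** Course-of-values recursion: the value at [n] calls on many earlier values, so the whole table up
    to [n] is carried and [corr] reads its diagonal. *)
Fixpoint corr_upto n : nat -> R :=
  if n is n'.+1 then fun m => if m == n then
      (\sum_(j < p.+1 | (2 <= j <= n')%N) beta j * corr_upto n' (n' - j)%N) / n%:R
    else corr_upto n' m
  else fun m => (m == 0%N)%:R.

(* Coefficients of the formal density [sum_m corr m * hermite m] of the corrected normal law; the
   recursion is the one that makes the correction satisfy the Stein expansion. *)
Definition corr m := corr_upto m m.

Lemma corr_uptoE n m : (m <= n)%N -> corr_upto n m = corr m.
Proof.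
elim: n => [|n IH]; first by rewrite leqn0 => /eqP ->.
rewrite leq_eqVlt ltnS => /predU1P[->//|mn] /=.
by rewrite ltn_eqF ?ltnS// IH.
Qed.

Lemma corr0 : corr 0 = 1. Proof. by []. Qed.

Lemma corrS n : n.+1%:R * corr n.+1 =
  \sum_(j < p.+1 | (2 <= j <= n)%N) beta j * corr (n - j)%N.
Proof.
rewrite {1}/corr /= eqxx mulrCA divff ?mulr1 ?pnatr_eq0//.
by apply: eq_bigr => j _; rewrite corr_uptoE// leq_subr.
Qed.

Lemma corr1 : corr 1 = 0.
Proof.
have := corrS 0; rewrite mul1r => ->; rewrite big_pred0// => j.
by apply/negP => /andP[/leq_trans h /h].
Qed.

Lemma corr2 : corr 2 = 0.
Proof.
have : 2 * corr 2 = 0.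
  rewrite corrS big_pred0// => j.
  by apply/negP => /andP[/leq_trans h /h].
by move/eqP; rewrite mulf_eq0 pnatr_eq0 /= => /eqP.
Qed.

Definition corr_const : R := p.+1%:R * B.

Lemma corr_const_ge1 : 1 <= corr_const.
Proof. by rewrite /corr_const -[leLHS]mulr1 ler_pM// ler1n. Qed.

(** The rate is [eps ^+ 3]. The step from the index [n - j] to [n + 1] asks for [j + 1] further
    powers of [eps], and [beta j] supplies [3 * (j - 1)], which is enough from [j = 2] on. *)
Lemma corr_le m : `|corr m| <= corr_const ^+ m * eps ^+ m.
Proof.
have Q1 := corr_const_ge1; have Q0 := le_trans ler01 Q1.
elim/ltn_ind: m => -[_|n IH]; first by rewrite corr0 normr1 mulr1.
apply: (@le_trans _ _ `|n.+1%:R * corr n.+1|).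
  by rewrite normrM ler_peMl// ger0_norm// ler1n.
rewrite corrS (le_trans (ler_norm_sum _ _ _))//.
apply: (@le_trans _ _ (\sum_(j < p.+1) B * (corr_const ^+ n * eps ^+ n.+1))).
  rewrite big_mkcond /=; apply: ler_sum => j _; case: ifP => [/andP[j2 jn]|_]; last first.
    by rewrite !mulr_ge0 ?exprn_ge0 ?(le_trans ler01 B1).
  have jp : (j <= p)%N by rewrite -ltnS.
  have /beta_le h1 : (2 <= j <= p)%N by rewrite j2.
  have h2 := IH (n - j)%N; rewrite ltnS leq_subr in h2; have {}h2 := h2 isT.
  rewrite normrM; apply: le_trans (ler_pM _ _ h1 h2) _ => //.
  rewrite -!mulrA ler_wpM2l ?(le_trans ler01 B1)//.
  rewrite mulrCA ler_pM ?mulr_ge0 ?exprn_ge0//.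
    by rewrite ler_weXn2l// leq_subr.
  by rewrite -exprD ler_wiXn2l//; lia.
rewrite sumr_const card_ord -mulr_natl mulrA -/corr_const mulrA -exprS//.
Qed.

Lemma corr_le_eps3 m : (0 < m <= M)%N -> `|corr m| <= corr_const ^+ M * eps ^+ 3.
Proof.
have Q1 := corr_const_ge1; have Q0 := le_trans ler01 Q1.
case: m => [|[|[|m]]]// mM.
- by rewrite corr1 normr0 mulr_ge0 ?exprn_ge0.
- by rewrite corr2 normr0 mulr_ge0 ?exprn_ge0.
apply: (le_trans (corr_le _)); rewrite ler_pM ?exprn_ge0//.
  by rewrite ler_weXn2l.
by rewrite ler_wiXn2l.
Qed.

(* With [c n = NN (hermite n * f)], the left-hand sum is the correction functional at [x * f x]. *)
Lemma corr_identity q (c : nat -> R) : (q <= p)%N -> (0 < q)%N ->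
  \sum_(m < M.+1) corr m * (c m.+1 + m%:R * c m.-1) -
  \sum_(j < q.+1) beta j * \sum_(m < M.+1) corr m * c (m + j)%N =
  \sum_(j < p.+1 | (2 <= j)%N) \sum_(m < M.+1)
    beta j * corr m * c (m + j)%N * ((m + j < M)%N%:R - (j <= q)%N%:R).
Proof.
move=> qp q0.
have e1 : \sum_(j < q.+1) beta j * \sum_(m < M.+1) corr m * c (m + j)%N =
   \sum_(m < M.+1) corr m * c m.+1 +
   \sum_(j < p.+1 | (2 <= j)%N) \sum_(m < M.+1) beta j * corr m * c (m + j)%N * (j <= q)%N%:R.
  have := big_ord_widen_cond p.+1 xpredT (fun j => beta j * \sum_(m < M.+1) corr m * c (m + j)%N) (_ : (q.+1 <= p.+1)%N).
  move=> -> //; rewrite (bigID (fun j : 'I_p.+1 => (2 <= j)%N)) /= addrC; congr (_ + _).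
    have lp : (1 < p.+1)%N by rewrite ltnS (leq_trans q0).
    rewrite (bigD1 (Ordinal lp)) /=; last by rewrite ltnS q0.
    rewrite beta1 mul1r [X in _ + X]big1 ?addr0.
      by apply: eq_bigr => m _; rewrite addn1.
    move=> i /andP[/andP[_]]; rewrite -ltnNge => i2 /eqP i1.
    have -> : i = 0%N :> nat.
      by move: i1 i2; case: i => -[|[|i]] //= hi i1 _; case: i1; apply: val_inj.
    by rewrite beta0 mul0r.
  rewrite [LHS]big_mkcond [RHS]big_mkcond /=; apply: eq_bigr => j _.
  rewrite andbC ltnS; case: (2 <= j)%N => //=; case: (j <= q)%N.
    by rewrite mulr_sumr; apply: eq_bigr => m _; rewrite mulr1 mulrA.
  by rewrite big1// => m _; rewrite mulr0.
(* The recursion of [corr] turns the lowering terms into a double sum, reindexed by [n = m + j]; the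
   range [n < M] becomes the truncation [m + j < M]. *)
have e2 : \sum_(m < M.+1) corr m * (m%:R * c m.-1) =
   \sum_(j < p.+1 | (2 <= j)%N) \sum_(m < M.+1) beta j * corr m * c (m + j)%N * (m + j < M)%N%:R.
  rewrite big_ord_recl /= mul0r mulr0 add0r.
  under eq_bigr => n _ do rewrite /= add0n mulrA (mulrC (corr _)) corrS mulr_suml.
  rewrite (exchange_big_dep (fun j : 'I_p.+1 => (2 <= j)%N)) /=; last by move=> i j _ /andP[].
  apply: eq_bigr => j j2.
  transitivity (\sum_(0 <= n < M | (j <= n)%N) beta j * corr (n - j)%N * c n).
    by rewrite big_mkord; apply: eq_bigl => i; rewrite j2.
  transitivity (\sum_(0 <= m < M.+1 | (m + j < M)%N) beta j * corr m * c (m + j)%N); last first.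
    rewrite big_mkord big_mkcond /=; apply: eq_bigr => m _.
    by case: ifP => _; rewrite ?mulr1 ?mulr0.
  case: (leqP j M) => jM; last first.
    rewrite big_nat_cond big_pred0; last by move=> i; apply/negP; lia.
    by rewrite big_nat_cond big_pred0// => i; apply/negP; lia.
  rewrite (big_cat_nat (n := j))//= big_nat_cond big_pred0 ?add0r; last by move=> i; apply/negP; lia.
  rewrite (big_cat_nat (n := (M - j)%N) (m := 0%N)); try lia.
  rewrite [X in _ = X + _](_ : _ = \sum_(0 <= m < M - j) beta j * corr m * c (m + j)%N); last first.
    by rewrite big_nat_cond [RHS]big_nat_cond; apply: eq_bigl => i; lia.
  rewrite [X in _ = _ + X]big_nat_cond [X in _ = _ + X]big_pred0 ?addr0; last by move=> i; apply/negP; lia.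
  rewrite -{1}(add0n j) big_addn; rewrite big_mkcond big_nat_cond [RHS]big_nat_cond.
  by apply: eq_bigr => i _; rewrite leq_addl addnK.
under eq_bigr do rewrite mulrDr.
rewrite big_split /= e1 e2 opprD addrACA subrr add0r -sumrB.
apply: eq_bigr => j _; rewrite -sumrB; apply: eq_bigr => m _.
by rewrite mulrBr.
Qed.

(** A term survives only if exactly one of [m + j < M] and [j <= q] holds. If [j > q], the factor
    [beta j] alone supplies the power [3 * q]; if [m + j >= M >= 3 * p], the factors [beta j] and
    [corr m] supply it together. In both cases [m + j >= q], so [K] bounds [c]. *)
Lemma corr_identity_le q (c : nat -> R) K : (q <= p)%N -> (0 < q)%N -> 0 <= K ->
  (forall n, (q <= n <= M + p)%N -> `|c n| <= K) ->
  `|\sum_(m < M.+1) corr m * (c m.+1 + m%:R * c m.-1) -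
    \sum_(j < q.+1) beta j * \sum_(m < M.+1) corr m * c (m + j)%N| <=
  p.+1%:R * (M.+1%:R * (B * corr_const ^+ M * K * eps ^+ (3 * q))).
Proof.
move=> qp q0 K0 hc; rewrite corr_identity//.
have Q1 := corr_const_ge1; have Q0 := le_trans ler01 Q1.
have B0 := le_trans ler01 B1.
set T := B * _ * _ * _.
have T0 : 0 <= T by rewrite !mulr_ge0 ?exprn_ge0.
rewrite (le_trans (ler_norm_sum _ _ _))//.
apply: (@le_trans _ _ (\sum_(j < p.+1) M.+1%:R * T)); last first.
  by rewrite sumr_const card_ord !mulr_natl.
rewrite big_mkcond /=; apply: ler_sum => j _; case: ifP => [j2|_]; last by rewrite mulr_ge0.
rewrite (le_trans (ler_norm_sum _ _ _))//.
apply: (@le_trans _ _ (\sum_(m < M.+1) T)); last by rewrite sumr_const card_ord mulr_natl lexx.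
apply: ler_sum => m _.
have jp : (j <= p)%N by rewrite -ltnS.
have mM : (m <= M)%N by rewrite -ltnS.
have main : (q <= m + j)%N -> (3 * q <= 3 * j.-1 + m)%N -> `|beta j * corr m * c (m + j)%N| <= T.
  move=> h1 h2; have hb := beta_le (j := j); rewrite j2 jp in hb; have {}hb := hb isT.
  have hcc : `|c (m + j)%N| <= K by apply: hc; rewrite h1 leq_add.
  rewrite !normrM; apply: le_trans (ler_pM _ _ (ler_pM _ _ hb (corr_le m)) hcc) _; rewrite ?mulr_ge0//.
  rewrite (_ : _ * _ * _ = B * K * (corr_const ^+ m * eps ^+ (3 * j.-1 + m))); last by rewrite exprD; ring.
  rewrite /T (_ : B * _ * _ * _ = B * K * (corr_const ^+ M * eps ^+ (3 * q))); last by ring.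
  by rewrite ler_wpM2l ?mulr_ge0// ler_pM ?exprn_ge0//; [rewrite ler_weXn2l|rewrite ler_wiXn2l].
rewrite normrM; case: (ltnP (m + j)%N M) => hm; case: (leqP j q) => hq.
- by rewrite subrr normr0 mulr0.
- by rewrite subr0 normr1 mulr1; apply: main; move: M3 qp q0 j2 mM jp hm hq; clear; lia.
- by rewrite sub0r normrN normr1 mulr1; apply: main; move: M3 qp q0 j2 mM jp hm hq; clear; lia.
- by rewrite subrr normr0 mulr0.
Qed.

Definition gcorr (f : R -> R) : R := \sum_(m < M.+1) corr m * NN (fun x => hermite m x * f x).

Lemma pg_hermiteM m (f : R -> R) : pg f -> pg (fun x => hermite m x * f x).
Proof. by move=> pf; apply: pgM => //; exact: pg_hermite. Qed.

Lemma gcorrD f g : pg f -> pg g -> gcorr (fun x => f x + g x) = gcorr f + gcorr g.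
Proof.
move=> pf pg'; rewrite /gcorr -big_split; apply: eq_bigr => m _ /=.
by rewrite -mulrDr -NND; [congr (_ * _); apply: eq_NN => x; rewrite mulrDr|exact: pg_hermiteM|exact: pg_hermiteM].
Qed.

Lemma gcorrZ k f : pg f -> gcorr (fun x => k * f x) = k * gcorr f.
Proof.
move=> pf; rewrite /gcorr mulr_sumr; apply: eq_bigr => m _ /=.
rewrite mulrCA -(NNZ k (pg_hermiteM m pf)); congr (_ * _).
by apply: eq_NN => x; rewrite mulrCA.
Qed.

Lemma gcorr1 : gcorr (fun=> 1) = 1.
Proof.
rewrite /gcorr big_ord_recl big1 => [|i _].
  by rewrite corr0 mul1r addr0 /=; under eq_NN do rewrite mulr1; rewrite NN_cst.
by under eq_NN do rewrite mulr1; rewrite NN_hermite0// mulr0.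
Qed.

Definition gcorr_const : R :=
  p.+1%:R * (M.+1%:R * (B * corr_const ^+ M * hermite_max (M + p))).

(** Integration by parts expresses both sides through the single sequence of pairings of [f 0] with
    the Hermite polynomials. In the error all indices are at least [q], so [q] derivatives can be
    moved onto [f] and only the bound on [f q] enters. *)
Lemma gcorr_stein q f w : (0 < q <= p)%N -> chain f q ->
  (forall k, (k <= q)%N -> continuous (f k)) -> (forall k, (k <= q)%N -> pg (f k)) ->
  (forall x, `|f q x| <= w) ->
  `|gcorr (fun x => x * f 0%N x) - \sum_(j < q.+1) beta j * gcorr (f j)| <=
  gcorr_const * w * eps ^+ (3 * q).
Proof.
move=> /andP[q0 qp] cf ctf pf fw.
have w0 : 0 <= w by exact: le_trans (fw 0).
pose c n := NN (fun x => hermite n x * f 0%N x).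
have hc n : (q <= n <= M + p)%N -> `|c n| <= hermite_max (M + p) * w.
  move=> /andP[qn nM]; rewrite /c -(subnK qn) (NN_hermite_chain _ cf ctf pf (leqnn q)).
  apply: (@le_trans _ _ (NN (fun x => w * `|hermite (n - q) x|))).
    apply: NN_abs_le; first by apply: pg_hermiteM; exact: pf.
      by apply: pgZ; apply: pg_abs; exact: pg_hermite.
    by move=> x; rewrite normrM mulrC ler_wpM2r.
  rewrite NNZ; last by apply: pg_abs; exact: pg_hermite.
  by rewrite mulrC ler_wpM2r// hermite_le_max//; lia.
have := corr_identity_le qp q0 (mulr_ge0 (hermite_max_ge0 _) w0) hc.
rewrite [leRHS](_ : _ = gcorr_const * w * eps ^+ (3 * q)); last by rewrite /gcorr_const; ring.
congr (`| _ - _ | <= _).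
  apply: eq_bigr => m _; congr (_ * _).
  have pH n : pg (fun x => hermite n x * f 0%N x) by apply: pg_hermiteM; exact: pf.
  rewrite (eq_NN (g := fun x => hermite m.+1 x * f 0%N x + m%:R * (hermite m.-1 x * f 0%N x))).
    by rewrite NND ?NNZ//; exact: pgZ.
  by move=> x; rewrite mulrCA mulrA hermite_rec; ring.
apply: eq_bigr => j _; congr (_ * _); apply: eq_bigr => m _; congr (_ * _).
by apply: (NN_hermite_chain _ cf ctf pf); rewrite -ltnS.
Qed.

End correction.

(** * Polynomial test functions and growth degrees *)

Section monomials.
Context {R : realType}.
Implicit Types (x : R) (j k : nat).
Local Notation bas x := (1 + `|x|) (only parsing).

Definition mono j k x : R := (j ^_ k)%:R * x ^+ (j - k).

Lemma chain_mono j K : chain (mono j) K.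
Proof.
move=> k _ x; apply: der_eq (derZ _ (derX _ (der_id x))).
by rewrite /mono ffactnSr natrM mulr1 subnS mulrA.
Qed.

(** The top derivative is constant, so on these monomials the expansion holds with [w = 0], that is,
    exactly. *)
Lemma osc_mono j K : (j <= K)%N -> osc 0 (mono j K).
Proof.
move=> jK x y; have -> : mono j K x = mono j K y.
  by rewrite /mono (eqP (_ : (j - K)%N == 0%N)) // subn_eq0.
by rewrite subrr normr0 mul0r.
Qed.

Lemma mono_small j k : (j < k)%N -> mono j k = fun=> 0.
Proof. by move=> jk; apply/funext => x; rewrite /mono ffact_small// mul0r. Qed.

(** Unlike [pg], this keeps the degree: [W] has only [p + 1] moments at hand here, whereas the
    Gaussian law integrates every power. *)
Definition dg m (f : R -> R) := measurable_fun setT f /\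
  exists2 C, 0 <= C & forall x, `|f x| <= C * bas x ^+ m.

Lemma dg_pg m f : dg m f -> pg f.
Proof. by move=> [mf [C C0 h]]; split=> //; exists C, m. Qed.

Lemma dg_le m n f : (m <= n)%N -> dg m f -> dg n f.
Proof.
move=> mn [mf [C C0 h]]; split=> //; exists C => // x; apply: (le_trans (h x)).
by rewrite ler_wpM2l// ler_weXn2l// bas_ge1.
Qed.

Lemma dgD m f g : dg m f -> dg m g -> dg m (fun x => f x + g x).
Proof.
move=> [mf [C C0 hf]] [mg [K K0 hg]]; split; first exact: measurable_funD.
exists (C + K); first exact: addr_ge0.
by move=> x; rewrite (le_trans (ler_normD _ _))// mulrDl lerD.
Qed.

Lemma dgM m n f g : dg m f -> dg n g -> dg (m + n) (fun x => f x * g x).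
Proof.
move=> [mf [C C0 hf]] [mg [K K0 hg]]; split; first exact: measurable_funM.
exists (C * K); first exact: mulr_ge0.
by move=> x; rewrite normrM exprD mulrACA ler_pM.
Qed.

Lemma dg_cst c : dg 0 (fun=> c).
Proof. by split=> //; exists `|c| => // x; rewrite mulr1. Qed.

Lemma dgZ m (k : R) f : dg m f -> dg m (fun x => k * f x).
Proof. by move=> hf; rewrite -[m]add0n; apply: dgM => //; exact: dg_cst. Qed.

Lemma dgN m f : dg m f -> dg m (fun x => - f x).
Proof. by move=> /(dgZ (-1)); under eq_fun do rewrite mulN1r. Qed.

Lemma dgB m f g : dg m f -> dg m g -> dg m (fun x => f x - g x).
Proof. by move=> hf hg; apply: dgD => //; exact: dgN. Qed.

Lemma dg_id : dg 1 (fun x => x).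
Proof. by split; [exact: measurable_id|exists 1 => // x; rewrite mul1r expr1 lerDr]. Qed.

Lemma dgX m : dg m (fun x => x ^+ m).
Proof.
elim: m => [|m IH]; first by under eq_fun do rewrite expr0; exact: dg_cst.
by under eq_fun do rewrite exprS; rewrite -add1n; apply: dgM => //; exact: dg_id.
Qed.

Lemma dg_sum m (I : Type) (s : seq I) (F : I -> R -> R) : (forall i, dg m (F i)) ->
  dg m (fun x => \sum_(i <- s) F i x).
Proof.
move=> hF; elim: s => [|i s IH].
  by under eq_fun do rewrite big_nil; exact: dg_le (leq0n m) (dg_cst 0).
by under eq_fun do rewrite big_cons; exact: dgD.
Qed.

Lemma dg_mono j k : dg (j - k) (mono j k).
Proof. by apply: dgZ; exact: dgX. Qed.

Lemma chain_dg f K w : chain f K -> osc w (f K) -> forall k, (k <= K)%N -> dg (K - k) (f k).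
Proof.
move=> cf of' k kK; split; first by apply: continuous_meas; exact: chain_cont_le cf of' kK.
by have [C C0 hC] := chain_growth cf of'; exists C => // x; exact: hC.
Qed.

Lemma stein_w_gt0 p : 0 < stein_w p :> R.
Proof.
rewrite /stein_w ltr_pwDr// ?mulr_ge0 ?Kgrow_ge0 ?stein_const_ge0//.
rewrite ltr_pwDr ?mulr_ge0 ?Kgrow_ge0 ?stein_const_ge0//.
case: p => [|p] /=; [rewrite ltr_pwDl//|rewrite ltr_wpDl//].
  by apply: Ex_ge0 => x; rewrite mulr_ge0 ?exprn_ge0 ?(ltW (bas_gt0 _)) ?(ltW (gs_gt0 _)).
by apply: mulr_ge0 => //; rewrite mulr_ge0 ?Kgrow_ge0 ?stein_const_ge0.
Qed.

(** Subtracting the Taylor polynomial at 0 preserves the top derivative and makes the chain flat at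
    0, as [stein_chain] requires. *)
Lemma chain_split (h : nat -> R -> R) q : chain h q -> exists g : nat -> R -> R,
  [/\ chain g q, g q = h q, forall k, (k < q)%N -> g k 0 = 0 &
    forall x, h 0%N x = g 0%N x + \sum_(j < q) h j 0 / j`!%:R * x ^+ j].
Proof.
move=> ch.
pose T := fun k x => \sum_(j < q) h j 0 / j`!%:R * mono j k x.
have cT : chain T q.
  move=> k kq x; have := @is_derive_sum R R R q (fun (j : 'I_q) x => h j 0 / j`!%:R * mono j k x) x 1 (fun j : 'I_q => h j 0 / j`!%:R * mono j k.+1 x).
  rewrite (_ : \sum_(i < q) (fun x : R => h i 0 / i`!%:R * mono i k x) = T k); last by apply/funext => z; rewrite fct_sumE.
  by apply => j; apply: derZ; exact: (@chain_mono j k.+1 k (ltnSn k) x).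
exists (fun k x => h k x - T k x); split.
- by move=> k kq x; apply: derB; [exact: ch|exact: cT].
- by apply/funext => x; rewrite /T big1 ?subr0// => j _; rewrite mono_small ?mulr0.
- move=> k kq; apply/eqP; rewrite subr_eq0 /T (bigD1 (Ordinal kq))//= big1 ?addr0.
    rewrite /mono subnn ffactnn expr0 mulr1 divfK//.
  move=> j jk; rewrite /mono; case: (ltngtP j k) => [jk'|kj|/eqP jk'].
  + by rewrite ffact_small// mul0r mulr0.
  + by rewrite expr0n subn_eq0 leqNgt kj /= mulr0 mulr0.
  + by case/negP: jk; rewrite -val_eqE.
- move=> x; rewrite (_ : \sum_(j < q) _ = T 0%N x) ?subrK//.
  by apply: eq_bigr => j _; rewrite /mono ffactn0 subn0 mul1r.
Qed.

Lemma chain_dg1 (h : nat -> R -> R) q : (0 < q)%N -> chain h q -> (forall x, `|h q x| <= 1) -> dg q (h 0%N).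
Proof.
move=> q0 ch h1; have [g [cg gq g0 hE]] := chain_split ch.
have g1 x : `|g q x| <= 1 by rewrite gq.
rewrite (funext hE); apply: dgD.
  split; first by apply: continuous_meas; exact: chain_continuous cg q0.
  by exists 1 => // x; rewrite mul1r; have := chain_flat_growth cg g1 g0 (leq0n q) x; rewrite subn0.
rewrite (_ : (fun x => _) = (fun x => \sum_(j <- enum 'I_q) h j 0 / j`!%:R * x ^+ j)); last first.
  by apply/funext => x; rewrite big_enum.
by apply: dg_sum => j; apply: dg_le (ltnW (ltn_ord j)) _; apply: dgZ; exact: dgX.
Qed.

End monomials.

(** * Comparison of the law with the corrected normal law *)

Section corrected_clt.
Context d {Om : measurableType d} {R : realType}.
Variables (P : probability Om R) (W : Om -> R) (p M : nat) (b : nat -> nat -> R) (eps B : R).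
Hypotheses (mW : measurable_fun setT W) (momW : L1 P (fun o => `|W o| ^+ p.+1)).
Hypotheses (eps0 : 0 <= eps) (eps1 : eps <= 1) (B1 : 1 <= B) (M3 : (3 * p <= M)%N).
Hypotheses (EW0 : Ex P W = 0) (EW2 : Ex P (fun o => W o ^+ 2) = 1).
Hypothesis b_le : forall q k, (q <= p)%N -> (2 <= k <= q)%N -> `|b q k| <= B * eps ^+ (3 * k.-1).
Hypothesis expansion : forall q F w, (0 < q <= p)%N -> chain F q -> osc w (F q) ->
  `|Ex P (fun o => W o * F 0%N (W o)) - \sum_(k < q.+1) b q k * Ex P (fun o => F k (W o))| <=
  B * w * eps ^+ (3 * q).

Lemma L1W m f : (m <= p.+1)%N -> dg m f -> L1 P (fun o => f (W o)).
Proof.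
move=> mp /(dg_le mp) [mf [C C0 hf]].
apply: (L1_le _ _ (L1Z (C * 2 ^+ p.+1) (L1D (L1_cst P 1) momW))).
  by apply: measurableT_comp.
move=> o; apply: (le_trans (hf _)); rewrite -mulrA ler_wpM2l//.
case: (leP `|W o| 1) => h.
  apply: (@le_trans _ _ (2 ^+ p.+1)); first by rewrite lerXn2r ?nnegrE ?addr_ge0//; lra.
  by rewrite ler_peMr ?exprn_ge0// lerDl exprn_ge0.
apply: (@le_trans _ _ ((2 * `|W o|) ^+ p.+1)).
  by rewrite lerXn2r ?nnegrE ?addr_ge0 ?mulr_ge0//; lra.
by rewrite exprMn ler_wpM2l ?exprn_ge0// lerDr.
Qed.

Lemma moment_rec q m : (0 < q <= p)%N -> (m <= q)%N ->
  Ex P (fun o => W o * mono m 0 (W o)) = \sum_(k < q.+1) b q k * Ex P (fun o => mono m k (W o)).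
Proof.
move=> qp mq; apply/eqP; rewrite -subr_eq0 -normr_le0.
by have := expansion qp (@chain_mono R m q) (osc_mono mq); rewrite mulr0 mul0r.
Qed.

Lemma moment_rec' q m : (0 < q <= p)%N -> (m <= q)%N ->
  Ex P (fun o => W o * mono m 0 (W o)) =
  \sum_(k < m) b q k * Ex P (fun o => mono m k (W o)) + b q m * m`!%:R.
Proof.
move=> qp mq; rewrite (moment_rec qp mq) -(big_mkord xpredT (fun k => b q k * Ex P (fun o => mono m k (W o)))).
rewrite (big_cat_nat (n := m.+1))//= [X in _ + X]big_nat_cond [X in _ + X]big1 ?addr0; last first.
  move=> k /andP[/andP[mk _] _]; rewrite mono_small//.
  by rewrite (Ex_cst P 0) mulr0.
rewrite big_nat_recr//= big_mkord; congr (_ + _ * _).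
rewrite -[RHS](Ex_cst P); apply: eq_Ex => o.
by rewrite /mono subnn ffactnn expr0 mulr1.
Qed.

(** Testing on monomials yields a triangular system with diagonal entries [k!] and otherwise only
    moments of [W], so the law alone determines its solution. *)
Lemma b_unique q q' k : (0 < q <= p)%N -> (0 < q' <= p)%N -> (k <= q)%N -> (k <= q')%N -> b q k = b q' k.
Proof.
elim/ltn_ind: k => k IH hq hq' kq kq'.
have := moment_rec' hq kq; rewrite (moment_rec' hq' kq').
rewrite (eq_bigr (fun j : 'I_k => b q j * Ex P (fun o => mono k j (W o)))); last first.
  move=> j _; rewrite (IH j (ltn_ord j))//; exact: leq_trans (ltnW (ltn_ord j)) _.
move=> /addrI /(mulIf _) -> //; by rewrite pnatr_eq0 -lt0n fact_gt0.
Qed.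

Hypothesis p0 : (0 < p)%N.
Let beta := b p.

Lemma beta0E : beta 0%N = 0.
Proof.
have := @moment_rec' p 0; rewrite p0 leqnn => /(_ isT isT).
rewrite big_ord0 add0r fact0 mulr1 /beta => <-; rewrite -[RHS]EW0; apply: eq_Ex => o.
by rewrite /mono ffactn0 subnn expr0 !mulr1.
Qed.

Lemma beta1E : beta 1%N = 1.
Proof.
have := @moment_rec' p 1; rewrite p0 leqnn => /(_ isT isT).
rewrite big_ord1 -/beta beta0E mul0r add0r mulr1 => <-; rewrite -[RHS]EW2; apply: eq_Ex => o.
by rewrite /mono ffactn0 subn0 mul1r expr1 expr2.
Qed.

Lemma beta_le j : (2 <= j <= p)%N -> `|beta j| <= B * eps ^+ (3 * j.-1).
Proof. by apply: b_le. Qed.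

Local Notation G := (gcorr p M beta).

Definition defect (f : R -> R) : R := Ex P (fun o => f (W o)) - G f.

Lemma defectD m f g : (m <= p.+1)%N -> dg m f -> dg m g ->
  defect (fun x => f x + g x) = defect f + defect g.
Proof.
move=> mp df dg'; rewrite /defect gcorrD; [|exact: dg_pg df|exact: dg_pg dg'].
by rewrite ExD; [ring|exact: L1W df|exact: L1W dg'].
Qed.

Lemma defectZ m k f : (m <= p.+1)%N -> dg m f -> defect (fun x => k * f x) = k * defect f.
Proof.
move=> mp df; rewrite /defect gcorrZ; last exact: dg_pg df.
by rewrite ExZ; [ring|exact: L1W df].
Qed.

Lemma defectB m f g : (m <= p.+1)%N -> dg m f -> dg m g ->
  defect (fun x => f x - g x) = defect f - defect g.
Proof.
move=> mp df dg'; rewrite -mulN1r -(defectZ (-1) mp dg') -(defectD mp df); last exact: dgZ.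
by congr defect; apply/funext => x; rewrite mulN1r.
Qed.

Lemma defect_sum m n (F : nat -> R -> R) : (m <= p.+1)%N -> (forall i, dg m (F i)) ->
  defect (fun x => \sum_(i < n) F i x) = \sum_(i < n) defect (F i).
Proof.
move=> mp hF; elim: n => [|n IH].
  rewrite big_ord0; transitivity (defect (fun x => 0 * F 0%N x)); last by rewrite (defectZ 0 mp (hF 0%N)) mul0r.
  by congr defect; apply/funext => x; rewrite big_ord0 mul0r.
under [in LHS]eq_fun do rewrite big_ord_recr; rewrite (defectD mp)//; last exact: dg_sum.
by rewrite IH big_ord_recr.
Qed.

(** The moments of [W] and the corrected Gaussian moments obey the same recursion exactly, because
    on monomials both error bounds carry the factor 0. *)
Lemma defectX j : (j <= p)%N -> defect (fun x => x ^+ j) = 0.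
Proof.
elim/ltn_ind: j => -[_ _|j IH jp].
  rewrite /defect; under eq_Ex do rewrite expr0; rewrite Ex_cst.
  have -> : (fun x : R => x ^+ 0) = fun=> 1 by apply/funext => x; rewrite expr0.
  by rewrite gcorr1 subrr.
have qp : (0 < j.+1 <= p)%N by rewrite jp.
have h1 := moment_rec qp (leqnSn j).
have e : (fun x : R => x ^+ j.+1) = (fun x => x * mono j 0 x).
  by apply/funext => x; rewrite /mono ffactn0 subn0 mul1r exprS.
have h2 : G (fun x => x * mono j 0 x) = \sum_(k < j.+2) beta k * G (mono j k).
  apply/eqP; rewrite -subr_eq0 -normr_le0.
  have mc k : continuous (mono (R := R) j k).
    by move=> x; apply: (der_continuous (@chain_mono R j k.+1 k (ltnSn k) x)).
  have := @gcorr_stein R p M beta eps B eps0 eps1 B1 M3 beta_le beta0E beta1E j.+1 (mono j) 0 qp.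
  rewrite mulr0 mul0r; apply=> //; first exact: chain_mono.
    by move=> k _; apply: dg_pg (dg_mono j k).
  by move=> x; rewrite mono_small// normr0.
rewrite e /defect h1 h2 -sumrB big1// => k _.
rewrite (b_unique qp (q' := p)) ?p0 ?leqnn//; last 2 first.
- by rewrite -ltnS.
- by apply: leq_trans jp; rewrite -ltnS.
rewrite -mulrBr -[X in _ * X]/(defect (mono j k)) (defectZ (m := (j - k)%N))//; last 2 first.
- lia.
- exact: dgX.
by rewrite IH ?mulr0//; lia.
Qed.

Fixpoint defect_const q : R :=
  if q is q'.+1 then defect_const q' +
    stein_w q * (p%:R * B * defect_const q' + B + gcorr_const p M B)
  else 0.

Lemma gcorr_const_ge0 : 0 <= gcorr_const p M B :> R.
Proof.
have B0 := le_trans ler01 B1.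
by rewrite /gcorr_const !mulr_ge0 ?exprn_ge0 ?hermite_max_ge0 ?mulr_ge0.
Qed.

Lemma defect_const_ge0 q : 0 <= defect_const q.
Proof.
have B0 := le_trans ler01 B1; have G0 := gcorr_const_ge0.
elim: q => //= q IH; apply: addr_ge0 => //.
by apply: mulr_ge0; [exact: stein_w_ge0|do ?[by []|exact: ler0n|apply: addr_ge0|apply: mulr_ge0]].
Qed.

Lemma defect_const_mono q q' : (q <= q')%N -> defect_const q <= defect_const q'.
Proof.
have B0 := le_trans ler01 B1; have G0 := gcorr_const_ge0.
elim: q' => [|q' IH]; first by rewrite leqn0 => /eqP ->.
rewrite leq_eqVlt => /predU1P[->//|/IH h]; apply: le_trans h _ => /=; rewrite lerDl.
by apply: mulr_ge0; [exact: stein_w_ge0|do ?[by []|exact: ler0n|exact: defect_const_ge0|apply: addr_ge0|apply: mulr_ge0]].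
Qed.

(** The expansion of [W] and that of the corrected Gaussian mean are applied to one Stein solution.
    The term of [beta 1] cancels the derivative in Stein's equation and [beta 0] vanishes. What
    remains is [beta k] times the defect of the [k]-th derivative for [k >= 2]; since the solution
    gains a derivative, this function has [q + 1 - k] derivatives with bounded top, and the
    induction hypothesis applies. *)
Theorem defect_le q h w : (0 < q <= p)%N -> chain h q -> 0 < w -> (forall x, `|h q x| <= w) ->
  `|defect (h 0%N)| <= defect_const q * w * eps ^+ (3 * q).
Proof.
elim/ltn_ind: q h w => q IH h w; wlog w1 : h w / w = 1 => [H qp ch w0 hw|].
  have qp' := qp; case/andP: qp' => q0 qp'.
  pose h' k x := w^-1 * h k x.
  have ch' : chain h' q by move=> k kq x; apply: derZ; exact: ch.
  have hw' x : `|h' q x| <= 1.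
    by rewrite normrM gtr0_norm ?invr_gt0// mulrC ler_pdivrMr// mul1r.
  have := H h' 1 erefl qp ch' ltr01 hw'.
  have -> : h 0%N = (fun x => w * h' 0%N x).
    by apply/funext => x; rewrite /h' mulVKf// gt_eqF.
  suff dh : dg q (h' 0%N).
    rewrite (defectZ _ _ dh); last exact: leqW.
    rewrite mulr1 => h1; rewrite normrM gtr0_norm// (mulrAC (defect_const q)) [leRHS]mulrC.
    by rewrite ler_wpM2l ?(ltW w0).
  exact: chain_dg1.
rewrite w1 => qp ch _ hw; rewrite mulr1; case/andP: (qp) => q0 qle.
have [g [cg gq g0 hE]] := chain_split ch.
have g1 x : `|g q x| <= 1 by rewrite gq.
have dg0 := chain_dg1 q0 cg g1.
have dT : dg q (fun x => \sum_(j < q) h j 0 / j`!%:R * x ^+ j).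
  rewrite (_ : (fun x => _) = (fun x => \sum_(j <- enum 'I_q) h j 0 / j`!%:R * x ^+ j)); last first.
    by apply/funext => x; rewrite big_enum.
  by apply: dg_sum => j; apply: dg_le (ltnW (ltn_ord j)) _; apply: dgZ; exact: dgX.
have qp1 : (q <= p.+1)%N by exact: leqW.
have -> : defect (h 0%N) = defect (g 0%N).
  rewrite (funext hE) (defectD qp1)//.
  rewrite (_ : (fun x => _) = (fun x => \sum_(j < q) h j 0 / j`!%:R * (x ^+ minn j q))); last first.
    by apply/funext => x; apply: eq_bigr => j _; rewrite (minn_idPl (ltnW (ltn_ord j))).
  rewrite (@defect_sum q q (fun j x => h j 0 / j`!%:R * (x ^+ minn j q)) qp1); last first.
    by move=> j; apply: dg_le (geq_minr j q) _; apply: dgZ; exact: dgX.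
  rewrite big1 ?addr0// => j _; have jq : (j <= q)%N by exact: ltnW.
  rewrite (minn_idPl jq) (defectZ (m := j)) ?defectX ?mulr0//; last exact: dgX.
  - exact: leq_trans jq qle.
  - exact: leq_trans jq qp1.
have [f [cf of' fw fw1 fE]] := stein_chain q0 cg g1 g0.
set w' := stein_w q in of' fw fw1.
have w0 : 0 < w' by exact: stein_w_gt0.
have cfq : chain f q by exact: chain_le cf.
have dgf := chain_dg cfq of'.
have dxf : dg q.+1 (fun x => x * f 0%N x).
  by rewrite -add1n; apply: dgM; [exact: dg_id|have := dgf 0%N isT; rewrite subn0].
have df1 : dg q.+1 (f 1%N) by apply: dg_le (dgf 1%N q0); lia.
have dc := dg_le (leq0n q.+1) (dg_cst (NN (g 0%N))).
have dD : defect (g 0%N) = defect (f 1%N) - defect (fun x => x * f 0%N x).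
  have D1 : defect (fun=> NN (g 0%N)) = 0.
    have := defectZ (NN (g 0%N)) (isT : (0 <= p.+1)%N) (dgX 0).
    rewrite defectX// mulr0; under [in LHS]eq_fun do rewrite expr0 mulr1; exact.
  rewrite -(defectB (m := q.+1))// -(funext fE) (defectB (m := q.+1)) ?D1 ?subr0//.
  exact: dg_le dg0.
have cty k : (k <= q)%N -> continuous (f k) by exact: chain_cont_le cfq of'.
have pgf k : (k <= q)%N -> pg (f k) by move=> kq; exact: dg_pg (dgf k kq).
have h2 := gcorr_stein eps0 eps1 B1 M3 beta_le beta0E beta1E qp cfq cty pgf fw.
have h1 := expansion qp cfq of'.
have e : defect (fun x => x * f 0%N x) =
    (Ex P (fun o => W o * f 0%N (W o)) - \sum_(k < q.+1) b q k * Ex P (fun o => f k (W o))) -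
    (G (fun x => x * f 0%N x) - \sum_(j < q.+1) beta j * G (f j)) +
    (defect (f 1%N) + \sum_(2 <= k < q.+1) beta k * defect (f k)).
  have -> : defect (f 1%N) + \sum_(2 <= k < q.+1) beta k * defect (f k) =
     \sum_(k < q.+1) beta k * defect (f k).
    rewrite -(big_mkord xpredT (fun k => beta k * defect (f k))) big_ltn// big_ltn ?ltnS//.
    by rewrite beta0E beta1E mul0r add0r mul1r.
  rewrite [X in _ - X - _](_ : _ = \sum_(k < q.+1) beta k * Ex P (fun o => f k (W o))); last first.
    by apply: eq_bigr => k _; rewrite (b_unique qp (q' := p)) ?p0 ?leqnn// -ltnS// ltnS (leq_trans _ qle)// -ltnS.
  rewrite /defect; under [X in _ = _ + X]eq_bigr do rewrite mulrBr.
  by rewrite sumrB; ring.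
have h3 : `|\sum_(2 <= k < q.+1) beta k * defect (f k)| <= p%:R * B * defect_const q.-1 * w' * eps ^+ (3 * q).
  rewrite (le_trans (ler_norm_sum _ _ _))//.
  apply: (@le_trans _ _ (\sum_(2 <= k < q.+1) B * defect_const q.-1 * w' * eps ^+ (3 * q))); last first.
    rewrite sumr_const_nat -[leLHS]mulr_natl -!mulrA ler_wpM2r//.
      by rewrite !mulr_ge0 ?defect_const_ge0 ?(le_trans ler01 B1) ?exprn_ge0 ?(ltW w0).
    by rewrite ler_nat; move: qp; clear; lia.
  rewrite big_nat_cond [leRHS]big_nat_cond; apply: ler_sum => k /andP[/andP[k2 kq] _].
  have kq' : (k <= q)%N by rewrite -ltnS.
  have hb : `|beta k| <= B * eps ^+ (3 * k.-1) by apply: beta_le; rewrite k2 (leq_trans kq').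
  (* The exponents match exactly: [3 * (k - 1) + 3 * q' = 3 * q]. *)
  pose q' := (q.+1 - k)%N.
  have [lt qq' q'_le qE] : [/\ (q' < q)%N, (0 < q' <= p)%N, (q' <= q.-1)%N &
      (3 * q)%N = (3 * k.-1 + 3 * q')%N].
    by move: k2 kq' qp; rewrite /q'; clear => k2 kq' qp; split; lia.
  have cs : chain (shift k f) q' by apply: chain_shift cf; exact: leqW.
  have ts x : `|shift k f q' x| <= w' by rewrite /shift /q' subnKC// leqW.
  have := IH q' lt (shift k f) w' qq' cs w0 ts; rewrite {1}/shift addn0 => hd.
  rewrite normrM; apply: le_trans (ler_pM _ _ hb hd) _ => //.
  rewrite [leRHS](_ : _ = B * eps ^+ (3 * k.-1) * (defect_const q.-1 * w' * eps ^+ (3 * q'))); last first.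
    by rewrite qE exprD; ring.
  rewrite ler_wpM2l ?mulr_ge0 ?exprn_ge0 ?(le_trans ler01 B1)//.
  rewrite ler_wpM2r ?exprn_ge0// ler_wpM2r ?(ltW w0)//.
  exact: defect_const_mono.
rewrite dD e.
set A1 := _ - \sum_(k < q.+1) b q k * _ in h1 *.
set A2 := _ - \sum_(j < q.+1) beta j * _ in h2 *.
set A3 := \sum_(2 <= k < q.+1) _ in h3 *.
rewrite (_ : _ - _ = A2 - A1 - A3); last by ring.
have := ler_normB (A2 - A1) A3; have := ler_normB A2 A1 => n1 n2.
have dq : defect_const q = defect_const q.-1 + w' * (p%:R * B * defect_const q.-1 + B + gcorr_const p M B).
  by rewrite -{1}(prednK q0) /= prednK.
rewrite dq mulrDl.
have := mulr_ge0 (defect_const_ge0 q.-1) (exprn_ge0 (3 * q) eps0).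
rewrite -/w' in h1 h2 h3; lra.
Qed.

(** The bump functions have a top derivative that is only Lipschitz. Averaging over [[x, x + t]]
    turns it into a difference quotient bounded by the Lipschitz constant, and the error, linear in
    [t], disappears as [t] tends to 0. *)
Theorem defect_lipschitz (h : nat -> R -> R) C : chain h p.-1 ->
  (forall x y, `|h p.-1 x - h p.-1 y| <= `|x - y|) ->
  (forall x y, `|h 0%N x - h 0%N y| <= C * `|x - y|) ->
  `|defect (h 0%N)| <= defect_const p * eps ^+ (3 * p).
Proof.
move=> ch lip lip0.
have ch0 := lipschitz_continuous lip0.
have C0 : 0 <= C by have := lip0 1 0; rewrite subr0 normr1 mulr1; exact: le_trans.
have [Q dQ] := primitive ch0.
pose hs (t : R) k x := if k is k'.+1 then t^-1 * (h k' (x + t) - h k' x) else t^-1 * (Q (x + t) - Q x).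
have dshift (t x a : R) (g : R -> R) : is_derive (x + t) 1 g a -> is_derive x 1 (fun y => g (y + t)) a.
  move=> hg; have := @der_comp _ g (fun y => y + t) x a _ hg (derD (der_id x) (der_cst t x)).
  by apply: der_eq; ring.
have chs t : chain (hs t) p.
  case=> [|k] kp x /=.
    apply: derZ; by apply: derB; [apply: dshift|]; exact: dQ.
  apply: derZ; have kp' : (k < p.-1)%N by lia.
  by apply: derB; [apply: dshift|]; exact: ch.
have top t : 0 < t -> forall x, `|hs t p x| <= 1.
  move=> t0 x; rewrite -(prednK p0) /= normrM normfV (gtr0_norm t0) mulrC ler_pdivrMr// mul1r.
  have := lip (x + t) x; rewrite (_ : x + t - x = t); last by ring.
  by rewrite (gtr0_norm t0).
have app t : 0 < t -> forall x, `|hs t 0%N x - h 0%N x| <= C * t.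
  move=> t0 x; have xt : x <= x + t by rewrite lerDl ltW.
  have := @MVT_seg R (fun y => Q y - y * h 0%N x) (fun y => h 0%N y - h 0%N x) x (x + t) (C * t) xt.
  have H1 y : x <= y <= x + t -> is_derive y 1 (fun y => Q y - y * h 0%N x) (h 0%N y - h 0%N x).
    by move=> _; have := derB (dQ y) (derM (der_id y) (der_cst (h 0%N x) y)); apply: der_eq; ring.
  have H2 y : x <= y <= x + t -> `|h 0%N y - h 0%N x| <= C * t.
    move=> /andP[y1 y2]; apply: (le_trans (lip0 y x)); rewrite ler_wpM2l// ger0_norm ?subr_ge0//.
    by rewrite lerBlDl.
  move=> /(_ H1 H2); rewrite (_ : _ - _ - _ = t * (hs t 0%N x - h 0%N x)); last first.
    by rewrite /=; field; rewrite gt_eqF.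
  rewrite (_ : x + t - x = t); last by ring.
  by rewrite normrM (gtr0_norm t0) mulrC ler_pM2r.
have dgh : dg 1 (h 0%N).
  split; first exact: continuous_meas.
  exists (`|h 0%N 0| + C) => [|x]; first by rewrite addr_ge0.
  have := lip0 x 0; rewrite subr0 expr1 => hx.
  have := ler_normD (h 0%N x - h 0%N 0) (h 0%N 0); rewrite subrK.
  by have := mulr_ge0 (normr_ge0 (h 0%N 0)) (normr_ge0 x); lra.
pose K := C + \sum_(m < M.+1) `|corr p beta m| * (C * NN (fun x => `|hermite m x|)).
have K0 : 0 <= K.
  rewrite addr_ge0// sumr_ge0// => m _; rewrite !mulr_ge0//; apply: Ex_ge0 => x.
  by rewrite mulr_ge0 ?(ltW (gs_gt0 _)).
have bnd t : 0 < t -> `|defect (h 0%N)| <= defect_const p * eps ^+ (3 * p) + K * t.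
  move=> t0; pose e x := hs t 0%N x - h 0%N x.
  have pp : (0 < p <= p)%N by rewrite p0 leqnn.
  have dghs : dg p (hs t 0%N) by apply: chain_dg1 => //; exact: top.
  have dge : dg p (fun x => hs t 0%N x - h 0%N x) by apply: dgB => //; exact: dg_le dgh.
  have -> : h 0%N = (fun x => hs t 0%N x - e x) by apply/funext => x; rewrite /e; ring.
  rewrite (defectB (m := p)) ?leqnSn//.
  rewrite (le_trans (ler_normB _ _))// lerD//.
    by have := defect_le pp (chs t) ltr01 (top t t0); rewrite mulr1.
  have ee x : `|e x| <= C * t by exact: app.
  rewrite /defect (le_trans (ler_normB _ _))// /K mulrDl lerD//.
    rewrite -(Ex_cst P (C * t)); apply: Ex_abs_le; [exact: L1W (leqnSn p) dge|exact: L1_cst|].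
    by move=> o; exact: ee.
  rewrite (le_trans (ler_norm_sum _ _ _))// mulr_suml; apply: ler_sum => m _.
  rewrite normrM -mulrA ler_wpM2l// mulrAC -NNZ; last by apply: pg_abs; exact: pg_hermite.
  apply: NN_abs_le; [apply: pg_hermiteM; exact: dg_pg dge| by apply: pgZ; apply: pg_abs; exact: pg_hermite |].
  by move=> x; rewrite normrM mulrC ler_wpM2r.
apply/ler_addgt0Pr => z z0.
have t0 : 0 < z / (K + 1) by rewrite divr_gt0// ltr_wpDl.
apply: (le_trans (bnd _ t0)); rewrite lerD2l mulrCA ler_piMr ?(ltW z0)//.
by rewrite ler_pdivrMr ?ltr_wpDl// mul1r lerDl.
Qed.

End corrected_clt.

(** * Test functions and transport *)

Section bump_polynomial.
Context {R : realType}.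
Implicit Types (q : {poly R}) (n j : nat) (t : R).

Definition bump_poly n : {poly R} := ('X * (1 - 'X)) ^+ n.

(** Each differentiation lowers the order of vanishing at both ends by at most one. *)
Lemma bump_poly_factor n j : (j <= n)%N ->
  exists q, (bump_poly n)^`(j) = ('X * (1 - 'X)) ^+ (n - j) * q.
Proof.
elim: j => [|j IH] jn; first by exists 1; rewrite subn0 mulr1.
have [q E] := IH (ltnW jn); rewrite derivnS E.
have -> : (n - j = (n - j.+1).+1)%N by lia.
set m := (n - j.+1)%N; set u : {poly R} := 'X * (1 - 'X).
exists (m.+1%:R * u^`() * q + u * q^`()).
by rewrite derivM deriv_exp /= exprS -mulr_natl; ring.
Qed.

Lemma poly_bounded01 q : exists2 C, 0 <= C & forall t, 0 <= t <= 1 -> `|q.[t]| <= C.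
Proof.
exists (\sum_(i < size q) `|q`_i|); first by rewrite sumr_ge0.
move=> t /andP[t0 t1]; rewrite horner_coef (le_trans (ler_norm_sum _ _ _))//.
apply: ler_sum => i _; rewrite normrM ler_piMr// normrX ger0_norm//.
by rewrite exprn_ile1.
Qed.

Lemma bump_poly_bound n : exists2 C, 0 < C & forall j, (j <= n)%N -> forall t, 0 <= t <= 1 ->
  `|(bump_poly n)^`(j).[t]| <= C * (t * (1 - t)) ^+ (n - j).
Proof.
have H (j : 'I_n.+1) : exists C, 0 <= C /\ forall t, 0 <= t <= 1 ->
    `|(bump_poly n)^`(j).[t]| <= C * (t * (1 - t)) ^+ (n - j).
  have [|q E] := @bump_poly_factor n j; first by rewrite -ltnS.
  have [C C0 hC] := poly_bounded01 q; exists C; split=> // t t01.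
  have /andP[t0 t1] := t01.
  rewrite E hornerM normrM mulrC horner_exp !hornerE normrX (ger0_norm (x := t * (1 - t))) ?mulr_ge0 ?subr_ge0//.
  by rewrite ler_wpM2r ?hC// exprn_ge0// mulr_ge0 ?subr_ge0.
have [C hC] := choice H.
exists (1 + \sum_i C i); first by rewrite ltr_pwDl// sumr_ge0// => i _; case: (hC i).
move=> j jn t t01; have jn' : (j < n.+1)%N by [].
have [_ h] := hC (Ordinal jn'); have /andP[t0 t1] := t01.
apply: (le_trans (h t t01)); rewrite ler_wpM2r ?exprn_ge0 ?mulr_ge0 ?subr_ge0//.
rewrite (bigD1 (Ordinal jn'))//= addrCA lerDl addr_ge0// sumr_ge0// => i _.
by case: (hC i).
Qed.

End bump_polynomial.

(** * Bumps on the components of an open set *)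

Section bump.
Context {R : realType}.
Variables (n : nat) (C : R).
Hypotheses (C0 : 0 < C) (hC : forall j, (j <= n)%N -> forall t, 0 <= t <= 1 ->
  `|(bump_poly n)^`(j).[t]| <= C * (t * (1 - t)) ^+ (n - j)).
Variables (O : set R) (r : R).
Hypotheses (openO : open O) (bndO : forall s, O s -> `|s| < r) (O0 : ~ O 0).
Implicit Types (s x y z a b : R) (j : nat).
Local Notation mu := (@lebesgue_measure R).

(** The components of [O], described by their end points; both are finite because [O] is bounded. *)
Definition gap a b := [/\ ~ O a, ~ O b & forall y, a < y < b -> O y].

Lemma gap_left s : O s -> exists2 a, a < s & ~ O a /\ forall y, a < y <= s -> O y.
Proof.
move=> Os; pose A := [set y | y <= s /\ ~ O y].
have A0 : A !=set0.
  exists (- `|r| - `|s|); split.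
    by have := ler_norm (- s); rewrite normrN; have := normr_ge0 r; lra.
  move=> /bndO; rewrite -normrN opprD !opprK (ger0_norm (addr_ge0 _ _))// => h.
  by have := ler_norm r; have := normr_ge0 s; lra.
have Ab : has_ubound A by exists s => y [].
have hs : has_sup A by [].
have as' : sup A <= s by apply: ge_sup => // y [].
have nO : ~ O (sup A).
  move=> Oa; have /nbhs_ballP[e e0 he] := openO Oa.
  have [y [ys nOy] hy] := sup_adherent e0 hs.
  apply: (nOy); apply: he; rewrite /ball /= ger0_norm; first by rewrite ltrBlDr addrC -ltrBlDr.
  by rewrite subr_ge0; apply: (ub_le_sup Ab); split.
exists (sup A).
  by rewrite lt_neqAle as' andbT; apply/eqP => E; apply: nO; rewrite E.
split=> // y /andP[ay ys]; apply: contrapT => nOy.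
by move: ay; rewrite ltNge; apply/negP/negPn; apply: ub_le_sup.
Qed.

Lemma gap_right s : O s -> exists2 b, s < b & ~ O b /\ forall y, s <= y < b -> O y.
Proof.
move=> Os; pose A := [set y | s <= y /\ ~ O y].
have A0 : A !=set0.
  exists (`|r| + `|s|); split.
    by have := ler_norm s; have := normr_ge0 r; lra.
  move=> /bndO; rewrite (ger0_norm (addr_ge0 _ _))// => h.
  by have := ler_norm r; have := normr_ge0 s; lra.
have Ab : has_lbound A by exists s => y [].
have hs : has_inf A by [].
have as' : s <= inf A by apply: lb_le_inf => // y [].
have nO : ~ O (inf A).
  move=> Oa; have /nbhs_ballP[e e0 he] := openO Oa.
  have [y [ys nOy] hy] := inf_adherent e0 hs.
  apply: (nOy); apply: he; rewrite /ball /= distrC ger0_norm; first by rewrite ltrBlDl.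
  by rewrite subr_ge0; apply: (ge_inf Ab); split.
exists (inf A).
  by rewrite lt_neqAle as' andbT; apply/eqP => E; apply: nO; rewrite -E.
split=> // y /andP[ys ay]; apply: contrapT => nOy.
by move: ay; rewrite ltNge; apply/negP/negPn; apply: ge_inf.
Qed.

Lemma gap_exists s : exists ab : R * R, O s -> ab.1 < s < ab.2 /\ gap ab.1 ab.2.
Proof.
case: (pselect (O s)) => Os; last by exists (0, 0).
have [a as' [nOa ha]] := gap_left Os; have [b sb [nOb hb]] := gap_right Os.
exists (a, b) => _ /=; rewrite as' sb; split=> //; split=> // y /andP[ay yb].
by case: (leP y s) => ys; [apply: ha; rewrite ay|apply: hb; rewrite yb (ltW ys)].
Qed.

Definition ends := projT1 (choice gap_exists).
Lemma endsP s : O s -> (ends s).1 < s < (ends s).2 /\ gap (ends s).1 (ends s).2.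
Proof. exact: (projT2 (choice gap_exists)). Qed.

Lemma gap_unique a b a' b' s : gap a b -> gap a' b' -> a < s < b -> a' < s < b' -> a = a' /\ b = b'.
Proof.
move=> [na nb h] [na' nb' h'] /andP[as' sb] /andP[as'' sb'].
split.
  case: (ltgtP a a') => // aa; exfalso.
    by apply: na'; apply: h; rewrite aa (lt_trans as'').
  by apply: na; apply: h'; rewrite aa (lt_trans as').
case: (ltgtP b b') => // bb; exfalso.
  by apply: nb; apply: h'; rewrite bb (lt_trans as'').
by apply: nb'; apply: h; rewrite bb (lt_trans as').
Qed.

(** The [j]-th derivative of [((s - a) * (b - s) / (b - a)) ^+ n], obtained by scaling from the unit
    interval. *)
Definition bump_on a b j s : R := (b - a) ^+ (n - j) * (bump_poly n)^`(j).[(s - a) / (b - a)].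

Definition bump j s : R :=
  if pselect (O s) then bump_on (ends s).1 (ends s).2 j s else 0.

Lemma bump_out j s : ~ O s -> bump j s = 0.
Proof. by rewrite /bump; case: pselect. Qed.

Lemma bumpE j a b s : gap a b -> a < s < b -> bump j s = bump_on a b j s.
Proof.
move=> g asb; have Os : O s by case: g => _ _; exact.
have [e g'] := endsP Os; rewrite /bump; case: pselect => [?|//].
by have [-> ->] := gap_unique g g' asb e.
Qed.

Lemma bump_on_le a b s j : a < s < b -> (j <= n)%N ->
  `|bump_on a b j s| <= C * ((s - a) * (b - s) / (b - a)) ^+ (n - j).
Proof.
move=> /andP[as' sb] jn; have ab : 0 < b - a by rewrite subr_gt0 (lt_trans as').
have t01 : 0 <= (s - a) / (b - a) <= 1.
  by apply/andP; split; [rewrite divr_ge0 ?subr_ge0 ?(ltW as')// -subr_ge0 ltW|rewrite ler_pdivrMr// mul1r lerD2r ltW].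
rewrite normrM normrX (gtr0_norm ab); have := ler_wpM2l (exprn_ge0 (n - j) (ltW ab)) (hC jn t01).
move=> /le_trans; apply; rewrite mulrCA -exprMn; rewrite ler_wpM2l ?(ltW C0)//.
rewrite le_eqVlt; apply/orP; left; apply/eqP; congr (_ ^+ _); field.
by rewrite gt_eqF.
Qed.

Lemma harmonic_le a b s z : a < s < b -> ~~ (a < z < b) ->
  (s - a) * (b - s) / (b - a) <= `|s - z|.
Proof.
move=> /andP[as' sb] zab; have ab : 0 < b - a by rewrite subr_gt0 (lt_trans as').
rewrite ler_pdivrMr//; have := ler_norm (s - z); have := ler_norm (- (s - z)).
rewrite normrN; move: zab; rewrite negb_and -!leNgt => /orP[h|h] h1 h2; nra.
Qed.

(** The base of the bump at [s] is at most the distance from [s] to any point outside its component.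
    The bound is free of the length of the component, which allows infinitely many components to be
    glued together. *)
Lemma bump_le j s z : (j <= n)%N -> ~ O z -> `|bump j s| <= C * `|s - z| ^+ (n - j).
Proof.
move=> jn nOz; case: (pselect (O s)) => [Os|nOs]; last first.
  by rewrite bump_out// normr0 mulr_ge0 ?exprn_ge0 ?(ltW C0).
have [e g] := endsP Os; rewrite (bumpE j g e).
apply: (le_trans (bump_on_le e jn)); rewrite ler_wpM2l ?(ltW C0)//.
have /andP[e1 e2] := e.
rewrite lerXn2r ?nnegrE// ?harmonic_le//.
  by rewrite divr_ge0 ?mulr_ge0 ?subr_ge0 ?ltW// (lt_trans e1).
by apply/negP => h; apply: nOz; case: g => _ _; exact.
Qed.

Lemma der_bump_on a b j s : a < b -> (j < n)%N ->
  is_derive s 1 (bump_on a b j) (bump_on a b j.+1 s).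
Proof.
move=> ab jn; have ab0 : b - a != 0 by rewrite subr_eq0 gt_eqF.
have d1 : is_derive s 1 (fun y => (b - a)^-1 * (y - a)) ((b - a)^-1 * (1 - 0)).
  exact: derZ (derB (der_id s) (der_cst a s)).
have d2 := der_comp (g := fun y => (b - a)^-1 * (y - a)) (is_derive_poly (bump_poly n)^`(j) _) d1.
have E : bump_on a b j = fun y => (b - a) ^+ (n - j) * (bump_poly n)^`(j).[(b - a)^-1 * (y - a)].
  by apply/funext => y; rewrite /bump_on (mulrC (y - a)).
rewrite E; apply: der_eq (derZ ((b - a) ^+ (n - j)) d2).
rewrite /bump_on derivnS (mulrC (s - a)) subr0 mulr1.
have -> : (n - j = (n - j.+1).+1)%N by lia.
by rewrite exprS; field.
Qed.

(** For the points outside [O], where components may accumulate and no single formula describes the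
    bump on a neighbourhood. *)
Lemma is_derive_quadratic (f : R -> R) s K : f s = 0 ->
  (forall y, `|y - s| < 1 -> `|f y| <= K * `|y - s| ^+ 2) -> is_derive s 1 f 0.
Proof.
move=> fs hf.
have K0 : 0 <= K.
  have h : `|(s + 2^-1) - s| < 1 :> R by rewrite addrAC subrr add0r gtr0_norm// invf_lt1// ltr1n.
  have := le_trans (normr_ge0 _) (hf _ h).
  by rewrite pmulr_lge0// exprn_gt0// normr_gt0 addrAC subrr add0r.
have H : h^-1 *: (f (h *: (1 : R) + s) - f s) @[h --> (0:R)^'] --> (0 : R).
  apply/cvgrPdist_le => e e0; near=> h.
  have h0 : h != 0 by near: h; exact: nbhs_dnbhs_neq.
  have h1 : `|h| < 1 by near: h; apply: dnbhs0_lt.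
  have h2 : `|h| <= e / (K + 1) by near: h; apply: dnbhs0_le; rewrite divr_gt0// ltr_wpDl.
  rewrite sub0r normrN fs subr0 normrM normfV /GRing.scale /= mulr1.
  have := hf (h + s); rewrite addrK => /(_ h1) h3.
  rewrite mulrC ler_pdivrMr ?normr_gt0//; apply: (le_trans h3).
  rewrite expr2 mulrA ler_wpM2r//.
  move: h2; rewrite ler_pdivlMr ?ltr_wpDl// => h2.
  by have := normr_ge0 h; nra.
split; first by apply/cvg_ex; exists 0.
by apply: cvg_lim => //; exact: Rhausdorff.
Unshelve. all: by end_near. Qed.

Lemma der_bump j s : (j.+1 < n)%N -> is_derive s 1 (bump j) (bump j.+1 s).
Proof.
move=> jn; case: (pselect (O s)) => [Os|nOs]; last first.
  rewrite [X in is_derive _ _ _ X]bump_out//; apply: (@is_derive_quadratic _ _ C); first by rewrite bump_out.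
  move=> y y1; apply: (le_trans (bump_le y _ nOs)); first by lia.
  rewrite ler_wpM2l ?(ltW C0)// ler_wiXn2l ?(ltW y1)//; lia.
have [e g] := endsP Os; set a := (ends s).1 in e g; set b := (ends s).2 in e g.
have /andP[as' sb] := e.
rewrite [X in is_derive _ _ _ X](bumpE _ g e).
have d := der_bump_on s (lt_trans as' sb) (ltnW jn).
apply: near_eq_is_derive d; apply: (@near_dist _ _ (Num.min (s - a) (b - s))).
  by rewrite lt_min !subr_gt0 as' sb.
move=> y; rewrite lt_min ltr_norml ltr_norml => /andP[/andP[h1 _] /andP[_ h2]].
by rewrite (bumpE j g)//; apply/andP; split; lra.
Qed.

(** At the ends of a component the derivative of order [n - 1] may have a corner. If the segment
    meets the complement of [O], both values are compared with 0 there; otherwise the segment lies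
    in one component. *)
Lemma bump_lipschitz x y : (0 < n)%N -> `|bump n.-1 x - bump n.-1 y| <= C * `|x - y|.
Proof.
move=> n0; wlog xy : x y / x <= y => [H|].
  by case: (leP x y) => h; [exact: H|rewrite distrC (distrC x); apply: H; exact: ltW].
have n1 : (n - n.-1 = 1)%N by lia.
case: (pselect (exists2 z, x <= z <= y & ~ O z)) => [[z /andP[xz zy] nOz]|noz].
  have := bump_le x (leq_pred n) nOz; have := bump_le y (leq_pred n) nOz.
  rewrite n1 !expr1 (ler0_norm (x := x - z)) ?subr_le0// (ger0_norm (x := y - z)) ?subr_ge0//.
  rewrite (ler0_norm (x := x - y)) ?subr_le0// => h1 h2.
  by have := ler_normB (bump n.-1 x) (bump n.-1 y); lra.
have Oz z : x <= z <= y -> O z by move=> h; apply: contrapT => nz; apply: noz; exists z.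
have Ox : O x by apply: Oz; rewrite lexx.
have [e g] := endsP Ox; set a := (ends x).1 in e g; set b := (ends x).2 in e g.
have /andP[ax xb] := e.
have yb : y < b.
  by rewrite ltNge; apply/negP => b_y; case: g => _ nb _; apply: nb; apply: Oz; rewrite (ltW xb).
have zab z : x <= z <= y -> a < z < b.
  by move=> /andP[h1 h2]; rewrite (lt_le_trans ax h1) (le_lt_trans h2 yb).
rewrite (bumpE _ g e) (bumpE _ g (zab y _)) ?xy ?lexx// distrC (distrC x) (ger0_norm (x := y - x)) ?subr_ge0//.
apply: (@MVT_seg _ _ (bump_on a b n)) xy _ _ => z hz.
  by rewrite -{2}(prednK n0); apply: der_bump_on; [exact: lt_trans ax xb|rewrite prednK].
have := bump_on_le (zab z hz) (leqnn n).
by rewrite subnn expr0 mulr1.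
Qed.

Lemma bump0E a b s : a < b -> bump_on a b 0 s = ((s - a) * (b - s) / (b - a)) ^+ n.
Proof.
move=> ab; rewrite /bump_on /bump_poly derivn0 subn0 horner_exp !hornerE -exprMn.
by congr (_ ^+ _); field; rewrite subr_eq0 gt_eqF.
Qed.

Lemma bump_ge0 s : 0 <= bump 0 s.
Proof.
case: (pselect (O s)) => [Os|nOs]; last by rewrite bump_out.
have [e g] := endsP Os; have /andP[e1 e2] := e.
rewrite (bumpE _ g e) bump0E ?(lt_trans e1)// exprn_ge0//.
by rewrite divr_ge0 ?mulr_ge0 ?subr_ge0 ?ltW// (lt_trans e1).
Qed.

(** The quantity [(s - x) * (y - s) / (y - x)] increases with the interval, so a subinterval of a
    component gives a lower bound. *)
Lemma bump_lower x y s : (forall z, x < z < y -> O z) -> x < s < y ->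
  ((s - x) * (y - s) / (y - x)) ^+ n <= bump 0 s.
Proof.
move=> hO e; have Os := hO s e.
have [e' g] := endsP Os; set a := (ends s).1 in e' g; set b := (ends s).2 in e' g.
have /andP[xs sy] := e; have /andP[as' sb] := e'.
have ab := lt_trans as' sb; have xy := lt_trans xs sy.
rewrite (bumpE _ g e') bump0E//.
have ax : a <= x.
  by rewrite leNgt; apply/negP => xa; case: g => na _ _; apply: na; apply: hO; rewrite xa (lt_trans as').
have yb : y <= b.
  by rewrite leNgt; apply/negP => xa; case: g => _ na _; apply: na; apply: hO; rewrite xa (lt_trans xs).
rewrite lerXn2r ?nnegrE ?divr_ge0 ?mulr_ge0 ?subr_ge0 ?(ltW xs) ?(ltW sy) ?(ltW xy) ?(ltW as') ?(ltW sb) ?(ltW ab)//.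
rewrite ler_pdivrMr ?subr_gt0// mulrAC ler_pdivlMr ?subr_gt0//.
have s1 : 0 < s - x by rewrite subr_gt0. have s2 : 0 < y - s by rewrite subr_gt0.
have s3 : 0 <= x - a by rewrite subr_ge0. have s4 : 0 <= b - y by rewrite subr_ge0.
rewrite -subr_ge0 (_ : _ - _ = (s - x) ^+ 2 * (b - y) + (y - s) ^+ 2 * (x - a) + (x - a) * (b - y) * ((y - s) + (s - x))); last by ring.
apply: addr_ge0; first by apply: addr_ge0; apply: mulr_ge0; rewrite // sqr_ge0.
by apply: mulr_ge0; [exact: mulr_ge0|apply: addr_ge0; exact: ltW].
Qed.

End bump.

(** * Test functions as primitives of bumps *)

Section test_function.
Context {R : realType}.
Implicit Types (k : R -> R) (x y r K : R) (n : nat).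
Local Notation mu := (@lebesgue_measure R).

Lemma L1_itv x y : L1 mu (\1_`]x, y] : R -> R).
Proof.
exact: (integrable_indic_itv x y false false).
Qed.

Lemma Ex_itv x y : x <= y -> Ex mu (\1_`]x, y]) = y - x.
Proof.
rewrite /Ex /Rintegral integral_indic//= setIT lebesgue_measure_itv /= lte_fin le_eqVlt.
by case/predU1P => [->|->] //=; rewrite ltxx subrr.
Qed.

Lemma L1_bounded_support k r K : measurable_fun setT k -> (forall s, `|k s| <= K) ->
  (forall s, r <= `|s| -> k s = 0) -> L1 mu k.
Proof.
move=> mk kK ks.
have K0 : 0 <= K by exact: le_trans (kK 0).
apply: (L1_le _ _ (L1Z K (L1_itv (- r) r))) => // s.
rewrite indicE; case: (boolP (s \in _)) => [_|]; first by rewrite mulr1.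
rewrite notin_setE /= in_itv /= => /negP; rewrite negb_and -leNgt -ltNge mulr0 => h.
rewrite ks ?normr0//; case/orP: h => h; rewrite ler_normr; apply/orP; first by right; rewrite lerNr.
by left; exact: ltW.
Qed.

Lemma lint_diff k x y : L1 mu k -> x <= y ->
  lint k y - lint k x = Ex mu (fun s => k s * \1_`]x, y] s).
Proof.
move=> hk xy; rewrite !lintE -ExB; [|exact: L1_indicM|exact: L1_indicM].
apply: eq_Ex => s; rewrite -mulrBr; congr (_ * _); rewrite !indicE !mem_setE /= !in_itv /=.
by case: (leP s x) => sx; rewrite ?(le_trans sx xy)//= ?subrr// subr0.
Qed.

Lemma lint_lipschitz k K x y : L1 mu k -> (forall s, `|k s| <= K) ->
  `|lint k x - lint k y| <= K * `|x - y|.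
Proof.
move=> hk kK; wlog xy : x y / x <= y => [H|].
  by case: (leP x y) => h; [exact: H|rewrite distrC (distrC x); apply: H; exact: ltW].
rewrite distrC (distrC x) lint_diff// (ger0_norm (x := y - x)) ?subr_ge0//.
rewrite -(Ex_itv xy) -ExZ; last exact: L1_itv.
apply: Ex_abs_le; [exact: L1_indicM|exact: L1Z (L1_itv x y)|].
by move=> s; rewrite normrM ler_pM// ger0_norm.
Qed.

Lemma lint_lower k m x y x1 y1 : L1 mu k -> (forall s, 0 <= k s) -> x <= x1 -> x1 <= y1 -> y1 <= y ->
  (forall s, x1 < s <= y1 -> m <= k s) -> m * (y1 - x1) <= lint k y - lint k x.
Proof.
move=> hk k0 xx1 xy1 yy1 hm; rewrite lint_diff ?(le_trans xx1) ?(le_trans xy1)//.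
rewrite -(Ex_itv xy1) -ExZ; last exact: L1_itv.
apply: Ex_le; [exact: L1Z (L1_itv _ _)|exact: L1_indicM|].
move=> s; rewrite !indicE !mem_setE /= !in_itv /=.
case: (boolP (x1 < s <= y1)) => h; last by rewrite mulr0 mulr_ge0.
case/andP: (h) => h1 h2; rewrite (le_lt_trans xx1 h1) (le_trans h2 yy1) !mulr1; exact: hm.
Qed.

Theorem test_function n : exists2 c : R, 0 < c & forall (O : set R) r, open O ->
  (forall s, O s -> `|s| < r) -> ~ O 0 -> exists h : nat -> R -> R, exists k : R -> R,
  [/\ chain h n, forall x y, `|h n x - h n y| <= `|x - y|,
    [/\ measurable_fun setT k, forall s, 0 <= k s <= `|s| ^+ n & forall s, ~ O s -> k s = 0],
    h 0%N = lint k /\ ((0 < n)%N -> continuous k /\ forall x, is_derive x 1 (h 0%N) (k x)) &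
    forall x y, x < y -> (forall z, x < z < y -> O z) -> c * (y - x) ^+ n.+1 <= h 0%N y - h 0%N x].
Proof.
have [C C0 hC] := bump_poly_bound (R := R) n.
have C1 : 0 < C^-1 by rewrite invr_gt0.
(* On the middle half of an interval of length [l] the base of the bump is at least [3 / 16 * l];
   the half has length [l / 2], and dividing by [C] makes the top Lipschitz constant 1. *)
exists (C^-1 * (3 / 16) ^+ n * 2^-1); first by rewrite !mulr_gt0 ?exprn_gt0// divr_gt0.
move=> O r openO bndO O0.
pose k s := C^-1 * bump n openO bndO 0 s.
have k0 s : 0 <= k s by rewrite mulr_ge0 ?(ltW C1)// bump_ge0.
have kn s : k s <= `|s| ^+ n.
  rewrite /k ler_pdivrMl//; apply: le_trans (ler_norm _) _.
  by have := bump_le C0 hC openO bndO s (leq0n n) O0; rewrite subr0 subn0.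
have kout s : ~ O s -> k s = 0 by move=> nOs; rewrite /k bump_out// mulr0.
have lipk x y : (0 < n)%N -> `|C^-1 * bump n openO bndO n.-1 x - C^-1 * bump n openO bndO n.-1 y| <= `|x - y|.
  move=> n0; rewrite -mulrBr normrM (gtr0_norm C1) ler_pdivrMl//.
  exact: bump_lipschitz.
have kc : (0 < n)%N -> continuous k.
  move=> n0; case: (ltnP 1 n) => n1.
    move=> x; apply: (der_continuous (derZ C^-1 (der_bump C0 hC openO bndO x n1))).
  have e : n.-1 = 0%N by lia.
  apply: (@lipschitz_continuous _ _ 1) => x y; rewrite mul1r; have := lipk x y n0.
  by rewrite e.
have mk : measurable_fun setT k.
  case: (posnP n) => n0; last by apply: continuous_meas; exact: kc.
  rewrite (_ : k = fun s => C^-1 * \1_O s); last first.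
    apply/funext => s; rewrite /k; congr (_ * _); rewrite indicE.
    case: (boolP (s \in O)); rewrite ?inE ?notin_setE => hs; last by rewrite bump_out.
    have [e g] := endsP openO bndO hs; have /andP[e1 e2] := e.
    rewrite (bumpE n openO bndO 0 g e) bump0E ?(lt_trans e1)//.
    by rewrite n0 expr0.
  apply: measurable_funM => //; apply: measurable_indic; exact: open_measurable.
have kb s : `|k s| <= `|r| ^+ n.
  rewrite ger0_norm//; case: (pselect (O s)) => Os; last by rewrite kout// exprn_ge0.
  apply: (le_trans (kn s)); rewrite lerXn2r ?nnegrE//.
  by rewrite (le_trans (ltW (bndO s Os)))// ler_norm.
have Lk : L1 mu k.
  apply: (L1_bounded_support (r := r) mk kb) => s rs; apply: kout => /bndO.
  by rewrite ltNge rs.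
pose h j := if j is j'.+1 then (fun x => C^-1 * bump n openO bndO j' x) else lint k.
have dk : (0 < n)%N -> forall x, is_derive x 1 (lint k) (k x).
  by move=> n0 x; apply: der_lint => //; exact: kc.
exists h, k; split.
- case=> [|j] jn x /=; first exact: dk.
  exact: derZ (der_bump C0 hC openO bndO x jn).
- case: (posnP n) => n0 x y; last by rewrite -(prednK n0) /=; exact: lipk.
  rewrite n0 /= -[leRHS]mul1r; apply: lint_lipschitz => // s.
  by have := kb s; rewrite n0 expr0.
- by split=> // s; rewrite k0 kn.
- by split=> // n0; split; [exact: kc|exact: dk].
- move=> x y xy hO /=; set l := y - x.
  have l0 : 0 < l by rewrite subr_gt0.
  have := @lint_lower k (C^-1 * (3 / 16 * l) ^+ n) x y (x + l / 4) (y - l / 4) Lk k0.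
  have -> : C^-1 * (3 / 16 * l) ^+ n * (y - l / 4 - (x + l / 4)) = C^-1 * (3 / 16) ^+ n / 2 * l ^+ n.+1.
    by rewrite exprMn exprS /l; field; rewrite gt_eqF.
  apply; rewrite /l; [lra|lra|lra|] => s /andP[s1 s2].
  rewrite /k ler_wpM2l ?(ltW C1)//.
  have e : x < s < y by apply/andP; split; rewrite /l in s1 s2; lra.
  apply: le_trans (bump_lower n openO bndO hO e).
  have b1 : 3 / 16 * (y - x) <= (s - x) * (y - s) / (y - x).
    by rewrite ler_pdivlMr//; rewrite /l in s1 s2 l0; nra.
  have b2 : 0 <= 3 / 16 * (y - x) by rewrite mulr_ge0// ltW.
  by rewrite lerXn2r ?nnegrE// (le_trans b2).
Qed.

End test_function.

(** * The normal distribution function *)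

Section gaussian_cdf.
Context {R : realType}.
Implicit Types (k : R -> R) (x y s z : R).
Local Notation mu := (@lebesgue_measure R).

Lemma lint_diff_itv k x y (b1 b2 : bool) : L1 mu k -> x <= y ->
  lint k y - lint k x = Ex mu (fun s => k s * \1_[set` Interval (BSide b1 x) (BSide b2 y)] s).
Proof.
move=> hk xy; rewrite lint_diff//.
have E (i : interval R) : Ex mu (fun s => k s * \1_[set` i] s) = \int[mu]_(s in [set` i]) k s.
  rewrite Rintegral_mkcond; apply: eq_Ex => t; rewrite patchE indicE.
  by case: ifP => _; rewrite ?mulr1 ?mulr0.
rewrite !E; have hi (i : interval R) : mu.-integrable [set` i] (EFin \o k) by apply: integrableS hk.
case: b1 b2 => [] [] //.
- by rewrite Rintegral_itv_bndo_bndc// -Rintegral_itv_obnd_cbnd.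
- by rewrite -Rintegral_itv_obnd_cbnd.
- by rewrite Rintegral_itv_bndo_bndc.
Qed.

Lemma lint_homo k x y : L1 mu k -> (forall s, 0 <= k s) -> x <= y -> lint k x <= lint k y.
Proof.
move=> hk k0 xy; rewrite -subr_ge0 lint_diff//; apply: Ex_ge0 => s.
by rewrite mulr_ge0.
Qed.

Definition Phi : R -> R := lint gs.

Lemma L1_gs : L1 mu gs. Proof. exact: integrable_normal_pdf. Qed.

Lemma Phi_homo x y : x <= y -> Phi x <= Phi y.
Proof. by apply: lint_homo => [|s]; [exact: L1_gs|exact: ltW (gs_gt0 s)]. Qed.

Lemma Phi_lt x y : x < y -> Phi x < Phi y.
Proof.
move=> xy; rewrite -subr_gt0.
have d z : x <= z <= y -> is_derive z 1 Phi (gs z).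
  by move=> _; apply: der_lint; [exact: L1_gs|exact: gs_continuous].
have cf : {within `[x, y], continuous Phi}.
  by apply: derivable_within_continuous => z; rewrite in_itv /= => /d h; exact: ex_derive.
have hf' z : z \in `]x, y[ -> is_derive z 1 Phi (gs z).
  by rewrite in_itv /= => /andP[h1 h2]; apply: d; rewrite !ltW.
by have [z _ ->] := MVT xy hf' cf; rewrite mulr_gt0 ?gs_gt0 ?subr_gt0.
Qed.

(** Tonelli's theorem. [D] will be the strip between [s] and its shifted point, and [g s] the normal
    mass of its section, which is what the shift has available to absorb the correction at [s]. *)
Lemma fubini_gauss k (D : set (R * R)) (g : R -> R) : (forall s, 0 <= k s) -> L1 mu k ->
  measurable D -> (forall s, Ex mu (fun z => gs z * \1_D (z, s)) = g s) -> (forall s, 0 <= g s <= 1) ->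
  measurable_fun setT g ->
  let J z := Ex mu (fun s => k s * \1_D (z, s)) in
  [/\ pg J, forall z, 0 <= J z, forall z, L1 mu (fun s => k s * \1_D (z, s)) &
    NN J = Ex mu (fun s => k s * g s)].
Proof.
move=> k0 Lk mD hg g01 mg J.
have mk := L1_meas Lk.
have ind01 (zs : R * R) : (0 <= \1_D zs :> R) && (\1_D zs <= 1 :> R) by rewrite indicE; case: (_ \in _); rewrite /= ?ler01 lexx.
have iD (a : R) zs : 0 <= a -> `|a * \1_D zs| <= a.
  move=> a0; rewrite normrM (ger0_norm a0) ler_piMr// ger0_norm; by case/andP: (ind01 zs).
have mi2 z : measurable_fun setT (fun s => \1_D (z, s) : R).
  by apply: (@measurableT_comp _ _ _ _ _ _ (\1_D : R * R -> R)); [exact: measurable_indic|exact: pair1_measurable].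
have mi1 s : measurable_fun setT (fun z => \1_D (z, s) : R).
  by apply: (@measurableT_comp _ _ _ _ _ _ (\1_D : R * R -> R)); [exact: measurable_indic|exact: pair2_measurable].
have Lz z : L1 mu (fun s => k s * \1_D (z, s)).
  apply: (L1_le _ _ Lk); first by apply: measurable_funM; [exact: mk|exact: (mi2 z)].
  by move=> s; exact: iD.
have Ls s : L1 mu (fun z => gs z * \1_D (z, s)).
  apply: (L1_le _ _ L1_gs); first by apply: measurable_funM; [exact: L1_meas L1_gs|exact: (mi1 s)].
  by move=> z; apply: iD; exact: ltW (gs_gt0 z).
have mf : measurable_fun setT (fun zs : R * R => k zs.2 * \1_D zs).
  by apply: measurable_funM; [apply: measurableT_comp => //|exact: measurable_indic].
have mJ : measurable_fun setT J.
  have h := @measurable_fun_fubini_tonelli_F _ _ _ _ _ mu (fun zs : R * R => (k zs.2 * \1_D zs)%:E) _ _.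
  apply/measurable_EFinP; apply: eq_measurable_fun (h _ _) => [z _||].
  - by rewrite /fubini_F /= Ex_fin.
  - have mf' : measurable_fun setT (fun zs : R * R => (k zs.2 * \1_D zs)%:E) by exact/measurable_EFinP.
    exact: mf'.
  - by move=> zs; rewrite lee_fin mulr_ge0//; case/andP: (ind01 zs).
have J0 z : 0 <= J z by apply: Ex_ge0 => s; rewrite mulr_ge0//; case/andP: (ind01 (z, s)).
have pJ : pg J.
  by apply: (@pg_bounded _ _ (Ex mu k)) => // z; apply: Ex_abs_le => // s; exact: iD.
split=> //.
have mf3 : measurable_fun setT (fun zs : R * R => (k zs.2 * \1_D zs * gs zs.1)%:E).
  apply/measurable_EFinP; apply: measurable_funM => //.
  apply: (@measurableT_comp _ _ _ _ _ _ gs) => //; exact: measurable_normal_pdf.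
have Lkg : L1 mu (fun s => k s * g s).
  apply: (L1_le _ _ Lk); first by apply: measurable_funM; [exact: mk|exact: mg].
  move=> s; case/andP: (g01 s) => g0 g1.
  by rewrite normrM !ger0_norm// ler_piMr.
have E1 z : (\int[mu]_s (k s * \1_D (z, s) * gs z)%:E)%E = (J z * gs z)%:E.
  under eq_integral do rewrite mulrC.
  by rewrite Ex_fin ?ExZ 1?mulrC//; exact: L1Z.
have E2 s : (\int[mu]_z (k s * \1_D (z, s) * gs z)%:E)%E = (k s * g s)%:E.
  under eq_integral do rewrite -mulrA (mulrC (\1_D _)).
  by rewrite Ex_fin ?ExZ ?hg//; exact: L1Z.
apply: EFin_inj; rewrite -(Ex_fin (L1_pg pJ)) -(Ex_fin Lkg).
under eq_integral do rewrite -E1.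
under [RHS]eq_integral do rewrite -E2.
apply: (@fubini_tonelli _ _ _ _ R mu mu (fun zs : R * R => (k zs.2 * \1_D zs * gs zs.1)%:E)).
  exact: mf3.
by move=> zs; rewrite lee_fin !mulr_ge0 ?(ltW (gs_gt0 _))//; case/andP: (ind01 zs).
Qed.

End gaussian_cdf.

(* A definition and not an existential, so that the bounds below are uniform in the law of [W]. *)
Definition bump_const (R : realType) n : R := s2val (cid2 (@test_function R n)).

Lemma bump_const_gt0 (R : realType) n : 0 < bump_const R n.
Proof. exact: (s2valP (cid2 (@test_function R n))). Qed.

(** * One-sided transport bounds *)

Section transport.
Context {R : realType}.
Variables (n : nat) (F T eta Ec tau : R -> R) (kap tau0 Eb : R).
Implicit Types (h k : R -> R) (x y s z r c : R).
Local Notation mu := (@lebesgue_measure R).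

(** This Galois connection characterizes [T] as the generalized inverse of [F] composed with [Phi],
    and covers jumps and flat parts of [F] alike. *)
Hypothesis gal : forall z s, (T z <= s) = (Phi z <= F s).
Hypotheses (eta0 : forall s, 0 <= eta s) (eta_lip : forall x y, `|eta x - eta y| <= `|x - y| / 2).
Hypotheses (mEc : measurable_fun setT Ec) (Ecb : forall s, `|Ec s| <= Eb).
(** [tau] is the part of the correction that the shift leaves uncovered. The weight [|s| ^+ n] is
    the bound on the density of every test function. *)
Hypotheses (tau_ge0 : forall s, 0 <= tau s) (Ltau : L1 mu (fun s => `|s| ^+ n * tau s))
  (tauE : Ex mu (fun s => `|s| ^+ n * tau s) <= tau0).
Hypothesis test : forall (h : nat -> R -> R) k, chain h n ->
  (forall x y, `|h n x - h n y| <= `|x - y|) -> measurable_fun setT k ->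
  L1 mu k -> (exists K, forall s, `|k s| <= K) -> h 0%N = lint k ->
  ((0 < n)%N -> continuous k /\ forall x, is_derive x 1 (h 0%N) (k x)) ->
  `|NN (fun z => h 0%N (T z)) - NN (h 0%N) - Ex mu (fun s => k s * Ec s)| <= kap.

Lemma quantile_lt z s : (s < T z) = (F s < Phi z).
Proof. by rewrite !ltNge gal. Qed.

Lemma quantile_homo z z' : z <= z' -> T z <= T z'.
Proof. by move=> zz; rewrite gal; apply: (le_trans (Phi_homo zz)); rewrite -gal. Qed.

Lemma measurable_quantile : measurable_fun setT T.
Proof. by apply: nondecreasing_measurable => // x y; exact: quantile_homo. Qed.

Lemma measurable_eta : measurable_fun setT eta.
Proof.
apply: continuous_meas; apply: (@lipschitz_continuous _ _ 2^-1) => x y.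
by rewrite mulrC; exact: eta_lip.
Qed.

(** A power of the length of the part of the interval inside [[-r, r]]. The truncation keeps all
    integrals finite and is removed by monotone convergence. *)
Definition clip_len r x y : R := Num.max 0 (Num.min y r - Num.max x (- r)) ^+ n.+1.

Lemma clip_len_ge0 r x y : 0 <= clip_len r x y.
Proof. by rewrite exprn_ge0// le_max lexx. Qed.

Lemma clip_len_out r x y : y <= x -> clip_len r x y = 0.
Proof.
move=> yx; rewrite /clip_len; have -> : Num.max 0 (Num.min y r - Num.max x (- r)) = 0; last by rewrite expr0n.
apply/max_idPl; rewrite subr_le0; apply: (@le_trans _ _ y); first by rewrite ge_min lexx.
by apply: (le_trans yx); rewrite le_max lexx.
Qed.

Lemma clip_len_le r x y : 0 <= r -> clip_len r x y <= (2 * r) ^+ n.+1.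
Proof.
move=> r0; rewrite lerXn2r ?nnegrE ?mulr_ge0 ?le_max ?lexx//.
rewrite ge_max mulr_ge0//= mulr_natl mulr2n lerD// ?ge_min ?lexx ?orbT//.
by rewrite lerNl le_max lexx orbT.
Qed.

Lemma measurable_clip_len r (u v : R -> R) : measurable_fun setT u -> measurable_fun setT v ->
  measurable_fun setT (fun z => clip_len r (u z) (v z)).
Proof.
move=> mu' mv; apply: measurable_funX; apply: measurable_maxr => //.
by apply: measurable_funB; [exact: measurable_minr|exact: measurable_maxr].
Qed.

(** The interior is taken since [B] involves [F], which may jump. Removing the origin puts it in the
    complement, and the distance to it yields the bound [|s| ^+ n] on the density of the test
    function. *)
Definition trunc_region (B : set R) r : set R := [set s | interior B s /\ `|s| < r /\ s != 0].

Lemma open_trunc_region (B : set R) r : open (trunc_region B r).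
Proof.
have -> : trunc_region B r = interior B `&` (`]-r, r[%classic `&` ~` [set 0]).
  apply/seteqP; split => s /=; rewrite /trunc_region /= in_itv /= -ltr_norml.
    by move=> [h1 [h2 /eqP h3]].
  by move=> [h1 [h2 /eqP h3]].
apply: openI; first exact: open_interior.
apply: openI; first exact: interval_open.
by apply: closed_openC; apply: accessible_closed_set1; exact: hausdorff_accessible (@Rhausdorff R).
Qed.

(** Removing the origin may cut the interval in two. The longer piece has at least half of the
    length, hence the factor [2 ^+ n.+1]. *)
Lemma clip_len_lower (B : set R) r c (h : R -> R) x y :
  0 <= c -> (forall x y, x <= y -> h x <= h y) ->
  (forall x y, x < y -> (forall z, x < z < y -> trunc_region B r z) ->
    c * (y - x) ^+ n.+1 <= h y - h x) ->
  x <= y -> (forall s, x < s < y -> B s) ->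
  c * clip_len r x y <= 2 ^+ n.+1 * (h y - h x).
Proof.
move=> c0 hm low xy hB.
have two : 1 <= 2 ^+ n.+1 :> R by rewrite exprn_ege1// ler1n.
set a := Num.max x (- r); set b := Num.min y r.
have hxy : 0 <= h y - h x by rewrite subr_ge0 hm.
case: (leP b a) => ab.
  rewrite /clip_len -/a -/b (max_idPl _) ?subr_le0// expr0n mulr0.
  by rewrite mulr_ge0// exprn_ge0.
rewrite /clip_len -/a -/b (max_idPr _) ?subr_ge0 ?(ltW ab)//.
have xa : x <= a by rewrite le_max lexx.
have ra : - r <= a by rewrite le_max lexx orbT.
have yb : b <= y by rewrite ge_min lexx.
have rb : b <= r by rewrite ge_min lexx orbT.
have reg u v : a <= u -> v <= b -> (v <= 0) || (0 <= u) -> forall z, u < z < v -> trunc_region B r z.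
  move=> au vb uv z /andP[uz zv]; split.
    have xz : x < z by rewrite (le_lt_trans xa (le_lt_trans au uz)).
    have zy : z < y by rewrite (lt_le_trans (lt_le_trans zv vb) yb).
    apply: (@near_dist _ _ (Num.min (z - x) (y - z))); first by rewrite lt_min !subr_gt0 xz.
    move=> t; rewrite lt_min !ltr_norml => /andP[/andP[t1 _] /andP[_ t2]].
    by apply: hB; apply/andP; split; lra.
  split; first by rewrite ltr_norml (le_lt_trans ra (le_lt_trans au uz)) (lt_le_trans (lt_le_trans zv vb) rb).
  by case/orP: uv => h'; [rewrite lt_eqF// (lt_le_trans zv)|rewrite gt_eqF// (le_lt_trans h')].
have whole : (b <= 0) || (0 <= a) -> c * (b - a) ^+ n.+1 <= 2 ^+ n.+1 * (h y - h x).
  move=> ab0; have := low a b ab (reg a b (lexx _) (lexx _) ab0) => /le_trans; apply.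
  apply: (@le_trans _ _ (h y - h x)); first by rewrite lerB ?hm.
  by rewrite ler_peMl.
case: (leP b 0) => b0; first by apply: whole; rewrite b0.
case: (leP 0 a) => a0; first by apply: whole; rewrite a0 orbT.
have l1 := low a 0 a0 (reg a 0 (lexx _) (ltW b0) _).
have l2 := low 0 b b0 (reg 0 b (ltW a0) (lexx _) _).
rewrite lexx orbT in l2; have {}l2 := l2 isT; rewrite lexx in l1; have {}l1 := l1 isT; rewrite sub0r subr0 in l1 l2.
have pw : (b - a) ^+ n.+1 <= 2 ^+ n.+1 * ((- a) ^+ n.+1 + b ^+ n.+1).
  have na0 : 0 <= - a by rewrite oppr_ge0 ltW.
  case: (leP (- a) b) => hab.
    apply: (@le_trans _ _ ((2 * b) ^+ n.+1)).
      by rewrite lerXn2r ?nnegrE ?mulr_ge0 ?(ltW b0)// ?subr_ge0 ?(ltW ab)//; lra.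
    by rewrite exprMn ler_wpM2l ?exprn_ge0// lerDr exprn_ge0.
  apply: (@le_trans _ _ ((2 * - a) ^+ n.+1)).
    by rewrite lerXn2r ?nnegrE ?mulr_ge0// ?subr_ge0 ?(ltW ab)//; lra.
  by rewrite exprMn ler_wpM2l ?exprn_ge0// lerDl exprn_ge0// ltW.
apply: (le_trans (ler_wpM2l c0 pw)); rewrite mulrCA ler_wpM2l ?exprn_ge0//.
have := hm _ _ xa; have := hm _ _ yb; lra.
Qed.

Lemma tau_test k g : measurable_fun setT k -> L1 mu k -> (forall s, 0 <= k s <= `|s| ^+ n) ->
  L1 mu (fun s => k s * g s) -> (forall s, - tau s <= g s) ->
  - tau0 <= Ex mu (fun s => k s * g s).
Proof.
move=> mk Lk k01 Lkg hg; rewrite lerNl -ExN//; apply: le_trans tauE; apply: Ex_le => //.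
  exact: L1N.
move=> s; have /andP[k0 kn] := k01 s; have := hg s; have := tau_ge0 s.
move=> t0 h; have : k s * - tau s <= k s * g s by rewrite ler_wpM2l.
by have := ler_wpM2r t0 kn; lra.
Qed.

Lemma L1_kM k (g : R -> R) (K : R) : L1 mu k -> measurable_fun setT g -> (forall s, `|g s| <= K) ->
  L1 mu (fun s => k s * g s).
Proof.
move=> Lk mg gK; apply: (L1_le _ _ (L1Z K (L1_abs Lk))).
  by apply: measurable_funM; [exact: L1_meas Lk|exact: mg].
by move=> s; rewrite normrM mulrC ler_wpM2r.
Qed.

Lemma Phi_ge0 s : 0 <= Phi s :> R.
Proof.
by rewrite /Phi lintE; apply: Ex_ge0 => z; rewrite mulr_ge0 ?(ltW (gs_gt0 z)).
Qed.

Lemma Phi_le1 s : Phi s <= 1 :> R.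
Proof.
have <- : Ex mu (@gs R) = 1.
  by rewrite /Ex /Rintegral integral_normal_pdf.
rewrite /Phi lintE; apply: Ex_le; [apply: L1_indicM => //; exact: L1_gs|exact: L1_gs|].
by move=> z; rewrite ler_piMr ?(ltW (gs_gt0 z))// indicE; case: (_ \in _).
Qed.

Lemma measurable_Phi : measurable_fun setT (@Phi R).
Proof. by apply: nondecreasing_measurable => // x y; exact: Phi_homo. Qed.

Lemma pg_lint k : L1 mu k -> measurable_fun setT (lint k) -> pg (lint k).
Proof.
move=> Lk ml; apply: (@pg_bounded _ _ (Ex mu (fun s => `|k s|))) => // x.
rewrite lintE; apply: Ex_abs_le; [exact: L1_indicM|exact: L1_abs|].
by move=> s; rewrite normrM ler_piMr// indicE; case: (_ \in _); rewrite ?normr1 ?normr0.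
Qed.

(** As [eta] has Lipschitz constant one half, a step of [2 * eta z] leaves room for the shift at the
    point reached. This is the origin of the factor 2 in the transport bounds. *)
Lemma eta_left z s : s <= z - 2 * eta z -> s + eta s <= z.
Proof. by move=> sz; have := eta_lip s z; have := eta0 z; rewrite !ler_norml => ? /andP[? ?];
  have := ler_norm (s - z); have : `|s - z| = z - s; [by rewrite ler0_norm ?opprB//; lra|lra]. Qed.

Lemma eta_left_lt z s : s < z - 2 * eta z -> s + eta s < z.
Proof. by move=> sz; have := eta_lip s z; have := eta0 z; rewrite !ler_norml => ? /andP[? ?];
  have : `|s - z| = z - s; [by rewrite ler0_norm ?opprB//; lra|lra]. Qed.

Lemma eta_right_lt z s : z + 2 * eta z < s -> z < s - eta s.
Proof. by move=> sz; have := eta_lip s z; have := eta0 z; rewrite !ler_norml => ? /andP[? ?];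
  have : `|s - z| = s - z; [by rewrite ger0_norm//; lra|lra]. Qed.

Lemma eta_right z s : z + 2 * eta z <= s -> z <= s - eta s.
Proof. by move=> sz; have := eta_lip s z; have := eta0 z; rewrite !ler_norml => ? /andP[? ?];
  have : `|s - z| = s - z; [by rewrite ger0_norm//; lra|lra]. Qed.

Lemma test_le k (O : set R) (A I : set R) : (forall s, 0 <= k s) -> (forall s, ~ O s -> k s = 0) ->
  L1 mu (fun s => k s * \1_A s) -> L1 mu (fun s => k s * \1_I s) ->
  (forall s, O s -> A s -> I s) ->
  Ex mu (fun s => k s * \1_A s) <= Ex mu (fun s => k s * \1_I s).
Proof.
move=> k0 kout LA LI h; apply: Ex_le => // s.
case: (pselect (O s)) => Os; last by rewrite kout ?mul0r.
rewrite ler_wpM2l// !indicE; case: (boolP (s \in A)) => //; rewrite inE => As.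
by rewrite (mem_set (h s Os As)).
Qed.

Lemma test_eq0 k (O : set R) (A : set R) : (forall s, ~ O s -> k s = 0) ->
  (forall s, O s -> A s -> False) -> Ex mu (fun s => k s * \1_A s) = 0.
Proof.
move=> kout h; rewrite -[RHS](_ : Ex mu (fun=> 0) = 0); last by rewrite /Ex Rintegral_cst//= mul0r.
apply: eq_Ex => s; case: (pselect (O s)) => Os; last by rewrite kout ?mul0r.
rewrite indicE; case: (boolP (s \in A)) => As; rewrite ?mulr0//.
by case: (h s Os); rewrite inE in As.
Qed.

Lemma measurable_strip (u v : R -> R) : measurable_fun setT u -> measurable_fun setT v ->
  measurable [set zs : R * R | u zs.2 <= zs.1 < v zs.2].
Proof.
move=> mu' mv.
have -> : [set zs : R * R | u zs.2 <= zs.1 < v zs.2] =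
   ((fun zs : R * R => zs.1 - u zs.2) @^-1` `[0, +oo[%classic) `&`
   ((fun zs : R * R => v zs.2 - zs.1) @^-1` `]0, +oo[%classic).
  apply/seteqP; split=> zs /=; rewrite !in_itv /= !andbT subr_ge0 subr_gt0; first by move/andP.
  by move=> [-> ->].
apply: measurableI; rewrite -[X in measurable X]setTI.
  have m : measurable_fun setT (fun zs : R * R => zs.1 - u zs.2).
    by apply: measurable_funB => //; apply: measurableT_comp.
  exact: m.
have m : measurable_fun setT (fun zs : R * R => v zs.2 - zs.1).
  by apply: measurable_funB => //; apply: measurableT_comp.
exact: m.
Qed.

Definition test_props c (O : set R) (h : nat -> R -> R) k :=
  [/\ (forall s, 0 <= k s <= `|s| ^+ n), (forall s, ~ O s -> k s = 0), measurable_fun setT k,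
    L1 mu k & [/\ h 0%N = lint k,
    (forall x y, x < y -> (forall z, x < z < y -> O z) -> c * (y - x) ^+ n.+1 <= h 0%N y - h 0%N x) &
    `|NN (fun z => h 0%N (T z)) - NN (h 0%N) - Ex mu (fun s => k s * Ec s)| <= kap]].

Lemma side_test (B : set R) r : exists h : nat -> R -> R, exists k,
  test_props (bump_const R n) (trunc_region B r) h k.
Proof.
have H := s2valP' (cid2 (@test_function R n)).
have Obnd s : trunc_region B r s -> `|s| < r by case=> _ [].
have O0 : ~ trunc_region B r 0 by case=> _ [_]; rewrite eqxx.
have [h [k [ch lip [mk k01 kout] [h0 dk] low]]] := H _ r (@open_trunc_region B r) Obnd O0.
have kb s : `|k s| <= `|r| ^+ n.
  have /andP[k0 kn] := k01 s; rewrite ger0_norm//.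
  case: (pselect (trunc_region B r s)) => Os; last by rewrite kout// exprn_ge0.
  apply: (le_trans kn); rewrite lerXn2r ?nnegrE//.
  by rewrite (le_trans (ltW (Obnd s Os)))// ler_norm.
have Lk : L1 mu k.
  apply: (L1_bounded_support (r := r) mk kb) => s rs; apply: kout => /Obnd.
  by rewrite ltNge rs.
exists h, k; split=> //; split=> //.
by apply: test => //; exists (`|r| ^+ n).
Qed.

Section integrate.
Variables (c r : R) (B : set R) (h : nat -> R -> R) (k : R -> R).
Hypotheses (c0 : 0 < c) (r0 : 0 <= r) (tp : test_props c (trunc_region B r) h k).

Let k0 s : 0 <= k s. Proof. by case: tp => H _ _ _ _; case/andP: (H s). Qed.
Let Lk : L1 mu k. Proof. by case: tp. Qed.
Let kout s : ~ trunc_region B r s -> k s = 0. Proof. by case: tp => _ H _ _ _; exact: H. Qed.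
Let hE : h 0%N = lint k. Proof. by case: tp => _ _ _ _ []. Qed.

Lemma test_homo x y : x <= y -> h 0%N x <= h 0%N y.
Proof. by rewrite hE; apply: lint_homo. Qed.

Lemma test_diff x y (b1 b2 : bool) : x <= y ->
  h 0%N y - h 0%N x = Ex mu (fun s => k s * \1_[set` Interval (BSide b1 x) (BSide b2 y)] s).
Proof. by rewrite hE; apply: lint_diff_itv. Qed.

Lemma test_pg : pg (h 0%N).
Proof.
rewrite hE; apply: pg_lint => //; apply: nondecreasing_measurable => // x y.
exact: lint_homo.
Qed.

Lemma test_pgT : pg (fun z => h 0%N (T z)).
Proof.
have [mh [C [m [C0 hC]]]] := test_pg.
have mhT : measurable_fun setT (fun z => h 0%N (T z)).
  by apply: nondecreasing_measurable => // x y xy; apply: test_homo; exact: quantile_homo.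
apply: (@pg_bounded _ _ (Ex mu (fun s => `|k s|))) => // x.
rewrite hE lintE; apply: Ex_abs_le; [exact: L1_indicM|exact: L1_abs|].
by move=> s; rewrite normrM ler_piMr// indicE; case: (_ \in _); rewrite ?normr1 ?normr0.
Qed.

(* [sg] is [1] or [-1]: the two signs bound the two one-sided transport distances. *)
Lemma side_bound (sg : R) (x y g : R -> R) (J : R -> R) :
  sg = 1 \/ sg = -1 -> measurable_fun setT x -> measurable_fun setT y -> pg J ->
  NN J = Ex mu (fun s => k s * g s) -> measurable_fun setT g -> (forall s, `|g s| <= 1) ->
  (forall s, - tau s <= sg * Ec s + g s) ->
  (forall z, c * clip_len r (x z) (y z) <=
     2 ^+ n.+1 * (sg * (h 0%N z - h 0%N (T z)) - J z)) ->
  c * NN (fun z => clip_len r (x z) (y z)) <= 2 ^+ n.+1 * (kap + tau0).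
Proof.
move=> sg1 mx my pJ NJ mg g1 dom ptw.
have pc : pg (fun z => clip_len r (x z) (y z)).
  apply: (@pg_bounded _ _ ((2 * r) ^+ n.+1)); first exact: measurable_clip_len.
  by move=> z; rewrite ger0_norm ?clip_len_ge0 ?clip_len_le.
have ph := test_pg; have phT := test_pgT.
have pd : pg (fun z => sg * (h 0%N z - h 0%N (T z)) - J z) by apply: pgB => //; apply: pgZ; exact: pgB.
rewrite -NNZ//; apply: (le_trans (NN_le (pgZ _ pc) (pgZ _ pd) ptw)).
rewrite NNZ// ler_wpM2l ?exprn_ge0//.
rewrite NNB//; last by apply: pgZ; exact: pgB.
rewrite NNZ ?NNB//; last exact: pgB.
have [k01 _ mk _ [_ _ hk]] := tp.
have LkE : L1 mu (fun s => k s * Ec s) by apply: L1_kM.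
have Lkg : L1 mu (fun s => k s * g s) by apply: L1_kM.
have LkD : L1 mu (fun s => k s * (sg * Ec s + g s)).
  by apply: eq_L1 (L1D (L1Z sg LkE) Lkg) => s; ring.
have := tau_test mk Lk k01 LkD dom.
have -> : Ex mu (fun s => k s * (sg * Ec s + g s)) = sg * Ex mu (fun s => k s * Ec s) + NN J.
  by rewrite NJ -ExZ// -ExD//; [apply: eq_Ex => s; ring|exact: L1Z].
move: hk; rewrite ler_norml => /andP[h1 h2].
by case: sg1 => ->; lra.
Qed.

End integrate.

Hypotheses (dom_plus : forall s, - tau s <= Ec s + (Phi (s + eta s) - Phi s))
  (dom_minus : forall s, - tau s <= - Ec s + (Phi s - Phi (s - eta s))).

Lemma Phi_diff_le1 x y : x <= y -> `|Phi y - Phi x| <= 1 :> R.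
Proof.
move=> xy; rewrite ger0_norm ?subr_ge0 ?Phi_homo//.
by have := Phi_ge0 x; have := Phi_le1 y; lra.
Qed.

Lemma strip_mass (u v : R) s : u <= v -> Ex mu (fun z => gs z * \1_[set z | u <= z < v] z) = Phi v - Phi u.
Proof.
move=> uv; rewrite /Phi (lint_diff_itv true true L1_gs uv); apply: eq_Ex => z.
by congr (_ * _); rewrite !indicE !mem_setE /= in_itv.
Qed.

Theorem transport_bound r : 0 <= r ->
  bump_const R n * NN (fun z => clip_len r (T z) (z - 2 * eta z)) <= 2 ^+ n.+1 * (kap + tau0) /\
  bump_const R n * NN (fun z => clip_len r (z + 2 * eta z) (T z)) <= 2 ^+ n.+1 * (kap + tau0).
Proof.
set c := bump_const R n; have c0 : 0 < c by exact: bump_const_gt0.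
have H := side_test; move=> r0.
have mT := measurable_quantile; have me := measurable_eta.
have mid : measurable_fun setT (fun z : R => z) by exact: measurable_id.
have mPhi := measurable_Phi.
have m2 : measurable_fun setT (fun z => 2 * eta z) by exact: measurable_funM.
have mp : measurable_fun setT (fun z => z + eta z) by exact: measurable_funD.
have mm : measurable_fun setT (fun z => z - eta z) by exact: measurable_funB.
split.
  (* If [T z] lies below [z - 2 * eta z], the whole interval between these two points is contained
     in [B], so the test function grows along it. *)
  pose B := [set s | Phi (s + eta s) < F s].
  have [h [k tp]] := H B r; have [k01 kout mk Lk [hE low _]] := tp.
  have k0 s : 0 <= k s by case/andP: (k01 s).
  pose D := [set zs : R * R | zs.2 <= zs.1 < zs.2 + eta zs.2].
  have OB s : trunc_region B r s -> Phi (s + eta s) < F s by case=> /interior_subset.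
  have se s : s <= s + eta s by rewrite lerDl.
  have mg : measurable_fun setT (fun s => Phi (s + eta s) - Phi s).
    by apply: measurable_funB => //; apply: measurableT_comp.
  have g01 s : 0 <= Phi (s + eta s) - Phi s <= 1.
    rewrite subr_ge0 Phi_homo//=; by have := Phi_diff_le1 (se s); rewrite ler_norml => /andP[].
  have [pJ J0 LJ EJ] := fubini_gauss k0 Lk (measurable_strip mid mp)
     (fun s => strip_mass s (se s)) g01 mg.
  (* The strip integral is the part of the increment of [h] used up by the shift. It is supported
     between [z - 2 * eta z] and [z], so the increment from [T z] to [z - 2 * eta z] remains; in the
     other positions of [T z] it is enough that the difference is nonnegative. *)
  have ptw z : c * clip_len r (T z) (z - 2 * eta z) <=
      2 ^+ n.+1 * (1 * (h 0%N z - h 0%N (T z)) - Ex mu (fun s => k s * \1_D (z, s))).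
    rewrite mul1r; set y := z - 2 * eta z.
    have yz : y <= z by rewrite /y lerBlDr lerDl mulr_ge0.
    have JE : Ex mu (fun s => k s * \1_D (z, s)) = Ex mu (fun s => k s * \1_[set s | D (z, s)] s) by [].
    have LA := LJ z.
    case: (leP (T z) y) => Ty.
      apply: (le_trans (clip_len_lower (B := B) (ltW c0) (test_homo tp) low Ty _)).
        move=> s /andP[Ts sy]; apply: lt_le_trans (Phi_lt (eta_left_lt sy)) _.
        by rewrite -gal ltW.
      rewrite ler_wpM2l ?exprn_ge0//.
      suff : Ex mu (fun s => k s * \1_D (z, s)) <= h 0%N z - h 0%N y by lra.
      rewrite (test_diff tp false false yz) JE.
      apply: (test_le k0 kout) => //; first exact: L1_indicM.
      move=> s _ /= /andP[sz zs]; rewrite in_itv /= sz andbT ltNge; apply/negP => /eta_left.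
      by rewrite leNgt zs.
    rewrite clip_len_out ?(ltW Ty)// mulr0 mulr_ge0 ?exprn_ge0// subr_ge0.
    have OT s : trunc_region B r s -> D (z, s) -> T z <= s.
      move=> Os /andP[_ zs]; rewrite gal; apply: le_trans (ltW (OB s Os)).
      by apply: Phi_homo; exact: ltW.
    case: (leP (T z) z) => Tz.
      rewrite (test_diff tp true false Tz) JE; apply: (test_le k0 kout) => //; first exact: L1_indicM.
      by move=> s Os hD; rewrite /= in_itv /= (OT s Os hD); case/andP: hD.
    rewrite JE (test_eq0 kout); last first.
      by move=> s Os hD; have := OT s Os hD; case/andP: hD => /= sz _; rewrite leNgt (le_lt_trans sz Tz).
    rewrite -opprB (test_diff tp true true (ltW Tz)) (test_eq0 kout) ?oppr0//.
    move=> s Os; rewrite /= in_itv /= => /andP[zs sT].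
    rewrite quantile_lt in sT; have := lt_trans (OB s Os) sT.
    by rewrite ltNge Phi_homo// (le_trans zs).
  have my : measurable_fun setT (fun z => z - 2 * eta z) by exact: measurable_funB.
  apply: (side_bound r0 tp (sg := 1) (x := T) (y := fun z => z - 2 * eta z) _ mT my pJ EJ mg _ _ ptw); first by left.
  - by move=> s; exact: Phi_diff_le1.
  - by move=> s; rewrite mul1r.
(* The mirror image, for points that are transported to the right. *)
pose B := [set s | F s < Phi (s - eta s)].
have [h [k tp]] := H B r; have [k01 kout mk Lk [hE low _]] := tp.
have k0 s : 0 <= k s by case/andP: (k01 s).
pose D := [set zs : R * R | zs.2 - eta zs.2 <= zs.1 < zs.2].
have OB s : trunc_region B r s -> F s < Phi (s - eta s) by case=> /interior_subset.
have se s : s - eta s <= s by rewrite lerBlDr lerDl.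
have mg : measurable_fun setT (fun s => Phi s - Phi (s - eta s)).
  by apply: measurable_funB => //; apply: measurableT_comp.
have g01 s : 0 <= Phi s - Phi (s - eta s) <= 1.
  rewrite subr_ge0 Phi_homo//=; by have := Phi_diff_le1 (se s); rewrite ler_norml => /andP[].
have [pJ J0 LJ EJ] := fubini_gauss k0 Lk (measurable_strip mm mid)
   (fun s => strip_mass s (se s)) g01 mg.
have ptw z : c * clip_len r (z + 2 * eta z) (T z) <=
    2 ^+ n.+1 * (-1 * (h 0%N z - h 0%N (T z)) - Ex mu (fun s => k s * \1_D (z, s))).
  rewrite mulN1r opprB; set y := z + 2 * eta z.
  have zy : z <= y by rewrite /y lerDl mulr_ge0.
  have JE : Ex mu (fun s => k s * \1_D (z, s)) = Ex mu (fun s => k s * \1_[set s | D (z, s)] s) by [].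
  have LA := LJ z.
  case: (leP y (T z)) => Ty.
    apply: (le_trans (clip_len_lower (B := B) (ltW c0) (test_homo tp) low Ty _)).
      move=> s /andP[ys sT]; rewrite quantile_lt in sT; apply: (lt_le_trans sT).
      by apply: Phi_homo; apply: eta_right; exact: ltW.
    rewrite ler_wpM2l ?exprn_ge0//.
    suff : Ex mu (fun s => k s * \1_D (z, s)) <= h 0%N y - h 0%N z by lra.
    rewrite (test_diff tp false false zy) JE.
    apply: (test_le k0 kout) => //; first exact: L1_indicM.
    move=> s _ /= /andP[sz zs]; rewrite in_itv /= zs leNgt; apply/negP => /eta_right_lt.
    by rewrite ltNge sz.
  rewrite clip_len_out ?(ltW Ty)// mulr0 mulr_ge0 ?exprn_ge0// subr_ge0.
  have OT s : trunc_region B r s -> D (z, s) -> s < T z.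
    move=> Os /andP[sz _]; rewrite quantile_lt; apply: (lt_le_trans (OB s Os)).
    exact: Phi_homo.
  case: (leP z (T z)) => Tz.
    rewrite (test_diff tp false false Tz) JE; apply: (test_le k0 kout) => //; first exact: L1_indicM.
    by move=> s Os hD; rewrite /= in_itv /= (ltW (OT s Os hD)) andbT; case/andP: hD.
  rewrite JE (test_eq0 kout); last first.
    by move=> s Os hD; have := OT s Os hD; case/andP: hD => /= _ zs; rewrite ltNge (ltW (lt_trans Tz zs)).
  rewrite -opprB (test_diff tp true true (ltW Tz)) (test_eq0 kout) ?oppr0//.
  move=> s Os; rewrite /= in_itv /= => /andP[Ts sz].
  rewrite gal in Ts; have := le_lt_trans Ts (OB s Os).
  by rewrite ltNge Phi_homo// (le_trans (se s))// ltW.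
have my : measurable_fun setT (fun z => z + 2 * eta z) by exact: measurable_funD.
apply: (side_bound r0 tp (sg := -1) (x := fun z => z + 2 * eta z) (y := T) _ my mT pJ EJ mg _ _ ptw); first by right.
- by move=> s; exact: Phi_diff_le1.
- by move=> s; rewrite mulN1r.
Qed.

End transport.

(** * Size of the correction and of small shifts of the normal law *)

Section hermite_bound.
Context {R : realType}.
Implicit Types (s x y : R) (m n : nat).
Local Notation mu := (@lebesgue_measure R).
Local Notation bas x := (1 + `|x|) (only parsing).

Lemma hermite_le m s : `|hermite m s| <= 2 ^+ m * m`!%:R * bas s ^+ m.
Proof.
have b1 := bas_ge1 s.
elim/ltn_ind: m => -[_|m IH]; first by rewrite fact0 !mulr1 normr1.
have h1 := IH m (ltnSn m).
rewrite hermiteS (le_trans (ler_normB _ _))//.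
have A : `|s * hermite m s| <= 2 ^+ m * m`!%:R * bas s ^+ m.+1.
  by rewrite normrM exprS mulrCA ler_pM// lerDr.
have Bd : `|m%:R * hermite m.-1 s| <= 2 ^+ m * m`!%:R * bas s ^+ m.+1.
  case: m IH {h1 A} => [|m] IH; first by rewrite mul0r normr0 !mulr_ge0 ?exprn_ge0 ?(ltW (bas_gt0 s)).
  rewrite normrM ger0_norm//.
  have := IH m (leqW (ltnSn m)) => /(ler_wpM2l (ler0n R m.+1)) /le_trans; apply.
  rewrite factS natrM mulrA [leLHS](_ : _ = 2 ^+ m * (m.+1%:R * m`!%:R) * bas s ^+ m); last by ring.
  rewrite ler_pM ?mulr_ge0 ?exprn_ge0 ?(ltW (bas_gt0 s))//.
    by rewrite mulrA ler_wpM2r// ler_wpM2r// ler_weXn2l// ler1n.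
  by rewrite ler_weXn2l// leqW// leqW.
apply: (le_trans (lerD A Bd)).
rewrite [leLHS](_ : _ = 2 ^+ m.+1 * m`!%:R * bas s ^+ m.+1); last by rewrite (exprS 2); ring.
rewrite ler_wpM2r ?exprn_ge0 ?(ltW (bas_gt0 s))// ler_wpM2l ?exprn_ge0//.
by rewrite ler_nat factS leq_pmull.
Qed.

Definition hermite_sum M : R := \sum_(m < M) 2 ^+ m * m`!%:R.

(** Up to sign, the correction of the distribution function: [hermite m * gs] has derivative minus
    [hermite m.+1 * gs], which accounts for the drop in the index. *)
Definition corr_density M (e : nat -> R) s : R := \sum_(m < M) e m.+1 * hermite m s * gs s.

Lemma corr_density_le M (e : nat -> R) E s : 0 <= E -> (forall m, (0 < m <= M)%N -> `|e m| <= E) ->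
  `|corr_density M e s| <= E * hermite_sum M * bas s ^+ M * gs s.
Proof.
move=> E0 he; rewrite (le_trans (ler_norm_sum _ _ _))//.
rewrite /hermite_sum mulr_sumr !mulr_suml; apply: ler_sum => m _.
rewrite !normrM (gtr0_norm (gs_gt0 s)) ler_wpM2r ?(ltW (gs_gt0 s))// -mulrA.
rewrite ler_pM//; first by apply: he; rewrite ltn_ord.
apply: (le_trans (hermite_le m s)); rewrite ler_wpM2l ?mulr_ge0 ?exprn_ge0//.
by rewrite ler_weXn2l ?bas_ge1// ltnW.
Qed.

Lemma hermite_sum_ge0 M : 0 <= hermite_sum M.
Proof. by apply: sumr_ge0 => m _; rewrite mulr_ge0 ?exprn_ge0. Qed.

Lemma measurable_corr_density M (e : nat -> R) : measurable_fun setT (corr_density M e).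
Proof.
apply: measurable_sum => m; apply: measurable_funM; last exact: measurable_normal_pdf.
by apply: measurable_funM => //; apply: continuous_meas; exact: hermite_continuous.
Qed.

Lemma power_sub_le m x y K : 0 <= x <= K -> 0 <= y <= K ->
  `|x ^+ m - y ^+ m| <= m%:R * K ^+ m.-1 * `|x - y|.
Proof.
move=> /andP[x0 xK] /andP[y0 yK]; have K0 := le_trans x0 xK.
rewrite subrXX normrM mulrC ler_wpM2r// (le_trans (ler_norm_sum _ _ _))//.
rewrite mulr_natl -[X in _ *+ X]card_ord -sumr_const; apply: ler_sum => i _.
rewrite normrM !normrX !ger0_norm//.
have -> : (m.-1 - i = m - i.+1)%N by lia.
rewrite [X in K ^+ X](_ : m.-1 = (m - i.+1 + i)%N); last by have := ltn_ord i; lia.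
by rewrite exprD ler_pM ?exprn_ge0// lerXn2r ?nnegrE.
Qed.

(** Half the square of [s + t] exceeds half the square of [s] by at most [|t| (|s| + |t|)]. *)
Lemma gs_shift_ge s t : `|t| * (`|s| + `|t|) <= 1 -> gs s <= expR 1 * gs (s + t).
Proof.
move=> h; rewrite !gsE mulrCA ler_wpM2l ?(ltW gpk_gt0)// /gex -expRD ler_expR.
have h1 : s * t <= `|s| * `|t| by rewrite -normrM ler_norm.
have h2 : t ^+ 2 = `|t| ^+ 2 by rewrite real_normK ?num_real.
nra.
Qed.

Lemma Phi_shift_ge s t : 0 <= t -> t * (`|s| + t) <= 1 ->
  expR (-1) * gs s * t <= Phi (s + t) - Phi s /\ expR (-1) * gs s * t <= Phi s - Phi (s - t).
Proof.
move=> t0 h.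
have key a b : a <= b -> b - a = t -> (forall z, a <= z <= b -> `|z - s| <= t) ->
    expR (-1) * gs s * t <= Phi b - Phi a.
  move=> ab e hz; rewrite -e /Phi (lint_diff L1_gs ab) -(Ex_itv ab) -ExZ; last exact: L1_itv.
  apply: Ex_le; [exact: L1Z (L1_itv a b)|apply: L1_indicM => //; exact: L1_gs|].
  move=> z; rewrite !indicE !mem_setE /= in_itv /=.
  case: (boolP (a < z <= b)) => hh; last by rewrite !mulr0.
  rewrite !mulr1; have hz' : `|z - s| <= t by apply: hz; case/andP: hh => h1 ->; rewrite ltW.
  have := @gs_shift_ge s (z - s) _; rewrite addrCA subrr addr0 => H.
  rewrite expRN mulrC ler_pdivrMr ?expR_gt0// mulrC; apply: H.
  apply: le_trans h; rewrite ler_pM ?addr_ge0//; by rewrite lerD2l.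
split; apply: key.
- by rewrite lerDl.
- by ring.
- by move=> z /andP[h1 h2]; rewrite ger0_norm ?subr_ge0//; lra.
- by rewrite lerBlDr lerDl.
- by ring.
- by move=> z /andP[h1 h2]; rewrite ler0_norm ?subr_le0//; lra.
Qed.

End hermite_bound.

Section transport_limit.
Context {R : realType}.
Implicit Types (u v : R -> R) (n : nat).
Local Notation mu := (@lebesgue_measure R).

Lemma pos_part_ge0 (a : R) : 0 <= Num.max 0 a.
Proof. by rewrite le_max lexx. Qed.

Lemma pos_part_le (a b : R) : a <= b -> Num.max 0 a <= Num.max 0 b.
Proof. by move=> ab; rewrite ge_max !le_max lexx ab orbT. Qed.

Lemma clip_len_limit n u v c A : 0 < c -> measurable_fun setT u -> measurable_fun setT v ->
  (forall r, 0 <= r -> c * NN (fun z => clip_len n r (u z) (v z)) <= A) ->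
  (\int[mu]_z (Num.max 0 (v z - u z) ^+ n.+1 * gs z)%:E <= (A / c)%:E)%E.
Proof.
move=> c0 mu' mv hA.
pose f (m : nat) z := (clip_len n m%:R (u z) (v z) * gs z)%:E.
have mf m : measurable_fun setT (f m).
  apply/measurable_EFinP; apply: measurable_funM; last exact: measurable_normal_pdf.
  exact: measurable_clip_len.
have f0 m z : setT z -> (0 <= f m z)%E.
  by move=> _; rewrite lee_fin mulr_ge0 ?clip_len_ge0 ?(ltW (gs_gt0 z)).
have fh z : setT z -> {homo f^~ z : a b / (a <= b)%N >-> (a <= b)%E}.
  move=> _ a b ab; rewrite lee_fin ler_wpM2r ?(ltW (gs_gt0 z))//.
  have ab' : (a%:R : R) <= b%:R by rewrite ler_nat.
  rewrite /clip_len lerXn2r ?nnegrE ?pos_part_ge0//; apply: pos_part_le; apply: lerB.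
    by rewrite le_min ge_min lexx /= ge_min ab' orbT.
  by rewrite ge_max le_max lexx /= le_max lerN2 ab' orbT.
have fin m : (\int[mu]_z f m z <= (A / c)%:E)%E.
  have pc : pg (fun z => clip_len n m%:R (u z) (v z)).
    apply: (@pg_bounded _ _ ((2 * m%:R) ^+ n.+1)); first exact: measurable_clip_len.
    by move=> z; rewrite ger0_norm ?clip_len_ge0 ?clip_len_le.
  rewrite /f (Ex_fin (L1_pg pc)) lee_fin ler_pdivlMr// mulrC.
  exact: hA.
have lim z : (Num.max 0 (v z - u z) ^+ n.+1 * gs z)%:E = limn (f^~ z).
  apply/esym/cvg_lim => //; apply: cvg_near_cst.
  exists (Num.truncn (`|u z| + `|v z|)).+1 => //= m /= hm.
  have hm' : `|u z| + `|v z| <= m%:R.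
    have := truncnS_gt (`|u z| + `|v z|) => h; apply: (le_trans (ltW h)).
    by rewrite ler_nat.
  congr (_ * _)%:E; rewrite /clip_len.
  have -> : Num.min (v z) m%:R = v z.
    by apply/min_idPl; apply: le_trans hm'; apply: (le_trans (ler_norm _)); rewrite lerDr.
  have -> // : Num.max (u z) (- m%:R) = u z.
  apply/max_idPl; rewrite lerNl; apply: le_trans hm'; apply: (le_trans (ler_norm _)).
  by rewrite normrN lerDl.
under eq_integral do rewrite lim.
rewrite (monotone_convergence mu measurableT mf f0 fh).
apply: lime_le; last by near=> m; exact: fin.
apply: ereal_nondecreasing_is_cvgn => a b ab; apply: ge0_le_integral => //.
- by move=> z _; exact: f0.
- exact: mf.
- exact: mf.
- by move=> z _; exact: fh.
Unshelve. all: by end_near. Qed.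

Lemma abs_split n (x y t : R) : 0 <= t ->
  `|x - y| ^+ n.+1 <= 3 ^+ n.+1 * (Num.max 0 (y - 2 * t - x) ^+ n.+1 +
     Num.max 0 (x - (y + 2 * t)) ^+ n.+1 + (2 * t) ^+ n.+1).
Proof.
move=> t0; set a := Num.max 0 (y - 2 * t - x); set b := Num.max 0 (x - (y + 2 * t)).
have a0 : 0 <= a by rewrite le_max lexx.
have b0 : 0 <= b by rewrite le_max lexx.
have ha : y - 2 * t - x <= a by rewrite le_max lexx orbT.
have hb : x - (y + 2 * t) <= b by rewrite le_max lexx orbT.
have h : `|x - y| <= a + b + 2 * t by rewrite ler_norml; apply/andP; split; lra.
pose m := Num.max a (Num.max b (2 * t)).
have am : a <= m by rewrite le_max lexx.
have bm : b <= m by rewrite le_max; apply/orP; right; rewrite le_max lexx.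
have tm : 2 * t <= m by rewrite le_max; apply/orP; right; rewrite le_max lexx orbT.
have mc : m = a \/ m = b \/ m = 2 * t.
  by rewrite /m !maxEle; case: ifP => _; [case: ifP => _; auto|auto].
have m0 : 0 <= m := le_trans a0 am.
clearbody m a b.
have hm : `|x - y| <= 3 * m by lra.
apply: (@le_trans _ _ ((3 * m) ^+ n.+1)); first by rewrite lerXn2r ?nnegrE// mulr_ge0.
rewrite exprMn ler_wpM2l ?exprn_ge0//.
have pa : 0 <= a ^+ n.+1 by rewrite exprn_ge0.
have pb : 0 <= b ^+ n.+1 by rewrite exprn_ge0.
have pt : 0 <= (2 * t) ^+ n.+1 by rewrite exprn_ge0// mulr_ge0.
by case: mc => [->|[->|->]]; lra.
Qed.

End transport_limit.

(** * The shift that absorbs the correction *)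

Section corrected_transport.
Context {R : realType}.
Implicit Types (F T : R -> R) (e : nat -> R) (s x y z : R) (n M : nat).
Local Notation mu := (@lebesgue_measure R).
Local Notation bas x := (1 + `|x|) (only parsing).

Section shift.
Variables (n M : nat) (E0 del : R) (e : nat -> R).
Hypotheses (E00 : 0 <= E0) (del0 : 0 < del).
Hypothesis e_le : forall m, (0 < m <= M)%N -> `|e m| <= E0 * del.

(** Chosen so that [expR (-1) * gs s] times the shift, a lower bound for the normal mass it gains,
    dominates the correction of the distribution function. The factor [expR 1] compensates the loss
    in [gs_shift_ge], and the added 1 keeps the slope positive. *)
Definition shift_slope : R := expR 1 * (E0 * hermite_sum M + 1).

Lemma shift_slope_gt0 : 0 < shift_slope.
Proof. by rewrite mulr_gt0 ?expR_gt0// ltr_wpDl// mulr_ge0 ?hermite_sum_ge0. Qed.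

Lemma slope_del_ge0 : 0 <= shift_slope * del.
Proof. by rewrite mulr_ge0// ltW// shift_slope_gt0. Qed.

(** Normalized for [slope_cutoff], which gives both the Lipschitz constant one half of [eta] and the
    smallness required by [Phi_shift_ge]. *)
Definition shift_small : R := (2 * M.+1%:R * shift_slope)^-1.

Lemma shift_small_gt0 : 0 < shift_small.
Proof. by rewrite invr_gt0; apply: mulr_gt0; [exact: mulr_gt0|exact: shift_slope_gt0]. Qed.

Hypothesis del_small : del <= shift_small.

(* [1 + L], beyond which the correction is negligible and the shift is frozen. *)
Definition cutoff : R := (shift_small / del) `^ (M.+1%:R^-1).

Lemma cutoff_pow : cutoff ^+ M.+1 = shift_small / del.
Proof.
rewrite /cutoff -powR_mulrn ?powR_ge0// -powRrM mulVf ?pnatr_eq0// powRr1//.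
by rewrite divr_ge0 ?(ltW shift_small_gt0)// ltW.
Qed.

Lemma cutoff_ge1 : 1 <= cutoff.
Proof.
have h : 1 <= shift_small / del by rewrite ler_pdivlMr// mul1r.
rewrite leNgt; apply/negP => c1; move: h; rewrite -cutoff_pow leNgt => /negP; apply.
by rewrite exprn_ilt1// powR_ge0.
Qed.

Lemma cutoff_gt0 : 0 < cutoff. Proof. exact: lt_le_trans ltr01 cutoff_ge1. Qed.

Definition eta s : R := shift_slope * del * (Num.min (bas s) cutoff) ^+ M.

Lemma eta_ge0 s : 0 <= eta s.
Proof.
rewrite /eta mulr_ge0 ?slope_del_ge0// exprn_ge0//.
by rewrite le_min (ltW (bas_gt0 s)) (ltW cutoff_gt0).
Qed.

Lemma slope_cutoff : M.+1%:R * (shift_slope * del * cutoff ^+ M.+1) = 2^-1.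
Proof.
rewrite cutoff_pow /shift_small; field.
by rewrite !gt_eqF ?shift_slope_gt0// ltr0n.
Qed.

Lemma min_bas_range s : 0 <= Num.min (bas s) cutoff <= cutoff.
Proof. by rewrite le_min (ltW (bas_gt0 s)) (ltW cutoff_gt0)/= ge_min lexx orbT. Qed.

Lemma min_bas_lip x y : `|Num.min (bas x) cutoff - Num.min (bas y) cutoff| <= `|x - y|.
Proof.
have h1 := ler_dist_dist x y; move: h1; rewrite ler_norml => /andP[h1 h2].
rewrite ler_norml; have := normr_ge0 (x - y) => h0.
by rewrite !minEle; case: ifPn; rewrite -?ltNge => c1; case: ifPn; rewrite -?ltNge => c2; apply/andP; split; lra.
Qed.

Lemma eta_lip x y : `|eta x - eta y| <= `|x - y| / 2.
Proof.
have sd := slope_del_ge0.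
rewrite /eta -mulrBr normrM (ger0_norm sd).
have h := power_sub_le M (min_bas_range x) (min_bas_range y).
have h2 := min_bas_lip x y.
apply: (le_trans (ler_wpM2l sd (le_trans h (ler_wpM2l _ h2)))).
  by rewrite mulr_ge0// exprn_ge0// ltW// cutoff_gt0.
rewrite mulrA [leRHS]mulrC ler_wpM2r// -slope_cutoff mulrCA; apply: ler_pM => //.
  by rewrite mulr_ge0// exprn_ge0// ltW// cutoff_gt0.
  by rewrite ler_nat.
by rewrite ler_wpM2l// ler_weXn2l ?cutoff_ge1//; lia.
Qed.

Lemma eta_le s : eta s <= shift_slope * del * bas s ^+ M.
Proof.
rewrite ler_wpM2l ?slope_del_ge0//.
have /andP[h _] := min_bas_range s.
by rewrite lerXn2r ?nnegrE ?(ltW (bas_gt0 s))// ge_min lexx.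
Qed.

Definition Ecor := corr_density M e.
Definition far_part s : R := if bas s <= cutoff then 0 else `|Ecor s|.

Lemma Ecor_le s : `|Ecor s| <= expR (-1) * gs s * (shift_slope * del * bas s ^+ M).
Proof.
have h := corr_density_le s (mulr_ge0 E00 (ltW del0)) e_le.
apply: (le_trans h); rewrite /shift_slope expRN.
rewrite [leRHS](_ : _ = (E0 * hermite_sum M + 1) * (del * bas s ^+ M * gs s)); last first.
  by field; rewrite gt_eqF// expR_gt0.
rewrite [leLHS](_ : _ = (E0 * hermite_sum M) * (del * bas s ^+ M * gs s)); last by ring.
rewrite ler_wpM2r ?lerDl// !mulr_ge0 ?(ltW del0) ?exprn_ge0 ?(ltW (bas_gt0 s)) ?(ltW (gs_gt0 s))//.
Qed.

Lemma dom_both s : - far_part s <= Ecor s + (Phi (s + eta s) - Phi s) /\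
  - far_part s <= - Ecor s + (Phi s - Phi (s - eta s)).
Proof.
rewrite /far_part; case: (leP (bas s) cutoff) => hs; last first.
  have h1 := ler_norm (Ecor s); have h2 := ler_norm (- Ecor s); rewrite normrN in h2.
  have e0 := eta_ge0 s.
  have : Phi s <= Phi (s + eta s) by apply: Phi_homo; rewrite lerDl.
  have : Phi (s - eta s) <= Phi s by apply: Phi_homo; rewrite lerBlDr lerDl.
  by split; lra.
have E : eta s = shift_slope * del * bas s ^+ M by rewrite /eta (min_idPl hs).
have eb : eta s * bas s <= 2^-1.
  rewrite E -mulrA -exprSr -slope_cutoff.
  apply: (@le_trans _ _ (shift_slope * del * cutoff ^+ M.+1)).
    by rewrite ler_wpM2l ?slope_del_ge0// lerXn2r ?nnegrE ?(ltW (bas_gt0 s)) ?(ltW cutoff_gt0).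
  by rewrite ler_peMl ?ler1n// mulr_ge0 ?slope_del_ge0// exprn_ge0// ltW// cutoff_gt0.
have e0 := eta_ge0 s.
have he : eta s * (`|s| + eta s) <= 1.
  by have := normr_ge0 s; have : 1 <= bas s := bas_ge1 s; nra.
have [p1 p2] := Phi_shift_ge e0 he.
have := Ecor_le s; rewrite -E ler_norml => /andP[h1 h2].
by split; lra.
Qed.

Definition tail_const : R :=
  (E0 * hermite_sum M) * (shift_small^-1) ^+ n * NN (fun s => bas s ^+ (n + M + M.+1 * n)).

Lemma measurable_bas : measurable_fun setT (fun s : R => bas s).
Proof. by apply: measurable_funD => //; exact: measurableT_comp. Qed.

Lemma measurable_tail : measurable_fun setT far_part.
Proof.
apply: measurable_fun_ifT => //.
  exact: measurable_fun_ler measurable_bas _.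
by apply: measurableT_comp => //; exact: measurable_corr_density.
Qed.

(** Beyond the cutoff [(del / shift_small) * (1 + |s|) ^+ M.+1] exceeds 1, so its [n]-th power may
    be inserted: polynomial growth, harmless against the Gaussian, is traded for [del ^+ n]. One
    more [del] comes from the coefficients. *)
Lemma tail_le s : `|s| ^+ n * far_part s <=
  (E0 * del * hermite_sum M) * (shift_small^-1 * del) ^+ n * (bas s ^+ (n + M + M.+1 * n) * gs s).
Proof.
have b0 := ltW (bas_gt0 s); have g0 := ltW (gs_gt0 s).
have K0 : 0 <= E0 * del * hermite_sum M by rewrite !mulr_ge0 ?hermite_sum_ge0// ltW.
have sm : 0 <= shift_small^-1 * del by apply: mulr_ge0; [rewrite invr_ge0; exact: ltW shift_small_gt0|exact: ltW].
rewrite /far_part; case: (leP (bas s) cutoff) => hs.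
  by rewrite mulr0; apply: mulr_ge0; apply: mulr_ge0 => //; exact: exprn_ge0.
have h := corr_density_le s (mulr_ge0 E00 (ltW del0)) e_le.
have h1 : `|s| ^+ n <= bas s ^+ n by rewrite lerXn2r ?nnegrE// lerDr.
apply: (le_trans (ler_pM _ _ h1 h)); rewrite ?exprn_ge0//.
rewrite [leLHS](_ : _ = (E0 * del * hermite_sum M) * (bas s ^+ (n + M) * gs s)); last by rewrite exprD; ring.
rewrite [leRHS](_ : _ = (E0 * del * hermite_sum M) * (bas s ^+ (n + M) * gs s *
   ((shift_small^-1 * del) ^+ n * bas s ^+ (M.+1 * n)))); last by rewrite (exprD _ (n + M)); ring.
rewrite ler_wpM2l// ler_peMr//; first by apply: mulr_ge0 => //; exact: exprn_ge0.
rewrite exprM -exprMn exprn_ege1//.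
have : cutoff ^+ M.+1 <= bas s ^+ M.+1 by rewrite lerXn2r ?nnegrE ?(ltW cutoff_gt0)// ltW.
rewrite cutoff_pow => h3; apply: le_trans (ler_wpM2l sm h3).
by rewrite le_eqVlt; apply/orP; left; apply/eqP; field; rewrite !gt_eqF// shift_small_gt0.
Qed.

Lemma L1_tail : L1 mu (fun s => `|s| ^+ n * far_part s).
Proof.
apply: (L1_le _ _ (L1Z ((E0 * del * hermite_sum M) * (shift_small^-1 * del) ^+ n) (L1_pg (pg_bas (n + M + M.+1 * n))))).
  apply: measurable_funM; last exact: measurable_tail.
  have m : measurable_fun setT (fun s : R => `|s| ^+ n).
    by apply: pg_meas; apply: pgX; apply: pg_abs; exact: pg_id.
  exact: m.
move=> s; rewrite ger0_norm ?tail_le// mulr_ge0 ?exprn_ge0// /far_part.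
by case: ifP.
Qed.

Lemma Ex_tail : Ex mu (fun s => `|s| ^+ n * far_part s) <= tail_const * del ^+ n.+1.
Proof.
have p := L1_pg (pg_bas (R := R) (n + M + M.+1 * n)).
apply: (le_trans (Ex_le L1_tail (L1Z _ p) tail_le)).
rewrite ExZ// /tail_const -/(NN _) exprMn exprS.
by rewrite le_eqVlt; apply/orP; left; apply/eqP; ring.
Qed.

Variables (F T : R -> R) (kap : R).
Hypothesis gal : forall z s, (T z <= s) = (Phi z <= F s).
Hypotheses (e0 : e 0%N = 1) (en0 : n = 0%N -> forall m, (0 < m)%N -> e m = 0).
Hypothesis test : forall h : nat -> R -> R, chain h n ->
  (forall x y, `|h n x - h n y| <= `|x - y|) ->
  (exists C, forall x y, `|h 0%N x - h 0%N y| <= C * `|x - y|) ->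
  `|NN (fun z => h 0%N (T z)) - \sum_(m < M.+1) e m * NN (fun x => hermite m x * h 0%N x)| <= kap.

(** One integration by parts replaces the pairing of [hermite m.+1] with [h] by that of [hermite m]
    with the derivative [k], which is the pairing with [Ecor]. For [n = 0] the function [k] may
    jump, but then all the coefficients vanish. *)
Lemma corrected_test (h : nat -> R -> R) k : chain h n ->
  (forall x y, `|h n x - h n y| <= `|x - y|) -> measurable_fun setT k ->
  L1 mu k -> (exists K, forall s, `|k s| <= K) -> h 0%N = lint k ->
  ((0 < n)%N -> continuous k /\ forall x, is_derive x 1 (h 0%N) (k x)) ->
  `|NN (fun z => h 0%N (T z)) - NN (h 0%N) - Ex mu (fun s => k s * Ecor s)| <= kap.
Proof.
move=> ch lip mk Lk [K kK] hE dk.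
have lip0 x y : `|h 0%N x - h 0%N y| <= K * `|x - y| by rewrite hE; apply: lint_lipschitz.
have := test ch lip (ex_intro _ K lip0); congr (`| _ | <= _).
rewrite -addrA -opprD; congr (_ - _).
rewrite big_ord_recl e0 mul1r; congr (_ + _).
  by apply: eq_Ex => z; rewrite /= mul1r.
have pk : pg k by exact: pg_bounded mk kK.
transitivity (Ex mu (fun s => \sum_(m < M) e m.+1 * (hermite m s * k s * gs s))); last first.
  apply: eq_Ex.
  by move=> s; rewrite /Ecor /corr_density mulr_sumr; apply: eq_bigr => m _; ring.
rewrite Ex_sum; last by move=> m; apply: L1Z; apply: L1_pg; exact: pg_hermiteM.
apply: eq_bigr => m _ /=; rewrite ExZ; last by apply: L1_pg; exact: pg_hermiteM.
case: (posnP n) => n0; first by rewrite (en0 n0)// !mul0r.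
have [ck dh] := dk n0; congr (_ * _); apply: NN_hermiteS => //.
have ch0 : continuous (h 0%N) by move=> x; exact: der_continuous (dh x).
split; first exact: continuous_meas.
exists (`|h 0%N 0| + K), 1%N; have K0 : 0 <= K := le_trans (normr_ge0 _) (kK 0).
split=> [|x]; first exact: addr_ge0.
have := lip0 x 0; rewrite subr0 expr1 => hx.
have := ler_normD (h 0%N x - h 0%N 0) (h 0%N 0); rewrite subrK.
by have := mulr_ge0 (normr_ge0 (h 0%N 0)) (normr_ge0 x); lra.
Qed.

Lemma Ecor_bounded s : `|Ecor s| <= expR (-1) * (shift_slope * del) * (gpk * Kpow M).
Proof.
apply: (le_trans (Ecor_le s)).
rewrite [leLHS](_ : _ = expR (-1) * (shift_slope * del) * (bas s ^+ M * gs s)); last by ring.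
rewrite ler_wpM2l//; first by apply: mulr_ge0; [exact: expR_ge0|exact: slope_del_ge0].
rewrite gsE mulrCA ler_wpM2l ?(ltW gpk_gt0)//; apply: (le_trans (pow_decay M s)).
rewrite ler_piMr ?(ltW (Kpow_gt0 M))// -expR0 ler_expR oppr_le0.
by rewrite divr_ge0// sqr_ge0.
Qed.

Definition transport_const : R :=
  3 ^+ n.+1 * (2 * (2 ^+ n.+1 * (1 + tail_const) / bump_const R n) +
    (2 * shift_slope) ^+ n.+1 * NN (fun s => bas s ^+ (M * n.+1))).

Lemma tail_const_ge0 : 0 <= tail_const.
Proof.
rewrite /tail_const mulr_ge0//.
  apply: mulr_ge0; first by rewrite mulr_ge0// hermite_sum_ge0.
  by apply: exprn_ge0; rewrite invr_ge0; exact: ltW shift_small_gt0.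
apply: Ex_ge0 => s; by rewrite mulr_ge0 ?exprn_ge0 ?(ltW (bas_gt0 _)) ?(ltW (gs_gt0 _)).
Qed.

Lemma eta_pow z : (2 * eta z) ^+ n.+1 <= (2 * shift_slope * del) ^+ n.+1 * bas z ^+ (M * n.+1).
Proof.
have h0 : 0 <= 2 * eta z by rewrite mulr_ge0 ?eta_ge0.
have h1 : 2 * eta z <= 2 * shift_slope * del * bas z ^+ M.
  by rewrite -(mulrA 2) -(mulrA 2) ler_wpM2l// eta_le.
by rewrite exprM -exprMn lerXn2r ?nnegrE// (le_trans h0).
Qed.

(** Of the three parts of [abs_split], the two overshoots are bounded by [transport_bound] after
    letting the truncation grow, and the third by a Gaussian moment of the shift. *)
Theorem corrected_transport :
  (\int[mu]_z (`|T z - z| ^+ n.+1 * gs z)%:E <= (transport_const * (kap + del ^+ n.+1))%:E)%E.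
Proof.
have tg s : 0 <= far_part s by rewrite /far_part; case: ifP.
have main r : 0 <= r -> _ := transport_bound gal eta_ge0 eta_lip (measurable_corr_density M e)
  Ecor_bounded tg L1_tail Ex_tail corrected_test (fun s => (dom_both s).1) (fun s => (dom_both s).2) (r := r).
have mT : measurable_fun setT T := measurable_quantile gal.
have me : measurable_fun setT eta := measurable_eta eta_lip.
have mid : measurable_fun setT (fun z : R => z) by exact: measurable_id.
have m2 : measurable_fun setT (fun z => 2 * eta z) by exact: measurable_funM.
have ma : measurable_fun setT (fun z => z - 2 * eta z) by exact: measurable_funB.
have mb : measurable_fun setT (fun z => z + 2 * eta z) by exact: measurable_funD.
have c0 := bump_const_gt0 R n.
have I1 := clip_len_limit c0 mT ma (fun r r0 => (main r r0).1).
have I2 := clip_len_limit c0 mb mT (fun r r0 => (main r r0).2).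
set c := bump_const R n in I1 I2 *; set A := 2 ^+ n.+1 * _ in I1 I2.
have d0 : 0 <= del := ltW del0.
have kap0 : 0 <= kap.
  have Z : `|NN (fun z => 0) - \sum_(m < M.+1) e m * NN (fun x => hermite m x * 0)| <= kap.
    apply: (test (h := fun _ _ => 0)).
    - by move=> k _ x; exact: der_cst.
    - by move=> x y; rewrite subrr normr0.
    - by exists 0 => x y; rewrite subrr normr0 mul0r.
  exact: le_trans (normr_ge0 _) Z.
have pe : pg (fun z => (2 * shift_slope * del) ^+ n.+1 * bas z ^+ (M * n.+1)).
  by apply: pgZ; exact: pg_bas.
have mf (f : R -> R) : measurable_fun setT f -> measurable_fun setT (fun z => (f z * gs z)%:E).
  move=> hf; apply/measurable_EFinP; apply: measurable_funM => //; exact: measurable_normal_pdf.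
have m1 : measurable_fun setT (fun z => Num.max 0 (z - 2 * eta z - T z) ^+ n.+1).
  by apply: measurable_funX; apply: measurable_maxr => //; exact: measurable_funB.
have m3 : measurable_fun setT (fun z => Num.max 0 (T z - (z + 2 * eta z)) ^+ n.+1).
  by apply: measurable_funX; apply: measurable_maxr => //; exact: measurable_funB.
pose f1 z := (Num.max 0 (z - 2 * eta z - T z) ^+ n.+1 * gs z)%:E.
pose f2 z := (Num.max 0 (T z - (z + 2 * eta z)) ^+ n.+1 * gs z)%:E.
pose f3 z := ((2 * shift_slope * del) ^+ n.+1 * bas z ^+ (M * n.+1) * gs z)%:E.
have pos_g a : 0 <= a -> forall z : R, (0 <= (a * gs z)%:E)%E.
  by move=> a0 z; rewrite lee_fin mulr_ge0// ltW// gs_gt0.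
have f10 z : (0 <= f1 z)%E by apply: pos_g; rewrite exprn_ge0 ?pos_part_ge0.
have f20 z : (0 <= f2 z)%E by apply: pos_g; rewrite exprn_ge0 ?pos_part_ge0.
have sd : 0 <= 2 * shift_slope * del by rewrite -mulrA; apply: mulr_ge0 => //; exact: slope_del_ge0.
have f30 z : (0 <= f3 z)%E.
  by apply: pos_g; rewrite mulr_ge0 ?exprn_ge0 ?(ltW (bas_gt0 z)).
have I3 : (\int[mu]_z f3 z = ((2 * shift_slope * del) ^+ n.+1 * NN (fun s => bas s ^+ (M * n.+1)))%:E)%E.
  by rewrite /f3 (Ex_fin (L1_pg pe)) -NNZ //; exact: pg_bas.
have mf1 : measurable_fun setT f1 by exact: (mf _ m1).
have mf2 : measurable_fun setT f2 by exact: (mf _ m3).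
have mf3 : measurable_fun setT f3 by exact: (mf _ (pg_meas pe)).
have mf12 : measurable_fun setT (fun z => f1 z + f2 z)%E by exact: emeasurable_funD.
have mf123 : measurable_fun setT (fun z => f1 z + f2 z + f3 z)%E by exact: emeasurable_funD.
apply: (@le_trans _ _ (\int[mu]_z ((3 ^+ n.+1)%:E * (f1 z + f2 z + f3 z)))%E).
  apply: ge0_le_integral => //.
  - by move=> z _; apply: pos_g; rewrite exprn_ge0.
  - apply: mf; apply: measurable_funX; apply: measurableT_comp => //; exact: measurable_funB.
  - by apply: measurable_funeM; exact: mf123.
  - move=> z _; rewrite -!EFinD -EFinM lee_fin -!mulrDl mulrA ler_wpM2r ?(ltW (gs_gt0 z))//.
    apply: (le_trans (abs_split n (T z) z (eta_ge0 z))); rewrite ler_wpM2l ?exprn_ge0//.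
    by rewrite lerD2l eta_pow.
have ZI : (\int[mu]_z ((3 ^+ n.+1)%:E * (f1 z + f2 z + f3 z)) = (3 ^+ n.+1)%:E * (\int[mu]_z f1 z + \int[mu]_z f2 z + \int[mu]_z f3 z))%E.
  rewrite ge0_integralZl_EFin; [|exact: measurableT|by move=> z _; rewrite !adde_ge0|exact: mf123|exact: exprn_ge0].
  rewrite ge0_integralD; [|exact: measurableT|by move=> z _; rewrite adde_ge0|exact: mf12|by []|exact: mf3].
  by rewrite ge0_integralD; [|exact: measurableT|by []|exact: mf1|by []|exact: mf2].
rewrite ZI.
apply: (@le_trans _ _ ((3 ^+ n.+1)%:E * ((A / c)%:E + (A / c)%:E + ((2 * shift_slope * del) ^+ n.+1 * NN (fun s => bas s ^+ (M * n.+1)))%:E))%E).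
  by apply: lee_wpmul2l; [rewrite lee_fin exprn_ge0|rewrite I3; apply: leeD => //; exact: leeD].
rewrite -!EFinD -EFinM lee_fin /transport_const -/c.
have NB : 0 <= NN (fun s : R => bas s ^+ (M * n.+1)).
  by apply: Ex_ge0 => s; rewrite mulr_ge0 ?exprn_ge0 ?(ltW (bas_gt0 _)) ?(ltW (gs_gt0 _)).
have dn0 : 0 <= del ^+ n.+1 by exact: exprn_ge0.
have U0 : 0 <= (2 * shift_slope) ^+ n.+1.
  by rewrite exprn_ge0// mulr_ge0// ltW// shift_slope_gt0.
have Q0 : 0 <= 2 ^+ n.+1 / c by rewrite divr_ge0 ?exprn_ge0// ltW.
have S0 : 0 <= 3 ^+ n.+1 :> R by rewrite exprn_ge0.
rewrite /A (exprMn n.+1 (2 * shift_slope)) -[leRHS]mulrA ler_wpM2l// -subr_ge0.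
have t0 := tail_const_ge0.
move: (NN (fun s => bas s ^+ (M * n.+1))) (del ^+ n.+1) ((2 * shift_slope) ^+ n.+1) (tail_const) NB dn0 U0 t0 => nb d U t nb0 d0' U0 t0.
rewrite [leRHS](_ : _ = 2 * (2 ^+ n.+1 / c) * d + 2 * (2 ^+ n.+1 / c) * t * kap + U * nb * kap); last by ring.
move: (2 ^+ n.+1 / c) Q0 => X X0.
by rewrite !addr_ge0// !mulr_ge0.
Qed.

End shift.

End corrected_transport.

(** * Quantile coupling and Wasserstein distance *)

Section quantile.
Context {R : realType}.
Implicit Types (x y z s c : R) (f F : R -> R).
Local Notation mu := (@lebesgue_measure R).

Lemma eq_distribution d1 d2 (O1 : measurableType d1) (O2 : measurableType d2)
    (P1 : probability O1 R) (P2 : probability O2 R) (X1 : {RV P1 >-> R}) (X2 : {RV P2 >-> R}) :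
  (forall x, cdf X1 x = cdf X2 x) ->
  forall B : set R, measurable B -> distribution P1 X1 B = distribution P2 X2 B.
Proof.
move=> E B mB.
have fin d (O : measurableType d) (P' : probability O R) (X : {RV P' >-> R}) (D : set R) : measurable D ->
    distribution P' X D \is a fin_num.
  by move=> mD; rewrite fin_num_measure.
have cE d (O : measurableType d) (P' : probability O R) (X : {RV P' >-> R}) x :
    distribution P' X `]x, +oo[ = (1 - cdf X x)%E.
  by rewrite -setCitvl probability_setC.
apply: (@measure_unique _ R _ (@RGenOInfty.G R) (fun k => `]- k%:R, +oo[%classic)) => //.
- exact: RGenOInfty.measurableE.
- move=> _ _ [a ->] [b ->]; exists (Num.max a b); apply/seteqP; split=> [x|x] /=.
    by rewrite !in_itv/= !andbT gt_max => -[-> ->].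
  by rewrite !in_itv/= !andbT gt_max => /andP[].
- by move=> i; eexists.
- apply/seteqP; split=> // x _; exists (Num.truncn `|x|).+1 => //=.
  rewrite in_itv/= andbT ltrNl; apply: (le_lt_trans (ler_norm _)); rewrite normrN.
  by case/andP: (truncn_itv (normr_ge0 x)).
- by move=> _ [x ->]; transitivity (1 - cdf X1 x)%E; [exact: cE|rewrite E; exact/esym/cE].
- by move=> k; rewrite ltey_eq fin.
Qed.

Definition quantile F y : R := inf [set x | y <= F x].

(** The Galois connection of a distribution function and its generalized inverse; right continuity
    gives the implication from left to right. *)
Lemma quantile_le F y s : {homo F : a b / a <= b} -> (forall x, F x @[x --> x^'+] --> F x) ->
  (exists x, F x < y) -> (exists x, y < F x) -> (quantile F y <= s) = (y <= F s).
Proof.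
move=> hF rF [x0 lo] [x1 hi].
have lb : has_lbound [set x | y <= F x].
  exists x0 => x /= yx; rewrite leNgt; apply/negP => xx0.
  by have := le_lt_trans (le_trans yx (hF _ _ (ltW xx0))) lo; rewrite ltxx.
apply/idP/idP => h; last exact: ge_inf.
rewrite leNgt; apply/negP => Fs.
have : \forall x \near s^'+, F x < y by apply: (cvgr_lt (F s)) => //; exact: rF.
move=> H; have [x [Fx sx]] := @filter_ex _ _ (at_right_proper_filter s) _ (filterI H (nbhs_right_gt s)).
have [z yz zx] : exists2 z, y <= F z & z < x.
  have [|z Hz zx] := @inf_lt _ [set x | y <= F x] x _ (le_lt_trans h sx); last by exists z.
  by exists x1; exact: ltW.
by have := le_lt_trans (le_trans yz (hF _ _ (ltW zx))) Fx; rewrite ltxx.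
Qed.

Lemma Phi_gt0 z : 0 < Phi z :> R.
Proof. by apply: (le_lt_trans (Phi_ge0 (z - 1))); apply: Phi_lt; rewrite ltrBlDr ltrDl. Qed.

Lemma Phi_lt1 z : Phi z < 1 :> R.
Proof. by apply: lt_le_trans (Phi_le1 (z + 1)); apply: Phi_lt; rewrite ltrDl. Qed.

Definition gauss : probability (measurableTypeR R) R := normal_prob 0 1.

Import HBNNSimple.

(** The normal law is given by integrals of its density over sets; the formula is checked on simple
    functions and extended by monotone convergence. *)
Lemma ge0_integral_gauss f : measurable_fun setT f -> (forall x, 0 <= f x) ->
  (\int[gauss]_x (f x)%:E = \int[mu]_x (f x * gs x)%:E)%E.
Proof.
move=> mf f0.
have mg : measurable_fun setT (EFin \o (gs : R -> R)).
  by apply/measurable_EFinP; exact: measurable_normal_pdf.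
have mE : measurable_fun setT (EFin \o f) by exact/measurable_EFinP.
pose f_ := @nnsfun_approx _ (measurableTypeR R) R setT measurableT (EFin \o f) mE.
have cf x : (f_ n x)%:E @[n --> \oo] --> (f x)%:E.
  by apply: (@cvg_nnsfun_approx _ (measurableTypeR R) R setT measurableT (EFin \o f) mE) => // z _; rewrite lee_fin.
have g0 x : (0 <= (gs x : R)%:E)%E by rewrite lee_fin ltW ?gs_gt0.
have nn (h : {nnsfun measurableTypeR R >-> R}) : (\int[gauss]_x (h x)%:E = \int[mu]_x ((h x)%:E * (gs x)%:E))%E.
  under [LHS]eq_integral do rewrite fimfunE -fsumEFin//.
  rewrite [LHS]ge0_integral_fsum//; last 2 first.
  - by move=> r; exact/measurable_EFinP/measurableT_comp.
  - by move=> n x _; rewrite EFinM nnfun_muleindic_ge0.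
  under [RHS]eq_integral.
    move=> x xD; rewrite fimfunE -fsumEFin// ge0_mule_fsuml; last first.
      by move=> r; rewrite EFinM nnfun_muleindic_ge0.
    over.
  rewrite [RHS]ge0_integral_fsum//; last 2 first.
  - move=> r; apply: emeasurable_funM => //; exact/measurable_EFinP/measurableT_comp.
  - by move=> n x _; rewrite mule_ge0// EFinM nnfun_muleindic_ge0.
  apply: eq_fsbigr => r _; rewrite integralZl_indic_nnsfun//= integral_indic//= setIT.
  rewrite [in LHS]/normal_prob integral_mkcond -integralZl//.
    apply: eq_integral => x _; rewrite patchE indicE EFinM.
    by case: ifP => _; rewrite ?mule1 ?mule0 ?mul0e// mul1e.
  rewrite -integrable_mkcond; last exact: measurable_funPTI.
  by apply: (integrableS measurableT _ _ (@L1_gs R)) => //; exact: measurable_funPTI.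
transitivity (limn (fun n => \int[gauss]_x (f_ n x)%:E))%E.
  rewrite -monotone_convergence//=.
  - apply: eq_integral => ? /[!inE] xD; apply/esym/cvg_lim => //=; exact: cf.
  - by move=> n; exact/measurable_EFinP/measurable_funTS.
  - by move=> n ? _; rewrite lee_fin.
  - by move=> ? _ ? ? mn; rewrite lee_fin; exact/lefP/nd_nnsfun_approx.
transitivity (limn (fun n => \int[mu]_x ((f_ n x)%:E * (gs x)%:E)))%E.
  by apply: congr_lim; apply/funext => n /=; exact: nn.
rewrite -monotone_convergence//=.
- apply: eq_integral => x _; apply/cvg_lim => //; rewrite EFinM.
  by apply: cvgeMr => //; exact: cf.
- by move=> n; apply: emeasurable_funM => //; exact/measurable_EFinP/measurable_funTS.
- by move=> n ? _; rewrite mule_ge0// lee_fin.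
- by move=> x _ ? ? mn; rewrite lee_wpmul2r// lee_fin; exact/lefP/nd_nnsfun_approx.
Qed.

Lemma gauss_itv y : gauss `]-oo, y]%classic = (Phi y)%:E.
Proof.
rewrite /gauss /= /normal_prob /Phi /lint /Rintegral fineK//.
apply: integrable_fin_num => //; apply: integrableS (@L1_gs R) => //.
Qed.

(** [Phi] of a normal variable is uniform: a level strictly between 0 and 1 is attained by the
    intermediate value theorem, and the sublevel set is a half-line. *)
Lemma gauss_Phi c : 0 <= c <= 1 -> gauss [set z | Phi z <= c] = c%:E.
Proof.
case/andP=> c0 c1.
have [c_lt0|c_gt0] := leP c 0.
  have -> : c = 0 by apply/eqP; rewrite eq_le c_lt0.
  rewrite (_ : [set _ | _] = set0) ?measure0//.
  by apply/seteqP; split=> // z /=; rewrite leNgt Phi_gt0.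
have [c_ge1|c_lt1] := leP 1 c.
  have -> : c = 1 by apply/eqP; rewrite eq_le c1.
  rewrite (_ : [set _ | _] = setT) ?probability_setT//.
  by apply/seteqP; split=> // z /= _; exact: Phi_le1.
pose I : {RV gauss >-> R} := @mfun_Sub _ _ (measurableTypeR R) R id (mem_set (@measurable_id _ (measurableTypeR R) setT)).
have cI x : cdf I x = (Phi x)%:E by exact: gauss_itv.
have [a ha] : exists a, Phi a < c.
  have h : fine \o cdf I @ -oo --> (0 : R) by exact/fine_cvg/cvg_cdfNy0.
  have [x] := filter_ex (cvgr_lt 0 h c c_gt0).
  by rewrite /comp cI; exists x.
have [b hb] : exists b, c < Phi b.
  have h : fine \o cdf I @ +oo --> (1 : R) by exact/fine_cvg/cvg_cdfy1.
  have [x] := filter_ex (cvgr_gt 1 h c c_lt1).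
  by rewrite /comp cI; exists x.
have ab : a <= b by rewrite leNgt; apply/negP => /Phi_lt h; have := lt_trans (lt_trans ha hb) h; rewrite ltxx.
have [||y _ Ey] := @IVT R Phi a b c ab.
- apply: continuous_subspaceT => x.
  by apply: differentiable_continuous; apply/derivable1_diffP; apply: ex_derive; apply: der_lint; [exact: L1_gs|exact: gs_continuous].
- by rewrite ge_min le_max (ltW ha) (ltW hb) orbT.
rewrite -Ey -gauss_itv; congr (gauss _); apply/seteqP; split=> z /=; rewrite in_itv/=.
  by rewrite !leNgt => /negP h; apply/negP => /Phi_lt.
exact: Phi_homo.
Qed.

End quantile.

Section quantile_coupling.
Context {R : realType} d {Om : measurableType d} (P : probability Om R) (W : {RV P >-> R}).
Implicit Types (z s c : R) (h : R -> R).
Local Notation mu := (@lebesgue_measure R).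

Let F s := fine (cdf W s).
Definition transport z := quantile F (Phi z).

Let FE s : (F s)%:E = cdf W s. Proof. by rewrite fineK ?fin_num_measure. Qed.

Lemma transport_le z s : (transport z <= s) = (Phi z <= F s).
Proof.
apply: quantile_le.
- by move=> a b ab; rewrite -lee_fin !FE cdf_nondecreasing.
- by move=> x; apply: fine_cvg; rewrite FE; exact: cdf_right_continuous.
- have h : F @ -oo --> (0 : R) by exact/fine_cvg/cvg_cdfNy0.
  by have [x] := filter_ex (cvgr_lt 0 h _ (Phi_gt0 z)); exists x.
- have h : F @ +oo --> (1 : R) by exact/fine_cvg/cvg_cdfy1.
  by have [x] := filter_ex (cvgr_gt 1 h _ (Phi_lt1 z)); exists x.
Qed.

Lemma measurable_transport : measurable_fun setT transport.
Proof. exact: measurable_quantile transport_le. Qed.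

Definition transport_RV : {RV (@gauss R) >-> R} :=
  @mfun_Sub _ _ (measurableTypeR R) R _ (mem_set measurable_transport).

Lemma transport_law (B : set R) : measurable B ->
  distribution gauss transport_RV B = distribution P W B.
Proof.
apply: eq_distribution => x; rewrite -[RHS]FE -[RHS]gauss_Phi.
  by congr (gauss _); apply/seteqP; split=> z /=; rewrite in_itv/= transport_le.
by rewrite -!lee_fin FE cdf_ge0 cdf_le1.
Qed.

Lemma ge0_integral_transport h : measurable_fun setT h -> (forall x, 0 <= h x) ->
  (\int[P]_x (h (W x))%:E = \int[mu]_z (h (transport z) * gs z)%:E)%E.
Proof.
move=> mh h0; have mE : measurable_fun setT (EFin \o h) by exact/measurable_EFinP.
transitivity (\int[distribution P W]_y (h y)%:E)%E.
  by rewrite ge0_integral_distribution// => y; rewrite lee_fin.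
transitivity (\int[distribution gauss transport_RV]_y (h y)%:E)%E.
  by apply: eq_measure_integral => B mB _; apply/esym/transport_law.
rewrite ge0_integral_distribution//.
rewrite -ge0_integral_gauss//; apply: measurableT_comp => //; exact: measurable_transport.
Qed.

(** The formula for nonnegative functions is applied to [|h|] and to [h + |h|], whose difference is
    [h]. *)
Lemma Ex_transport h : measurable_fun setT h -> L1 P (fun x => h (W x)) ->
  Ex P (fun x => h (W x)) = NN (fun z => h (transport z)).
Proof.
move=> mh Lh.
have nn (g : R -> R) : measurable_fun setT g -> (forall x, 0 <= g x) -> L1 P (fun x => g (W x)) ->
    L1 mu (fun z => g (transport z) * gs z) /\ Ex P (fun x => g (W x)) = NN (fun z => g (transport z)).
  move=> mg g0 Lg; have E := ge0_integral_transport mg g0.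
  have mgT : measurable_fun setT (fun z => (g (transport z) * gs z)%:E).
    apply/measurable_EFinP; apply: measurable_funM; last exact: measurable_normal_pdf.
    by apply: measurableT_comp => //; exact: measurable_transport.
  split; last by rewrite /NN /Ex /Rintegral E.
  apply/integrableP; split; first exact: mgT.
  under eq_integral do rewrite gee0_abs ?lee_fin ?mulr_ge0 ?(ltW (gs_gt0 _))//=.
  by rewrite -E (Ex_fin Lg) ltry.
have La := L1_abs Lh.
have mha : measurable_fun setT (fun x => `|h x|) by exact: measurableT_comp.
have [L1a E1] := nn _ mha (fun x => normr_ge0 _) La.
have [||L2 E2] := nn (fun x => h x + `|h x|) (measurable_funD mh mha).
- by move=> x; rewrite addrC -lerBlDr sub0r; apply: le_trans (ler_norm _) _; rewrite normrN.
- exact: L1D.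
transitivity (Ex P (fun x => (h (W x) + `|h (W x)|) - `|h (W x)|)).
  by apply: eq_Ex => x; rewrite addrK.
rewrite ExB//; last exact: L1D.
rewrite E1 E2 /NN -ExB//; apply: eq_Ex => z; ring.
Qed.

Definition transport_pair (z : measurableTypeR R) : (R * R)%type := (transport z, z).

Lemma measurable_transport_pair : measurable_fun setT transport_pair.
Proof. by apply: measurable_fun_pair; [exact: measurable_transport|exact: measurable_id]. Qed.

Definition transport_pair_RV : {RV (@gauss R) >-> (R * R)%type} :=
  @mfun_Sub _ _ (measurableTypeR R) (R * R)%type _ (mem_set measurable_transport_pair).

Definition transport_coupling : probability (R * R)%type R := distribution gauss transport_pair_RV.

Lemma transport_couplingP : is_coupling (distribution P W) (normal_prob 0 1) transport_coupling.
Proof. by split=> B mB; [rewrite -transport_law|]. Qed.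

Lemma wasserstein_le p (K : R) : (0 < p)%N -> 0 <= K ->
  (\int[mu]_z (`|transport z - z| ^+ p * gs z)%:E <= K%:E)%E ->
  (wasserstein p (distribution P W) (normal_prob 0 1) <= (K `^ (p%:R^-1))%:E)%E.
Proof.
move=> p0 K0 hK.
have mp : measurable_fun setT (fun z : R * R => `|z.1 - z.2| ^+ p).
  by apply: measurable_funX; apply: measurableT_comp => //; exact: measurable_funB.
have mT : measurable_fun setT (fun z => `|transport z - z| ^+ p).
  apply: measurable_funX; apply: measurableT_comp => //; apply: measurable_funB => //; exact: measurable_transport.
apply: (@le_trans _ _ ((\int[transport_coupling]_z (`|z.1 - z.2| ^+ p)%:E) `^ (p%:R^-1))%E).
  by apply: ereal_inf_lbound; exists transport_coupling => //; exact: transport_couplingP.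
rewrite -poweR_EFin; apply: gt0_ler_poweR.
- by rewrite invr_ge0.
- by rewrite in_itv /= leey andbT; apply: integral_ge0 => z _; rewrite lee_fin.
- by rewrite in_itv /= leey andbT lee_fin.
rewrite /transport_coupling ge0_integral_distribution//; first by rewrite ge0_integral_gauss.
exact/measurable_EFinP.
Qed.

End quantile_coupling.

(** * From the expansion to the Wasserstein distance *)

Section corrected_wasserstein.
Context {R : realType}.
Variables (p : nat) (B : R).
Hypotheses (p0 : (0 < p)%N) (B1 : 1 <= B).

Let M := (3 * p)%N.
Let E0 := corr_const p B ^+ M.

(** This threshold and [wass_const] depend on [p] and [B] only, so that they serve a whole sequence
    of laws at once. *)
Definition wass_small : R := Num.min 1 (shift_small M E0).
Definition wass_const : R :=
  (transport_const p.-1 M E0 * (defect_const p M B p + 1)) `^ (p%:R^-1).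

Let E00 : 0 <= E0.
Proof. by rewrite exprn_ge0// (le_trans ler01)// corr_const_ge1. Qed.

Lemma wass_small_gt0 : 0 < wass_small.
Proof. by rewrite lt_min ltr01 shift_small_gt0. Qed.

Variables (d : measure_display) (Om : measurableType d) (P : probability Om R) (W : {RV P >-> R}).
Variables (b : nat -> nat -> R) (del : R).
Hypotheses (momW : L1 P (fun o => `|W o| ^+ p.+1)) (EW0 : Ex P W = 0)
  (EW2 : Ex P (fun o => W o ^+ 2) = 1).
Hypotheses (del0 : 0 < del) (del_small : del <= wass_small).
Hypothesis b_le : forall q k, (q <= p)%N -> (1 < k <= q)%N -> `|b q k| <= B * del ^+ k.-1.
Hypothesis expansion : forall q (F : nat -> R -> R) w, (0 < q <= p)%N -> chain F q -> osc w (F q) ->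
  `|Ex P (fun o => W o * F 0%N (W o)) - \sum_(k < q.+1) b q k * Ex P (fun o => F k (W o))|
    <= B * w * del ^+ q.

Theorem corrected_wasserstein :
  (wasserstein p (distribution P W) (normal_prob 0 1) <= (wass_const * del)%:E)%E.
Proof.
(* The correction is bounded in powers of the cube root of the rate; its powers [3 * k] become
   [del ^+ k]. *)
pose eps := del `^ 3^-1.
have eps3 : eps ^+ 3 = del by rewrite -powR_mulrn ?powR_ge0// -powRrM mulVf// powRr1// ltW.
have eps0 : 0 <= eps by exact: powR_ge0.
have del1 : del <= 1 by apply: (le_trans del_small); rewrite ge_min lexx.
have eps1 : eps <= 1 by rewrite -(@ler_pXn2r _ 3%N)// ?nnegrE// expr1n eps3.
have epsX k : eps ^+ (3 * k) = del ^+ k by rewrite exprM eps3.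
have b_le' q k : (q <= p)%N -> (1 < k <= q)%N -> `|b q k| <= B * eps ^+ (3 * k.-1).
  by move=> h1 h2; rewrite epsX; exact: b_le.
have exp' q (F : nat -> R -> R) w : (0 < q <= p)%N -> chain F q -> osc w (F q) ->
    `|Ex P (fun o => W o * F 0%N (W o)) - \sum_(k < q.+1) b q k * Ex P (fun o => F k (W o))|
      <= B * w * eps ^+ (3 * q) by rewrite epsX; exact: expansion.
have mW : measurable_fun setT W by [].
have D := defect_lipschitz mW momW eps0 eps1 B1 (leqnn M) EW0 EW2 b_le' exp' p0.
have LW : L1 P (fun o => 1 + `|W o| ^+ p.+1) by apply: L1D => //; exact: L1_cst.
have c0 m : (0 < m <= M)%N -> `|corr p (b p) m| <= E0 * del.
  by rewrite -eps3; exact: (corr_le_eps3 eps0 eps1 B1 (leqnn M) (fun j => b_le' p j (leqnn p))).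
have del_s : del <= shift_small M E0 by apply: (le_trans del_small); rewrite ge_min lexx orbT.
have p1 : p.-1.+1 = p by rewrite prednK.
(* For [p = 1] the recursion of the coefficients sums over the empty range [2 <= j <= p]. *)
have ini : p.-1 = 0%N -> forall m, (0 < m)%N -> corr p (b p) m = 0.
  move=> pe m m0; apply/eqP; rewrite -normr_le0.
  have : forall m', (0 < m')%N -> corr p (b p) m' = 0; last by move=> ->; rewrite ?normr0.
  move=> [//|n] _; apply: (mulfI (_ : n.+1%:R != 0 :> R)); first by rewrite pnatr_eq0.
  by rewrite corrS mulr0 big_pred0// => j; rewrite leqNgt (leq_trans (ltn_ord j))// -p1 pe.
have meas_lip (h : R -> R) C : (forall x y, `|h x - h y| <= C * `|x - y|) -> measurable_fun setT h.
  by move=> hC; apply: continuous_meas; exact: lipschitz_continuous hC.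
have H : (\int[lebesgue_measure]_z (`|transport W z - z| ^+ p.-1.+1 * gs z)%:E <=
    (transport_const p.-1 M E0 * (defect_const p M B p * del ^+ p + del ^+ p.-1.+1))%:E)%E.
  apply: (corrected_transport E00 del0 c0 del_s (transport_le W) (corr0 p (b p)) ini) => h ch h1 [C hC].
  rewrite -Ex_transport; [|exact: meas_lip hC|].
    by rewrite -epsX; exact: (D h C).
  apply: (L1_le _ _ (L1Z (`|h 0%N 0| + `|C|) LW)).
    by apply: measurableT_comp => //; exact: meas_lip hC.
  move=> o; have h0 : `|h 0%N (W o)| <= `|h 0%N 0| + `|C| * `|W o|.
    rewrite -[h 0%N (W o)](subrK (h 0%N 0)) addrC (le_trans (ler_normD _ _))// lerD2l.
    by apply: (le_trans (hC _ _)); rewrite subr0 ler_wpM2r// ler_norm.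
  have w1 : `|W o| <= 1 + `|W o| ^+ p.+1.
    have [w1|w1] := leP `|W o| 1; first by rewrite (le_trans w1)// lerDl exprn_ge0.
    by rewrite (@le_trans _ _ (`|W o| ^+ p.+1)) ?lerDr// -[leLHS]expr1 ler_weXn2l// ltW.
  apply: (le_trans h0); rewrite mulrDl lerD//; last by rewrite ler_wpM2l.
  by rewrite ler_peMr// lerDl exprn_ge0.
rewrite p1 -[X in (_ + X)]mul1r -mulrDl mulrA in H.
have K0 : 0 <= transport_const p.-1 M E0 * (defect_const p M B p + 1).
  rewrite -(@pmulr_lge0 _ (del ^+ p)) ?exprn_gt0// -lee_fin; apply: le_trans H.
  by apply: integral_ge0 => z _; rewrite lee_fin mulr_ge0// ltW// gs_gt0.
apply: (le_trans (wasserstein_le p0 _ H)); first by rewrite mulr_ge0 ?exprn_ge0 ?(ltW del0).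
rewrite lee_fin powRM ?exprn_ge0 ?(ltW del0)// -(powR_mulrn _ (ltW del0)) -powRrM divff ?powRr1 ?(ltW del0)//.
by rewrite pnatr_eq0 -lt0n.
Qed.

End corrected_wasserstein.

(** * Rates *)

Section power_sums.
Context {R : realType}.
Implicit Types (a b s x y : R) (l m n k : nat).

Lemma powR_expR x a : 0 < x -> x `^ a = expR (a * ln x).
Proof. by move=> x0; rewrite /powR gt_eqF. Qed.

Let ln_step x : 1 <= x -> 0 <= ln (x + 1) - ln x /\ ln (x + 1) <= ln 2 + ln x.
Proof.
move=> x1; have x0 : 0 < x := lt_le_trans ltr01 x1.
split; first by rewrite subr_ge0 ler_ln ?posrE ?addr_gt0// lerDl.
by rewrite -lnM ?posrE// ler_ln ?posrE ?addr_gt0 ?mulr_gt0// mulr2n mulrDl mul1r lerD2l.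
Qed.

(** The increment of the logarithm plays the part of [dx / x]. Multiplied by a power of [x] it is
    compared with a difference of powers, or is itself a difference, so the sums below telescope in
    all three regimes. *)
Lemma powR_diff_le s x : 0 <= s -> 1 <= x ->
  x `^ (- s) - (x + 1) `^ (- s) <= s * (ln (x + 1) - ln x) * x `^ (- s).
Proof.
move=> s0 x1; have x0 : 0 < x := lt_le_trans ltr01 x1.
rewrite !powR_expR ?addr_gt0// (_ : - s * ln (x + 1) = - s * ln x + - (s * (ln (x + 1) - ln x))); last by ring.
rewrite expRD -[X in X - _]mulr1 -mulrBr mulrC ler_wpM2r ?expR_ge0// lerBlDr.
have := expR_ge1Dx (- (s * (ln (x + 1) - ln x))); lra.
Qed.

Lemma log_step_pos a x : 0 < a -> 1 <= x ->
  (ln (x + 1) - ln x) * x `^ a <= a^-1 * ((x + 1) `^ a - x `^ a).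
Proof.
move=> a0 x1; have x0 : 0 < x := lt_le_trans ltr01 x1.
rewrite -(ler_pM2l a0) [leRHS]mulrA divff ?gt_eqF// mul1r.
rewrite !powR_expR ?addr_gt0// (_ : a * ln (x + 1) = a * ln x + a * (ln (x + 1) - ln x)); last by ring.
rewrite expRD -[X in _ <= _ - X]mulr1 -mulrBr mulrA mulrC ler_wpM2l ?expR_ge0//.
have := expR_ge1Dx (a * (ln (x + 1) - ln x)); lra.
Qed.

Lemma log_step_neg a x : 0 < a -> 1 <= x ->
  (ln (x + 1) - ln x) * x `^ (- a) <= 2 `^ a / a * (x `^ (- a) - (x + 1) `^ (- a)).
Proof.
move=> a0 x1; have x0 : 0 < x := lt_le_trans ltr01 x1.
have [y0 y2] := ln_step x1.
rewrite !powR_expR ?addr_gt0// (_ : - a * ln x = - a * ln (x + 1) + a * (ln (x + 1) - ln x)); last by ring.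
set y := ln (x + 1) - ln x in y0 *.
have h1 : a * y <= expR (a * y) - 1 by have := expR_ge1Dx (a * y); lra.
have h2 : expR (a * y) <= expR (a * ln 2) by rewrite ler_expR ler_pM2l// /y; lra.
rewrite expRD [leLHS](_ : _ = expR (- a * ln (x + 1)) * (y * expR (a * y))); last by ring.
rewrite [leRHS](_ : _ = expR (- a * ln (x + 1)) * (a^-1 * (expR (a * y) - 1) * expR (a * ln 2))); last by ring.
rewrite ler_wpM2l ?expR_ge0// ler_pM ?expR_ge0//.
by rewrite -(ler_pM2l a0) [leRHS]mulrA divff ?gt_eqF// mul1r.
Qed.

(** The shift by one makes the decay defined, and equal to 1, at distance 0. *)
Definition th s l : R := l.+1%:R `^ (- s).

Lemma th_ge0 s l : 0 <= th s l. Proof. exact: powR_ge0. Qed.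

Lemma th0 s : th s 0 = 1. Proof. by rewrite /th powR1. Qed.

Lemma th_anti s l l' : 0 <= s -> (l <= l')%N -> th s l' <= th s l.
Proof.
move=> s0 ll; rewrite /th !powR_expR ?ltr0n// ler_expR !mulNr lerN2 ler_wpM2l// ler_ln ?posrE ?ltr0n//.
by rewrite ler_nat ltnS.
Qed.

Lemma th_exp s s' l : s <= s' -> th s' l <= th s l.
Proof. by move=> ss; rewrite /th ler_powR ?ler1n// lerN2. Qed.

Lemma th_le1 s l : 0 <= s -> th s l <= 1.
Proof. by move=> s0; rewrite -(th0 s); exact: th_anti. Qed.

Lemma sum_telescope (f : nat -> R) m n : (m <= n)%N ->
  \sum_(m <= l < n) (f l - f l.+1) = f m - f n.
Proof.
by move=> mn; rewrite -[RHS]opprB -telescope_sumr// -sumrN; apply: eq_bigr => l _; rewrite opprB.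
Qed.

Let term s b l : 0 <= s ->
  (th s l - th s l.+1) * l.+1%:R `^ b <= s * ((ln (l.+1%:R + 1) - ln l.+1%:R) * l.+1%:R `^ (b - s)).
Proof.
move=> s0; have l1 : 1 <= l.+1%:R :> R by rewrite ler1n.
rewrite /th -[l.+2%:R]natr1; apply: (le_trans (ler_wpM2r (powR_ge0 _ _) (powR_diff_le s0 l1))).
by rewrite -!mulrA -powRD ?(addrC (- s)) ?pnatr_eq0 ?implybT.
Qed.

Lemma sum_fast s b m n : 0 <= s -> b < s -> (m <= n)%N ->
  \sum_(m <= l < n) (th s l - th s l.+1) * l.+1%:R `^ b <= s * (2 `^ (s - b) / (s - b)) * m.+1%:R `^ (b - s).
Proof.
move=> s0 bs mn; have a0 : 0 < s - b by rewrite subr_gt0.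
have C0 : 0 <= s * (2 `^ (s - b) / (s - b)) by rewrite mulr_ge0// divr_ge0 ?powR_ge0// ltW.
apply: (@le_trans _ _ (\sum_(m <= l < n) s * (2 `^ (s - b) / (s - b)) * (l.+1%:R `^ (b - s) - l.+2%:R `^ (b - s)))).
  apply: ler_sum => l _; apply: (le_trans (term b l s0)); rewrite -mulrA ler_wpM2l//.
  have l1 : 1 <= l.+1%:R :> R by rewrite ler1n.
  by rewrite -[l.+2%:R]natr1 -(opprB s b); exact: log_step_neg.
rewrite -mulr_sumr (sum_telescope (fun l => l.+1%:R `^ (b - s)))// ler_wpM2l// lerBlDr lerDl powR_ge0//.
Qed.

Lemma sum_log s n : 0 <= s -> \sum_(0 <= l < n) (th s l - th s l.+1) * l.+1%:R `^ s <= s * ln n.+1%:R.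
Proof.
move=> s0; apply: (@le_trans _ _ (\sum_(0 <= l < n) s * (ln l.+2%:R - ln l.+1%:R))).
  by apply: ler_sum => l _; apply: (le_trans (term s l s0)); rewrite subrr powRr0 mulr1 natr1.
by rewrite -mulr_sumr (telescope_sumr (fun l => ln l.+1%:R))// ln1 subr0.
Qed.

Lemma sum_slow s b n : 0 <= s -> s < b ->
  \sum_(0 <= l < n) (th s l - th s l.+1) * l.+1%:R `^ b <= s / (b - s) * n.+1%:R `^ (b - s).
Proof.
move=> s0 sb; have a0 : 0 < b - s by rewrite subr_gt0.
apply: (@le_trans _ _ (\sum_(0 <= l < n) s / (b - s) * (l.+2%:R `^ (b - s) - l.+1%:R `^ (b - s)))).
  apply: ler_sum => l _; apply: (le_trans (term b l s0)); rewrite -mulrA ler_wpM2l//.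
  have l1 : 1 <= l.+1%:R :> R by rewrite ler1n.
  by rewrite -[l.+2%:R]natr1; exact: log_step_pos.
rewrite -mulr_sumr (telescope_sumr (fun l => l.+1%:R `^ (b - s)))// ler_wpM2l ?(divr_ge0 s0 (ltW a0))//.
by rewrite lerBlDr lerDl powR_ge0.
Qed.

End power_sums.

(** * Weighted ball counts *)

Section ball_weights.
Context {R : realType}.
Variables (d L0 : nat).
Implicit Types (s : R) (l m n k N D g : nat).

(** A ball of radius [l] in the maximum norm has [(2 l + 1)^d] lattice points and contains at most
    all [N] sites; [L0] bounds the number of centers. *)
Definition ball_bound N l : R := L0%:R * Num.min ((2 * l).+1%:R ^+ d) N%:R.

(* Chosen so that [th s g] is the sum of [dth s D l] over [g <= l <= D]. *)
Definition dth s D l : R := if l == D then th s D else th s l - th s l.+1.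

Lemma dth_ge0 s D l : 0 <= s -> 0 <= dth s D l.
Proof. by move=> s0; rewrite /dth; case: ifP => _; rewrite ?th_ge0// subr_ge0 th_anti. Qed.

Lemma VE N D e k m : V D (ball_bound N) e k m = \sum_(m <= l < D.+1) e l * ball_bound N l ^+ k :> R.
Proof. by rewrite /V big_geq_mkord. Qed.

Lemma V_split N D s k m : (m <= D)%N -> V D (ball_bound N) (dth s D) k m =
  \sum_(m <= l < D) (th s l - th s l.+1) * ball_bound N l ^+ k + th s D * ball_bound N D ^+ k.
Proof.
move=> mD; rewrite VE big_nat_recr//= {2}/dth eqxx; congr (_ + _).
by apply: eq_big_nat => l /andP[_ lD]; rewrite /dth ltn_eqF.
Qed.

Lemma V_dth0 N s D g : (g <= D)%N -> V D (ball_bound N) (dth s D) 0 g = th s g.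
Proof.
move=> gD; rewrite V_split// expr0 mulr1.
under eq_bigr do rewrite expr0 mulr1.
by rewrite sum_telescope// subrK.
Qed.

Lemma ball_bound_ge0 N l : 0 <= ball_bound N l.
Proof. by rewrite mulr_ge0// le_min exprn_ge0. Qed.

Lemma ball_bound_ge1 N l : (0 < L0)%N -> (0 < N)%N -> 1 <= ball_bound N l.
Proof.
by move=> L1 N1; rewrite -[leLHS]mulr1 ler_pM// ?ler1n// le_min exprn_ege1// ler1n.
Qed.

Lemma ball_bound_mono N l l' : (l <= l')%N -> ball_bound N l <= ball_bound N l'.
Proof.
move=> ll; rewrite ler_wpM2l// le_min; apply/andP; split.
  by rewrite ge_min lerXn2r ?nnegrE// ler_nat ltnS leq_mul2l ll orbT.
by rewrite ge_min lexx orbT.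
Qed.

Lemma ball_bound_pow N l k : ball_bound N l ^+ k <= (L0%:R * 2 ^+ d) ^+ k * l.+1%:R `^ (d%:R * k%:R).
Proof.
rewrite -natrM powR_mulrn// exprM -exprMn -(mulrA L0%:R) -exprMn lerXn2r ?nnegrE ?ball_bound_ge0//.
rewrite ler_wpM2l// ge_min lerXn2r ?nnegrE ?mulr_ge0//.
by rewrite -natrM ler_nat mulnS addSn ltnS leqnSn.
Qed.

Lemma ball_bound_leN N l k : ball_bound N l ^+ k <= L0%:R ^+ k * N%:R ^+ k.
Proof.
rewrite -exprMn lerXn2r ?nnegrE ?ball_bound_ge0 ?mulr_ge0//.
by rewrite ler_wpM2l// ge_min lexx orbT.
Qed.

Let K0 k : 0 <= (L0%:R * 2 ^+ d) ^+ k :> R. Proof. by rewrite exprn_ge0// mulr_ge0// exprn_ge0. Qed.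

Let head N s k m n : 0 <= s -> \sum_(m <= l < n) (th s l - th s l.+1) * ball_bound N l ^+ k <=
  (L0%:R * 2 ^+ d) ^+ k * \sum_(m <= l < n) (th s l - th s l.+1) * l.+1%:R `^ (d%:R * k%:R).
Proof.
move=> s0; rewrite mulr_sumr; apply: ler_sum => l _; rewrite mulrCA ler_wpM2l ?subr_ge0 ?th_anti//.
exact: ball_bound_pow.
Qed.

Lemma V_fast s k : 0 <= s -> d%:R * k%:R < s -> exists2 C : R, 0 <= C &
  forall N D m, (m <= D)%N -> V D (ball_bound N) (dth s D) k m <= C * m.+1%:R `^ (d%:R * k%:R - s).
Proof.
move=> s0 ks; set b := d%:R * k%:R in ks *.
have a0 : 0 < s - b by rewrite subr_gt0.
exists ((L0%:R * 2 ^+ d) ^+ k * (s * (2 `^ (s - b) / (s - b)) + 1)).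
  by rewrite mulr_ge0// addr_ge0// mulr_ge0// divr_ge0 ?powR_ge0// ltW.
move=> N D m mD; rewrite V_split// -mulrA mulrDl mul1r mulrDr lerD//.
  by apply: (le_trans (head _ _ _ _ s0)); rewrite ler_wpM2l// sum_fast.
apply: (le_trans (ler_wpM2l (th_ge0 _ _) (ball_bound_pow N D k))).
rewrite mulrCA ler_wpM2l// /th -powRD ?pnatr_eq0 ?implybT// (addrC (- s)) -/b -(opprB s b).
exact: (th_anti (ltW a0)).
Qed.

(* The scale [n] at which the ball has about [N] points. *)
Let scale N : (0 < d)%N -> (0 < N)%N -> exists n,
  [/\ (n <= N)%N, N%:R `^ (d%:R^-1) <= n.+1%:R :> R & n.+1%:R <= 2 * N%:R `^ (d%:R^-1) :> R].
Proof.
move=> d0 N0; set x := N%:R `^ (d%:R^-1).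
have x1 : 1 <= x by rewrite -(powRr0 N%:R) ler_powR ?ler1n// invr_ge0.
have xN : x <= N%:R by rewrite -[leRHS]powRr1// ler_powR ?ler1n// invf_le1 ?ltr0n// ler1n.
have /andP[h1 h2] := truncn_itv (le_trans ler01 x1).
exists (Num.truncn x); split; last by rewrite -natr1; lra.
- by rewrite -(ler_nat R) (le_trans h1).
- exact: ltW.
Qed.

Let V_tail N s k n : 0 <= s -> (n <= N)%N -> V N (ball_bound N) (dth s N) k n <= L0%:R ^+ k * (N%:R ^+ k * th s n).
Proof.
move=> s0 nN; rewrite -(V_dth0 N s nN) !VE [leRHS]mulrCA !mulr_sumr; apply: ler_sum => l _.
rewrite [leRHS](_ : _ = dth s N l * (L0%:R ^+ k * N%:R ^+ k)); last by rewrite expr0; ring.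
by rewrite ler_wpM2l ?dth_ge0// ball_bound_leN.
Qed.

(** Below the scale [n] the ball count is taken polynomial in the radius, beyond it the cap [N] is
    used. *)
Let cut N s k n : 0 <= s -> (n <= N)%N -> V N (ball_bound N) (dth s N) k 0 <=
  (L0%:R * 2 ^+ d) ^+ k * \sum_(0 <= l < n) (th s l - th s l.+1) * l.+1%:R `^ (d%:R * k%:R) +
  L0%:R ^+ k * (N%:R ^+ k * th s n).
Proof.
move=> s0 nN; rewrite VE (@big_cat_nat _ _ _ n)//=; last by rewrite ltnW.
rewrite lerD//; last by have := V_tail k s0 nN; rewrite VE.
apply: le_trans (head N k 0 n s0); rewrite le_eqVlt; apply/orP; left; apply/eqP.
by apply: eq_big_nat => l /andP[_ ln]; rewrite /dth ltn_eqF// (leq_trans ln).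
Qed.

Let thn N s n : (0 < d)%N -> (0 < N)%N -> 0 <= s -> N%:R `^ (d%:R^-1) <= n.+1%:R :> R ->
  th s n <= N%:R `^ (- (s / d%:R)).
Proof.
move=> d0 N0 s0 h; have x0 : 0 < N%:R `^ (d%:R^-1) :> R by rewrite powR_gt0// ltr0n.
have -> : - (s / d%:R) = d%:R^-1 * - s by rewrite mulrN mulrC.
rewrite powRrM /th !(powR_expR (- s))// ?ltr0n// ler_expR !mulNr lerN2 ler_wpM2l// ler_ln ?posrE ?ltr0n//.
Qed.

(** Cutting at the scale where a ball has about [N] points makes both parts of order
    [N^(k - s/d)]. *)
Lemma V_slow s k : (0 < d)%N -> 0 <= s -> s < d%:R * k%:R -> exists2 C : R, 0 <= C &
  forall N, (0 < N)%N -> V N (ball_bound N) (dth s N) k 0 <= C * N%:R `^ (k%:R - s / d%:R).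
Proof.
move=> d0 s0 sk; set b := d%:R * k%:R in sk *; have a0 : 0 < b - s by rewrite subr_gt0.
have dn : d%:R != 0 :> R by rewrite pnatr_eq0 -lt0n.
exists ((L0%:R * 2 ^+ d) ^+ k * (s / (b - s) * 2 `^ (b - s)) + L0%:R ^+ k).
  by rewrite addr_ge0 ?exprn_ge0// mulr_ge0// mulr_ge0 ?powR_ge0// divr_ge0// ltW.
move=> N N0; have [n [nN h1 h2]] := scale d0 N0.
apply: (le_trans (cut k s0 nN)); rewrite mulrDl lerD//.
  rewrite -[leRHS]mulrA ler_wpM2l//; apply: (le_trans (sum_slow n s0 sk)).
  rewrite -[leRHS]mulrA ler_wpM2l ?(divr_ge0 s0 (ltW a0))//.
  apply: (@le_trans _ _ ((2 * N%:R `^ (d%:R^-1)) `^ (b - s))).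
    by rewrite ge0_ler_powR ?nnegrE ?(ltW a0)// mulr_ge0 ?powR_ge0.
  rewrite powRM ?powR_ge0// -powRrM ler_wpM2l ?powR_ge0// le_eqVlt; apply/orP; left; apply/eqP; congr powR.
  by rewrite /b; field.
rewrite ler_wpM2l ?exprn_ge0// powRD ?pnatr_eq0 -?lt0n ?N0 ?implybT// powR_mulrn// ler_wpM2l ?exprn_ge0//.
exact: thn.
Qed.

Lemma V_crit s k : (0 < d)%N -> 0 <= s -> s = d%:R * k%:R -> exists2 C : R, 0 <= C &
  forall N, (1 < N)%N -> V N (ball_bound N) (dth s N) k 0 <= C * (1 + ln N%:R).
Proof.
move=> d0 s0 sk; have dn : d%:R != 0 :> R by rewrite pnatr_eq0 -lt0n.
exists ((L0%:R * 2 ^+ d) ^+ k * (s * (ln 2 + 1)) + L0%:R ^+ k).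
  by rewrite addr_ge0 ?exprn_ge0// mulr_ge0// mulr_ge0// addr_ge0// ln_ge0// ler1n.
move=> N N1; have N0 := ltnW N1; have [n [nN h1 h2]] := scale d0 N0.
have lN : 0 <= ln N%:R :> R by rewrite ln_ge0// ler1n.
have l2 : 0 <= ln 2 :> R by rewrite ln_ge0// ler1n.
apply: (le_trans (cut k s0 nN)); rewrite mulrDl lerD//.
  rewrite -mulrA ler_wpM2l// -sk; apply: (le_trans (sum_log n s0)); rewrite -mulrA ler_wpM2l//.
  apply: (@le_trans _ _ (ln (2 * N%:R))).
    rewrite ler_ln ?posrE ?mulr_gt0 ?ltr0n//; apply: (le_trans h2); rewrite ler_pM2l//.
    by rewrite -[leRHS]powRr1// ler_powR ?ler1n// invf_le1 ?ltr0n// ler1n.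
  rewrite lnM ?posrE ?ltr0n//; nra.
rewrite ler_wpM2l ?exprn_ge0//; apply: (@le_trans _ _ 1); last by rewrite lerDl.
apply: (le_trans (ler_wpM2l (exprn_ge0 _ (ler0n _ _)) (thn d0 N0 s0 h1))).
rewrite -powR_mulrn// -powRD ?pnatr_eq0 -?lt0n ?N0 ?implybT// sk mulrAC divff// mul1r subrr powRr0//.
Qed.

End ball_weights.

Lemma uniform_const (R : realType) (Q : nat -> R -> Prop) n :
  (forall k C C', C <= C' -> Q k C -> Q k C') ->
  (forall k, (k < n)%N -> exists2 C, 0 <= C & Q k C) ->
  exists2 C, 0 <= C & forall k, (k < n)%N -> Q k C.
Proof.
move=> mono; elim: n => [|n IH] h; first by exists 0.
have [C C0 hC] := IH (fun k kn => h k (ltnW kn)); have [C' C'0 hC'] := h n (ltnSn n).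
exists (C + C'); first exact: addr_ge0.
move=> k; rewrite ltnS leq_eqVlt => /predU1P[->|/hC]; last by apply: mono; rewrite lerDl.
by apply: mono hC'; rewrite lerDr.
Qed.

(** * Exponents of the rates *)

Section rates.
Context {R : realType}.
Variables (d p : nat) (A : R) (L0 : nat).
Hypotheses (d0 : (0 < d)%N) (p0 : (0 < p)%N) (A_gt : d%:R * (p%:R + 1) / 2 < A).
Implicit Types (N k m : nat) (e x : R).

Let a : R := A / d%:R.
Let dgt0 : 0 < d%:R :> R. Proof. by rewrite ltr0n. Qed.
Let pge1 : 1 <= p%:R :> R. Proof. by rewrite ler1n. Qed.
Let pgt0 : 0 < p%:R :> R. Proof. by rewrite ltr0n. Qed.
Let AE : A = d%:R * a. Proof. by rewrite /a mulrCA divff ?mulr1// gt_eqF. Qed.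
Let aE : A / (d%:R * p%:R) = a / p%:R. Proof. by rewrite /a invfM mulrA. Qed.
Let a_gt : (p%:R + 1) / 2 < a.
Proof. by move: A_gt; rewrite AE -mulrA ltr_pM2l. Qed.
Let A0 : 0 <= A.
Proof. by rewrite AE mulr_ge0// ltW// (le_lt_trans _ a_gt)// divr_ge0// addr_ge0. Qed.

(** Source of the requirement of 4 sites: a logarithm that is at least 1 may be inserted in lower
    bounds for the rates. *)
Lemma ln_ge1 N : (4 <= N)%N -> 1 <= ln N%:R :> R.
Proof.
move=> N4; have N0 : (0 < N)%N by exact: leq_trans N4.
rewrite -ler_expR lnK ?posrE ?ltr0n//.
apply: (@le_trans _ _ 4); last by rewrite ler_nat.
have h : expR (2^-1) <= 2 :> R.
  have : 2^-1 <= expR (- 2^-1) :> R by have := expR_ge1Dx (- 2^-1 : R); lra.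
  by rewrite expRN lef_pV2 ?posrE ?expR_gt0.
have -> : expR 1 = expR 2^-1 * expR 2^-1 :> R by rewrite -expRD; congr expR; field.
by rewrite (_ : 4 = 2 * 2 :> R) ?ler_pM ?expR_ge0// -natrM.
Qed.

Lemma log_le_pow e : 0 < e -> exists2 C : R, 0 <= C & forall N, (4 <= N)%N -> 1 + ln N%:R <= C * N%:R `^ e.
Proof.
move=> e0; exists (1 + e^-1); first by rewrite addr_ge0// invr_ge0 ltW.
move=> N N4; have N0 : (0 < N)%N by exact: leq_trans N4.
have x0 : 0 < N%:R :> R by rewrite ltr0n.
have h1 : 1 <= N%:R `^ e by rewrite -[leLHS](powRr0 N%:R) ler_powR ?ler1n// ltW.
rewrite mulrDl mul1r lerD// -(ler_pM2l e0) mulrA divff ?gt_eqF// mul1r powR_expR//.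
have := expR_ge1Dx (e * ln N%:R); lra.
Qed.

Let pw N e k : (0 < N)%N -> (N%:R `^ e) ^+ k = N%:R `^ (e * k%:R) :> R.
Proof. by move=> N0; rewrite -powR_mulrn ?powR_ge0// powRrM. Qed.

Let powD N e e' : (0 < N)%N -> N%:R `^ e * N%:R `^ e' = N%:R `^ (e + e') :> R.
Proof. by move=> N0; rewrite powRD// pnatr_eq0 -lt0n N0 implybT. Qed.

Let pow_mono N e e' : (0 < N)%N -> e <= e' -> N%:R `^ e <= N%:R `^ e' :> R.
Proof. by move=> N0 ee; rewrite ler_powR// ler1n. Qed.

(** The weighted count of index [k] is bounded, logarithmic or a power of [N] according to the sign
    of [d k - A]. The strict inequality in the last hypothesis leaves a positive power of [N] to
    absorb the logarithm of the critical index. *)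
Lemma beta_rate e (del : nat -> R) : e <= 2^-1 -> (forall N, (4 <= N)%N -> N%:R `^ (- e) <= del N) ->
  (forall k, (1 < k <= p)%N -> a <= k%:R -> k%:R - a - (k%:R - 1) / 2 < - ((k%:R - 1) * e)) ->
  exists2 C : R, 0 <= C & forall k, (1 < k <= p)%N -> forall N, (4 <= N)%N ->
    N%:R `^ ((1 - k%:R) / 2) * V N (ball_bound d L0 N) (dth A N) k 0 <= C * del N ^+ k.-1.
Proof.
move=> e_le lo slack.
pose Q k (C : R) := (1 < k)%N -> forall N, (4 <= N)%N ->
  N%:R `^ ((1 - k%:R) / 2) * V N (ball_bound d L0 N) (dth A N) k 0 <= C * del N ^+ k.-1.
have step k : (k < p.+1)%N -> exists2 C : R, 0 <= C & Q k C.
  rewrite /Q ltnS => kp; have [k2|k2] := leqP 2 k; last by exists 0.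
  have kr : 1 + k.-1%:R = k%:R :> R by rewrite nat1r prednK// ltnW.
  have fin (C w : R) : 0 <= C -> w + (1 - k%:R) / 2 <= - ((k%:R - 1) * e) ->
     (forall N, (4 <= N)%N -> V N (ball_bound d L0 N) (dth A N) k 0 <= C * N%:R `^ w) ->
     exists2 C : R, 0 <= C & true -> forall N, (4 <= N)%N ->
      N%:R `^ ((1 - k%:R) / 2) * V N (ball_bound d L0 N) (dth A N) k 0 <= C * del N ^+ k.-1.
    move=> C0 we hV; exists C => // _ N N4; have N0 : (0 < N)%N by exact: leq_trans N4.
    apply: (le_trans (ler_wpM2l (powR_ge0 _ _) (hV N N4))).
    rewrite mulrCA ler_wpM2l// powD//; apply: (@le_trans _ _ ((N%:R `^ (- e)) ^+ k.-1)).
      rewrite pw// pow_mono// addrC; apply: (le_trans we); rewrite -kr; lra.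
    by rewrite lerXn2r ?nnegrE ?powR_ge0 ?lo// (le_trans (powR_ge0 _ _) (lo N N4)).
  have [kA|kA|kA] := ltgtP (d%:R * k%:R) A.
  - have [C C0 hC] := V_fast L0 A0 kA; apply: (fin C 0 C0).
      rewrite add0r -subr_ge0 (_ : _ - _ = (k%:R - 1) * (2^-1 - e)); last by field.
      by rewrite mulr_ge0 ?subr_ge0// ler1n ltnW.
    move=> N N4; apply: (le_trans (hC N N 0%N (leq0n N))).
    by rewrite powR1 powRr0.
  - have ak : a < k%:R by rewrite -(ltr_pM2l dgt0) -AE.
    have [C C0 hC] := V_slow L0 d0 A0 kA; apply: (fin C (k%:R - a) C0); last first.
      by move=> N N4; apply: hC; exact: leq_trans N4.
    by have := slack k; rewrite k2 kp (ltW ak) => /(_ isT isT); lra.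
  - have ak : a = k%:R by apply: (mulfI (lt0r_neq0 dgt0)); rewrite -AE.
    have [C C0 hC] := V_crit L0 d0 A0 (esym kA).
    have s0 : 0 < (k%:R - 1) * (2^-1 - e).
      have := slack k; rewrite k2 kp ak lexx => /(_ isT isT) h.
      rewrite (_ : _ * _ = - ((k%:R - 1) * e) - (k%:R - k%:R - (k%:R - 1) / 2)); last by field.
      by rewrite subr_gt0.
    have [C' C'0 hC'] := log_le_pow s0.
    apply: (fin (C * C') ((k%:R - 1) * (2^-1 - e)) (mulr_ge0 C0 C'0)).
      by rewrite le_eqVlt; apply/orP; left; apply/eqP; field.
    move=> N N4; apply: (le_trans (hC N (leq_trans _ N4))) => //.
    by rewrite -mulrA ler_wpM2l// hC'.
have [|C C0 hC] := uniform_const (Q := Q) (n := p.+1) _ step; last first.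
  by exists C => // k /andP[k1 kp] N N4; apply: hC.
move=> k C C' CC h k1 N N4; apply: (le_trans (h k1 N N4)); rewrite ler_wpM2r// exprn_ge0//.
by rewrite (le_trans (powR_ge0 _ _) (lo N N4)).
Qed.

(** [expo1] and [expo2] are the exponents of [rate_S] for [A <= d p] and for [A > d p]; in the
    critical case [expo1] is the exponent up to the logarithm. *)
Definition expo1 : R := a / p%:R - (p%:R + 1) / (2 * p%:R).
Definition expo2 : R := 2^-1 - d%:R * (p%:R + 1) / (2 * p%:R * (A + d%:R)).

Let expo1E : p%:R * expo1 = a - (p%:R + 1) / 2.
Proof. by rewrite /expo1; field; exact: lt0r_neq0. Qed.

Let expo1_gt0 : 0 < expo1.
Proof. by rewrite -(pmulr_rgt0 _ pgt0) expo1E subr_gt0. Qed.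

Let expo1_le : a <= p%:R -> expo1 <= 2^-1.
Proof. by move=> ap; rewrite -(ler_pM2l pgt0) expo1E; have := pge1; lra. Qed.

Let Ad0 : 0 < A + d%:R. Proof. exact: ltr_wpDl A0 dgt0. Qed.

Let expo2_le : expo2 <= 2^-1.
Proof. by rewrite /expo2 gerBl divr_ge0 ?mulr_ge0 ?addr_ge0// ltW// mulr_gt0. Qed.

Let expo2_gt0 : d%:R * p%:R < A -> 0 < expo2.
Proof.
move=> dpA; rewrite /expo2 subr_gt0 ltr_pdivrMr ?mulr_gt0//.
rewrite (_ : 2^-1 * _ = p%:R * (A + d%:R)); last by field.
rewrite mulrDr mulrDr mulr1 (mulrC p%:R d%:R) [X in _ < X]addrC ltrD2l.
have h : d%:R <= d%:R * p%:R :> R by rewrite ler_peMr.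
by apply: (le_lt_trans h); apply: (lt_le_trans dpA); rewrite ler_peMl.
Qed.

Lemma rate_S_lower N : (4 <= N)%N -> N%:R `^ (- (if A <= d%:R * p%:R then expo1 else expo2)) <= rate_S d p A N.
Proof.
move=> N4; rewrite /rate_S /rate_R; case: ifP => h //; case: ifP => h'.
  by rewrite aE.
have -> : A == d%:R * p%:R by rewrite eq_le h leNgt h'.
have ap : a = p%:R.
  by apply: (mulfI (lt0r_neq0 dgt0)); rewrite -AE; apply/eqP; rewrite eq_le h leNgt h'.
rewrite -[leLHS]mulr1 ler_pM ?powR_ge0//.
  rewrite le_eqVlt; apply/orP; left; apply/eqP; congr (_ `^ (- _)); rewrite /expo1 ap; field; exact: lt0r_neq0.
by rewrite -[leLHS](powRr0 (ln N%:R)) ler_powR ?ln_ge1// invr_ge0.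
Qed.

Let log_pow N : (4 <= N)%N -> (ln N%:R `^ (p%:R^-1)) ^+ p = ln N%:R :> R.
Proof.
move=> N4; have l0 : 0 <= ln N%:R :> R by rewrite (le_trans ler01)// ln_ge1.
by rewrite -powR_mulrn ?powR_ge0// -powRrM mulVf ?powRr1// gt_eqF.
Qed.

Let le_of_eq x y : x = y -> x <= y. Proof. by move=> ->. Qed.

Lemma rate_S_beta : exists2 C : R, 0 <= C & forall k, (1 < k <= p)%N -> forall N, (4 <= N)%N ->
    N%:R `^ ((1 - k%:R) / 2) * V N (ball_bound d L0 N) (dth A N) k 0 <= C * rate_S d p A N ^+ k.-1.
Proof.
apply: (beta_rate _ rate_S_lower).
  case: ifP => // h; apply: expo1_le; by rewrite -(ler_pM2l dgt0) -AE.
move=> k /andP[k1 kp] ak; have kpR : k%:R <= p%:R :> R by rewrite ler_nat.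
have -> : A <= d%:R * p%:R by rewrite AE ler_pM2l// (le_trans ak).
have k1R : 1 < k%:R :> R by rewrite ltr1n.
rewrite -(ltr_pM2l pgt0) (_ : p%:R * - _ = - ((k%:R - 1) * (p%:R * expo1))); last by ring.
(* The slack equals this product plus one half of the product in [h2]. *)
rewrite expo1E; have h1 : 0 < (a - (p%:R + 1) / 2) * (p%:R - k%:R + 1) by rewrite mulr_gt0 ?subr_gt0//; lra.
have h2 : 0 <= p%:R * (p%:R - k%:R) :> R by rewrite mulr_ge0// subr_ge0.
nra.
Qed.

Lemma rate_S_top : exists2 C : R, 0 <= C & forall N, (4 <= N)%N -> exists2 m, (m <= N)%N &
  N%:R `^ ((1 - p%:R) / 2) * (N%:R `^ (- 2^-1) * ball_bound d L0 N m ^+ p.+1 +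
    V N (ball_bound d L0 N) (dth A N) p m) <= C * rate_S d p A N ^+ p.
Proof.
have [Ap|pA] := leP A (d%:R * p%:R).
  have ap : a <= p%:R by rewrite -(ler_pM2l dgt0) -AE.
  have e_le := expo1_le ap.
  have [C C0 hC] : exists2 C : R, 0 <= C & forall N, (4 <= N)%N ->
      N%:R `^ ((1 - p%:R) / 2) * V N (ball_bound d L0 N) (dth A N) p 0 <= C * rate_S d p A N ^+ p.
    have [/eqP Ae|Ane] := boolP (A == d%:R * p%:R).
      have [C C0 hC] := V_crit L0 d0 A0 Ae; exists (C * 2); first by rewrite mulr_ge0.
      move=> N N4; have N0 : (0 < N)%N by exact: leq_trans N4.
      have E1 : A < d%:R * p%:R = false by rewrite [in LHS]Ae ltxx.
      have E2 : A == d%:R * p%:R by apply/eqP.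
      rewrite /rate_S Ap /rate_R E1 E2 exprMn log_pow// pw//.
      rewrite (_ : - _ * _ = (1 - p%:R) / 2); last by field; exact: lt0r_neq0.
      rewrite mulrCA ler_wpM2l ?powR_ge0//; apply: (le_trans (hC N (leq_trans _ N4))) => //.
      by rewrite -mulrA ler_wpM2l//; have := ln_ge1 N4; lra.
    have Alt : A < d%:R * p%:R by rewrite lt_neqAle Ane.
    have [C C0 hC] := V_slow L0 d0 A0 Alt; exists C => // N N4; have N0 : (0 < N)%N by exact: leq_trans N4.
    rewrite /rate_S Ap /rate_R Alt pw//.
    apply: (le_trans (ler_wpM2l (powR_ge0 _ _) (hC N N0))); rewrite mulrCA ler_wpM2l// powD//.
    rewrite aE; apply: le_of_eq; congr (_ `^ _); rewrite -/a; field; exact: lt0r_neq0.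
  exists (L0%:R ^+ p.+1 + C); first by rewrite addr_ge0 ?exprn_ge0.
  move=> N N4; exists 0%N => //; have N0 : (0 < N)%N by exact: leq_trans N4.
  rewrite [leLHS]mulrDr [leRHS]mulrDl lerD ?hC// mulrA powD// mulrC ler_pM ?exprn_ge0 ?ball_bound_ge0 ?powR_ge0//.
    by rewrite lerXn2r ?nnegrE ?ball_bound_ge0// -[leRHS]mulr1 ler_wpM2l// ge_min expr1n lexx.
  apply: (@le_trans _ _ ((N%:R `^ (- expo1)) ^+ p)).
    by rewrite pw// pow_mono// (mulNr expo1) (mulrC expo1) expo1E; have := pge1; lra.
  have := rate_S_lower N4; rewrite Ap => h; rewrite lerXn2r ?nnegrE ?powR_ge0//; exact: le_trans h.
have [C C0 hC] := V_fast L0 A0 pA.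
pose K : R := (L0%:R * 2 ^+ d) ^+ p.+1 * 2 `^ (d%:R * p.+1%:R).
have K0 : 0 <= K by rewrite mulr_ge0 ?powR_ge0// exprn_ge0// mulr_ge0// exprn_ge0.
exists (K + C); first by rewrite addr_ge0.
move=> N N4; have N0 : (0 < N)%N by exact: leq_trans N4.
have AdE : A + d%:R != 0 by rewrite gt_eqF.
set y : R := N%:R `^ ((2 * (A + d%:R))^-1).
have y1 : 1 <= y by rewrite -[leLHS](powRr0 N%:R) pow_mono// invr_ge0 mulr_ge0// ltW.
have y0 : 0 < y := lt_le_trans ltr01 y1.
have Ad1 : 1 <= A + d%:R by rewrite (le_trans (_ : 1 <= d%:R))// ?ler1n// lerDr.
have yN : y <= N%:R by rewrite -[leRHS]powRr1// pow_mono// invf_le1; lra.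
have /andP[h1 h2] := truncn_itv (le_trans ler01 y1).
set m := Num.truncn y in h1 h2.
exists m; first by rewrite -(ler_nat R) (le_trans h1).
have rS : rate_S d p A N ^+ p = N%:R `^ ((1 - p%:R) / 2) * y `^ (d%:R * p%:R - A).
  rewrite /rate_S leNgt pA /= pw// /y -powRrM powD//; congr (_ `^ _); field.
  by rewrite AdE gt_eqF.
rewrite rS [leRHS]mulrCA ler_wpM2l ?powR_ge0// [leRHS]mulrDl lerD//.
  have -> : y `^ (d%:R * p%:R - A) = N%:R `^ (- 2^-1) * y `^ (d%:R * p.+1%:R).
    rewrite /y -!powRrM powD//; congr (_ `^ _); rewrite -natr1; field; exact: AdE.
  rewrite mulrCA ler_wpM2l ?powR_ge0//; apply: (le_trans (ball_bound_pow _ _ _ _ _)).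
  rewrite /K -[leRHS]mulrA ler_wpM2l//.
  rewrite -powRM ?(ltW y0)// ge0_ler_powR ?nnegrE ?mulr_ge0 ?(ltW y0)//.
  by rewrite -natr1; move: h1 y1; rewrite -/m; lra.
apply: (le_trans (hC N N m _)); first by rewrite -(ler_nat R) (le_trans h1).
rewrite ler_wpM2l// !powR_expR ?ltr0n// ler_expR ler_wnM2l ?subr_le0 ?(ltW pA)//.
by rewrite ler_ln ?posrE ?ltr0n// ltW.
Qed.

Lemma rate_S_gt0 N : (4 <= N)%N -> 0 < rate_S d p A N.
Proof.
by move=> N4; apply: lt_le_trans (rate_S_lower N4); rewrite powR_gt0// ltr0n (leq_trans _ N4).
Qed.

Lemma log_pow_small e : 0 < e -> exists2 C : R, 0 <= C & forall N, (4 <= N)%N ->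
  ln N%:R `^ (p%:R^-1) <= C * N%:R `^ e.
Proof.
move=> e0; have ep : 0 < e * p%:R by rewrite mulr_gt0.
have [C C0 hC] := log_le_pow ep; exists (C `^ (p%:R^-1)); first exact: powR_ge0.
move=> N N4; have l1 := ln_ge1 N4.
apply: (@le_trans _ _ ((C * N%:R `^ (e * p%:R)) `^ (p%:R^-1))).
  rewrite ge0_ler_powR ?nnegrE ?mulr_ge0 ?powR_ge0 ?invr_ge0//; first by rewrite (le_trans ler01).
  by apply: le_trans (hC N N4); lra.
by rewrite powRM ?powR_ge0// -powRrM mulfK ?gt_eqF.
Qed.

Lemma rate_S_decay : exists2 C : R, 0 <= C & exists2 e, 0 < e &
  forall N, (4 <= N)%N -> rate_S d p A N <= C * N%:R `^ (- e).
Proof.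
have [Ap|pA] := leP A (d%:R * p%:R); last first.
  exists 1 => //; exists expo2; first exact: expo2_gt0.
  by move=> N _; rewrite /rate_S (leNgt A) pA mul1r.
have [/eqP Ae|Ane] := boolP (A == d%:R * p%:R); last first.
  have Alt : A < d%:R * p%:R by rewrite lt_neqAle Ane.
  exists 1 => //; exists expo1 => // N _; rewrite /rate_S Ap /rate_R Alt mul1r.
  by rewrite aE.
(* At the critical value the lower bound on [A] forces [p > 1], so that a negative power of [N] is
   there to beat the logarithm. *)
have p1 : (1 < p)%N.
  have ap : a = p%:R by apply: (mulfI (lt0r_neq0 dgt0)); rewrite -AE.
  by rewrite -(ltr1n R); have := a_gt; rewrite ap; lra.
pose e : R := (p%:R - 1) / (4 * p%:R).
have e0 : 0 < e by rewrite divr_gt0 ?mulr_gt0// subr_gt0 ltr1n.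
have [C C0 hC] := log_pow_small e0; exists C => //; exists e => // N N4.
have N0 : (0 < N)%N by exact: leq_trans N4.
rewrite /rate_S Ap /rate_R (ltNge A) Ae lexx /= eqxx.
apply: (le_trans (ler_wpM2l (powR_ge0 _ _) (hC N N4))); rewrite mulrCA ler_wpM2l// powD//.
by apply: le_of_eq; congr (_ `^ _); rewrite /e; field; exact: lt0r_neq0.
Qed.

Lemma rate_S_le_R N : (0 < N)%N -> rate_S d p A N <= rate_R d p A N.
Proof.
move=> N0; rewrite /rate_S; case: ifP => //= /negbT; rewrite -ltNge => pA.
rewrite /rate_R ltNge (ltW pA) /= gt_eqF// pow_mono// lerN2 lerD2l lerN2.
have Adp0 : 0 < A + d%:R * p%:R by rewrite ltr_wpDl// mulr_gt0.
rewrite ler_pdivrMr ?mulr_gt0// mulrAC ler_pdivlMr//.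
rewrite -subr_ge0 (_ : _ - _ = d%:R * ((p%:R - 1) * (A - d%:R * p%:R))); last by ring.
by rewrite mulr_ge0// mulr_ge0 ?subr_ge0// ltW.
Qed.

Variable u : R.
Hypotheses (u_le : u <= A) (u_gt : d%:R * (p%:R + 2) / 2 < u).

Let b : R := u / d%:R.
Let uE : u = d%:R * b. Proof. by rewrite /b mulrCA divff ?mulr1// gt_eqF. Qed.
Let bE : u / (d%:R * p%:R) = b / p%:R. Proof. by rewrite /b invfM mulrA. Qed.
Let b_gt : (p%:R + 2) / 2 < b.
Proof. by move: u_gt; rewrite uE -mulrA ltr_pM2l. Qed.
Let u0 : 0 <= u.
Proof. by rewrite uE mulr_ge0// ltW// (le_lt_trans _ b_gt)// divr_ge0// addr_ge0. Qed.

Definition expoG : R := if u < d%:R * (p%:R + 1) then b / p%:R - (p%:R + 2) / (2 * p%:R) else 2^-1.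

Let expoGE : u < d%:R * (p%:R + 1) -> p%:R * expoG = b - (p%:R + 2) / 2.
Proof. by move=> h; rewrite /expoG h; field; exact: lt0r_neq0. Qed.

Let expoG_gt0 : 0 < expoG.
Proof.
have [h|h] := ltP u (d%:R * (p%:R + 1)); last by rewrite /expoG (ltNge u) h /= invr_gt0.
by rewrite -(pmulr_rgt0 _ pgt0) expoGE// subr_gt0.
Qed.

Let expoG_le : expoG <= 2^-1.
Proof.
have [h|h] := ltP u (d%:R * (p%:R + 1)); last by rewrite /expoG (ltNge u) h.
rewrite -(ler_pM2l pgt0) expoGE//; move: h; rewrite uE ltr_pM2l//; lra.
Qed.

Lemma rate_G_lower N : (4 <= N)%N -> N%:R `^ (- expoG) <= rate_G d p u N.
Proof.
move=> N4; rewrite /rate_G /expoG; case: ifP => h.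
  by rewrite bE.
case: ifP => // _; rewrite -[leLHS]mulr1 ler_pM ?powR_ge0//.
by rewrite -[leLHS](powRr0 (ln N%:R)) ler_powR ?ln_ge1// invr_ge0.
Qed.

Lemma rate_G_beta : exists2 C : R, 0 <= C & forall k, (1 < k <= p)%N -> forall N, (4 <= N)%N ->
    N%:R `^ ((1 - k%:R) / 2) * V N (ball_bound d L0 N) (dth A N) k 0 <= C * rate_G d p u N ^+ k.-1.
Proof.
apply: (beta_rate expoG_le rate_G_lower) => k /andP[k1 kp] ak.
have kpR : k%:R <= p%:R :> R by rewrite ler_nat.
have ba : b <= a by rewrite -(ler_pM2l dgt0) -uE -AE.
have h : u < d%:R * (p%:R + 1) by rewrite uE ltr_pM2l//; lra.
have k1R : 1 < k%:R :> R by rewrite ltr1n.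
rewrite -(ltr_pM2l pgt0) (_ : p%:R * - _ = - ((k%:R - 1) * (p%:R * expoG))); last by ring.
rewrite expoGE//; have h1 : 0 < (b - 1) * (p%:R - k%:R + 1).
  by rewrite mulr_gt0//; have := b_gt; have := pge1; lra.
have h2 : 0 <= p%:R * (a - b) by rewrite mulr_ge0// subr_ge0.
nra.
Qed.

(** The full expansion ends with the weighted count of index [p + 1] at the exponent [u], whence the
    critical value [u = d (p + 1)]. *)
Lemma rate_G_top : exists2 C : R, 0 <= C & forall N, (4 <= N)%N ->
  N%:R `^ (- (p%:R / 2)) * V N (ball_bound d L0 N) (dth u N) p.+1 0 <= C * rate_G d p u N ^+ p.
Proof.
have pS : p.+1%:R = p%:R + 1 :> R by rewrite natr1.
have [h|h|h] := ltgtP u (d%:R * p.+1%:R).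
- have [C C0 hC] := V_slow L0 d0 u0 h; exists C => // N N4; have N0 : (0 < N)%N by exact: leq_trans N4.
  apply: (le_trans (ler_wpM2l (powR_ge0 _ _) (hC N N0))); rewrite mulrCA ler_wpM2l// powD//.
  rewrite /rate_G -pS h pw// bE; apply: le_of_eq; congr (_ `^ _); rewrite -/b pS; field; exact: lt0r_neq0.
- have [C C0 hC] := V_fast L0 u0 h; exists C => // N N4; have N0 : (0 < N)%N by exact: leq_trans N4.
  apply: (le_trans (ler_wpM2l (powR_ge0 _ _) (hC N N 0%N (leq0n N)))); rewrite powR1 mulr1 mulrC ler_wpM2l//.
  rewrite /rate_G -pS (ltNge u) (ltW h) /= gt_eqF// pw//; by apply: le_of_eq; congr (_ `^ _); field.
- have [C C0 hC] := V_crit L0 d0 u0 h; exists (C * 2); first by rewrite mulr_ge0.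
  move=> N N4; have N0 : (0 < N)%N by exact: leq_trans N4.
  have E1 : u < d%:R * p.+1%:R = false by rewrite [in LHS]h ltxx.
  have E2 : u == d%:R * p.+1%:R by apply/eqP.
  rewrite /rate_G -pS E1 E2 exprMn log_pow// pw//.
  rewrite (_ : - 2^-1 * _ = - (p%:R / 2)); last by field.
  rewrite mulrCA ler_wpM2l ?powR_ge0//; apply: (le_trans (hC N (leq_trans _ N4))) => //.
  by rewrite -mulrA ler_wpM2l//; have := ln_ge1 N4; lra.
Qed.

Lemma rate_G_gt0 N : (4 <= N)%N -> 0 < rate_G d p u N.
Proof.
by move=> N4; apply: lt_le_trans (rate_G_lower N4); rewrite powR_gt0// ltr0n (leq_trans _ N4).
Qed.

Lemma rate_G_decay : exists2 C : R, 0 <= C & exists2 e, 0 < e &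
  forall N, (4 <= N)%N -> rate_G d p u N <= C * N%:R `^ (- e).
Proof.
have [h|h|h] := ltgtP u (d%:R * (p%:R + 1)).
- exists 1 => //; exists expoG => // N _; rewrite /rate_G /expoG h mul1r.
  by rewrite bE.
- exists 1 => //; exists 2^-1 => [|N _]; first by rewrite invr_gt0.
  by rewrite /rate_G (ltNge u) (ltW h) /= gt_eqF// mul1r.
have e0 : 0 < 4^-1 :> R by rewrite invr_gt0.
have [C C0 hC] := log_pow_small e0; exists C => //; exists 4^-1 => // N N4.
have N0 : (0 < N)%N by exact: leq_trans N4.
rewrite /rate_G h ltxx eqxx; apply: (le_trans (ler_wpM2l (powR_ge0 _ _) (hC N N4))).
by rewrite mulrCA ler_wpM2l// powD//; apply: le_of_eq; congr (_ `^ _); field.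
Qed.

End rates.

(** * Mixing random fields *)

Section field_expansion.
Context {dd} {Om : measurableType dd} {R : realType} {S : choiceType}.
Variables (P : probability Om R) (X : S -> Om -> R) (Ts : seq S).
Variables (x0 : S) (dist : S -> S -> nat) (d p : nat) (kap Lam c1 A u : R).
Implicit Types (q k l m n s : nat) (w : R) (F : nat -> R -> R) (b : nat -> R).

Local Notation N := (size Ts).
Local Notation B := (@ball_bound R d p.+1 N).

Hypotheses (mX : forall i, measurable_fun setT (X i)) (uTs : uniq Ts).
Hypotheses (Lam1 : 1 <= Lam) (kap0 : 0 <= kap) (c1_ge1 : 1 <= c1).
Hypotheses (kap_le : kap <= c1 * N%:R `^ (- 2^-1)) (N4 : (4 <= N)%N).
Hypotheses (d0 : (0 < d)%N) (u0 : 0 <= u) (uA : u <= A).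
Hypothesis Lenv : L1 P (fun o => env X Ts o ^+ p.+2).
Hypothesis mom : forall J s, {subset J <= Ts} -> (size J <= s)%N -> (s <= p.+2)%N ->
  Ex P (fun o => env X J o ^+ s) <= Lam.
(** Levels [L <= p] involve total orders up to [p + 1] at most, so even their extra order enjoys the
    fast decay; only the level [p + 1] meets the slow one. *)
Hypothesis covA : forall L, (L <= p)%N -> cov_decay P X Ts dist L Lam (th A) (th A).
Hypothesis covU : cov_decay P X Ts dist p.+1 Lam (th A) (th u).
Hypothesis ball : forall x l, x \in Ts -> (count (fun j => dist x j <= l)%N Ts <= (2 * l).+1 ^ d)%N.

Let A0 : 0 <= A. Proof. exact: le_trans uA. Qed.
Let N0 : (0 < N)%N. Proof. exact: leq_trans N4. Qed.
Let Lam0 : 0 <= Lam. Proof. exact: le_trans Lam1. Qed.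

Let Cf : R := 3 * (1 + Lam).
Let Cf0 : 0 <= Cf. Proof. by rewrite mulr_ge0// addr_ge0. Qed.

Definition level_const : R := expand_const Lam Cf p * Lam * c1 ^+ p.+2.

Lemma dst_lt j (Q : seq S) l : (dst dist N j Q <= l)%N -> (l < N)%N -> has (fun x => dist x j <= l)%N Q.
Proof.
move=> h lN; apply/contraT => /hasPn nh; move: h; rewrite leqNgt => /negP; case.
rewrite /dst; elim: Q nh => [|x Q IH] nh; first by rewrite big_nil.
rewrite big_cons leq_min ltnNge nh ?mem_head//= IH// => y yQ.
by apply: nh; rewrite inE yQ orbT.
Qed.

(** Below the cap, a site near [Q] is near one of its elements and the counts add; at the cap
    [l = N] all sites are counted. *)
Lemma ball_count (Q : seq S) : {subset Q <= Ts} -> (size Q <= p.+1)%N -> forall l, (l <= N)%N ->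
  (count (fun j => dst dist N j Q <= l)%N Ts)%:R <= B l.
Proof.
move=> QT sQ l; rewrite leq_eqVlt => /predU1P[->|lN].
  apply: (@le_trans _ _ N%:R); first by rewrite ler_nat count_size.
  have h : N%:R <= (2 * N).+1%:R ^+ d :> R.
    rewrite -natrX ler_nat (@leq_trans (2 * N).+1)//; first by rewrite mul2n -addnn -addSn leq_addl.
    by rewrite -{1}(expn1 (2 * N).+1) leq_pexp2l.
  by rewrite /ball_bound (min_idPr h) ler_peMl// ler1n.
have le1 : (count (fun j => dst dist N j Q <= l)%N Ts <= size Q * (2 * l).+1 ^ d)%N.
  apply: (@leq_trans (count (fun j => has (fun x => dist x j <= l)%N Q) Ts)).
    by apply: sub_count => j /= hj; exact: dst_lt.
  elim: Q QT {sQ} => [|x Q IH] QT; first by rewrite (eq_count (a2 := pred0)) ?count_pred0.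
  rewrite mulSn; apply: leq_trans (leq_add (ball l (QT x (mem_head _ _))) (IH _)); last first.
    by move=> y yQ; apply: QT; rewrite inE yQ orbT.
  rewrite -count_predUI; apply: leq_trans (leq_addr _ _); exact: sub_count.
rewrite /ball_bound minEle; case: ifP => _; rewrite -?natrX -natrM ler_nat.
  by apply: (leq_trans le1); rewrite leq_mul2r sQ orbT.
by apply: (leq_trans (count_size _ _)); rewrite leq_pmull.
Qed.

Let pw e k : (N%:R `^ e) ^+ k = N%:R `^ (e * k%:R) :> R.
Proof. by rewrite -powR_mulrn ?powR_ge0// powRrM. Qed.

Let powD e e' : N%:R `^ e * N%:R `^ e' = N%:R `^ (e + e') :> R.
Proof. by rewrite powRD// pnatr_eq0 -lt0n N0 implybT. Qed.

Let cX k : (k <= p.+2)%N -> c1 ^+ k <= c1 ^+ p.+2.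
Proof. by move=> h; rewrite ler_weXn2l. Qed.

Let c0 : 0 <= c1. Proof. exact: le_trans c1_ge1. Qed.

Let kap_pow k : kap ^+ k <= c1 ^+ k * N%:R `^ (- (k%:R / 2)).
Proof.
have -> : - (k%:R / 2) = - 2^-1 * k%:R :> R by rewrite mulNr mulrC.
by rewrite -pw -exprMn lerXn2r ?nnegrE ?mulr_ge0 ?powR_ge0.
Qed.

Let kap_conv k : (k <= p.+1)%N -> N%:R * kap ^+ k.+1 <= c1 ^+ p.+2 * N%:R `^ ((1 - k%:R) / 2).
Proof.
move=> kp; apply: (le_trans (ler_wpM2l (ler0n _ _) (kap_pow k.+1))).
rewrite mulrCA -{1}[N%:R](@powRr1 _ N%:R)// powD ler_pM ?exprn_ge0 ?powR_ge0 ?cX//.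
by rewrite le_eqVlt; apply/orP; left; apply/eqP; congr (_ `^ _); rewrite -natr1; field.
Qed.

Let Ckp K : (K <= p)%N -> 0 <= expand_const Lam Cf K * Lam <= expand_const Lam Cf p * Lam.
Proof.
move=> Kp; have C1 := expand_const_ge1 Lam1 Cf0 K.
by rewrite mulr_ge0 ?(le_trans ler01 C1)//= ler_wpM2r// expand_const_mono.
Qed.

Let conv K k v : (K <= p)%N -> (k <= p.+1)%N -> 0 <= v ->
  expand_const Lam Cf K * Lam * N%:R * kap ^+ k.+1 * v <= level_const * (N%:R `^ ((1 - k%:R) / 2) * v).
Proof.
move=> Kp kp v0; have /andP[C0 CC] := Ckp Kp.
rewrite mulrA ler_wpM2r// -mulrA /level_const -[leRHS]mulrA ler_pM ?kap_conv//.
by rewrite mulr_ge0// exprn_ge0.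
Qed.

Lemma level_const_ge0 : 0 <= level_const.
Proof. by have /andP[h _] := Ckp (leqnn p); rewrite /level_const mulr_ge0// exprn_ge0. Qed.

Let B1 l : 1 <= B l. Proof. exact: ball_bound_ge1. Qed.
Let BD l l' : (l <= l')%N -> B l <= B l'. Proof. exact: ball_bound_mono. Qed.

Definition level_bound K b (rem : R) :=
  (forall k, (k <= K)%N -> `|b k| <= level_const * (N%:R `^ ((1 - k%:R) / 2) * V N B (dth A N) k 0)) /\
  (forall F w, chain F K -> osc w (F K) ->
    `|Ex P (fun o => Wsum X kap Ts o * F 0%N (Wsum X kap Ts o)) -
      \sum_(k < K.+1) b k * Ex P (fun o => F k (Wsum X kap Ts o))| <= level_const * (w * rem)).

Let V0 (s : R) k m : 0 <= s -> 0 <= V N B (dth s N) k m.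
Proof. by move=> s0; apply: V_ge0 => // l; exact: dth_ge0. Qed.

(** Below the top level the last variable can be expanded at all distances with the fast decay, and
    the remainder is then as small as the next coefficient. *)
Lemma level_low K : (0 < K < p)%N ->
  exists b, level_bound K b (N%:R `^ ((1 - K.+1%:R) / 2) * V N B (dth A N) K.+1 0).
Proof.
case/andP=> K0 Kp; have Kp' := ltnW Kp.
have Le : L1 P (fun o => env X Ts o ^+ K.+2).
  apply: (dom_L1 (X := X) (L := p.+1) Lenv (s := K.+2)); first by rewrite !ltnS.
  apply: (@bound_dom _ _ _ _ X Ts Ts K.+2 _ 1) => //.
    by apply: measurable_funX; exact: measurable_env.
  by move=> o; rewrite mul1r ger0_norm// exprn_ge0// env_ge0.
have momK J s : {subset J <= Ts} -> (size J <= s)%N -> (s <= K.+2)%N -> Ex P (fun o => env X J o ^+ s) <= Lam.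
  by move=> h1 h2 h3; apply: mom => //; apply: (leq_trans h3); rewrite !ltnS.
have BK Q : {subset Q <= Ts} -> (size Q <= K.+1)%N -> forall l, (l <= N)%N ->
    (count (fun j => dst dist N j Q <= l)%N Ts)%:R <= B l.
  by move=> h1 h2 l; apply: ball_count => //; apply: (leq_trans h2); rewrite ltnS.
have thV g : (g <= N)%N -> th A g <= V N B (dth A N) 0 g by move=> h; rewrite V_dth0.
have [|l|l|g gN||b [hb hr]] := @beta_expansion _ _ _ _ P X Ts x0 dist N K.+1 kap Lam
  (th A) (th A) B mX uTs Lam1 kap0 Le momK (covA Kp) _ (th_ge0 A) (fun g => lexx _) B1 BK K Cf
  (full_weight kap B (dth A N)) (dth A N) erefl Cf0 _ _ thV _ _.
- by rewrite th0.
- by rewrite /full_weight !mulr_ge0 ?dth_ge0// (le_trans ler01).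
- exact: dth_ge0.
- by apply: tay_full => // l; exact: dth_ge0.
- exact: (final_full x0 mX uTs Lam1 kap0 Le momK (covA Kp) (th_ge0 A) (fun g => lexx _) B1 BK (fun l => dth_ge0 N l A0) thV).
exists b; split=> [k kK|F w cF hw].
  apply: (le_trans (hb k kK)); apply: conv => //; first exact: leq_trans kK (leqW Kp').
  exact: V0.
apply: (le_trans (hr F w cF hw)); have w0 := osc_ge0 hw; rewrite V_full.
rewrite [leLHS](_ : _ = w * (expand_const Lam Cf K * Lam * N%:R * kap ^+ K.+2 * V N B (dth A N) K.+1 0)); last by rewrite (exprS kap K.+1); ring.
by rewrite [leRHS]mulrCA ler_wpM2l//; apply: conv => //; exact: V0.
Qed.

Let thU g : th A g <= th u g. Proof. exact: th_exp. Qed.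

Lemma level_cut m : (0 < p)%N -> (m <= N)%N -> exists b, level_bound p b
  (N%:R `^ ((1 - p%:R) / 2) * (N%:R `^ (- 2^-1) * B m ^+ p.+1 + V N B (dth A N) p m)).
Proof.
move=> p0 mN.
have thV g : (g <= N)%N -> th A g <= V N B (dth A N) 0 g by move=> h; rewrite V_dth0.
have u1 g : th u g <= 1 by exact: th_le1.
have anti g g' : (g <= g')%N -> th A g' <= th A g by exact: th_anti.
have dA l : 0 <= dth A N l by exact: dth_ge0.
have [|l|g gN||b [hb hr]] := @beta_expansion _ _ _ _ P X Ts x0 dist N p.+1 kap Lam
  (th A) (th u) B mX uTs Lam1 kap0 Lenv mom covU _ (th_ge0 A) thU B1 ball_count p Cf
  (cut_weight kap B (dth A N) m) (dth A N) erefl Cf0 _ dA thV _ _.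
- by rewrite th0.
- by rewrite /cut_weight addr_ge0// !mulr_ge0// (le_trans ler01).
- exact: tay_cut.
- exact: (final_cut x0 mX uTs Lam1 kap0 Lenv mom covU (th_ge0 A) thU B1 ball_count BD mN dA thV u1 anti).
exists b; split=> [k kK|F w cF hw].
  apply: (le_trans (hb k kK)); apply: conv => //; first exact: leqW.
  exact: V0.
apply: (le_trans (hr F w cF hw)); have w0 := osc_ge0 hw; rewrite V_cut//.
rewrite [leLHS](_ : _ = w * (expand_const Lam Cf p * Lam * (N%:R * kap ^+ p.+2) * B m ^+ p.+1 +
  expand_const Lam Cf p * Lam * N%:R * kap ^+ p.+1 * V N B (dth A N) p m)); last by rewrite (exprS kap p.+1); ring.
rewrite [leRHS](_ : _ = w * (level_const * (N%:R `^ ((1 - p%:R) / 2) * N%:R `^ (- 2^-1) * B m ^+ p.+1) +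
  level_const * (N%:R `^ ((1 - p%:R) / 2) * V N B (dth A N) p m))); last by ring.
rewrite ler_wpM2l// lerD//; last by apply: conv => //; exact: V0.
have Bm0 : 0 <= B m ^+ p.+1 by rewrite exprn_ge0// (le_trans ler01).
rewrite mulrA powD; apply: (le_trans (conv (leqnn p) (leqnn p.+1) Bm0)).
by rewrite ler_wpM2l ?level_const_ge0// le_eqVlt; apply/orP; left; apply/eqP; congr (_ `^ _ * _); rewrite -natr1; field.
Qed.

Lemma level_full : (0 < p)%N -> exists b, level_bound p b (N%:R `^ (- (p%:R / 2)) * V N B (dth u N) p.+1 0).
Proof.
move=> p0.
have thV g : (g <= N)%N -> th A g <= V N B (dth A N) 0 g by move=> h; rewrite V_dth0.
have thVu g : (g <= N)%N -> th u g <= V N B (dth u N) 0 g by move=> h; rewrite V_dth0.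
have dA l : 0 <= dth A N l by exact: dth_ge0.
have du l : 0 <= dth u N l by exact: dth_ge0.
have [|l|g gN||b [hb hr]] := @beta_expansion _ _ _ _ P X Ts x0 dist N p.+1 kap Lam
  (th A) (th u) B mX uTs Lam1 kap0 Lenv mom covU _ (th_ge0 A) thU B1 ball_count p Cf
  (full_weight kap B (dth u N)) (dth A N) erefl Cf0 _ dA thV _ _.
- by rewrite th0.
- by rewrite /full_weight !mulr_ge0// (le_trans ler01).
- exact: tay_full.
- exact: (final_full x0 mX uTs Lam1 kap0 Lenv mom covU (th_ge0 A) thU B1 ball_count du thVu).
exists b; split=> [k kK|F w cF hw].
  apply: (le_trans (hb k kK)); apply: conv => //; first exact: leqW.
  exact: V0.
apply: (le_trans (hr F w cF hw)); have w0 := osc_ge0 hw; rewrite V_full.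
rewrite [leLHS](_ : _ = w * (expand_const Lam Cf p * Lam * N%:R * kap ^+ p.+2 * V N B (dth u N) p.+1 0)); last by rewrite (exprS kap p.+1); ring.
rewrite [leRHS]mulrCA ler_wpM2l//; apply: le_trans (conv (leqnn p) (leqnn p.+1) (V0 p.+1 0 u0)) _.
by rewrite ler_wpM2l ?level_const_ge0// le_eqVlt; apply/orP; left; apply/eqP; congr (_ `^ _ * _); rewrite -natr1; field.
Qed.

End field_expansion.

(** * Wasserstein bound for one field with uniform constants *)

Section field_wasserstein.
Context {R : realType}.
Variables (d p : nat) (Lam c1 A u : R) (del : nat -> R).
Implicit Types (N k m q : nat).

Local Notation B := (@ball_bound R d p.+1).

Hypotheses (d0 : (0 < d)%N) (p0 : (0 < p)%N) (Lam1 : 1 <= Lam) (c1_ge1 : 1 <= c1).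
Hypotheses (u0 : 0 <= u) (uA : u <= A).
Hypothesis del_beta : exists2 C : R, 0 <= C & forall k, (1 < k <= p)%N -> forall N, (4 <= N)%N ->
  N%:R `^ ((1 - k%:R) / 2) * V N (B N) (dth A N) k 0 <= C * del N ^+ k.-1.
(* Either of the two ways of treating the last variable of the expansion may be used. *)
Hypothesis del_top : exists2 C : R, 0 <= C & forall N, (4 <= N)%N ->
  (exists2 m, (m <= N)%N & N%:R `^ ((1 - p%:R) / 2) *
    (N%:R `^ (- 2^-1) * B N m ^+ p.+1 + V N (B N) (dth A N) p m) <= C * del N ^+ p) \/
  N%:R `^ (- (p%:R / 2)) * V N (B N) (dth u N) p.+1 0 <= C * del N ^+ p.
Hypothesis del_gt0 : forall N, (4 <= N)%N -> 0 < del N.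
Hypothesis del_decay : exists2 C : R, 0 <= C & exists2 e, 0 < e &
  forall N, (4 <= N)%N -> del N <= C * N%:R `^ (- e).

Lemma del_small eps : 0 < eps -> exists N0, forall N, (N0 <= N)%N -> (4 <= N)%N -> del N <= eps.
Proof.
move=> eps0; have [C C0 [e e0 hC]] := del_decay.
pose y := ((C + 1) / eps) `^ e^-1.
have Ce : 0 < (C + 1) / eps by rewrite divr_gt0// ltr_wpDl.
exists (Num.truncn y).+1 => N yN N4; apply: (le_trans (hC N N4)).
have y0 : 0 < y by rewrite powR_gt0.
have yN' : y <= N%:R.
  have /andP[_ h] := truncn_itv (ltW y0); apply: (le_trans (ltW h)); by rewrite ler_nat.
have h : (C + 1) / eps <= N%:R `^ e.
  have -> : (C + 1) / eps = y `^ e by rewrite /y -powRrM mulVf ?gt_eqF// powRr1// ltW.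
  by rewrite ge0_ler_powR ?nnegrE// ltW.
have N0 : 0 < N%:R `^ e by exact: lt_le_trans h.
rewrite powRN ler_pdivrMr//; move: h; rewrite ler_pdivrMr// mulrC => h.
by apply: le_trans h; rewrite lerDl.
Qed.

(** The order of the quantifiers is the point: [K] and [N0] are fixed before the field, so that the
    bound applies to all members of a sequence of fields. *)
Theorem field_wasserstein : exists K : R, exists N0 : nat,
  forall (dd : measure_display) (Om : measurableType dd) (P : probability Om R) (S : choiceType)
    (X : S -> Om -> R) (Ts : seq S) (x0 : S) (dist : S -> S -> nat) (kap : R) (W : {RV P >-> R}),
  (N0 <= size Ts)%N -> (4 <= size Ts)%N -> (forall i, measurable_fun setT (X i)) -> uniq Ts ->
  0 <= kap -> kap <= c1 * (size Ts)%:R `^ (- 2^-1) ->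
  L1 P (fun o => env X Ts o ^+ p.+2) ->
  (forall J s, {subset J <= Ts} -> (size J <= s)%N -> (s <= p.+2)%N -> Ex P (fun o => env X J o ^+ s) <= Lam) ->
  (forall L, (L <= p)%N -> cov_decay P X Ts dist L Lam (th A) (th A)) ->
  cov_decay P X Ts dist p.+1 Lam (th A) (th u) ->
  (forall x l, x \in Ts -> (count (fun j => dist x j <= l)%N Ts <= (2 * l).+1 ^ d)%N) ->
  (W : Om -> R) =1 Wsum X kap Ts -> Ex P W = 0 -> Ex P (fun o => W o ^+ 2) = 1 ->
  (wasserstein p (distribution P W) (normal_prob 0 1) <= (K * del (size Ts))%:E)%E.
Proof.
have [Cb Cb0 hb] := del_beta; have [Ct Ct0 ht] := del_top.
have l0 : 0 <= level_const p Lam c1 := level_const_ge0 p Lam1 c1_ge1.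
pose B0 := 1 + level_const p Lam c1 * (Cb + Ct).
have B1 : 1 <= B0 by rewrite lerDl mulr_ge0// addr_ge0.
have [N0 hN0] := del_small (wass_small_gt0 p B1).
exists (wass_const p B0), N0 => dd Om P S X Ts x0 dist kap W sN N4 mX uTs kap0 kap_le Lenv mom covA covU ball hW EW0 EW2.
have dl0 := del_gt0 N4; set N := size Ts in dl0 *.
have le_b C x y : 0 <= C <= Cb + Ct -> 0 <= y -> x <= C * y -> level_const p Lam c1 * x <= B0 * y.
  case/andP=> C0 CC y0 h; apply: (le_trans (ler_wpM2l l0 h)); rewrite mulrA ler_wpM2r//.
  by apply: (@le_trans _ _ (level_const p Lam c1 * (Cb + Ct))); [rewrite ler_wpM2l|rewrite lerDr].
(* Every level [q] comes with its own coefficients; [b_unique] identifies them inside the corrected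
   limit theorem. *)
have lev q : exists b : nat -> R, (0 < q <= p)%N -> exists2 rem,
    level_bound P X Ts d p kap Lam c1 A q b rem & level_const p Lam c1 * rem <= B0 * del N ^+ q.
  have [/andP[q0 qp]|nq] := boolP (0 < q <= p)%N; last by exists (fun=> 0).
  have dq := exprn_ge0 q (ltW dl0).
  have [qlt|] := ltnP q p.
    have [|b h] := level_low x0 mX uTs Lam1 kap0 c1_ge1 kap_le N4 d0 u0 uA Lenv mom covA ball (K := q).
      by rewrite q0.
    exists b => _; eexists; first exact: h.
    apply: (le_b Cb); [by rewrite Cb0 lerDl|exact: dq|apply: (hb q.+1 _ N N4)].
    by rewrite ltnS q0.
  move=> pq; have qe : q = p by apply/eqP; rewrite eqn_leq qp.
  rewrite qe in dq *; have [[m mN hm]|h] := ht N N4.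
    have [b h] := level_cut x0 mX uTs Lam1 kap0 c1_ge1 kap_le N4 d0 u0 uA Lenv mom covU ball p0 mN.
    exists b => _; eexists; first exact: h.
    by apply: (le_b Ct) => //; rewrite Ct0 lerDr.
  have [b h'] := level_full x0 mX uTs Lam1 kap0 c1_ge1 kap_le N4 d0 u0 uA Lenv mom covU ball p0.
  exists b => _; eexists; first exact: h'.
  by apply: (le_b Ct) => //; rewrite Ct0 lerDr.
have [b hlev] := choice lev.
apply: (corrected_wasserstein p0 B1 (b := b)) => //.
- apply: (L1_le _ _ (L1Z (kap ^+ p.+1) Lenv)).
    by apply: measurable_funX; apply: measurableT_comp.
  move=> o; rewrite normrX normr_id hW /Wsum normrM (ger0_norm kap0) exprMn ler_wpM2l ?exprn_ge0//.
  have e1 := env_ge1 X Ts o; rewrite (@le_trans _ _ (env X Ts o ^+ p.+1)) ?ler_weXn2l//.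
  rewrite lerXn2r ?nnegrE ?env_ge0//; apply: (le_trans (ler_norm_sum _ _ _)).
  by rewrite /env lerDr.
- exact: hN0.
- move=> q k qp /andP[k1 kq]; have q0 : (0 < q)%N by apply: leq_trans kq; exact: ltnW.
  have [|rem [h _] _] := hlev q; first by rewrite q0.
  apply: (le_trans (h k kq)); apply: (le_b Cb); first by rewrite Cb0 lerDl.
    by rewrite exprn_ge0// ltW.
  by apply: hb => //; rewrite k1 (leq_trans kq).
- move=> q F w qp cF oF; have [rem [_ h] hr] := hlev q qp.
  have E1 : Ex P (fun o => W o * F 0%N (W o)) = Ex P (fun o => Wsum X kap Ts o * F 0%N (Wsum X kap Ts o)).
    by apply: eq_Ex => o; rewrite hW.
  have E2 k : Ex P (fun o => F k (W o)) = Ex P (fun o => F k (Wsum X kap Ts o)).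
    by apply: eq_Ex => o; rewrite hW.
  rewrite E1; under eq_bigr do rewrite E2.
  apply: (le_trans (h F w cF oF)); have w0 := osc_ge0 oF.
  by rewrite mulrCA (mulrAC B0) [leRHS]mulrC ler_wpM2l.
Qed.

End field_wasserstein.

(** * From mixing coefficients to covariance decay *)

Section mixing_to_decay.
Context {dd} {Om : measurableType dd} {R : realType} {S : choiceType}.
Variables (P : probability Om R) (X : S -> Om -> R) (Ts : seq S) (dist : S -> S -> nat).
Variables (p : nat) (C v eA eU K Lam : R).
Implicit Types (I J U : seq S) (Z xi : Om -> R) (n s g : nat).

Hypotheses (mX : forall i, measurable_fun setT (X i)) (C0 : 0 < C) (v0 : 0 < v).
Hypotheses (eU0 : 0 <= eU) (eUA : eU <= eA) (eA1 : eA <= 1) (K0 : 0 <= K).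
Hypothesis Lenv : L1 P (fun o => env X Ts o ^+ p.+2).
Hypothesis cov_le : forall J Z xi n s al, {subset J <= Ts} -> (size J <= p.+2)%N ->
  measurable_fun setT Z -> measurable_fun setT xi ->
  (forall o, `|Z o| <= env X J o ^+ n) -> (forall o, `|xi o| <= env X J o ^+ s) ->
  (0 < n)%N -> 0 < al <= 1 -> mixing_bound P Z xi al ->
  ((n + s <= p.+1)%N -> `|Cov P Z xi| <= K * al `^ eA) /\
  ((n + s <= p.+2)%N -> `|Cov P Z xi| <= K * al `^ eU).
Hypothesis mix : forall I U g, {subset I <= Ts} -> {subset U <= Ts} -> (size I <= p.+1)%N -> (0 < g)%N ->
  (forall x y, x \in I -> y \in U -> (g <= dist x y)%N) ->
  forall A B, <<s gens X I>> A -> <<s gens X U>> B ->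
    `|fine (P (A `&` B)) - fine (P A) * fine (P B)| <= C * g%:R `^ (- v).

(** The mixing bound starts at distance 1 and [th] at distance 0: the factor 2 to the power [v] pays
    for replacing [g] by [g + 1], and the maximum with 1 for the trivial bound at distance 0. *)
Definition mix_const : R := Num.max 1 (C * 2 `^ v).
Hypothesis KLam : K * mix_const <= Lam.

Let mix1 : 1 <= mix_const. Proof. by rewrite le_max lexx. Qed.

Let alpha g : R := Num.min 1 (mix_const * g.+1%:R `^ (- v)).

Let alpha01 g : 0 < alpha g <= 1.
Proof. by rewrite lt_min ltr01 ge_min lexx mulr_gt0 ?powR_gt0 ?ltr0n// (lt_le_trans ltr01). Qed.

Let alpha_pow g e : 0 <= e <= 1 -> alpha g `^ e <= mix_const * th (v * e) g.
Proof.
case/andP=> e0 e1; have /andP[a0 _] := alpha01 g.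
apply: (@le_trans _ _ ((mix_const * g.+1%:R `^ (- v)) `^ e)).
  by rewrite ge0_ler_powR ?nnegrE ?(ltW a0) ?mulr_ge0 ?powR_ge0 ?(le_trans ler01 mix1)// ge_min lexx orbT.
rewrite powRM ?powR_ge0 ?(le_trans ler01 mix1)// -powRrM mulNr -/(th (v * e) g) ler_wpM2r ?th_ge0//.
by rewrite -[leRHS]powRr1 ?ler_powR// (le_trans ler01 mix1).
Qed.

Let mixing_alpha I U Z xi g : {subset I <= Ts} -> {subset U <= Ts} -> (size I <= p.+1)%N ->
  smeas X I Z -> smeas X U xi -> (forall x y, x \in I -> y \in U -> (g <= dist x y)%N) ->
  mixing_bound P Z xi (alpha g).
Proof.
move=> IT UT sI mZ mxi far s t; rewrite le_min.
set D := `|_|; have D1 : D <= 1.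
  have mZ' := smeas_measurable mX mZ; have mxi' := smeas_measurable mX mxi.
  have f01 A : measurable A -> 0 <= fine (P A) <= 1.
    move=> mA; rewrite fine_ge0//= -lee_fin fineK ?fin_num_measure//; exact: probability_le1.
  have m1 := measurable_gt s mZ'; have m2 := measurable_gt t mxi'.
  have /andP[a0 a1] := f01 _ m1; have /andP[b0 b1] := f01 _ m2.
  have /andP[c0 c1] := f01 _ (measurableI _ _ m1 m2).
  have ab0 := mulr_ge0 a0 b0; have ab1 := mulr_ile1 a0 b0 a1 b1.
  by rewrite ler_norml; apply/andP; split; lra.
rewrite D1 /=; case: g far => [|g] far; first by rewrite powR1 mulr1 (le_trans D1).
apply: (@le_trans _ _ (C * 2 `^ v * g.+2%:R `^ (- v))); last first.
  by rewrite ler_wpM2r ?powR_ge0// le_max lexx orbT.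
apply: (le_trans (mix IT UT sI (ltn0Sn g) far (smeas_level s mZ) (smeas_level t mxi))).
rewrite -mulrA ler_wpM2l ?(ltW C0)//.
have -> : 2 `^ v = (2^-1) `^ (- v) :> R by rewrite -powR_inv1// -powRrM mulrN mulNr mul1r opprK.
rewrite -powRM ?invr_ge0// !(powR_expR (- v)) ?mulr_gt0 ?invr_gt0 ?ltr0n// ler_expR.
rewrite ler_wnM2l ?oppr_le0 ?(ltW v0)// ler_ln ?posrE ?mulr_gt0 ?invr_gt0 ?ltr0n//.
by rewrite ler_pdivrMl// -natrM ler_nat mul2n -addnn -addn1 leq_add2l.
Qed.

(** After division by [c1] and [c2] both functions are dominated by powers of the common envelope of
    [I ++ J], which is the form of the covariance inequality. A zero constant forces the function to
    vanish. *)
Lemma cov_decay_of_mixing I U J Z xi n s c1 c2 g :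
  {subset I <= Ts} -> {subset U <= Ts} -> {subset J <= Ts} ->
  (size I <= n)%N -> (size J <= s)%N -> smeas X I Z -> smeas X U xi -> 0 <= c1 -> 0 <= c2 ->
  (forall o, `|Z o| <= c1 * env X I o ^+ n) -> (forall o, `|xi o| <= c2 * env X J o ^+ s) ->
  (forall x y, x \in I -> y \in U -> (g <= dist x y)%N) -> (0 < n <= p.+1)%N ->
  ((n + s <= p.+1)%N -> `|Cov P Z xi| <= c1 * c2 * Lam * th (v * eA) g) /\
  ((n + s <= p.+2)%N -> `|Cov P Z xi| <= c1 * c2 * Lam * th (v * eU) g).
Proof.
move=> IT UT JT sI sJ mZ mxi c10 c20 hZ hxi far /andP[n0 np].
have [ns|ns] := leqP (n + s) p.+2; last by split=> h; move: ns; rewrite ltnNge ?h ?(leqW h).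
have normal (c : R) (Y : Om -> R) I' k (L : seq S) : 0 <= c -> (forall o, `|Y o| <= c * env X I' o ^+ k) ->
    (forall o, env X I' o <= env X L o) ->
    (forall o, Y o = c * (c^-1 * Y o)) /\ (forall o, `|c^-1 * Y o| <= env X L o ^+ k).
  move=> c0 hY sub; have mono o : env X I' o ^+ k <= env X L o ^+ k by rewrite lerXn2r ?nnegrE ?env_ge0.
  have [cz|cn] := eqVneq c 0.
    rewrite cz in hY *; split=> o; last by rewrite invr0 mul0r normr0 exprn_ge0// env_ge0.
    by apply/eqP; rewrite mul0r -normr_le0 (le_trans (hY o))// mul0r.
  have cp : 0 < c by rewrite lt_neqAle eq_sym cn.
  split=> o; first by rewrite mulrA divff// mul1r.
  by rewrite normrM gtr0_norm ?invr_gt0// ler_pdivrMl// (le_trans (hY o))// ler_wpM2l.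
have subI o : env X I o <= env X (I ++ J) o by rewrite /env big_cat /= addrA lerDl sumr_ge0.
have subJ o : env X J o <= env X (I ++ J) o by rewrite /env big_cat /= lerD2l lerDr sumr_ge0.
have [Z1 Z2] := normal _ _ _ _ (I ++ J) c10 hZ subI; have [x1 x2] := normal _ _ _ _ (I ++ J) c20 hxi subJ.
have mZ1 : smeas X I (fun o => c1^-1 * Z o) by apply: smeasM => //; exact: smeas_cst.
have mx1 : smeas X U (fun o => c2^-1 * xi o) by apply: smeasM => //; exact: smeas_cst.
have IJT : {subset I ++ J <= Ts} by move=> x; rewrite mem_cat => /orP[/IT|/JT].
have dY (Y : Om -> R) k : measurable_fun setT Y -> (forall o, `|Y o| <= env X (I ++ J) o ^+ k) -> dom X Ts k Y.
  by move=> mY hY; apply: (@bound_dom _ _ _ _ X Ts (I ++ J) k Y 1) => // o; rewrite mul1r.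
have dZ := dY _ _ (smeas_measurable mX mZ1) Z2; have dx := dY _ _ (smeas_measurable mX mx1) x2.
have L k (Y : Om -> R) : (k <= p.+2)%N -> dom X Ts k Y -> L1 P Y by exact: (dom_L1 (L := p.+1) Lenv).
have E : Cov P Z xi = c1 * c2 * Cov P (fun o => c1^-1 * Z o) (fun o => c2^-1 * xi o).
  have e1 : Ex P (fun o => Z o * xi o) = c1 * c2 * Ex P (fun o => c1^-1 * Z o * (c2^-1 * xi o)).
    by rewrite -ExZ; [apply: eq_Ex => o; rewrite {1}Z1 {1}x1; ring|exact: L ns (domM dZ dx)].
  have e2 : Ex P Z = c1 * Ex P (fun o => c1^-1 * Z o).
    by rewrite -ExZ; [exact: eq_Ex|exact: L (leq_trans (leq_addr _ _) ns) dZ].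
  have e3 : Ex P xi = c2 * Ex P (fun o => c2^-1 * xi o).
    by rewrite -ExZ; [exact: eq_Ex|exact: L (leq_trans (leq_addl _ _) ns) dx].
  by rewrite /Cov e1 e2 e3; ring.
have sIJ : (size (I ++ J) <= p.+2)%N by rewrite size_cat (leq_trans _ ns)// leq_add.
have [C1 C2] := cov_le IJT sIJ (smeas_measurable mX mZ1) (smeas_measurable mX mx1) Z2 x2 n0 (alpha01 g)
  (mixing_alpha IT UT (leq_trans sI np) mZ1 mx1 far).
have cc : 0 <= c1 * c2 by rewrite mulr_ge0.
have fin e : 0 <= e <= 1 -> `|Cov P (fun o => c1^-1 * Z o) (fun o => c2^-1 * xi o)| <= K * alpha g `^ e ->
    `|Cov P Z xi| <= c1 * c2 * Lam * th (v * e) g.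
  move=> e01 h; rewrite E normrM (ger0_norm cc) -mulrA ler_wpM2l//; apply: (le_trans h).
  apply: (le_trans (ler_wpM2l K0 (alpha_pow g e01))); rewrite mulrA ler_wpM2r ?th_ge0//.
split=> h; [apply: (fin eA) => //; last exact: C1|apply: (fin eU) => //; last exact: C2].
  by rewrite eA1 (le_trans eU0).
by rewrite eU0 (le_trans eUA).
Qed.

End mixing_to_decay.

(** * Moments of envelopes *)

Section envelope_moments.
Context {dd} {Om : measurableType dd} {R : realType} {S : choiceType}.
Variables (P : probability Om R) (X : S -> Om -> R).
Hypothesis mX : forall i, measurable_fun setT (X i).
Implicit Types (J : seq S) (o : Om) (s b : R).

Lemma env_le_max J o : env X J o <= (size J).+1%:R * \big[Num.max/1]_(i <- J) `|X i o|.
Proof.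
have le m J' : \big[Num.max/1]_(i <- J') `|X i o| <= m -> \sum_(i <- J') `|X i o| <= (size J')%:R * m.
  elim: J' => [|i J' IH]; first by rewrite !big_nil mul0r.
  by rewrite !big_cons ge_max => /andP[h1 /IH h2] /=; rewrite -natr1 mulrDl mul1r addrC lerD.
have one : 1 <= \big[Num.max/1]_(i <- J) `|X i o|.
  by elim: J => [|i J IH]; rewrite ?big_nil// big_cons le_max IH orbT.
by rewrite /env -nat1r mulrDl mul1r lerD// le.
Qed.

Lemma env_powR_le J s o : 0 <= s ->
  env X J o `^ s <= (size J).+1%:R `^ s * (1 + \sum_(i <- J) `|X i o| `^ s).
Proof.
move=> s0; set m := \big[Num.max/1]_(i <- J) `|X i o|.
have m0 : 0 <= m by rewrite /m; elim: J {m} => [|i J IH]; rewrite ?big_nil// big_cons le_max IH orbT.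
apply: (@le_trans _ _ (((size J).+1%:R * m) `^ s)).
  by rewrite ge0_ler_powR ?nnegrE ?env_ge0 ?mulr_ge0// env_le_max.
rewrite powRM// ler_wpM2l ?powR_ge0// /m; elim: J {m m0} => [|i J IH].
  by rewrite !big_nil powR1 addr0.
rewrite !big_cons addrCA maxEle; case: ifP => _.
  by apply: (le_trans IH); rewrite lerDr powR_ge0.
by rewrite lerDl addr_ge0// sumr_ge0// => j _; exact: powR_ge0.
Qed.

Lemma Lnorm_fin_moment i s b : 0 < s -> 0 <= b -> ('N[P]_s%:E[EFin \o X i] <= b%:E)%E ->
  L1 P (fun o => `|X i o| `^ s) /\ Ex P (fun o => `|X i o| `^ s) <= b `^ s.
Proof.
move=> s0 b0; rewrite unlock /= => h.
have mI : measurable_fun setT (fun o => `|X i o| `^ s).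
  apply: (measurableT_comp (measurable_powR s)); exact: measurableT_comp.
have E : (\int[P]_o `|(EFin \o X i) o| `^ s = \int[P]_o (`|X i o| `^ s)%:E)%E.
  by apply: eq_integral => o _.
rewrite E in h.
have I0 : (0 <= \int[P]_o (`|X i o| `^ s)%:E)%E by apply: integral_ge0 => o _; rewrite lee_fin powR_ge0.
have le : (\int[P]_o (`|X i o| `^ s)%:E <= (b `^ s)%:E)%E.
  have -> : (\int[P]_o (`|X i o| `^ s)%:E = ((\int[P]_o (`|X i o| `^ s)%:E) `^ s^-1) `^ s)%E.
    by rewrite -poweRrM ?mulVf ?gt_eqF// poweRe1.
  rewrite -poweR_EFin; apply: gt0_ler_poweR => //; first exact: ltW.
    by rewrite in_itv /= leey andbT poweR_ge0.
  by rewrite in_itv /= leey andbT lee_fin.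
have LI : L1 P (fun o => `|X i o| `^ s).
  apply/integrableP; split; first exact/measurable_EFinP.
  under eq_integral do rewrite gee0_abs ?lee_fin ?powR_ge0//=.
  by apply: le_lt_trans le _; rewrite ltry.
by split=> //; rewrite -lee_fin -Ex_fin.
Qed.

Lemma env_fin_moment J s b : 0 < s -> 0 <= b -> (forall i, i \in J -> ('N[P]_s%:E[EFin \o X i] <= b%:E)%E) ->
  L1 P (fun o => env X J o `^ s) /\
  Ex P (fun o => env X J o `^ s) <= (size J).+1%:R `^ s * (1 + (size J)%:R * b `^ s).
Proof.
move=> s0 b0 hJ.
pose G o := (size J).+1%:R `^ s * (1 + \sum_(i <- J) `|X i o| `^ s).
have [L0 E0] : L1 P (fun o => \sum_(i <- J) `|X i o| `^ s) /\
    Ex P (fun o => \sum_(i <- J) `|X i o| `^ s) <= (size J)%:R * b `^ s.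
  elim: J hJ {G} => [|i J IH] hJ.
    split; first by apply: (eq_L1 _ (L1_cst P 0)) => o; rewrite big_nil.
    rewrite (_ : (fun o => _) = fun=> 0) ?Ex_cst ?mul0r//; by apply/funext => o; rewrite big_nil.
  have [Li Ei] := Lnorm_fin_moment s0 b0 (hJ i (mem_head _ _)).
  have [|LJ EJ] := IH; first by move=> j jJ; apply: hJ; rewrite inE jJ orbT.
  split; first by apply: (eq_L1 _ (L1D Li LJ)) => o; rewrite big_cons.
  rewrite [leLHS](_ : _ = Ex P (fun o => `|X i o| `^ s + \sum_(j <- J) `|X j o| `^ s)); last first.
    by apply: eq_Ex => o; rewrite big_cons.
  by rewrite ExD//= -nat1r mulrDl mul1r lerD.
have LG : L1 P G by apply: L1Z; apply: L1D => //; exact: L1_cst.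
have LE : L1 P (fun o => env X J o `^ s).
  apply: (L1_le _ _ LG).
    apply: (measurableT_comp (measurable_powR s)); exact: measurable_env.
  by move=> o; rewrite ger0_norm ?powR_ge0// env_powR_le// ltW.
split=> //; apply: (@le_trans _ _ (Ex P G)).
  by apply: Ex_le => // o; apply: env_powR_le; exact: ltW.
rewrite /G ExZ; last by apply: L1D => //; exact: L1_cst.
by rewrite ler_wpM2l ?powR_ge0// ExD ?Ex_cst ?lerD2l//; exact: L1_cst.
Qed.

Lemma env_bounded_ae J b : 0 <= b -> (forall i, i \in J -> ('N[P]_+oo[EFin \o X i] <= b%:E)%E) ->
  P [set o | 1 + (size J)%:R * b < env X J o] = 0%E.
Proof.
move=> b0 hJ.
have one i : i \in J -> P [set o | b < `|X i o|] = 0%E.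
  move=> /hJ; rewrite unlock /= probability_setT lte01 => /ess_supP [A [mA PA sub]].
  apply/eqP; rewrite -measure_le0 -PA le_measure ?inE//.
    have -> : [set o | b < `|X i o|] = setT `&` (fun o => `|X i o|) @^-1` `]b, +oo[.
      by rewrite setTI; apply/seteqP; split=> o /=; rewrite in_itv /= andbT.
    by have := measurableT_comp (@normr_measurable R setT) (mX i); apply.
  by move=> o /= bo; apply: sub => /=; rewrite lee_fin leNgt bo.
elim: J hJ one => [|i J IH] hJ one.
  rewrite mul0r addr0 (_ : [set o | _] = set0) ?measure0//.
  by apply/seteqP; split=> // o /=; rewrite /env big_nil addr0 ltxx.
have mE J' : measurable [set o | 1 + (size J')%:R * b < env X J' o] by exact: measurable_gt (measurable_env _ mX).
have mi : measurable [set o | b < `|X i o|] by apply: measurable_gt; exact: measurableT_comp.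
have h1 := one i (mem_head _ _).
have h2 : P [set o | 1 + (size J)%:R * b < env X J o] = 0%E.
  by apply: IH => j jJ; [apply: hJ|apply: one]; rewrite inE jJ orbT.
have sub : [set o | 1 + (size (i :: J))%:R * b < env X (i :: J) o] `<=`
    [set o | b < `|X i o|] `|` [set o | 1 + (size J)%:R * b < env X J o].
  move=> o /=; rewrite env_cons -natr1 => h; have [|bi] := ltP b `|X i o|; first by left.
  by right; rewrite ltNge; apply/negP => h'; move: h; lra.
apply/eqP; rewrite -measure_le0; apply: (le_trans (le_measure P _ _ sub)); rewrite ?inE//.
  exact: measurableU.
by apply: (le_trans (measureU2 _ _ _)) => //; rewrite [X in (X + _)%E]h1 [X in (_ + X)%E]h2 adde0.
Qed.

Lemma Ex_le_ae (M : Om -> R) c : measurable_fun setT M -> (forall o, 0 <= M o) -> 0 <= c ->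
  P [set o | c < M o] = 0%E -> L1 P M /\ Ex P M <= c.
Proof.
move=> mM M0 c0 h.
have mS : measurable [set o | c < M o] by exact: measurable_gt.
pose M' o := Num.min c (M o).
have mM' : measurable_fun setT M' by exact: measurable_minr.
have M'c o : `|M' o| <= c by rewrite ger0_norm ?ge_min ?lexx// le_min c0 M0.
have LM' : L1 P M' := L1_bounded P mM' M'c.
have E : (\int[P]_o (M o)%:E = \int[P]_o (M' o)%:E)%E.
  apply: ge0_ae_eq_integral => //; [exact/measurable_EFinP|exact/measurable_EFinP| | |].
  - by move=> o _; rewrite lee_fin.
  - by move=> o _; rewrite lee_fin le_min c0 M0.
  exists [set o | c < M o]; split=> // o /=; apply: contra_notP => /negP; rewrite -leNgt => hM _.
  by rewrite /M' (min_idPr hM).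
have LM : L1 P M.
  apply/integrableP; split; first exact/measurable_EFinP.
  under eq_integral do rewrite gee0_abs ?lee_fin ?M0//=.
  by rewrite E (Ex_fin LM') ltry.
split=> //; have -> : Ex P M = Ex P M' by rewrite /Ex /Rintegral E.
rewrite -(Ex_cst P c); apply: Ex_le => //; first exact: L1_cst.
by move=> o; rewrite ge_min lexx.
Qed.

End envelope_moments.

(** The exponents left by the covariance inequality at total orders [p + 1] and [p + 2]; times [v]
    they are [A] and [u]. *)
Definition exp_A {R : realType} p (r : \bar R) : R := if r is s%:E then 1 - p.+1%:R / s else 1.
Definition exp_U {R : realType} p (r : \bar R) : R := if r is s%:E then 1 - p.+2%:R / s else 1.

(** Finite and infinite [r] are brought to one form here: truncation at a power of the mixing
    coefficient in the first case, an almost sure bound with no loss of exponent in the second. The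
    constants precede the probability space. *)
Lemma moment_interface (R : realType) (p : nat) (r : \bar R) (b : R) : (p.+2%:R%:E <= r)%E -> 0 <= b ->
  exists2 K : R, 0 <= K & exists2 Lam, 1 <= Lam &
  forall (dd : measure_display) (Om : measurableType dd) (P : probability Om R) (S : choiceType)
    (X : S -> Om -> R) (Ts : seq S), (forall i, measurable_fun setT (X i)) ->
  (forall i, i \in Ts -> ('N[P]_r[EFin \o X i] <= b%:E)%E) ->
  [/\ L1 P (fun o => env X Ts o ^+ p.+2),
    (forall (J : seq S) (s : nat), {subset J <= Ts} -> (size J <= s)%N -> (s <= p.+2)%N -> Ex P (fun o => env X J o ^+ s) <= Lam) &
    forall (J : seq S) (Z xi : Om -> R) (n s : nat) (al : R), {subset J <= Ts} -> (size J <= p.+2)%N ->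
      measurable_fun setT Z -> measurable_fun setT xi ->
      (forall o, `|Z o| <= env X J o ^+ n) -> (forall o, `|xi o| <= env X J o ^+ s) ->
      (0 < n)%N -> 0 < al <= 1 -> mixing_bound P Z xi al ->
      ((n + s <= p.+1)%N -> `|Cov P Z xi| <= K * al `^ exp_A p r) /\
      ((n + s <= p.+2)%N -> `|Cov P Z xi| <= K * al `^ exp_U p r)].
Proof.
case: r => [s||//] ps b0.
  rewrite lee_fin in ps; have s0 : 0 < s by apply: lt_le_trans ps; rewrite ltr0n.
  pose K1 : R := p.+3%:R `^ s * (1 + p.+2%:R * b `^ s).
  have K10 : 0 <= K1 by rewrite mulr_ge0 ?powR_ge0// addr_ge0// mulr_ge0 ?powR_ge0.
  exists (4 + (2 + 2 * K1) * K1); first by rewrite addr_ge0// mulr_ge0// addr_ge0// mulr_ge0.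
  exists (1 + K1); first by rewrite lerDl.
  move=> dd Om P S X Ts mX hN.
  have sub (J : seq S) : {subset J <= Ts} -> forall i, i \in J -> ('N[P]_s%:E[EFin \o X i] <= b%:E)%E.
    by move=> JT i /JT; exact: hN.
  have le J (k : nat) o : (k <= p.+2)%N -> env X J o ^+ k <= env X J o `^ s.
    move=> kp; rewrite -powR_mulrn ?env_ge0//; apply: ler_powR; first exact: env_ge1.
    by apply: le_trans ps; rewrite ler_nat.
  have LE (J : seq S) (k : nat) : (k <= p.+2)%N -> {subset J <= Ts} -> L1 P (fun o => env X J o ^+ k).
    move=> kp JT; have [L _] := env_fin_moment mX s0 b0 (sub _ JT); apply: (L1_le _ _ L).
      by apply: measurable_funX; exact: measurable_env.
    by move=> o; rewrite ger0_norm ?exprn_ge0 ?env_ge0// le.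
  have mom (J : seq S) : {subset J <= Ts} -> (size J <= p.+2)%N -> Ex P (fun o => env X J o `^ s) <= K1.
    move=> JT sJ; have [_ h] := env_fin_moment mX s0 b0 (sub _ JT); apply: (le_trans h).
    rewrite /K1 ler_pM ?powR_ge0//; first by rewrite addr_ge0// mulr_ge0 ?powR_ge0.
      by rewrite ge0_ler_powR ?nnegrE ?(ltW s0)// ler_nat ltnS.
    by rewrite lerD2l ler_wpM2r ?powR_ge0// ler_nat.
  split; first exact: LE.
    move=> J k JT sJ kp; apply: (@le_trans _ _ K1); last by rewrite lerDr.
    apply: le_trans (mom J JT (leq_trans sJ kp)); apply: Ex_le; [exact: LE|by have [] := env_fin_moment mX s0 b0 (sub _ JT)|].
    by move=> o; exact: le.
  move=> J Z xi n k al JT sJ mZ mxi hZ hxi n0 al01 hmix.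
  have [L _] := env_fin_moment mX s0 b0 (sub _ JT).
  have main : (n + k <= p.+2)%N -> `|Cov P Z xi| <= (4 + (2 + 2 * K1) * K1) * al `^ (1 - (n + k)%:R / s).
    move=> nk; apply: (Cov_moment (M := env X J)) => //; last exact: mom.
    - by apply: le_trans ps; rewrite ler_nat.
    - by rewrite addn_gt0 n0.
    - exact: measurable_env.
    - by move=> o; exact: env_ge1.
  have mono (m : nat) : (n + k <= m)%N -> al `^ (1 - (n + k)%:R / s) <= al `^ (1 - m%:R / s).
    move=> h; case/andP: al01 => a0 a1; apply: ger_powR; first by rewrite a0.
    by rewrite lerD2l lerN2 ler_wpM2r ?invr_ge0 ?(ltW s0)// ler_nat.
  have C0 : 0 <= 4 + (2 + 2 * K1) * K1 by rewrite addr_ge0// mulr_ge0// addr_ge0// mulr_ge0.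
  split=> h; first by apply: (le_trans (main (leqW h))); rewrite ler_wpM2l// mono.
  by apply: (le_trans (main h)); rewrite ler_wpM2l// mono.
pose K1 : R := 1 + p.+2%:R * b.
have K11 : 1 <= K1 by rewrite lerDl mulr_ge0.
have K10 : 0 <= K1 by exact: le_trans K11.
exists (4 * K1 ^+ p.+2); first by rewrite mulr_ge0// exprn_ge0.
exists (K1 ^+ p.+2); first exact: exprn_ege1.
move=> dd Om P S X Ts mX hN.
have pow (J : seq S) (k : nat) : {subset J <= Ts} -> L1 P (fun o => env X J o ^+ k) /\
    Ex P (fun o => env X J o ^+ k) <= (1 + (size J)%:R * b) ^+ k.
  move=> JT; have c0 : 0 <= 1 + (size J)%:R * b by rewrite addr_ge0// mulr_ge0.
  apply: Ex_le_ae; [|by move=> o; rewrite exprn_ge0// env_ge0|by rewrite exprn_ge0|].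
    by apply: measurable_funX; exact: measurable_env.
  have h : P [set o | 1 + (size J)%:R * b < env X J o] = 0%E.
    by apply: env_bounded_ae => // i /JT; exact: hN.
  apply/eqP; rewrite -measure_le0 -h le_measure ?inE//.
  - by apply: measurable_gt; apply: measurable_funX; exact: measurable_env.
  - by apply: measurable_gt; exact: measurable_env.
  by move=> o /=; apply: contraTT; rewrite -!leNgt => h'; rewrite lerXn2r ?nnegrE ?env_ge0.
split; first by have [] := pow Ts p.+2 (fun x h => h).
  move=> J k JT sJ kp; have [_ h] := pow J k JT; apply: (le_trans h).
  apply: (@le_trans _ _ (K1 ^+ k)); last by rewrite ler_weXn2l.
  rewrite lerXn2r ?nnegrE ?addr_ge0 ?mulr_ge0// lerD2l ler_wpM2r// ler_nat; exact: leq_trans sJ kp.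
move=> J Z xi n k al JT sJ mZ mxi hZ hxi n0 /andP[a0 a1] hmix.
have main : (n + k <= p.+2)%N -> `|Cov P Z xi| <= 4 * K1 ^+ p.+2 * al `^ 1.
  move=> nk; rewrite powRr1 ?(ltW a0)//; apply: (@le_trans _ _ (4 * al * K1 ^+ (n + k))).
    apply: (Cov_bounded_ae (M := env X J)) => //; first exact: ltW.
    - exact: measurable_env.
    - by move=> o; exact: env_ge1.
    - by have [] := pow J (n + k)%N JT.
    have h : P [set o | 1 + (size J)%:R * b < env X J o] = 0%E.
      by apply: env_bounded_ae => // i /JT; exact: hN.
    apply/eqP; rewrite -measure_le0 -h le_measure ?inE//.
    - by apply: measurable_gt; exact: measurable_env.
    - by apply: measurable_gt; exact: measurable_env.
    by move=> o /=; apply: le_lt_trans; rewrite lerD2l ler_wpM2r// ler_nat.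
  by rewrite mulrAC ler_wpM2r ?(ltW a0)// ler_wpM2l// ler_weXn2l.
by split=> h; apply: main; rewrite // leqW.
Qed.

(** * Lattice balls and the notions of the statement *)

Section lattice_field.
Context {R : realType}.

(** Adding [l] to the coordinates of the difference embeds the ball into the functions from [d]
    coordinates to [2 * l + 1] values. *)
Lemma lattice_ball_count d (s : seq 'rV[int]_d) (x : 'rV[int]_d) (l : nat) : uniq s ->
  (count (fun j => max_norm (x - j)%R <= l)%N s <= (2 * l).+1 ^ d)%N.
Proof.
move=> us; set a := (fun j => _).
pose f (j : 'rV[int]_d) : {ffun 'I_d -> 'I_(2 * l).+1} := [ffun k => inord (absz ((x - j) ord0 k + l%:Z))].
have inj : {in [seq j <- s | a j] &, injective f}.
  move=> i j; rewrite !mem_filter => /andP[ai _] /andP[aj _] fij; apply/rowP => k.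
  have nn (y : 'rV[int]_d) : a y -> (0 <= (x - y)%R ord0 k + l%:Z <= (2 * l)%N%:Z).
    move=> ay; have : (absz ((x - y)%R ord0 k) <= l)%N.
      by apply: leq_trans ay; rewrite /max_norm (leq_bigmax (F := fun k => absz ((x - y)%R ord0 k))).
    by lia.
  have := congr1 (fun g : {ffun 'I_d -> 'I_(2 * l).+1} => val (g k)) fij; rewrite !ffunE /= !inordK; last 2 first.
  - by move: (nn j aj); move: ((x - j)%R ord0 k) => y; lia.
  - by move: (nn i ai); move: ((x - i)%R ord0 k) => y; lia.
  have e (y : 'rV[int]_d) : (x - y)%R ord0 k = (x ord0 k - y ord0 k)%R by rewrite !mxE.
  move: (nn i ai) (nn j aj); rewrite !e; move: (x ord0 k) (i ord0 k) (j ord0 k) => x' i' j'; lia.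
rewrite -size_filter -(size_map f) -[X in (_ <= X ^ _)%N]card_ord -[d in (_ ^ d)%N]card_ord -card_ffun.
have /card_uniqP <- : uniq (map f [seq j <- s | a j]) by rewrite map_inj_in_uniq// filter_uniq.
exact: max_card.
Qed.

Lemma field_sumE (disp : measure_display) (Om : measurableType disp) (P : probability Om R) d
    (T : {fset 'rV[int]_d}) (X : 'rV[int]_d -> {RV P >-> R}) o :
  field_sum T X o = \sum_(i <- T) X i o.
Proof.
rewrite /field_sum; elim: (enum_fset T) => [|i s IH]; first by rewrite !big_nil.
by rewrite !big_cons -IH.
Qed.

(** Sequences become finite sets, and dropping repetitions only lowers the cardinality. The distance
    condition holds vacuously when one of them is empty, in agreement with the infinite distance. *)
Lemma field_alpha_mixing (disp : measure_display) (Om : measurableType disp) (P : probability Om R) d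
    (T : {fset 'rV[int]_d}) (X : 'rV[int]_d -> {RV P >-> R}) q g a :
  (field_alpha T X q g <= a%:E)%E ->
  forall I U : seq 'rV[int]_d, {subset I <= T} -> {subset U <= T} -> (size I <= q)%N ->
  (forall x y, x \in I -> y \in U -> (g <= max_norm (x - y)%R)%N) ->
  forall A B, <<s gens (fun i => X i : Om -> R) I>> A -> <<s gens (fun i => X i : Om -> R) U>> B ->
    `|fine (P (A `&` B)) - fine (P A) * fine (P B)| <= a.
Proof.
move=> h I U IT UT sI far A B hA hB.
have mX i : measurable_fun setT (X i : Om -> R) by [].
have meas V C : <<s gens (fun i => X i : Om -> R) V>> C -> measurable C.
  apply: smallest_sub; first exact: sigma_algebra_measurable.
  by move=> D [i _ [E mE <-]]; exact: mX.
have mA := meas _ _ hA; have mB := meas _ _ hB.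
have sf V C : <<s gens (fun i => X i : Om -> R) V>> C -> sigma_field X [fset x in V]%fset C.
  apply: sub_sigma_algebra2 => D [i iV hD]; exists i => //=.
  by rewrite inE.
have le1 : (`|P (A `&` B) - P A * P B| <= a%:E)%E.
  apply: le_trans h; rewrite /field_alpha le_max; apply/orP; right.
  apply: (@le_trans _ _ (alpha_coef P (sigma_field X [fset x in I]%fset) (sigma_field X [fset x in U]%fset))).
    by apply: ereal_sup_ubound; exists (A, B) => //; split; exact: sf.
  apply: ereal_sup_ubound; exists ([fset x in I]%fset, [fset x in U]%fset) => //; split => /=.
  - by apply/fsubsetP => x; rewrite inE; exact: IT.
  - by apply/fsubsetP => x; rewrite inE; exact: UT.
  - by apply: leq_trans sI; rewrite card_fseq; exact: size_undup.
  apply: le_ereal_inf_tmp => _ [[x y] /= [hx hy] <-]; rewrite lee_fin ler_nat; apply: far.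
    by move: hx; rewrite /= inE.
  by move: hy; rewrite /= inE.
have fA : P A \is a fin_num by rewrite fin_num_measure.
have fB : P B \is a fin_num by rewrite fin_num_measure.
have fAB : P (A `&` B) \is a fin_num by rewrite fin_num_measure//; exact: measurableI.
by move: le1; rewrite -(fineK fA) -(fineK fB) -(fineK fAB) -EFinM -EFinB /= lee_fin.
Qed.

Lemma liminf_lower (w : nat -> \bar R) : (0 < limn_einf w)%E ->
  exists2 c : R, 0 < c & \forall n \near \oo, (c%:E <= w n)%E.
Proof.
rewrite limn_einf_lim => h.
have [c c0 hc] : exists2 c : R, 0 < c & (c%:E < limn (einfs w))%E.
  move: h; case: (limn (einfs w)) => [l||//] h; last by exists 1 => //; rewrite ltry.
  rewrite lte_fin in h; exists (l / 2); first by rewrite divr_gt0.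
  by rewrite lte_fin ltr_pdivrMr// ltr_pMr// ltr1n.
exists c => //.
have [n0 h0] : exists n0, (c%:E < einfs w n0)%E.
  apply: contrapT => /forallNP nex; move: hc; rewrite ltNge => /negP; apply.
  by apply: lime_le; [exact: is_cvg_einfs|apply: nearW => n; rewrite leNgt; apply/negP; exact: nex].
exists n0 => // n /= nn; apply: ltW; apply: (lt_le_trans h0); apply: ereal_inf_lbound; by exists n.
Qed.

Lemma wasserstein_ge0 p (nu mu : set R -> \bar R) : (0 <= wasserstein p nu mu)%E.
Proof. by apply: le_ereal_inf_tmp => _ [g _ <-]; exact: poweR_ge0. Qed.

End lattice_field.

Lemma centered_sum_moments (dd : measure_display) (Om : measurableType dd) (R : realType)
    (P : probability Om R) (S : eqType) (s : seq S) (Y : S -> Om -> R) :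
  (forall i, measurable_fun setT (Y i)) ->
  (forall i, i \in s -> [/\ L1 P (Y i), L1 P (fun o => Y i o ^+ 2) & Ex P (Y i) = 0]) ->
  [/\ L1 P (fun o => \sum_(i <- s) Y i o), L1 P (fun o => (\sum_(i <- s) Y i o) ^+ 2) &
    Ex P (fun o => \sum_(i <- s) Y i o) = 0].
Proof.
move=> mY; elim: s => [|i s IH] hs.
  split; [apply: (eq_L1 _ (L1_cst P 0))|apply: (eq_L1 _ (L1_cst P 0))|].
  - by move=> o; rewrite big_nil.
  - by move=> o; rewrite big_nil expr0n.
  by rewrite (_ : (fun o => _) = fun=> 0) ?Ex_cst//; apply/funext => o; rewrite big_nil.
have [L E2 E] := hs i (mem_head _ _).
have [|L' E2' E'] := IH; first by move=> j js; apply: hs; rewrite inE js orbT.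
have mS s' : measurable_fun setT (fun o => \sum_(j <- s') Y j o) by exact: measurable_sum.
split.
- by apply: (eq_L1 _ (L1D L L')) => o; rewrite big_cons.
- apply: (L1_le _ _ (L1Z 2 (L1D E2 E2'))); first exact: measurable_funX.
  move=> o; rewrite ger0_norm ?sqr_ge0// big_cons.
  by have := sqr_ge0 (Y i o - \sum_(j <- s) Y j o); nra.
rewrite (_ : (fun o => _) = fun o => Y i o + \sum_(j <- s) Y j o); last by apply/funext => o; rewrite big_cons.
by rewrite ExD// E E' addr0.
Qed.

(** * Assembly for the sequence of fields *)

Section assembly.
Variables (R : realType) (d p : nat) (T : nat -> {fset 'rV[int]_d}) (disp : nat -> measure_display)
  (Om : forall n, measurableType (disp n)) (P : forall n, probability (Om n) R)
  (X : forall n, 'rV[int]_d -> {RV (P n) >-> R}) (r : \bar R) (C v : R).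
Hypotheses (d_gt0 : (0 < d)%N) (p_gt0 : (0 < p)%N) (T_infty : (#|` T n|)%N @[n --> \oo] --> \oo)
  (X_Lfun2 : forall n i, i \in T n -> (X n i : Om n -> R) \in Lfun (P n) 2%:E)
  (X_mean0 : forall n i, i \in T n -> ('E_(P n)[X n i] = 0)%E)
  (r_ge : ((p%:R + 2)%:E <= r)%E)
  (var_liminf : (0 < limn_einf (fun n => field_var (T n) (X n) * (#|` T n|%:R^-1)%:E))%E)
  (X_bounded : (ereal_sup [set x | exists n i, i \in T n /\ x = 'N[P n]_r[EFin \o X n i]] < +oo)%E)
  (C_gt0 : 0 < C) (v_gt0 : 0 < v)
  (mixing : forall n l, (1 <= l)%N -> (field_alpha (T n) (X n) p.+1 l <= (C * l%:R `^ (- v))%:E)%E).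

Let A := mix_A p r v.
Let u := mix_u p r v.
Let Wp n := wasserstein p (distribution (P n) (field_W (T n) (X n))) (normal_prob 0 1).
Local Notation B N := (@ball_bound R d p.+1 N).

Let r_pos s : r = s%:E -> p.+2%:R <= s /\ 0 < s.
Proof.
move=> rs; move: r_ge; rewrite rs lee_fin => h.
have h' : p.+2%:R <= s by move: h; rewrite -[p.+2]addn2 natrD.
by split=> //; apply: lt_le_trans h'; rewrite ltr0n.
Qed.

Lemma mix_AE : A = v * exp_A p r.
Proof.
rewrite /A /mix_A /exp_A; case: r r_pos => [s /(_ s erefl)[_ s0]| |] //; rewrite ?mulr1//.
by rewrite -natr1; field; exact: lt0r_neq0.
Qed.

Lemma mix_uE : u = v * exp_U p r.
Proof.
rewrite /u /mix_u /exp_U; case: r r_pos => [s /(_ s erefl)[_ s0]| |] //; rewrite ?mulr1//.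
by rewrite -[p.+2]addn2 natrD; field; exact: lt0r_neq0.
Qed.

Let exp_U0 : 0 <= exp_U p r.
Proof.
rewrite /exp_U; case: r r_pos => [s /(_ s erefl)[h s0]| |] //.
by rewrite subr_ge0 ler_pdivrMr// mul1r.
Qed.

Let exp_UA : exp_U p r <= exp_A p r.
Proof.
rewrite /exp_U /exp_A; case: r r_pos => [s /(_ s erefl)[h s0]| |] //.
by rewrite lerD2l lerN2 ler_wpM2r ?invr_ge0 ?(ltW s0)// ler_nat.
Qed.

Let exp_A1 : exp_A p r <= 1.
Proof.
rewrite /exp_A; case: r r_pos => [s /(_ s erefl)[h s0]| |] //.
by rewrite gerBl divr_ge0// ltW.
Qed.

Lemma mix_uA : u <= A.
Proof. by rewrite mix_uE mix_AE ler_wpM2l ?(ltW v_gt0). Qed.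

Let norm_bound : exists2 b : R, 0 <= b & forall n i, i \in T n -> ('N[P n]_r[EFin \o X n i] <= b%:E)%E.
Proof.
have := X_bounded; set E := ereal_sup _ => XE.
have ub n i : i \in T n -> ('N[P n]_r[EFin \o X n i] <= E)%E.
  by move=> iT; apply: ereal_sup_ubound; exists n, i.
move: ub XE; case: E => [e| |] ub // _.
  exists `|e| => // n i iT; apply: (le_trans (ub n i iT)); by rewrite lee_fin ler_norm.
by exists 0 => // n i iT; apply: (le_trans (ub n i iT)); rewrite leNye.
Qed.

Let sum_moments n : [/\ L1 (P n) (field_sum (T n) (X n)),
  L1 (P n) (fun o => field_sum (T n) (X n) o ^+ 2), Ex (P n) (field_sum (T n) (X n)) = 0 &
  field_var (T n) (X n) = (Ex (P n) (fun o => field_sum (T n) (X n) o ^+ 2))%:E].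
Proof.
have mX i : measurable_fun setT (X n i : Om n -> R) by [].
have [L L2 E] : [/\ L1 (P n) (fun o => \sum_(i <- T n) X n i o),
    L1 (P n) (fun o => (\sum_(i <- T n) X n i o) ^+ 2) & Ex (P n) (fun o => \sum_(i <- T n) X n i o) = 0].
  apply: (centered_sum_moments (Y := fun i => X n i : Om n -> R)) => // i iT; split.
  - apply/Lfun1_integrable; apply: Lfun_subset12 (X_Lfun2 iT); exact: fin_num_measure.
  - exact: Lfun2_integrable_sqr (X_Lfun2 iT).
  - by have := X_mean0 iT; rewrite unlock /Ex /Rintegral => ->.
have fE : (fun o => \sum_(i <- T n) X n i o) = field_sum (T n) (X n) :> (Om n -> R).
  by apply/funext => o; rewrite field_sumE.
have fE2 : (fun o => (\sum_(i <- T n) X n i o) ^+ 2) = (fun o => field_sum (T n) (X n) o ^+ 2).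
  by apply/funext => o; rewrite field_sumE.
rewrite fE in L E; rewrite fE2 in L2; split=> //.
have E0 : 'E_(P n)[field_sum (T n) (X n)]%E = 0%E by rewrite unlock Ex_fin// E.
rewrite /field_var /variance covariance.unlock E0 /= expectation.unlock -(Ex_fin L2); apply: eq_integral => o _ /=.
rewrite -[(_ * _) o]/((field_sum (T n) (X n) o - 0) * (field_sum (T n) (X n) o - 0)).
by rewrite subr0 expr2.
Qed.

Let field_WE n o : field_W (T n) (X n) o = (field_sigma (T n) (X n))^-1 * field_sum (T n) (X n) o.
Proof. by rewrite mulrC. Qed.

Let W_moments n : 0 < fine (field_var (T n) (X n)) ->
  Ex (P n) (field_W (T n) (X n)) = 0 /\ Ex (P n) (fun o => field_W (T n) (X n) o ^+ 2) = 1.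
Proof.
move=> var0; set sig := field_sigma (T n) (X n).
have [L L2 E EV] := sum_moments n.
have sig2 : sig ^+ 2 = fine (field_var (T n) (X n)) by rewrite sqr_sqrtr// ltW.
have sig0 : sig != 0 by rewrite -sqrf_eq0 sig2 gt_eqF.
have WE := @field_WE n.
split.
  transitivity (sig^-1 * Ex (P n) (field_sum (T n) (X n))); last by rewrite E mulr0.
  by rewrite -ExZ//; apply: eq_Ex => o; rewrite WE.
transitivity (sig^-1 ^+ 2 * Ex (P n) (fun o => field_sum (T n) (X n) o ^+ 2)).
  by rewrite -ExZ//; apply: eq_Ex => o; rewrite WE exprMn.
by rewrite -[X in _ * X]/(fine (Ex _ _)%:E) -EV -sig2 -exprMn mulVf// expr1n.
Qed.

(** A rate enters through these four properties alone, so that one argument serves [rate_S] and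
    [rate_G]. *)
Lemma field_bigO (del : nat -> R) :
  (exists2 c : R, 0 <= c & forall k, (1 < k <= p)%N -> forall N, (4 <= N)%N ->
    N%:R `^ ((1 - k%:R) / 2) * V N (B N) (dth A N) k 0 <= c * del N ^+ k.-1) ->
  (exists2 c : R, 0 <= c & forall N, (4 <= N)%N ->
    (exists2 m, (m <= N)%N & N%:R `^ ((1 - p%:R) / 2) *
      (N%:R `^ (- 2^-1) * B N m ^+ p.+1 + V N (B N) (dth A N) p m) <= c * del N ^+ p) \/
    N%:R `^ (- (p%:R / 2)) * V N (B N) (dth u N) p.+1 0 <= c * del N ^+ p) ->
  (forall N, (4 <= N)%N -> 0 < del N) ->
  (exists2 c : R, 0 <= c & exists2 e, 0 < e & forall N, (4 <= N)%N -> del N <= c * N%:R `^ (- e)) ->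
  is_bigO Wp (fun n => del #|` T n|).
Proof.
move=> del_beta del_top del_gt0 del_decay.
have [b b0 hb] := norm_bound.
have r_ge' : (p.+2%:R%:E <= r)%E by move: r_ge; rewrite -[p.+2]addn2 natrD.
have [K K0 [Lam0 Lam01 hm]] := moment_interface r_ge' b0.
have [c c0 hc] := liminf_lower var_liminf.
pose Lam := Lam0 + K * mix_const C v.
have mc1 : 1 <= mix_const C v by rewrite /mix_const le_max lexx.
have Kc0 : 0 <= K * mix_const C v by rewrite mulr_ge0// (le_trans ler01).
have Lam1 : 1 <= Lam by rewrite (le_trans Lam01)// lerDl.
(* From a variance of at least [c * N], the normalization by the standard deviation is at most
   [c^(-1/2) N^(-1/2)]. *)
pose c1 := Num.max 1 (c `^ (- 2^-1)).
have c11 : 1 <= c1 by rewrite le_max lexx.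
have u0 : 0 <= u by rewrite mix_uE mulr_ge0// ltW.
have uA := mix_uA.
have [K' [N0 main]] := field_wasserstein d_gt0 p_gt0 Lam1 c11 u0 uA del_beta del_top del_gt0 del_decay.
exists K'.
have big m : \forall n \near \oo, (m <= #|` T n|)%N by move/cvgnyPge: T_infty; apply.
near=> n.
have N4 : (4 <= #|` T n|)%N by near: n; exact: big.
have NN0 : (N0 <= #|` T n|)%N by near: n; exact: big.
have hcn : (c%:E <= field_var (T n) (X n) * (#|` T n|%:R^-1)%:E)%E by near: n; exact: hc.
set N := #|` T n| in N4 NN0 hcn *.
have Npos : 0 < N%:R :> R by rewrite ltr0n (leq_trans _ N4).
rewrite gee0_abs ?wasserstein_ge0// (gtr0_norm (del_gt0 _ N4)).
pose Xf i : Om n -> R := X n i.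
have mX i : measurable_fun setT (Xf i) by rewrite /Xf.
have [Lenv mom cov] := hm _ _ (P n) _ Xf (T n) mX (hb n).
have varN : c * N%:R <= fine (field_var (T n) (X n)).
  by have [_ _ _ VE] := sum_moments n; move: hcn; rewrite VE -EFinM lee_fin ler_pdivlMr.
have var0 : 0 < fine (field_var (T n) (X n)) by apply: lt_le_trans varN; rewrite mulr_gt0.
have [EW0 EW2] := W_moments var0.
set sig := field_sigma (T n) (X n).
have sig0 : 0 < sig by rewrite sqrtr_gt0.
have dec := @cov_decay_of_mixing _ _ _ _ (P n) Xf (T n) (fun x y => max_norm (x - y)%R) p C v
  (exp_A p r) (exp_U p r) K Lam mX C_gt0 v_gt0 exp_U0 exp_UA exp_A1 K0 Lenv cov _ _.
have {}dec := dec (fun I U g IT UT sI g0 => field_alpha_mixing (mixing n g0) IT UT sI) _.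
rewrite -mix_AE -mix_uE in dec.
have KL : K * mix_const C v <= Lam by rewrite lerDr (le_trans ler01).
apply: (main _ _ (P n) _ Xf (T n) 0 (fun x y => max_norm (x - y)%R) sig^-1 (field_W (T n) (X n))) => //.
- by rewrite invr_ge0 ltW.
- have c_pow : 0 < c * N%:R by rewrite mulr_gt0.
  apply: (@le_trans _ _ ((c * N%:R) `^ (- 2^-1))).
    rewrite powRN powR12_sqrt ?(ltW c_pow)// lef_pV2 ?posrE ?sqrtr_gt0//.
    by rewrite ler_sqrt// ltW.
  by rewrite powRM ?(ltW c0)// ler_wpM2r ?powR_ge0// le_max lexx orbT.
- by move=> J s h1 h2 h3; apply: (le_trans (mom J s h1 h2 h3)); rewrite lerDl.
- move=> L Lp I U J Z xi k s c2 c3 g h1 h2 h3 h4 h5 h6 h7 h8 h9 h10 h11 h12 /andP[k0 kL].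
  have [|D1 _] := dec KL I U J Z xi k s c2 c3 g h1 h2 h3 h4 h5 h6 h7 h8 h9 h10 h11 h12 _.
    by rewrite k0 (leq_trans kL)// leqW.
  by split=> h; apply: D1; apply: (leq_trans h); rewrite ?ltnS// leqW.
- move=> I U J Z xi k s c2 c3 g h1 h2 h3 h4 h5 h6 h7 h8 h9 h10 h11 h12 h13.
  exact: dec KL I U J Z xi k s c2 c3 g h1 h2 h3 h4 h5 h6 h7 h8 h9 h10 h11 h12 h13.
- by move=> x l _; apply: lattice_ball_count; exact: fset_uniq.
- by move=> o; rewrite field_WE field_sumE.
Unshelve. all: by end_near. Qed.

End assembly.

Theorem corollary2p7 (R : realType) (d p : nat)
  (T : nat -> {fset 'rV[int]_d})
  (disp : nat -> measure_display)
  (Om : forall n, measurableType (disp n))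
  (P : forall n, probability (Om n) R)
  (X : forall n, 'rV[int]_d -> {RV (P n) >-> R})
  (r : \bar R) (C v : R)
  (d_gt0 : (0 < d)%N)
  (p_gt0 : (0 < p)%N)
  (T_neq0 : forall n, T n != fset0%fset)
  (T_nested : forall n, (T n `<=` T n.+1)%fset)
  (T_infty : (#|` T n|)%N @[n --> \oo] --> \oo)
  (X_Lfun2 : forall n i, i \in T n -> (X n i : Om n -> R) \in Lfun (P n) 2%:E)
  (X_mean0 : forall n i, i \in T n -> ('E_(P n)[X n i] = 0)%E)
  (r_ge : ((p%:R + 2)%:E <= r)%E)
  (var_liminf :
    (0 < limn_einf (fun n => field_var (T n) (X n) * (#|` T n|%:R^-1)%:E))%E)
  (X_bounded :
    (ereal_sup [set x | exists n i, i \in T n /\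
                        x = 'N[P n]_r[EFin \o X n i]] < +oo)%E)
  (C_gt0 : 0 < C)
  (v_gt0 : 0 < v)
  (mixing : forall n l, (1 <= l)%N ->
    (field_alpha (T n) (X n) p.+1 l <= (C * l%:R `^ (- v))%:E)%E) :
  let A := mix_A p r v in
  let u := mix_u p r v in
  let Wp := fun n => wasserstein p
    (distribution (P n) (field_W (T n) (X n))) (normal_prob 0 1) in
  ((2 <= p)%N -> d%:R * (p%:R + 1) / 2 < A ->
     is_bigO Wp (fun n => rate_R d p A #|` T n|))
  /\
  (((p%:R + 2)%:E < r)%E -> d%:R * (p%:R + 1) / 2 < u ->
     is_bigO Wp (fun n => rate_S d p A #|` T n|) /\
     (d%:R * (p%:R + 2) / 2 < u ->
        is_bigO Wp (fun n =>
          Num.min (rate_S d p A #|` T n|) (rate_G d p u #|` T n|)))).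
Proof.
move=> A u Wp.
have card4 : \forall n \near \oo, (4 <= #|` T n|)%N by move/cvgnyPge: T_infty; apply.
have bigO_S : d%:R * (p%:R + 1) / 2 < A -> is_bigO Wp (fun n => rate_S d p A #|` T n|).
  move=> A_gt; apply: (field_bigO d_gt0 p_gt0 T_infty X_Lfun2 X_mean0 r_ge var_liminf X_bounded
    C_gt0 v_gt0 mixing).
  - exact: rate_S_beta.
  - have [e e0 he] := rate_S_top p.+1 d_gt0 p_gt0 A_gt; exists e => // N N4; left; exact: he.
  - by move=> N N4; exact: rate_S_gt0.
  - exact: rate_S_decay.
have uA : u <= A := mix_uA r_ge v_gt0.
split=> [p2 A_gt|r_gt u_gt].
  (* The constant in [is_bigO] carries no sign; its absolute value allows the rate to be
     enlarged. *)
  have [K hK] := bigO_S A_gt; exists `|K|; near=> n.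
  have N4 : (4 <= #|` T n|)%N by near: n.
  have hn : (`|Wp n| <= (K * `|rate_S d p A (#|` T n|)%N|)%:E)%E by near: n.
  apply: (le_trans hn); rewrite lee_fin gtr0_norm ?rate_S_gt0//.
  apply: (@le_trans _ _ (`|K| * rate_S d p A #|` T n|)).
    by rewrite ler_wpM2r ?ler_norm// ltW// rate_S_gt0.
  rewrite ler_wpM2l// (le_trans _ (ler_norm _))// rate_S_le_R//; exact: leq_trans N4.
have A_gt : d%:R * (p%:R + 1) / 2 < A by exact: lt_le_trans uA.
split=> [|u_gt2]; first exact: bigO_S.
have [K hK] := bigO_S A_gt.
have [L hL] : is_bigO Wp (fun n => rate_G d p u #|` T n|).
  apply: (field_bigO d_gt0 p_gt0 T_infty X_Lfun2 X_mean0 r_ge var_liminf X_bounded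
    C_gt0 v_gt0 mixing).
  - exact: rate_G_beta.
  - have [e e0 he] := rate_G_top p.+1 d_gt0 p_gt0 u_gt2; exists e => // N N4; right; exact: he.
  - by move=> N N4; exact: rate_G_gt0.
  - exact: rate_G_decay.
exists (Num.max K L); near=> n.
have N4 : (4 <= #|` T n|)%N by near: n.
have hn : (`|Wp n| <= (K * `|rate_S d p A (#|` T n|)%N|)%:E)%E by near: n.
have hn' : (`|Wp n| <= (L * `|rate_G d p u (#|` T n|)%N|)%:E)%E by near: n.
rewrite minEle; case: ifP => _.
  by apply: (le_trans hn); rewrite lee_fin ler_wpM2r// le_max lexx.
by apply: (le_trans hn'); rewrite lee_fin ler_wpM2r// le_max lexx orbT.
Unshelve. all: by end_near. Qed.
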